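(* We have $\varphi=\varphi\breve R$. Thus $\varphi$ is also right invariant with respect to $\Delta$, i.e. $\varphi((\iota\otimes\omega)\Delta(x))=\varphi(x)\,\omega(1)$ for all $\omega\in(M_q)_*^+$ and all $x\in M_q^+$ with $\varphi(x)<\infty$.
   Context: Fix $0<q<1$. Let $\mathbb N=\{1,2,\dots\}$, $\mathbb T$ the unit circle with normalized Haar measure, $I_q=\{-q^k: k\in\mathbb N\}\cup\{q^k:k\in\mathbb Z\}$ with counting measure. $(a;q^2)_n=\prod_{i=0}^{n-1}(1-q^{2i}a)$, $(a;q^2)_\infty=\lim_n (a;q^2)_n$, $(a_1,\dots,a_j;q^2)_k=(a_1;q^2)_k\cdots(a_j;q^2)_k$, and for $a,b,z\in\mathbb C$, $\Psi(a;b;z)=\sum_{n=0}^\infty \frac{(a;q^2)_n(bq^{2n};q^2)_\infty}{(q^2;q^2)_n}(-1)^nq^{n(n-1)}z^n$. Put $\chi(x)=\log_q|x|$ and $\nu(x)=q^{\frac12(\chi(x)-1)(\chi(x)-2)}$ for $x\in -q^{\mathbb Z}\cup q^{\mathbb Z}$; $\kappa(x)=\mathrm{sgn}(x)x^2$ for $x\in\mathbb R$; $s(x,y)=-1$ if $x>0$ and $y<0$, $s(x,y)=1$ otherwise ($x,y\in\mathbb R\setminus\{0\}$); $c_q=(\sqrt2\,q\,(q^2,-q^2;q^2)_\infty)^{-1}$. For $p\in I_q$ define $a_p:I_q\times I_q\to\mathbb R$ by $a_p(x,y)=0$ if $\mathrm{sgn}(xy)\neq\mathrm{sgn}(p)$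 and, if $\mathrm{sgn}(xy)=\mathrm{sgn}(p)$, $$a_p(x,y)=c_q\,s(x,y)(-1)^{\chi(p)}(-\mathrm{sgn}(y))^{\chi(x)}|y|\,\nu(py/x)\sqrt{\frac{(-\kappa(p),-\kappa(y);q^2)_\infty}{(-\kappa(x);q^2)_\infty}}\;\Psi\big(-q^2/\kappa(y);\,q^2\kappa(x/y);\,q^2\kappa(x/p)\big).$$ $H=L^2(\mathbb T)\otimes L^2(I_q)$, with orthonormal basis $\zeta^m\otimes\delta_p$ ($m\in\mathbb Z$, $p\in I_q$), where $\zeta$ is the identity function on $\mathbb T$ and $\delta_p$ is the indicator function of $p$. $\gamma$ is the closed operator in $H$ having the linear span of this basis as core and $\gamma(\zeta^m\otimes\delta_p)=p^{-1}\zeta^{m+1}\otimes\delta_p$. $M_q=L^\infty(\mathbb T)\otimes B(L^2(I_q))$, acting on $H$. For $r,s,m\in\mathbb Z$, $p\in I_q$, $F_{r,s,m,p}\in H\otimes H=L^2(\mathbb T\times I_q\times\mathbb T\times I_q)$ is given by $F_{r,s,m,p}(\lambda,x,\mu,y)=a_p(x,y)\lambda^{r+\chi(y/p)}\mu^{s-\chi(x/p)}$ if $y=\mathrm{sgn}(p)q^mx$ and $0$ otherwise. These elements form an orthonormal basis of $H\otimes H$. $V : H\otimes H \to L^2(\mathbb T)\otimes L^2(\mathbb T)\otimes H$ is the unitary with $V(F_{r,s,m,p}) = \zeta^r\otimes\zeta^s\otimes\zeta^m\otimes\delta_p$, and $\Delta:M_q\to M_q\otimes M_q$ is the injective normal unital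 $*$-homomorphism $\Delta(a)=V^*(1_{L^2(\mathbb T)}\otimes1_{L^2(\mathbb T)}\otimes a)V$. $\mathrm{Tr}=\mathrm{Tr}_{L^\infty(\mathbb T)}\otimes\mathrm{Tr}_{B(L^2(I_q))}$ is the trace on $M_q$ with $\mathrm{Tr}_{L^\infty(\mathbb T)}$ integration against normalized Haar measure and $\mathrm{Tr}_{B(L^2(I_q))}$ the standard trace (value $1$ on rank one projections). $\varphi=\mathrm{Tr}_{\gamma^*\gamma}$ is the faithful normal semifinite weight on $M_q$ with density $\gamma^*\gamma$ relative to $\mathrm{Tr}$, formally $\varphi(x)=\mathrm{Tr}(|\gamma|\,x\,|\gamma|)$, where $\gamma^*\gamma(\zeta^m\otimes\delta_p)=p^{-2}\zeta^m\otimes\delta_p$. $\breve J$ is the anti-unitary operator on $H$ with $\breve J(\zeta^n\otimes\delta_x)=\mathrm{sgn}(x)^{\chi(x)}\zeta^{-n}\otimes\delta_x$ for $n\in\mathbb Z$, $x\in I_q$; it satisfies $\breve JM_q\breve J=M_q$, and $\breve R:M_q\to M_q$ is the $*$-anti-automorphism $\breve R(a)=\breve Ja^*\breve J$. $\iota$ denotes the identity map. *)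

(* Defs.v *)
From HB Require Import structures.
From mathcomp Require Import all_boot all_order all_algebra.
From mathcomp Require Import complex.
From mathcomp Require Import all_classical all_reals all_analysis.

Set Implicit Arguments.
Unset Strict Implicit.
Unset Printing Implicit Defensive.

Import Order.TTheory GRing.Theory Num.Theory.
Import numFieldNormedType.Exports.

Local Open Scope classical_set_scope.
Local Open Scope ring_scope.
Local Open Scope complex_scope.

(* Functions are not quotiented by almost everywhere equality: an operator acts
   on representatives, and identities between values of operators hold almost
   everywhere.  An operator satisfying [bounded_op] maps functions equal almost
   everywhere to functions equal almost everywhere, by its linearity and norm
   bound. *)

Definition normsq (R : realType) (z : R[i]) : R :=
  complex.Re z ^+ 2 + complex.Im z ^+ 2.

Definition cmeasurable d (X : measurableType d) (R : realType)
    (f : X -> R[i]) : Prop :=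
  measurable_fun setT (fun x => complex.Re (f x)) /\
  measurable_fun setT (fun x => complex.Im (f x)).

Section L2.
Context d (X : measurableType d) (R : realType).
Variable mu : {measure set X -> \bar R}.

Definition L2 : set (X -> R[i]) := [set f | cmeasurable f /\
  (\int[mu]_x (normsq (f x))%:E < +oo)%E].

Definition norm2sq (f : X -> R[i]) : R := \int[mu]_x normsq (f x).

Definition inner (f g : X -> R[i]) : R[i] :=
  (\int[mu]_x complex.Re (f x * (g x)^*)) +i*
  (\int[mu]_x complex.Im (f x * (g x)^*)).

End L2.

Section Operators.
Context d1 (X : measurableType d1) d2 (Y : measurableType d2) (R : realType).
Variables (mu : {measure set X -> \bar R}) (nu : {measure set Y -> \bar R}).

Definition op := (X -> R[i]) -> (Y -> R[i]).

Definition bounded_op (A : op) : Prop :=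
  [/\ forall f, L2 mu f -> L2 nu (A f),
      forall (a : R[i]) f g, L2 mu f -> L2 mu g ->
        A (fun x => a * f x + g x) = (fun y => a * A f y + A g y) %[ae nu]
    & exists M : R, forall f, L2 mu f -> norm2sq nu (A f) <= M * norm2sq mu f].

Definition unitary (V : op) : Prop :=
  [/\ bounded_op V,
      forall f g, L2 mu f -> L2 mu g -> inner nu (V f) (V g) = inner mu f g
    & forall g, L2 nu g -> exists2 f, L2 mu f & V f = g %[ae nu]].

Definition antiunitary (J : op) : Prop :=
  [/\ forall f, L2 mu f -> L2 nu (J f),
      forall (a : R[i]) f g, L2 mu f -> L2 mu g ->
        J (fun x => a * f x + g x) = (fun y => a^* * J f y + J g y) %[ae nu],
      forall f g, L2 mu f -> L2 mu g -> inner nu (J f) (J g) = inner mu g f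
    & forall g, L2 nu g -> exists2 f, L2 mu f & J f = g %[ae nu]].

End Operators.

Arguments op {d1} X {d2} Y R.

Definition is_adjoint d1 (X : measurableType d1) d2 (Y : measurableType d2)
    (R : realType) (mu : {measure set X -> \bar R})
    (nu : {measure set Y -> \bar R}) (A : op X Y R) (B : op Y X R) : Prop :=
  bounded_op nu mu B /\
  forall f g, L2 mu f -> L2 nu g -> inner nu (A f) g = inner mu f (B g).


Section VonNeumann.
Context d (X : measurableType d) (R : realType).
Variable mu : {measure set X -> \bar R}.

Definition BL2 : set (op X X R) := [set A | bounded_op mu mu A].

Definition positive_op (A : op X X R) : Prop :=
  forall f, L2 mu f -> 0 <= inner mu (A f) f.

Definition commutant (S : set (op X X R)) : set (op X X R) :=
  [set A | bounded_op mu mu A /\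
    forall B, S B -> forall f, L2 mu f -> A (B f) = B (A f) %[ae mu]].

(* M_*: the sigma-weakly continuous functionals
   A |-> \sum_n <A xi_n, eta_n>, with \sum_n |xi_n|^2, \sum_n |eta_n|^2 < oo;
   the series is required to converge through its real and imaginary parts. *)
Definition predual (M : set (op X X R)) (w : op X X R -> R[i]) : Prop :=
  exists xi eta : nat -> X -> R[i],
  [/\ forall n, L2 mu (xi n) /\ L2 mu (eta n),
      (\sum_(0 <= n <oo) (norm2sq mu (xi n))%:E < +oo)%E,
      (\sum_(0 <= n <oo) (norm2sq mu (eta n))%:E < +oo)%E
    & forall A, M A ->
      (series (fun n => complex.Re (inner mu (A (xi n)) (eta n)))
         @ \oo --> complex.Re (w A)) /\
      (series (fun n => complex.Im (inner mu (A (xi n)) (eta n)))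
         @ \oo --> complex.Im (w A))].

Definition positive_functional (M : set (op X X R)) (w : op X X R -> R[i]) :
    Prop :=
  forall A, M A -> positive_op A -> 0 <= w A.

End VonNeumann.


Definition tens (X Y : Type) (R : realType) (f : X -> R[i]) (g : Y -> R[i]) :
    X * Y -> R[i] :=
  fun z => f z.1 * g z.2.

(* mu \x nu, with its structure of sigma-finite measure *)
Section ProductMeasure.
Context d1 (X : measurableType d1) d2 (Y : measurableType d2) (R : realType).
Variables (mu : {sigma_finite_measure set X -> \bar R})
  (nu : {sigma_finite_measure set Y -> \bar R}).

Definition prodm : set (X * Y) -> \bar R := (mu \x nu)%E.

HB.instance Definition _ := Measure.copy prodm (mu \x nu)%E.

Lemma sigma_finite_prodm : sigma_finite setT prodm.
Proof.
have /sigma_finiteP[F [TF ndF Foo]] := sigma_finiteT mu.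
have /sigma_finiteP[G [TG ndG Goo]] := sigma_finiteT nu.
exists (fun n => F n `*` G n).
  rewrite -setXTT TF TG predeqE => -[x y]; split.
    move=> [/= [n _ Fnx] [k _ Gky]]; exists (maxn n k) => //; split.
    - by move: x Fnx; exact/subsetPset/ndF/leq_maxl.
    - by move: y Gky; exact/subsetPset/ndG/leq_maxr.
  by move=> [n _ []/= ? ?]; split; exists n.
move=> k; have [mF Fk] := Foo k; have [mG Gk] := Goo k.
split; first exact: measurableX.
rewrite /prodm product_measure1E//.
by rewrite lte_mul_pinfty// ge0_fin_numE.
Qed.

HB.instance Definition _ := @Measure_isSigmaFinite.Build _ _ _ prodm
  sigma_finite_prodm.

End ProductMeasure.

Section Tensor.
Context d1 (X : measurableType d1) d2 (Y : measurableType d2) (R : realType).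
Variables (mu : {sigma_finite_measure set X -> \bar R})
  (nu : {sigma_finite_measure set Y -> \bar R}).

(* C = A (x) B, on L^2(X) (x) L^2(Y) = L^2(X x Y) *)
Definition is_tensor_op (A : op X X R) (B : op Y Y R)
    (C : op (X * Y)%type (X * Y)%type R) : Prop :=
  bounded_op (prodm mu nu) (prodm mu nu) C /\
  forall f g, L2 mu f -> L2 nu g ->
    C (tens f g) = tens (A f) (B g) %[ae (prodm mu nu)].

(* von Neumann algebraic tensor product: the von Neumann algebra generated,
   as a bicommutant, by the operators A (x) B *)
Definition vN_tensor (M : set (op X X R)) (N : set (op Y Y R)) :
    set (op (X * Y)%type (X * Y)%type R) :=
  commutant (prodm mu nu) (commutant (prodm mu nu)
    [set C | exists A B, [/\ M A, N B & is_tensor_op A B C]]).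

(* T = (iota (x) w)(Z) for Z in M (x) N: T is the element of M such that
   rho(T) = (rho (x) w)(Z) for every rho in M_*, where rho (x) w is the normal
   functional on M (x) N with value rho(A) w(B) on A (x) B *)
Definition is_slice (M : set (op X X R)) (N : set (op Y Y R))
    (w : op Y Y R -> R[i]) (Z : op (X * Y)%type (X * Y)%type R)
    (T : op X X R) : Prop :=
  [/\ vN_tensor M N Z, M T &
      forall (rho : op X X R -> R[i])
        (rhow : op (X * Y)%type (X * Y)%type R -> R[i]),
      predual mu M rho -> predual (prodm mu nu) (vN_tensor M N) rhow ->
      (forall A B C, M A -> N B -> is_tensor_op A B C ->
        rhow C = rho A * w B) ->
      rho T = rhow Z].

End Tensor.


Section Unbounded.
Context d (X : measurableType d) (R : realType).
Variable mu : {measure set X -> \bar R}.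

Definition graph := (X -> R[i]) -> (X -> R[i]) -> Prop.

Definition graph_closure (G : graph) : graph := fun f g =>
  [/\ L2 mu f, L2 mu g & forall e : R, 0 < e -> exists f' g',
    [/\ G f' g', norm2sq mu (fun x => f x - f' x) < e
      & norm2sq mu (fun x => g x - g' x) < e]].

Definition graph_adjoint (G : graph) : graph := fun g k =>
  [/\ L2 mu g, L2 mu k & forall f h, G f h -> inner mu h g = inner mu f k].

Definition graph_comp (G H : graph) : graph := fun f k =>
  exists2 g, H f g & G g k.

(* k is the bounded positive square root of h_e = h (1 + e h)^-1 *)
Definition is_sqrt_reg (h : graph) (e : R) (k : op X X R) : Prop :=
  [/\ bounded_op mu mu k, positive_op mu k &
      forall f, L2 mu f -> exists g hg,
        [/\ h g hg, f = (fun x => g x + e%:C * hg x) %[ae mu]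
          & k (k f) = hg %[ae mu]]].

(* The weight Tr_h with density h relative to a trace Tr (Pedersen-Takesaki):
   Tr_h(x) is the limit of the increasing net Tr(h_e^(1/2) x h_e^(1/2)) for
   e -> 0+, h_e = h (1 + e h)^-1. *)
Definition weight_density (Tr : op X X R -> \bar R) (h : graph)
    (x : op X X R) : \bar R :=
  ereal_sup [set t | exists e k,
    [/\ 0 < e, is_sqrt_reg h e k & t = Tr (k \o x \o k)]].

End Unbounded.


Definition circle (R : realType) := {z : R[i] | `|z| == 1}.

Section Circle.
Variable R : realType.

Fact expi_subproof (t : R) :
  `|cos (2 * pi * t) +i* sin (2 * pi * t)| == 1 :> R[i].
Proof. by rewrite normc_def /= cos2Dsin2 sqrtr1. Qed.

Definition expi (t : measurableTypeR R) : circle R :=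
  exist (fun z : R[i] => `|z| == 1) _ (expi_subproof t).

HB.instance Definition _ := Choice.on (circle R).
HB.instance Definition _ := isPointed.Build (circle R) (expi 0).

(* The Borel sets of the circle, since [expi] restricts to a Borel isomorphism
   from [0, 1[ onto the circle. *)
Definition circle_measurable : set (set (circle R)) :=
  [set A | measurable (expi @^-1` A)].

Let circle_measurable0 : circle_measurable set0.
Proof. by rewrite /circle_measurable /= preimage_set0. Qed.

Let circle_measurableC A : circle_measurable A -> circle_measurable (~` A).
Proof. by rewrite /circle_measurable /= preimage_setC; exact: measurableC. Qed.

Let circle_measurableU (F : (set (circle R))^nat) :
  (forall i, circle_measurable (F i)) -> circle_measurable (\bigcup_i F i).
Proof.
by move=> mF; rewrite /circle_measurable /= preimage_bigcup; exact: bigcupT_measurable.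
Qed.

HB.instance Definition _ := @isMeasurable.Build default_measure_display
  (circle R) circle_measurable circle_measurable0 circle_measurableC
  circle_measurableU.

Lemma measurable_expi : measurable_fun setT expi.
Proof. by move=> _ A mA; rewrite setTI. Qed.

HB.instance Definition _ := isMeasurableFun.Build _ _ _ _ expi measurable_expi.

Definition haar : probability (circle R) R :=
  distribution (uniform_prob (@ltr01 R)) expi.

Definition zeta (m : int) : circle R -> R[i] := fun t => sval t ^ m.

End Circle.


Section Iq.
Variables (R : realType) (q : R).

Definition Iq_set : set R :=
  [set x | (exists2 k : nat, (0 < k)%N & x = - q ^+ k)
           \/ (exists k : int, x = q ^ k)].

Definition Iq := {x : R | x \in Iq_set}.

Definition Iq_val (p : Iq) : R := sval p.

Fact Iq_one_subproof : (1 : R) \in Iq_set.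
Proof. by rewrite inE; right; exists 0; rewrite expr0z. Qed.

HB.instance Definition _ := Choice.on Iq.
HB.instance Definition _ := isPointed.Build Iq
  (exist (fun x : R => x \in Iq_set) 1 Iq_one_subproof).
HB.instance Definition _ := @isMeasurable.Build default_measure_display
  Iq discrete_measurable discrete_measurable0 discrete_measurableC
  discrete_measurableU.

Definition Iq_enum (n : nat) : set Iq :=
  [set p | exists2 k : nat, (k <= n)%N &
    [\/ Iq_val p = - q ^+ k, Iq_val p = q ^+ k | Iq_val p = q ^- k]].

Lemma finite_Iq_enum n : finite_set (Iq_enum n).
Proof.
pose S : set R := (fun k => - q ^+ k) @` `I_n.+1 `|`
  ((fun k => q ^+ k) @` `I_n.+1 `|` (fun k => q ^- k) @` `I_n.+1).
have fS : finite_set S.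
  by rewrite !finite_setU; split; [|split]; apply: finite_image; exact: finite_II.
apply: (@sub_finite_set _ _ (Iq_val @^-1` S)).
  move=> p [k kn [] e] /=.
  - by left; exists k.
  - by right; left; exists k.
  - by right; right; exists k.
apply: finite_preimage fS.
by move=> x y _ _ /= /val_inj.
Qed.

Lemma sigma_finite_counting_Iq :
  sigma_finite [set: Iq] (counting : set Iq -> \bar R).
Proof.
exists Iq_enum.
  apply/seteqP; split => // p _.
  have := svalP p; rewrite inE => -[[k _ e]|[[k|k] e]].
  - by exists k => //; exists k => //; constructor 1.
  - by exists k => //; exists k => //; constructor 2.
  - by exists k.+1 => //; exists k.+1 => //; constructor 3; rewrite /Iq_val e.
move=> n; split => //.
by rewrite /counting/= asboolT ?ltry//; exact: finite_Iq_enum.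
Qed.

Definition counting_Iq : set Iq -> \bar R := counting.
HB.instance Definition _ := Measure.copy counting_Iq (counting : set Iq -> \bar R).
HB.instance Definition _ := @Measure_isSigmaFinite.Build _ _ _ counting_Iq
  sigma_finite_counting_Iq.

End Iq.

Arguments counting_Iq {R} q.


Section Coefficients.
Variables (R : realType) (q : R).

(* (a; q^2)_n and (a; q^2)_oo *)
Definition qpoch (a : R) (n : nat) : R := \prod_(i < n) (1 - q ^+ (2 * i) * a).

Definition qpoch_oo (a : R) : R := limn (qpoch a).

(* Only real arguments of Psi occur below. *)
Definition Psi (a b z : R) : R :=
  limn (series (fun n : nat =>
    qpoch a n * qpoch_oo (b * q ^+ (2 * n)) / qpoch (q ^+ 2) n
      * (- 1) ^+ n * q ^+ (n * n.-1) * z ^+ n)).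

(* log_q |x|, which is an integer for x in - q^Z \cup q^Z, the only arguments
   at which chi is used *)
Definition chi (x : R) : int := Num.floor (ln `|x| / ln q).

Definition nu_q (x : R) : R :=
  q `^ (((chi x)%:~R - 1) * ((chi x)%:~R - 2) / 2).

Definition kappa (x : R) : R := Num.sg x * x ^+ 2.

Definition sgnxy (x y : R) : R := if (0 < x) && (y < 0) then - 1 else 1.

Definition c_q : R :=
  (Num.sqrt 2 * q * (qpoch_oo (q ^+ 2) * qpoch_oo (- q ^+ 2)))^-1.

Definition a_ (p x y : R) : R :=
  if Num.sg (x * y) != Num.sg p then 0 else
  c_q * sgnxy x y * (- 1) ^ (chi p) * (- Num.sg y) ^ (chi x) * `|y|
  * nu_q (p * y / x)
  * Num.sqrt (qpoch_oo (- kappa p) * qpoch_oo (- kappa y)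
              / qpoch_oo (- kappa x))
  * Psi (- q ^+ 2 / kappa y) (q ^+ 2 * kappa (x / y)) (q ^+ 2 * kappa (x / p)).

End Coefficients.


Section QuantumGroup.
Variables (R : realType) (q : R).

Local Notation T := (circle R).
Local Notation I := (Iq q).

Definition mu_T : {sigma_finite_measure set T -> \bar R} := haar R.

Definition mu_I : {sigma_finite_measure set I -> \bar R} := counting_Iq q.

Definition mu_H : {sigma_finite_measure set (T * I)%type -> \bar R} :=
  prodm mu_T mu_I.

Definition mu_HH : {sigma_finite_measure set ((T * I) * (T * I))%type -> \bar R} :=
  prodm mu_H mu_H.

Definition mu_TH : {sigma_finite_measure set (T * (T * I))%type -> \bar R} :=
  prodm mu_T mu_H.

Definition mu_TTH : {sigma_finite_measure set (T * (T * (T * I)))%type -> \bar R} :=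
  prodm mu_T mu_TH.

Definition delta (p : I) : I -> R[i] := fun x => (x == p)%:R.

Definition ebasis (m : int) (p : I) : T * I -> R[i] := tens (zeta m) (delta p).

Definition Linfty_T : set (op T T R) := [set A | bounded_op mu_T mu_T A /\
  exists f : T -> R[i], [/\ cmeasurable f,
    exists K : R, \forall t \ae mu_T, normsq (f t) <= K
  & forall u, L2 mu_T u -> A u = (fun t => f t * u t) %[ae mu_T]]].

Definition Mq : set (op (T * I)%type (T * I)%type R) :=
  vN_tensor mu_T mu_I Linfty_T (BL2 mu_I).

Definition F_ (r s m : int) (p : I) : (T * I) * (T * I) -> R[i] := fun z =>
  let p := Iq_val p in
  let lam := sval z.1.1 in let x := Iq_val z.1.2 in
  let mu := sval z.2.1 in let y := Iq_val z.2.2 in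
  if y == Num.sg p * q ^ m * x
  then (a_ q p x y)%:C * lam ^ (r + chi q (y / p)) * mu ^ (s - chi q (x / p))
  else 0.

Definition is_V (V : op ((T * I) * (T * I))%type (T * (T * (T * I)))%type R) :
    Prop :=
  unitary mu_HH mu_TTH V /\
  forall r s m p,
    V (F_ r s m p) = tens (zeta r) (tens (zeta s) (ebasis m p)) %[ae mu_TTH].

(* D = Delta(a) = V^* (1 (x) 1 (x) a) V *)
Definition is_Delta
    (V : op ((T * I) * (T * I))%type (T * (T * (T * I)))%type R)
    (a : op (T * I)%type (T * I)%type R)
    (D : op ((T * I) * (T * I))%type ((T * I) * (T * I))%type R) : Prop :=
  exists Vs a1 a11,
  [/\ is_adjoint mu_HH mu_TTH V Vs, is_tensor_op mu_T mu_H id a a1,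
      is_tensor_op mu_T mu_TH id a1 a11 & D = Vs \o a11 \o V].

(* The trace Tr_{L^oo(T)} (x) Tr_{B(L^2(I_q))}.  An element x of M_q^+ is an
   infinite matrix over L^oo(T) whose entry at (p, p) is the function
   t |-> (x (1 (x) delta_p))(t, p), where 1 (x) delta_p = zeta^0 (x) delta_p;
   the trace is the sum over p of the integrals of these entries. *)
Definition Tr (x : op (T * I)%type (T * I)%type R) : \bar R :=
  \esum_(p in [set: I])
    (\int[mu_T]_t (complex.Re (x (ebasis 0 p) (t, p)))%:E)%E.

(* the span of the basis is a core of gamma: [gamma_core] is the graph of the
   restriction of gamma to the span *)
Definition gamma_core : graph (T * I)%type R := fun f g =>
  exists (n : nat) (c : 'I_n -> R[i]) (m : 'I_n -> int) (p : 'I_n -> I),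
    f = (fun z => \sum_(i < n) c i * ebasis (m i) (p i) z) /\
    g = (fun z => \sum_(i < n)
           c i * ((Iq_val (p i))^-1)%:C * ebasis (m i + 1) (p i) z).

Definition gamma : graph (T * I)%type R := graph_closure mu_H gamma_core.

Definition gamma_star_gamma : graph (T * I)%type R :=
  graph_comp (graph_adjoint mu_H gamma) gamma.

Definition phi (x : op (T * I)%type (T * I)%type R) : \bar R :=
  weight_density mu_H Tr gamma_star_gamma x.

Definition is_J (J : op (T * I)%type (T * I)%type R) : Prop :=
  antiunitary mu_H mu_H J /\
  forall n x, J (ebasis n x) =
    (fun z => (Num.sg (Iq_val x) ^ chi q (Iq_val x))%:C * ebasis (- n) x z)
    %[ae mu_H].

(* b = R(a) = J a^* J *)
Definition is_R (J a b : op (T * I)%type (T * I)%type R) : Prop :=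
  exists2 astar, is_adjoint mu_H mu_H a astar & b = J \o astar \o J.

End QuantumGroup.

Arguments Mq {R} q.

Notation opH q := (op (circle _ * Iq q)%type (circle _ * Iq q)%type _)
  (only parsing).
Notation opHH q :=
  (op ((circle _ * Iq q) * (circle _ * Iq q))%type
      ((circle _ * Iq q) * (circle _ * Iq q))%type _)
  (only parsing).
Notation opHH_TTH q :=
  (op ((circle _ * Iq q) * (circle _ * Iq q))%type
      (circle _ * (circle _ * (circle _ * Iq q)))%type _)
  (only parsing).

(* Main.v *)
Require Import Defs.
From HB Require Import structures.
From mathcomp Require Import all_boot all_order all_algebra.
From mathcomp Require Import complex.
From mathcomp Require Import all_classical all_reals all_analysis measurable_realfun.
From mathcomp Require Import ring lra zify.

(** The weight phi has the diagonal density gamma^* gamma, so on a positive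
    element x it only sees the diagonal: phi(x) = sum_p p^-2 <x e_p, e_p> with
    e_p = zeta^0 (x) delta_p (phi_formula). The square roots of the regularized
    densities are determined by an eigenvector argument and exist as
    multiplication operators. Since J maps e_p to e_p up to a sign, J a^* J and
    a have the same diagonal, whence phi = phi R (phi_R).

    For the right invariance, let B_p be the slice of Delta(x) at the vector
    state of e_p in the first leg. B_p commutes with the multiplication by
    zeta, hence lies in M_q (Mq_of_shift_invariant), and
    <y e_p, e_p> = w(B_p); the claim is that sum_p p^-2 B_p = phi(x) 1. The
    matrix of V is given by the numbers a_p(x, y), and everything rests on the
    exchange relation (a_swap)
      a_p(x, y) = (-1)^(chi x + chi p) sgn(y)^(chi y) |x / p| a_x(p, y),
    which moves the weights p^-2 onto the diagonal of x; the remaining sum over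
    p is then evaluated by the unitarity of V (a_orthogonality). The exchange
    relation is a symmetry of Psi: it follows from a symmetric finite q-sum, by
    passing to the limit when y > 0 and because the series terminates when
    y < 0. The vectors F_{r,s,m,p} are square-integrable by direct estimates of
    Psi (a_majorant, L2_F). *)

Set Implicit Arguments.
Unset Strict Implicit.
Unset Printing Implicit Defensive.

Import Order.TTheory GRing.Theory Num.Theory.
Import numFieldNormedType.Exports.

Local Open Scope classical_set_scope.
Local Open Scope ring_scope.
Local Open Scope complex_scope.

Local Notation Re := complex.Re.
Local Notation Im := complex.Im.
Local Notation conj := Num.conj.

(** * Complex numbers and semi-inner product spaces *)

Section ComplexFacts.
Variable R : realType.
Implicit Types z w : R[i].

Lemma normsqE z : (normsq z)%:C = z * (conj z).
Proof.
case: z => a b; apply/eqP; rewrite eq_complex /normsq /=.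
by apply/andP; split; apply/eqP; ring.
Qed.

Lemma normsq_ge0 z : 0 <= normsq z.
Proof. by rewrite /normsq addr_ge0 ?sqr_ge0. Qed.

Lemma normsqM z w : normsq (z * w) = normsq z * normsq w.
Proof. by case: z w => a b [c d]; rewrite /normsq /=; ring. Qed.

Lemma normsqJ z : normsq (conj z) = normsq z.
Proof. by case: z => a b; rewrite /normsq /= sqrrN. Qed.

Lemma normsq_eq0 z : normsq z = 0 -> z = 0.
Proof.
case: z => a b /eqP; rewrite /normsq /= paddr_eq0 ?sqr_ge0// !sqrf_eq0.
by move=> /andP[/eqP-> /eqP->].
Qed.

Lemma normsqR (x : R) : normsq x%:C = x ^+ 2.
Proof. by rewrite /normsq /= expr0n addr0. Qed.

Lemma normsqD_le z w : normsq (z + w) <= 2 * normsq z + 2 * normsq w.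
Proof.
case: z w => a b [c d]; rewrite /normsq /= -subr_ge0.
have -> : 2 * (a ^+ 2 + b ^+ 2) + 2 * (c ^+ 2 + d ^+ 2) -
  ((a + c) ^+ 2 + (b + d) ^+ 2) = (a - c) ^+ 2 + (b - d) ^+ 2 by ring.
by rewrite addr_ge0 ?sqr_ge0.
Qed.

Lemma Re_sqr_le z : Re z ^+ 2 <= normsq z.
Proof. by rewrite /normsq lerDl sqr_ge0. Qed.

Lemma ReD z w : Re (z + w) = Re z + Re w. Proof. by case: z w => ? ? []. Qed.
Lemma ImD z w : Im (z + w) = Im z + Im w. Proof. by case: z w => ? ? []. Qed.
Lemma ReJ z : Re (conj z) = Re z. Proof. by case: z. Qed.
Lemma ImJ z : Im (conj z) = - Im z. Proof. by case: z. Qed.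
Lemma ReZ (x : R) z : Re (x%:C * z) = x * Re z.
Proof. by case: z => a b /=; rewrite mul0r subr0. Qed.
Lemma ImZ (x : R) z : Im (x%:C * z) = x * Im z.
Proof. by case: z => a b /=; rewrite mul0r addr0. Qed.

Lemma Re_sum (I : Type) (s : seq I) (P : pred I) (F : I -> R[i]) :
  Re (\sum_(i <- s | P i) F i) = \sum_(i <- s | P i) Re (F i).
Proof.
by elim/big_rec2: _ => [//|i x y _ <-]; rewrite ReD.
Qed.

Lemma Im_sum (I : Type) (s : seq I) (P : pred I) (F : I -> R[i]) :
  Im (\sum_(i <- s | P i) F i) = \sum_(i <- s | P i) Im (F i).
Proof.
by elim/big_rec2: _ => [//|i x y _ <-]; rewrite ImD.
Qed.

Lemma eq_ReIm z w : Re z = Re w -> Im z = Im w -> z = w.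
Proof. by case: z w => ? ? [? ?] /= -> ->. Qed.

Lemma cjD z w : conj (z + w) = (conj z) + (conj w). Proof. exact: rmorphD. Qed.
Lemma cjM z w : conj (z * w) = (conj z) * (conj w). Proof. exact: rmorphM. Qed.
Lemma cjN z : conj (- z) = - conj z. Proof. exact: rmorphN. Qed.
Lemma cj0 : conj (0 : R[i]) = 0. Proof. exact: rmorph0. Qed.
Lemma cj1 : conj (1 : R[i]) = 1. Proof. exact: rmorph1. Qed.
Lemma ReN z : Re (- z) = - Re z. Proof. by case: z. Qed.
Lemma ImN z : Im (- z) = - Im z. Proof. by case: z. Qed.
Lemma cjK z : conj (conj z) = z. Proof. exact: conjCK. Qed.
Lemma rcM (x y : R) : (x * y)%:C = x%:C * y%:C. Proof. exact: rmorphM. Qed.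
Lemma rcD (x y : R) : (x + y)%:C = x%:C + y%:C. Proof. exact: rmorphD. Qed.
Lemma rcN (x : R) : (- x)%:C = - x%:C. Proof. exact: rmorphN. Qed.
Lemma rcX (x : R) n : (x ^+ n)%:C = x%:C ^+ n. Proof. exact: rmorphXn. Qed.
Lemma rc_sum (I : Type) (s : seq I) (P : pred I) (F : I -> R) :
  (\sum_(i <- s | P i) F i)%:C = \sum_(i <- s | P i) (F i)%:C.
Proof. exact: (rmorph_sum (real_complex R)). Qed.
Lemma cj_real (x : R) : conj x%:C = x%:C. Proof. exact: conjc_real. Qed.

End ComplexFacts.

Section SmallReal.
Variable R : realType.

Lemma eq_ler (x y : R) : x = y -> x <= y. Proof. by move=> ->. Qed.

Lemma le0_small (x K : R) : (forall e, 0 < e -> x <= K * e) -> x <= 0.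
Proof.
move=> h; rewrite leNgt; apply/negP => x0.
have [k k0 Kk] : exists2 k, 0 < k & K <= k.
  by exists (`|K| + 1); rewrite ?ltr_wpDl// (le_trans (ler_norm _))// lerDl.
have e0 : 0 < x / (2 * k) by rewrite divr_gt0// mulr_gt0.
have := h _ e0; apply/negP; rewrite -ltNge.
apply: (@le_lt_trans _ _ (k * (x / (2 * k)))); first by rewrite ler_pM2r.
have -> : k * (x / (2 * k)) = x / 2 by field; rewrite gt_eqF.
lra.
Qed.

Lemma geometric_small (r K e : R) : 0 <= r < 1 -> 0 < e ->
  exists n : nat, K * r ^+ n < e.
Proof.
move=> /andP[r0 r1] e0.
have /cvgrPdist_lt/(_ _ e0)[N _ /(_ N (leqnn N))] :
    (fun n => K * r ^+ n) @ \oo --> (K * 0 : R).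
  by apply: cvgMr; apply: cvg_expr; rewrite ger0_norm.
rewrite mulr0 sub0r normrN => h; exists N.
by rewrite (le_lt_trans (ler_norm _)).
Qed.

End SmallReal.

Lemma form_cauchy_schwarz (R : realType) (V : lmodType R[i]) (B : V -> V -> R[i]) :
  (forall (a : R[i]) u v w, B (a *: u + v) w = a * B u w + B v w) ->
  (forall u v, B v u = conj (B u v)) -> (forall u, 0 <= Re (B u u)) ->
  forall u v, normsq (B u v) <= Re (B u u) * Re (B v v).
Proof.
move=> Blin Bconj B_ge0 u v; set c := B u v.
have B0 w : B 0 w = 0.
  by have := Blin (-1) 0 0 w; rewrite scaler0 addr0 mulN1r addNr.
have BZ a x w : B (a *: x) w = a * B x w.
  by have := Blin a x 0 w; rewrite addr0 B0 addr0.
have BDl x y w : B (x + y) w = B x w + B y w.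
  by have := Blin 1 x y w; rewrite scale1r mul1r.
have BZr a x w : B w (a *: x) = conj a * B w x.
  by rewrite Bconj BZ cjM -Bconj.
have BDr x y w : B w (x + y) = B w x + B w y.
  by rewrite Bconj BDl cjD -!Bconj.
have cE : B v u = conj c by rewrite Bconj.
have key (t : R) :
    0 <= Re (B u u) - 2 * t * normsq c + t ^+ 2 * normsq c * Re (B v v).
  have := B_ge0 (- (t%:C * c) *: v + u).
  rewrite BDl !BDr !BZ !BZr cE -/c.
  have -> : - (t%:C * c) * (conj (- (t%:C * c)) * B v v) =
            (t ^+ 2 * normsq c)%:C * B v v.
    by rewrite rcM rcX normsqE cjN cjM cj_real; ring.
  have -> : - (t%:C * c) * conj c = (- (t * normsq c))%:C.
    by rewrite rcN rcM normsqE; ring.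
  have -> : conj (- (t%:C * c)) * c = (- (t * normsq c))%:C.
    by rewrite rcN rcM normsqE cjN cjM cj_real; ring.
  by rewrite !ReD ReZ /=; congr (_ <= _); ring.
have c0 := normsq_ge0 c; have v0 := B_ge0 v; have u0 := B_ge0 u.
have [vE|vN] := eqVneq (Re (B v v)) 0.
  rewrite vE mulr0; apply: (@le0_small _ _ (Re (B u u))) => e e0.
  have := key (e^-1); rewrite vE mulr0 addr0 subr_ge0 => h.
  have := ler_wpM2r (ltW e0) h.
  have -> : 2 * e^-1 * normsq c * e = 2 * normsq c by field; rewrite gt_eqF.
  lra.
have vp : 0 < Re (B v v) by rewrite lt_neqAle eq_sym vN.
have := key ((Re (B v v))^-1) => h.
rewrite -(ler_pdivrMr _ _ vp) -subr_ge0.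
by move: h; congr (_ <= _); field.
Qed.

Record semihilbert (R : realType) := SemiHilbert {
  shcar :> lmodType R[i];
  ip : shcar -> shcar -> R[i];
  ip_linear : forall (a : R[i]) u v w, ip (a *: u + v) w = a * ip u w + ip v w;
  ip_conj : forall u v, ip v u = conj (ip u v);
  ip_ge0 : forall u, 0 <= Re (ip u u);
  sh_complete : forall s : nat -> shcar,
    (forall k, Re (ip (s k.+1 - s k) (s k.+1 - s k)) <= 8^-1 ^+ k) ->
    exists K u, forall k, Re (ip (u - s k) (u - s k)) <= K * 4^-1 ^+ k
}.

Section SemiHilbertTheory.
Variables (R : realType) (E : semihilbert R).
Implicit Types (u v w : E) (a : R[i]).
Local Notation ip := (@ip R E).

Definition nrm2 u : R := Re (ip u u).

Lemma nrm2_ge0 u : 0 <= nrm2 u. Proof. exact: ip_ge0. Qed.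

Lemma ip0l w : ip 0 w = 0.
Proof.
have := ip_linear (-1) (0 : E) 0 w; rewrite scaler0 addr0 mulN1r addNr => <-//.
Qed.

Lemma ipDl u v w : ip (u + v) w = ip u w + ip v w.
Proof. by have := ip_linear 1 u v w; rewrite scale1r mul1r. Qed.

Lemma ipZl a u w : ip (a *: u) w = a * ip u w.
Proof. by have := ip_linear a u 0 w; rewrite addr0 ip0l addr0. Qed.

Lemma ipNl u w : ip (- u) w = - ip u w.
Proof. by rewrite -scaleN1r ipZl mulN1r. Qed.

Lemma ipBl u v w : ip (u - v) w = ip u w - ip v w.
Proof. by rewrite ipDl ipNl. Qed.

Lemma ip_suml (I : Type) (s : seq I) (P : pred I) (F : I -> E) w :
  ip (\sum_(i <- s | P i) F i) w = \sum_(i <- s | P i) ip (F i) w.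
Proof. by elim/big_rec2: _ => [|i x y _ <-]; rewrite ?ip0l ?ipDl. Qed.

Lemma ip0r w : ip w 0 = 0.
Proof. by rewrite ip_conj ip0l cj0. Qed.

Lemma ip_cj u v : conj (ip u v) = ip v u.
Proof. by rewrite [RHS]ip_conj. Qed.

Lemma ipDr u v w : ip w (u + v) = ip w u + ip w v.
Proof. by rewrite ip_conj ipDl cjD !ip_cj. Qed.

Lemma ipZr a u w : ip w (a *: u) = (conj a) * ip w u.
Proof. by rewrite ip_conj ipZl cjM !ip_cj. Qed.

Lemma ipNr u w : ip w (- u) = - ip w u.
Proof. by rewrite ip_conj ipNl cjN ip_cj. Qed.

Lemma ipBr u v w : ip w (u - v) = ip w u - ip w v.
Proof. by rewrite ipDr ipNr. Qed.

Lemma ip_sumr (I : Type) (s : seq I) (P : pred I) (F : I -> E) w :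
  ip w (\sum_(i <- s | P i) F i) = \sum_(i <- s | P i) ip w (F i).
Proof. by elim/big_rec2: _ => [|i x y _ <-]; rewrite ?ip0r ?ipDr. Qed.

Lemma ip_nrm2 u : ip u u = (nrm2 u)%:C.
Proof.
have : Im (ip u u) = - Im (ip u u) by rewrite {1}ip_conj ImJ.
move=> /eqP; rewrite -addr_eq0 -mulr2n mulrn_eq0 /= => /eqP h.
by apply: eq_ReIm.
Qed.

Lemma nrm2Z a u : nrm2 (a *: u) = normsq a * nrm2 u.
Proof.
rewrite /nrm2 ipZl ipZr mulrA -normsqE ReZ//.
Qed.

Lemma nrm2N u : nrm2 (- u) = nrm2 u.
Proof. by rewrite /nrm2 ipNl ipNr opprK. Qed.

Lemma nrm2BC u v : nrm2 (u - v) = nrm2 (v - u).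
Proof. by rewrite -nrm2N opprB. Qed.

Lemma nrm2D u v : nrm2 (u + v) = nrm2 u + nrm2 v + 2 * Re (ip u v).
Proof.
rewrite /nrm2 !(ipDl, ipDr) !ReD [ip v u]ip_conj ReJ; ring.
Qed.

Lemma nrm2D_le u v : nrm2 (u + v) <= 2 * nrm2 u + 2 * nrm2 v.
Proof.
have := nrm2_ge0 (u - v); rewrite !nrm2D nrm2N ipNr.
rewrite ReN; lra.
Qed.

Lemma cauchy_schwarz u v : normsq (ip u v) <= nrm2 u * nrm2 v.
Proof.
exact: (form_cauchy_schwarz (@ip_linear R E) (@ip_conj R E) (@ip_ge0 R E)).
Qed.

Lemma ip_null u v : nrm2 u = 0 -> ip u v = 0.
Proof.
move=> u0; apply: normsq_eq0; apply/eqP; rewrite eq_le normsq_ge0 andbT.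
by rewrite (le_trans (cauchy_schwarz _ _))// u0 mul0r.
Qed.

Lemma ip_eq_null u v : (forall w, ip u w = ip v w) -> nrm2 (u - v) = 0.
Proof. by move=> uv; rewrite /nrm2 ipBl uv subrr. Qed.

End SemiHilbertTheory.

(** * Orthonormal families and bounded operators *)

Section Orthonormal.
Variables (R : realType) (E : semihilbert R) (I : choiceType) (e : I -> E).
Hypothesis orth : forall i j, ip (e i) (e j) = (i == j)%:R.
Implicit Types (u v : E) (s : seq I).

Definition fourier_sum u s : E := \sum_(i <- s) ip u (e i) *: e i.

Lemma ip_fourier_sum u s i : uniq s ->
  ip (fourier_sum u s) (e i) = if i \in s then ip u (e i) else 0.
Proof.
move=> us; rewrite /fourier_sum ip_suml; case: ifPn => [si|/negP si].
  rewrite (bigD1_seq i)//= ipZl orth eqxx mulr1 big1 ?addr0// => j ji.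
  by rewrite ipZl orth (negbTE ji) mulr0.
rewrite big_seq big1// => j js; rewrite ipZl orth.
by case: eqP => [ji|]; rewrite ?mulr0//; move: si; rewrite -ji.
Qed.

Lemma nrm2_sub_fourier_sum u s : uniq s ->
  nrm2 (u - fourier_sum u s) = nrm2 u - \sum_(i <- s) normsq (ip u (e i)).
Proof.
move=> us; rewrite nrm2D nrm2N ipNr.
have h : ip u (fourier_sum u s) = (\sum_(i <- s) normsq (ip u (e i)))%:C.
  rewrite /fourier_sum ip_sumr rmorph_sum; apply: eq_bigr => i _.
  by rewrite ipZr /= normsqE mulrC.
have -> : nrm2 (fourier_sum u s) = \sum_(i <- s) normsq (ip u (e i)).
  rewrite /nrm2 {2}/fourier_sum ip_sumr Re_sum [in LHS]big_seq [in RHS]big_seq.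
  apply: eq_bigr => i si; rewrite ipZr ip_fourier_sum// si mulrC -normsqE//.
rewrite h ReN /=; ring.
Qed.

Lemma bessel u s : uniq s -> \sum_(i <- s) normsq (ip u (e i)) <= nrm2 u.
Proof. by move=> us; rewrite -subr_ge0 -nrm2_sub_fourier_sum// nrm2_ge0. Qed.

Lemma nrm2_fourier_sumB u s t : uniq s -> uniq t -> {subset s <= t} ->
  nrm2 (fourier_sum u t - fourier_sum u s) =
  \sum_(i <- t) normsq (ip u (e i)) - \sum_(i <- s) normsq (ip u (e i)).
Proof.
move=> us ut st; have ipe i : i \in s -> ip (fourier_sum u t) (e i) = ip u (e i).
  by move=> si; rewrite ip_fourier_sum// st.
have -> : fourier_sum u s = fourier_sum (fourier_sum u t) s.
  rewrite {1 2}/fourier_sum big_seq [RHS]big_seq.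
  by apply: eq_bigr => i si; rewrite ipe.
rewrite nrm2_sub_fourier_sum//.
have -> : \sum_(i <- s) normsq (ip (fourier_sum u t) (e i)) =
          \sum_(i <- s) normsq (ip u (e i)).
  by rewrite big_seq [RHS]big_seq; apply: eq_bigr => i si; rewrite ipe.
congr (_ - _).
rewrite /nrm2 {2}/fourier_sum ip_sumr Re_sum big_seq [in RHS]big_seq.
by apply: eq_bigr => i si; rewrite ipZr ip_fourier_sum// si mulrC -normsqE.
Qed.

Lemma le_sum_normsq u s t : uniq s -> uniq t -> {subset s <= t} ->
  \sum_(i <- s) normsq (ip u (e i)) <= \sum_(i <- t) normsq (ip u (e i)).
Proof.
by move=> us ut st; rewrite -subr_ge0 -nrm2_fourier_sumB// nrm2_ge0.
Qed.

Hypothesis total : forall g : E, (forall i, ip g (e i) = 0) -> nrm2 g = 0.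

(** The partial sums over a maximizing sequence of finite sets are Cauchy, and
    the difference between u and their limit is orthogonal to the family. *)
Theorem parseval_cvg u (eps : R) : 0 < eps ->
  exists2 s0, uniq s0 &
    forall s, uniq s -> {subset s0 <= s} -> nrm2 (u - fourier_sum u s) < eps.
Proof.
move=> eps0; pose A s := \sum_(i <- s) normsq (ip u (e i)).
pose S := [set A s | s in [set s | uniq s]].
have supS : has_sup S.
  split; first by exists (A [::]); exists [::].
  by exists (nrm2 u) => _ [s us <-]; exact: bessel.
have e8 k : (0 : R) < 8^-1 ^+ k by rewrite exprn_gt0.
have /choice[s sP] k : exists s, uniq s /\ sup S - 8^-1 ^+ k < A s.
  by have [_ [s us <-] h] := sup_adherent (e8 k) supS; exists s.
pose t k := undup (flatten [seq s j | j <- iota 0 k.+1]).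
have ut k : uniq (t k) by exact: undup_uniq.
have stS k : {subset t k <= t k.+1}.
  move=> i; rewrite !mem_undup => /flattenP[_ /mapP[j jk ->] ij].
  apply/flattenP; exists (s j) => //; apply: map_f; move: jk.
  by rewrite !mem_iota !add0n => /leq_trans; apply.
have st k : {subset s k <= t k}.
  move=> i ik; rewrite mem_undup; apply/flattenP; exists (s k) => //.
  by apply: map_f; rewrite mem_iota /= add0n ltnS.
have At k : sup S - 8^-1 ^+ k < A (t k).
  by apply: (lt_le_trans (sP k).2); apply: le_sum_normsq => //; exact: (sP k).1.
have AS r : uniq r -> A r <= sup S.
  by move=> ur; apply: sup_upper_bound => //; exists r.
have [k|K [v vP]] := @sh_complete R E (fun k => fourier_sum u (t k)).
  rewrite -/(nrm2 _) nrm2_fourier_sumB// lerBlDr -lerBlDl.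
  by apply: le_trans (ltW (At k)); rewrite lerD2r AS.
have uv0 : nrm2 (u - v) = 0.
  apply: total => i; apply: normsq_eq0; apply/eqP; rewrite eq_le normsq_ge0 andbT.
  have key k : normsq (ip (u - fourier_sum u (t k)) (e i)) <= 8^-1 ^+ k.
    rewrite ipBl ip_fourier_sum//; case: ifPn => [it|it].
      by rewrite subrr /normsq /= expr0n addr0 ltW.
    rewrite subr0.
    have /AS : uniq (i :: t k) by rewrite /= it ut.
    by rewrite /A big_cons -/(A _); move: (At k); lra.
  apply: (@le0_small _ _ 2) => eps1 e10.
  have [n hn] : exists n, (2 + `|K| + 1) * 4^-1 ^+ n < eps1.
    by apply: geometric_small => //; apply/andP; split; lra.
  have h48 : (8^-1 : R) ^+ n <= 4^-1 ^+ n.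
    by rewrite lerXn2r ?nnegrE//; lra.
  have := normsqD_le (ip (u - fourier_sum u (t n)) (e i))
                     (ip (fourier_sum u (t n) - v) (e i)).
  rewrite -ipDl addrA subrK => /le_trans; apply.
  have := cauchy_schwarz (fourier_sum u (t n) - v) (e i).
  rewrite nrm2BC {2}/nrm2 orth eqxx /= mulr1.
  have := vP n; rewrite -/(nrm2 _) => h1 h2; have := key n.
  have p4 : (0 : R) < 4^-1 ^+ n by rewrite exprn_gt0.
  have : K * 4^-1 ^+ n <= `|K| * 4^-1 ^+ n by rewrite ler_pM2r// ler_norm.
  move: hn; rewrite !mulrDl; lra.
have [n hn] : exists n, (2 * `|K|) * 4^-1 ^+ n < eps.
  by apply: geometric_small => //; apply/andP; split; lra.
exists (t n) => // r ur tr.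
apply: (@le_lt_trans _ _ (nrm2 (u - fourier_sum u (t n)))).
  by rewrite !nrm2_sub_fourier_sum// lerD2l lerN2; exact: le_sum_normsq.
rewrite (_ : u - _ = (u - v) + (v - fourier_sum u (t n))); last first.
  by rewrite addrA subrK.
apply: (le_lt_trans (nrm2D_le _ _)); rewrite uv0 mulr0 add0r.
apply: le_lt_trans hn; rewrite -mulrA ler_pM2l//.
apply: (le_trans (vP n)); rewrite ler_pM2r ?ler_norm//.
Qed.

End Orthonormal.

Section BoundedOperators.
Variable R : realType.

(** Up to null vectors, T is linear and bounded. *)
Definition wop (E F : semihilbert R) (T : E -> F) :=
  (forall a u v w, ip (T (a *: u + v)) w = a * ip (T u) w + ip (T v) w) /\
  (exists M : R, forall u, nrm2 (T u) <= M * nrm2 u).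

Definition hdense (E : semihilbert R) (D : set E) :=
  forall u (eps : R), 0 < eps -> exists2 v, D v & nrm2 (u - v) < eps.

Definition lspan (E : semihilbert R) (I : Type) (e : I -> E) : set E :=
  [set v | exists (s : seq I) (c : I -> R[i]), v = \sum_(i <- s) c i *: e i].

Lemma hdense_lspan (E : semihilbert R) (I : choiceType) (e : I -> E) :
  (forall i j, ip (e i) (e j) = (i == j)%:R) ->
  (forall g : E, (forall i, ip g (e i) = 0) -> nrm2 g = 0) ->
  hdense (lspan e).
Proof.
move=> orth tot u eps e0; have [s us] := parseval_cvg orth tot u e0.
move=> /(_ s us (fun x => id)) h; exists (fourier_sum e u s) => //.
by exists s, (fun i => ip u (e i)).
Qed.

Section OneOp.
Variables (E F : semihilbert R) (T : E -> F).
Hypothesis wT : wop T.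

Lemma wopZ a u w : ip (T (a *: u)) w = a * ip (T u) w.
Proof.
have [h _] := wT.
have h0 : ip (T 0) w = 0.
  by have := h (-1) 0 0 w; rewrite scaler0 addr0 mulN1r addNr.
by have := h a u 0 w; rewrite addr0 h0 addr0.
Qed.

Lemma wop0 w : ip (T 0) w = 0.
Proof. by have := wopZ 0 0 w; rewrite scale0r mul0r. Qed.

Lemma wopD u v w : ip (T (u + v)) w = ip (T u) w + ip (T v) w.
Proof. by have := wT.1 1 u v w; rewrite scale1r mul1r. Qed.

Lemma wopB u v w : ip (T (u - v)) w = ip (T u) w - ip (T v) w.
Proof. by rewrite wopD -scaleN1r wopZ mulN1r. Qed.

Lemma wop_sum (I : Type) (s : seq I) (c : I -> R[i]) (f : I -> E) w :
  ip (T (\sum_(i <- s) c i *: f i)) w = \sum_(i <- s) c i * ip (T (f i)) w.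
Proof.
elim: s => [|i s IH]; first by rewrite !big_nil wop0.
by rewrite !big_cons wopD wopZ IH.
Qed.

Lemma wop_bound : exists2 M : R, 0 < M & forall u, nrm2 (T u) <= M * nrm2 u.
Proof.
have [_ [M MP]] := wT; exists (`|M| + 1) => [|u]; first by rewrite ltr_wpDl.
by apply: (le_trans (MP u)); rewrite ler_wpM2r ?nrm2_ge0// ler_wpDr// ler_norm.
Qed.

Lemma wop_null u v : nrm2 (u - v) = 0 -> forall w, ip (T u) w = ip (T v) w.
Proof.
move=> uv w; apply/eqP; rewrite -subr_eq0 -wopB; apply/eqP/ip_null.
have [M _ MP] := wop_bound; apply/eqP; rewrite eq_le nrm2_ge0 andbT.
by rewrite (le_trans (MP _))// uv mulr0.
Qed.

Lemma wop_hdense0 (D : set E) w : hdense D -> (forall u, D u -> ip (T u) w = 0) ->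
  forall u, ip (T u) w = 0.
Proof.
move=> dD DT u; apply: normsq_eq0; apply/eqP; rewrite eq_le normsq_ge0 andbT.
have [M _ MP] := wop_bound.
apply: (@le0_small _ _ (`|M| * nrm2 w)) => eps e0; have [v Dv uv] := dD u _ e0.
have -> : ip (T u) w = ip (T (u - v)) w by rewrite wopB (DT v) ?subr0.
apply: (le_trans (cauchy_schwarz _ _)).
rewrite -mulrA [nrm2 w * _]mulrC mulrA ler_wpM2r ?nrm2_ge0//.
apply: (le_trans (MP _)).
apply: (@le_trans _ _ (`|M| * nrm2 (u - v))).
  by rewrite ler_wpM2r ?nrm2_ge0// ler_norm.
by rewrite ler_wpM2l// ltW.
Qed.

End OneOp.

Lemma wop_sub (E F : semihilbert R) (S T : E -> F) : wop S -> wop T ->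
  wop (fun u => S u - T u).
Proof.
move=> wS wT; split=> [a u v w|].
  rewrite !ipBl wS.1 wT.1; ring.
have [M M0 MP] := wop_bound wS; have [N N0 NP] := wop_bound wT.
exists (2 * M + 2 * N) => u; apply: (le_trans (nrm2D_le _ _)).
rewrite nrm2N (mulrDl (2 * M)) lerD//.
  by rewrite -mulrA ler_pM2l.
by rewrite -mulrA ler_pM2l.
Qed.

Lemma wop_comp (E F G : semihilbert R) (S : F -> G) (T : E -> F) :
  wop S -> wop T -> wop (S \o T).
Proof.
move=> wS wT; split=> [a u v w|] /=.
  rewrite -(wS.1 a); apply: wop_null => //; apply: ip_eq_null => z.
  by rewrite wT.1 ipDl ipZl.
have [M M0 MP] := wop_bound wS; have [N N0 NP] := wop_bound wT.
exists (M * N) => u; apply: (le_trans (MP _)).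
by rewrite -mulrA ler_pM2l.
Qed.

Lemma wop_ext (E F : semihilbert R) (S T : E -> F) (I : Type) (e : I -> E) :
  wop S -> wop T -> hdense (lspan e) ->
  (forall i w, ip (S (e i)) w = ip (T (e i)) w) ->
  forall u w, ip (S u) w = ip (T u) w.
Proof.
move=> wS wT dD ST u w; apply/eqP; rewrite -subr_eq0 -ipBl; apply/eqP.
apply: (wop_hdense0 (wop_sub wS wT) dD) => v [s [c ->]].
by rewrite ipBl (wop_sum wS) (wop_sum wT) -sumrB big1// => i _; rewrite ST subrr.
Qed.

Lemma pos_sym (E : semihilbert R) (T : E -> E) : wop T ->
  (forall u, 0 <= ip (T u) u) -> forall u v, ip (T u) v = ip u (T v).
Proof.
move=> wT pT u v.
have im0 x : Im (ip (T x) x) = 0 by exact: ger0_Im.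
have expand a : ip (T (a *: u + v)) (a *: u + v) = a * conj a * ip (T u) u +
    a * ip (T u) v + conj a * ip (T v) u + ip (T v) v.
  by rewrite wT.1 !ipDr !ipZr; ring.
have := im0 (1 *: u + v); have := im0 ('i%C *: u + v).
rewrite !expand -(ip_cj (T v) u).
case: (ip (T u) v) (ip (T v) u) (ip (T u) u) (ip (T v) v) (im0 u) (im0 v).
move=> a b [c d] [x y] [x' y'] /= -> -> h1 h2.
by apply/eqP; rewrite eq_complex /=; apply/andP; split; apply/eqP; lra.
Qed.

(** Cauchy-Schwarz for the form of a positive operator. *)
Lemma pos_cauchy_schwarz (E : semihilbert R) (T : E -> E) : wop T ->
  (forall u, 0 <= ip (T u) u) ->
  forall u v, normsq (ip (T u) v) <= Re (ip (T u) u) * Re (ip (T v) v).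
Proof.
move=> wT pT; apply: form_cauchy_schwarz => [a u v w|u v|u].
- by rewrite wT.1.
- by rewrite -[LHS]ip_cj -pos_sym.
- by have := pT u; rewrite lecE /= => /andP[].
Qed.

End BoundedOperators.

(** * Complex integrals and square-integrable functions *)

Section ComplexIntegral.
Context d (X : measurableType d) (R : realType).
Variable mu : {measure set X -> \bar R}.
Implicit Types (f g h : X -> R[i]).

Definition cintegrable f := mu.-integrable setT (EFin \o (fun x => Re (f x))) /\
  mu.-integrable setT (EFin \o (fun x => Im (f x))).

Definition cint f : R[i] := (\int[mu]_x Re (f x)) +i* (\int[mu]_x Im (f x)).

Lemma cmeasurable_cst (a : R[i]) : cmeasurable (fun _ : X => a).
Proof. by split; exact: measurable_cst. Qed.

Lemma cmeasurableD f g : cmeasurable f -> cmeasurable g ->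
  cmeasurable (fun x => f x + g x).
Proof.
move=> [f1 f2] [g1 g2]; split.
- rewrite (_ : (fun x => _) = (fun x => Re (f x) + Re (g x))); last first.
    by apply/funext => x; rewrite ReD.
  exact: measurable_funD.
- rewrite (_ : (fun x => _) = (fun x => Im (f x) + Im (g x))); last first.
    by apply/funext => x; rewrite ImD.
  exact: measurable_funD.
Qed.

Lemma cmeasurableM f g : cmeasurable f -> cmeasurable g ->
  cmeasurable (fun x => f x * g x).
Proof.
move=> [f1 f2] [g1 g2]; split.
- rewrite (_ : (fun x => _) =
    (fun x => Re (f x) * Re (g x) - Im (f x) * Im (g x))); last first.
    by apply/funext => x; case: (f x) (g x) => ? ? [].
  by apply: measurable_funB; exact: measurable_funM.
- rewrite (_ : (fun x => _) =
    (fun x => Re (f x) * Im (g x) + Im (f x) * Re (g x))); last first.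
    by apply/funext => x; case: (f x) (g x) => ? ? [].
  by apply: measurable_funD; exact: measurable_funM.
Qed.

Lemma cmeasurable_conj f : cmeasurable f -> cmeasurable (fun x => conj (f x)).
Proof.
move=> [f1 f2]; split.
- rewrite (_ : (fun x => _) = (fun x => Re (f x)))//.
  by apply/funext => x; rewrite ReJ.
- rewrite (_ : (fun x => _) = (fun x => 0 - Im (f x))); last first.
    by apply/funext => x; rewrite ImJ sub0r.
  exact: measurable_funB.
Qed.

Lemma measurable_normsq f : cmeasurable f ->
  measurable_fun setT (fun x => normsq (f x)).
Proof. by move=> [f1 f2]; apply: measurable_funD; exact: measurable_funX. Qed.

Lemma integrable_le (g : X -> R) (h : X -> R) : measurable_fun setT g ->
  (forall x, `|g x| <= h x) -> mu.-integrable setT (EFin \o h) ->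
  mu.-integrable setT (EFin \o g).
Proof.
move=> mg gh ih; apply: (le_integrable measurableT _ _ ih); first exact/measurable_EFinP.
by move=> x _; rewrite /= lee_fin (le_trans (gh x))// ler_norm.
Qed.

Lemma integrable_ge0 (h : X -> R) : measurable_fun setT h ->
  (forall x, 0 <= h x) -> (\int[mu]_x (h x)%:E < +oo)%E ->
  mu.-integrable setT (EFin \o h).
Proof.
move=> mh h0 hoo; apply/integrableP; split; first exact/measurable_EFinP.
by under eq_integral => x _ do rewrite /= ger0_norm//.
Qed.

Lemma cintegrable_le f (h : X -> R) : cmeasurable f ->
  (forall x, normsq (f x) <= h x ^+ 2) -> (forall x, 0 <= h x) ->
  mu.-integrable setT (EFin \o h) -> cintegrable f.
Proof.
move=> [f1 f2] fh h0 ih; split.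
- apply: integrable_le ih => // x; rewrite -ler_sqr ?nnegrE//.
  by rewrite real_normK ?num_real// (le_trans _ (fh x))// /normsq lerDl sqr_ge0.
- apply: integrable_le ih => // x; rewrite -ler_sqr ?nnegrE//.
  by rewrite real_normK ?num_real// (le_trans _ (fh x))// /normsq lerDr sqr_ge0.
Qed.

Lemma cintegrable_meas f : cintegrable f -> cmeasurable f.
Proof.
by move=> [/integrableP[/measurable_EFinP ? _] /integrableP[/measurable_EFinP ? _]].
Qed.

Lemma eq_cint f g : (forall x, f x = g x) -> cint f = cint g.
Proof. by move=> fg; congr cint; exact/funext. Qed.

Lemma cintD f g : cintegrable f -> cintegrable g ->
  cint (fun x => f x + g x) = cint f + cint g.
Proof.
move=> [f1 f2] [g1 g2]; rewrite /cint; apply: eq_ReIm => /=.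
- by under eq_Rintegral do rewrite ReD; rewrite RintegralD.
- by under eq_Rintegral do rewrite ImD; rewrite RintegralD.
Qed.

Lemma RintegrableZ (k : R) (h : X -> R) : mu.-integrable setT (EFin \o h) ->
  mu.-integrable setT (EFin \o (fun x => k * h x)).
Proof.
move=> ih; rewrite (_ : _ \o _ = (fun x => k%:E * (EFin \o h) x)%E)//.
exact: integrableZl.
Qed.

Lemma RintegrableD (g h : X -> R) : mu.-integrable setT (EFin \o g) ->
  mu.-integrable setT (EFin \o h) ->
  mu.-integrable setT (EFin \o (fun x => g x + h x)).
Proof.
move=> ig ih; rewrite (_ : _ \o _ = ((EFin \o g) \+ (EFin \o h))%E)//.
exact: integrableD.
Qed.

Lemma cintegrableZ (a : R[i]) f : cintegrable f ->
  cintegrable (fun x => a * f x).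
Proof.
move=> [f1 f2]; case: a => a b; split.
- rewrite (_ : (fun x => _) = (fun x => a * Re (f x) + (- b) * Im (f x))).
    by apply: RintegrableD; exact: RintegrableZ.
  by apply/funext => x; case: (f x) => ? ? /=; rewrite mulNr.
- rewrite (_ : (fun x => _) = (fun x => a * Im (f x) + b * Re (f x))).
    by apply: RintegrableD; exact: RintegrableZ.
  by apply/funext => x; case: (f x).
Qed.

Lemma cintZ (a : R[i]) f : cintegrable f -> cint (fun x => a * f x) = a * cint f.
Proof.
move=> [f1 f2]; case: a => a b; rewrite /cint; apply: eq_ReIm => /=.
- rewrite (_ : (fun x => _) = (fun x => a * Re (f x) + (- b) * Im (f x))); last first.
    by apply/funext => x; case: (f x) => ? ? /=; rewrite mulNr.
  rewrite RintegralD//; [|exact: RintegrableZ..].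
  by rewrite !RintegralZl// mulNr.
- rewrite (_ : (fun x => _) = (fun x => a * Im (f x) + b * Re (f x))); last first.
    by apply/funext => x; case: (f x).
  rewrite RintegralD//; [|exact: RintegrableZ..].
  by rewrite !RintegralZl.
Qed.

Lemma cint_conj f : cintegrable f -> cint (fun x => conj (f x)) = conj (cint f).
Proof.
move=> [f1 f2]; rewrite /cint; apply: eq_ReIm => /=.
- by under eq_Rintegral do rewrite ReJ.
- under eq_Rintegral do rewrite ImJ -mulN1r.
  by rewrite RintegralZl// mulN1r.
Qed.

Lemma ae_eq_Rintegral (g h : X -> R) : measurable_fun setT g ->
  measurable_fun setT h -> g = h %[ae mu] -> \int[mu]_x g x = \int[mu]_x h x.
Proof.
move=> mg mh gh; congr fine; apply: ae_eq_integral => //; try exact/measurable_EFinP.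
by apply: filterS gh => x /[swap] _ /(_ I) ->.
Qed.

Lemma cint_ae f g : cmeasurable f -> cmeasurable g -> f = g %[ae mu] ->
  cint f = cint g.
Proof.
move=> [f1 f2] [g1 g2] fg; congr (_ +i* _).
- by apply: ae_eq_Rintegral => //; apply: filterS fg => x /[apply] ->.
- by apply: ae_eq_Rintegral => //; apply: filterS fg => x /[apply] ->.
Qed.

End ComplexIntegral.

Lemma innerE d (X : measurableType d) (R : realType) (mu : {measure set X -> \bar R})
  (f g : X -> R[i]) : inner mu f g = cint mu (fun x => f x * conj (g x)).
Proof. by []. Qed.

Section L2basics.
Context d (X : measurableType d) (R : realType).
Variable mu : {measure set X -> \bar R}.
Implicit Types (f g h : X -> R[i]).

Lemma L2_meas f : L2 mu f -> cmeasurable f. Proof. by case. Qed.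

Lemma L2_integrable f : L2 mu f ->
  mu.-integrable setT (EFin \o (fun x => normsq (f x))).
Proof.
move=> [mf foo]; apply: integrable_ge0 => //; first exact: measurable_normsq.
by move=> x; exact: normsq_ge0.
Qed.

Lemma integrable_lty_ge0 (h : X -> R) : (forall x, 0 <= h x) ->
  mu.-integrable setT (EFin \o h) -> (\int[mu]_x (h x)%:E < +oo)%E.
Proof.
move=> h0 /integrableP[_]; under eq_integral => x _ do rewrite /= ger0_norm//.
by [].
Qed.

Lemma L2_le f (h : X -> R) : cmeasurable f -> (forall x, normsq (f x) <= h x) ->
  mu.-integrable setT (EFin \o h) -> L2 mu f.
Proof.
move=> mf fh ih; split => //; apply: integrable_lty_ge0.
  by move=> x; exact: normsq_ge0.
apply: integrable_le ih; first exact: measurable_normsq.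
by move=> x; rewrite ger0_norm ?normsq_ge0.
Qed.

Lemma L2_lin (a : R[i]) f g : L2 mu f -> L2 mu g -> L2 mu (fun x => a * f x + g x).
Proof.
move=> lf lg; apply: (@L2_le _ (fun x => (2 * normsq a) * normsq (f x) + 2 * normsq (g x))).
- apply: cmeasurableD; [|exact: L2_meas].
  by apply: cmeasurableM; [exact: cmeasurable_cst|exact: L2_meas].
- by move=> x; rewrite (le_trans (normsqD_le _ _))// normsqM mulrA.
- by apply: RintegrableD; apply: RintegrableZ; exact: L2_integrable.
Qed.

Lemma L2_0 : L2 mu (fun=> 0).
Proof.
split; first exact: cmeasurable_cst.
by rewrite (_ : (fun _ => _) = cst 0%E) ?integral0// /normsq /= expr0n addr0.
Qed.

Lemma L2_mul_integrable f g : L2 mu f -> L2 mu g ->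
  cintegrable mu (fun x => f x * conj (g x)).
Proof.
move=> lf lg.
apply: (@cintegrable_le _ _ _ _ _ (fun x => normsq (f x) + normsq (g x))).
- by apply: cmeasurableM; [|apply: cmeasurable_conj]; exact: L2_meas.
- move=> x; rewrite normsqM normsqJ.
  have := normsq_ge0 (f x); have := normsq_ge0 (g x); nra.
- by move=> x; rewrite addr_ge0 ?normsq_ge0.
- by apply: RintegrableD; exact: L2_integrable.
Qed.

Lemma inner_linear (a : R[i]) f g h : L2 mu f -> L2 mu g -> L2 mu h ->
  inner mu (fun x => a * f x + g x) h = a * inner mu f h + inner mu g h.
Proof.
move=> lf lg lh; rewrite !innerE.
rewrite (@eq_cint _ _ _ mu _ (fun x => a * (f x * conj (h x)) + g x * conj (h x))).
  rewrite cintD ?cintZ//; [exact: L2_mul_integrable|apply: cintegrableZ|];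
  exact: L2_mul_integrable.
by move=> x; ring.
Qed.

Lemma inner_conj f g : L2 mu f -> L2 mu g -> inner mu g f = conj (inner mu f g).
Proof.
move=> lf lg; rewrite !innerE.
rewrite -cint_conj; last exact: L2_mul_integrable.
by apply: eq_cint => x; rewrite cjM cjK mulrC.
Qed.

Lemma inner_self f : Re (inner mu f f) = norm2sq mu f.
Proof. by apply: eq_Rintegral => x _; rewrite -normsqE. Qed.

Lemma norm2sq_ge0 f : 0 <= norm2sq mu f.
Proof. by apply: Rintegral_ge0 => x _; exact: normsq_ge0. Qed.

Lemma norm2sqE f : L2 mu f -> (norm2sq mu f)%:E = (\int[mu]_x (normsq (f x))%:E)%E.
Proof.
move=> [mf lf]; rewrite /norm2sq /Rintegral fineK// ge0_fin_numE//.
by apply: integral_ge0 => x _; rewrite lee_fin normsq_ge0.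
Qed.

Lemma norm2sq_eq0 f : L2 mu f -> norm2sq mu f = 0 -> f = (fun=> 0) %[ae mu].
Proof.
move=> lf f0; have := norm2sqE lf; rewrite f0 => /esym h.
have mF : measurable_fun [set: X] (fun x => (normsq (f x))%:E).
  exact/measurable_EFinP/measurable_normsq/L2_meas.
have : (\int[mu]_x `|(normsq (f x))%:E| = 0)%E.
  rewrite -[RHS]h; apply: eq_integral => x _.
  by rewrite gee0_abs// lee_fin normsq_ge0.
move=> /(ae_eq_integral_abs mu measurableT mF); apply: filterS => x /[apply] -[].
exact: normsq_eq0.
Qed.

Lemma inner_ae f f' g : L2 mu f -> L2 mu f' -> L2 mu g -> f = f' %[ae mu] ->
  inner mu f g = inner mu f' g.
Proof.
move=> lf lf' lg ff'; apply: cint_ae; try by apply: (@cintegrable_meas _ _ _ mu);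
  exact: L2_mul_integrable.
by apply: filterS ff' => x /[apply] ->.
Qed.

End L2basics.

Section RieszFischer.
Context d (X : measurableType d) (R : realType).
Variable mu : {measure set X -> \bar R}.

Lemma geometric_cauchy_cvg (r : R) (u : nat -> R) (C : R) : 0 <= r < 1 ->
  (forall k, `|u k.+1 - u k| <= C * r ^+ k) ->
  cvgn u /\ forall k, `|limn u - u k| <= C / (1 - r) * r ^+ k.
Proof.
move=> /andP[r0 r1] uC; pose t k := C / (1 - r) * r ^+ k.
have r1' : 1 - r != 0 by rewrite subr_eq0 eq_sym lt_eqF.
have tS k : t k.+1 = t k - C * r ^+ k by rewrite /t exprS; field.
have C0 : 0 <= C by have := uC 0%N; rewrite expr0 mulr1; exact: le_trans.
have t0 k : 0 <= t k by rewrite /t !mulr_ge0// ?exprn_ge0// invr_ge0 subr_ge0 ltW.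
have nda : nondecreasing_seq (fun k => u k - t k).
  apply/nondecreasing_seqP => k; rewrite tS.
  by move: (uC k); rewrite ler_norml => /andP[]; lra.
have nib : nonincreasing_seq (fun k => u k + t k).
  apply/nonincreasing_seqP => k; rewrite tS.
  by move: (uC k); rewrite ler_norml => /andP[]; lra.
have ab j k : u j - t j <= u k + t k.
  apply: (@le_trans _ _ (u (maxn j k) - t (maxn j k))).
    exact/nda/leq_maxl.
  apply: (@le_trans _ _ (u (maxn j k) + t (maxn j k))).
    by rewrite lerD2l; move: (t0 (maxn j k)); lra.
  exact/nib/leq_maxr.
have t_0 : t @ \oo --> (0 : R).
  rewrite -[X in _ --> X](mulr0 (C / (1 - r))); apply: cvgMr.
  by apply: cvg_expr; rewrite ger0_norm.
have ca : cvgn (fun k => u k - t k).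
  apply: nondecreasing_is_cvgn => //; exists (u 0%N + t 0%N) => _ [k _ <-] /=.
  exact: ab.
have cu : u @ \oo --> limn (fun k => u k - t k).
  rewrite (_ : u = (fun k => (u k - t k) + t k)); last first.
    by apply/funext => k; rewrite subrK.
  rewrite -[X in _ --> X]addr0; apply: cvgD => //.
  rewrite (_ : (fun k => _) = (fun k => u k - t k))//.
  by apply/funext => k; rewrite subrK.
split; first by apply/cvg_ex; exists (limn (fun k => u k - t k)).
move=> k; rewrite (cvg_lim _ cu)//.
have h1 : u k - t k <= limn (fun k => u k - t k) by exact: nondecreasing_cvgn_le.
have h2 : limn (fun k => u k - t k) <= u k + t k.
  by apply: limr_le => //; near=> j; exact: ab.
by rewrite -/(t k) ler_norml; apply/andP; split; lra.
Unshelve. all: by end_near. Qed.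

Lemma riesz_fischer_real (s : nat -> X -> R) :
  (forall k, measurable_fun setT (s k)) ->
  (forall k, (\int[mu]_x ((s k.+1 x - s k x) ^+ 2)%:E <= (8^-1 ^+ k)%:E)%E) ->
  exists2 g : X -> R, measurable_fun setT g &
    forall k, (\int[mu]_x ((g x - s k x) ^+ 2)%:E <= (8 * 4^-1 ^+ k)%:E)%E.
Proof.
move=> ms hs; pose r k x := (s k.+1 x - s k x) ^+ 2.
have r0 k x : 0 <= r k x by exact: sqr_ge0.
have mr k : measurable_fun setT (r k).
  by apply: measurable_funX; exact: measurable_funB.
have mcr k : measurable_fun setT (fun x => 4 ^+ k * r k x).
  by apply: measurable_funM; [exact: measurable_cst|exact: mr].
pose G x := (\sum_(k <oo) (4 ^+ k * r k x)%:E)%E.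
have G0 x : (0 <= G x)%E.
  by apply: nneseries_ge0 => k _ _; rewrite lee_fin mulr_ge0// exprn_ge0.
have mG : measurable_fun setT G.
  apply: ge0_emeasurable_sum => [k x _ _|k _].
    by rewrite lee_fin mulr_ge0// exprn_ge0.
  by apply/measurable_EFinP; exact: mcr.
have iG : (\int[mu]_x G x <= 2%:E)%E.
  rewrite integral_nneseries//; last 2 first.
  - by move=> k; apply/measurable_EFinP; exact: mcr.
  - by move=> k x _; rewrite lee_fin mulr_ge0// exprn_ge0.
  apply: (@le_trans _ _ (\sum_(k <oo) (2 / (2 ^ k.+1)%:R)%:E)%E); last first.
    exact: epsilon_trick0.
  apply: lee_nneseries => [k _ _|k _].
    by apply: integral_ge0 => x _; rewrite lee_fin mulr_ge0// exprn_ge0.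
  under eq_integral do rewrite EFinM.
  rewrite ge0_integralZl_EFin; last 4 first.
  - exact: measurableT.
  - by move=> x _; rewrite lee_fin.
  - exact/measurable_EFinP.
  - by rewrite exprn_ge0.
  apply: (@le_trans _ _ ((4 ^+ k)%:E * (8^-1 ^+ k)%:E)%E).
    by apply: lee_wpmul2l; [rewrite lee_fin exprn_ge0|exact: hs].
  rewrite -EFinM lee_fin -exprMn (_ : 4 * 8^-1 = 2^-1); last by field.
  by rewrite natrX exprS exprVn; apply: eq_ler; field; rewrite expf_neq0.
have r_le k x : (G x < +oo)%E -> 4 ^+ k * r k x <= fine (G x).
  move=> Goo; rewrite -lee_fin fineK ?ge0_fin_numE//.
  rewrite /G (@nneseriesD1 _ _ k predT)//; last first.
    by move=> j _; rewrite lee_fin mulr_ge0// exprn_ge0.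
  rewrite leeDl// nneseries_ge0// => j _ _.
  by rewrite lee_fin mulr_ge0// exprn_ge0.
pose A := [set x | (G x < +oo)%E].
have mA : measurable A.
  rewrite -[A]setTI; apply: measurable_lte => //; exact: measurable_cst.
pose s' k x := s k x * \1_A x.
have ms' k : measurable_fun setT (s' k) by apply: measurable_funM.
have cs' x : A x -> cvgn (s' ^~ x) /\
    forall k, `|limn (s' ^~ x) - s' k x| <= 2 * Num.sqrt (fine (G x)) * 2^-1 ^+ k.
  have h2 : 2 * Num.sqrt (fine (G x)) = Num.sqrt (fine (G x)) / (1 - 2^-1) by field.
  move=> Ax; rewrite h2.
  apply: geometric_cauchy_cvg => [|k]; first by apply/andP; split; lra.
  rewrite /s' indicE mem_set// !mulr1 -sqrtr_sqr.
  have -> : (2^-1 : R) ^+ k = Num.sqrt (4^-1 ^+ k).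
    by rewrite (_ : 4^-1 = 2^-1 ^+ 2) -?exprM ?[(2 * k)%N]mulnC ?exprM ?sqrtr_sqr
      ?ger0_norm ?exprn_ge0//; field.
  rewrite -sqrtrM ?fine_ge0// ler_wsqrtr// exprVn ler_pdivlMr ?exprn_gt0//.
  by rewrite mulrC; exact: r_le.
pose g x := limn (s' ^~ x).
have cvs' x : s' ^~ x @ \oo --> g x.
  have [Ax|nAx] := pselect (A x); first exact: (cs' x Ax).1.
  rewrite /g (_ : s' ^~ x = fun=> 0); last first.
    by apply/funext => k; rewrite /s' indicE memNset// mulr0.
  by rewrite lim_cst//; exact: cvg_cst.
have mg : measurable_fun setT g by apply: (measurable_fun_cvg ms') => x _; exact: cvs'.
exists g => // k; apply: (@le_trans _ _ (\int[mu]_x ((4 * 4^-1 ^+ k)%:E * G x))%E).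
  apply: ge0_le_integral => //.
  - by move=> x _; rewrite lee_fin sqr_ge0.
  - by apply/measurable_EFinP/measurable_funX; exact: measurable_funB.
  - exact: measurable_funeM.
  move=> x _; have [Ax|nAx] := pselect (A x); last first.
    have -> : G x = +oo%E.
      by apply/eqP; rewrite -leye_eq leNgt; exact/negP.
    by rewrite gt0_muley ?leey// lte_fin mulr_gt0// exprn_gt0.
  have := (cs' x Ax).2 k; rewrite -/(g x) {1}/s' indicE mem_set// mulr1 => h.
  rewrite -(@fineK _ (G x)) ?ge0_fin_numE// -EFinM lee_fin.
  rewrite -real_normK ?num_real//.
  have h0 := le_trans (normr_ge0 _) h.
  apply: (@le_trans _ _ ((2 * Num.sqrt (fine (G x)) * 2^-1 ^+ k) ^+ 2)).
    by rewrite ler_sqr ?nnegrE.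
  rewrite !exprMn sqr_sqrtr ?fine_ge0// -exprM muln2 -mul2n exprM.
  by rewrite (_ : 2^-1 ^+ 2 = 4^-1 :> R); [apply: eq_ler; ring|field].
have p4 : (0 : R) <= 4 * 4^-1 ^+ k by rewrite mulr_ge0// exprn_ge0.
rewrite ge0_integralZl_EFin//.
apply: (@le_trans _ _ ((4 * 4^-1 ^+ k)%:E * 2%:E)%E).
  by apply: lee_wpmul2l; [rewrite lee_fin|].
by rewrite -EFinM lee_fin; apply: eq_ler; ring.
Qed.

End RieszFischer.

(** * L2 as a semi-inner product space *)

Section L2type.
Context d (X : measurableType d) (R : realType).
Variable mu : {measure set X -> \bar R}.

Definition L2_pred : {pred X -> R[i]} := mem (L2 mu).

Fact L2_submod_closed : submod_closed L2_pred.
Proof.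
split=> [|a f g]; rewrite !inE; first exact: L2_0.
exact: L2_lin.
Qed.

HB.instance Definition _ :=
  GRing.isSubmodClosed.Build R[i] (X -> R[i]) L2_pred L2_submod_closed.

Record L2_type := L2_mk { L2_val :> X -> R[i]; L2_valP : L2_val \in L2_pred }.

HB.instance Definition _ := [isSub for L2_val].
HB.instance Definition _ := [Choice of L2_type by <:].
HB.instance Definition _ := [SubChoice_isSubLmodule of L2_type by <:].

Lemma L2P (f : L2_type) : L2 mu f.
Proof. by have := L2_valP f; rewrite inE. Qed.

Definition mkL2 (f : X -> R[i]) (lf : L2 mu f) : L2_type :=
  L2_mk (mem_set lf : f \in L2_pred).

Lemma L2_val_lin (a : R[i]) (f g : L2_type) :
  (a *: f + g : L2_type) = (fun x => a * f x + g x) :> (X -> R[i]).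
Proof. by []. Qed.

Lemma L2_val_sum (I : Type) (s : seq I) (c : I -> R[i]) (F : I -> L2_type) :
  (\sum_(i <- s) c i *: F i : L2_type) = (fun x => \sum_(i <- s) c i * F i x)
  :> (X -> R[i]).
Proof.
elim: s => [|i s IH]; apply/funext => x; rewrite ?big_nil// !big_cons.
by rewrite -[X in _ = _ + X](congr1 (fun f => f x) IH).
Qed.

Definition L2_ip (f g : L2_type) : R[i] := inner mu f g.

Fact L2_ip_linear (a : R[i]) f g h : L2_ip (a *: f + g) h = a * L2_ip f h + L2_ip g h.
Proof. by apply: inner_linear; exact: L2P. Qed.

Fact L2_ip_conj f g : L2_ip g f = conj (L2_ip f g).
Proof. by apply: inner_conj; exact: L2P. Qed.

Fact L2_ip_ge0 f : 0 <= Re (L2_ip f f).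
Proof. by rewrite inner_self norm2sq_ge0. Qed.

(** Riesz-Fischer: geometrically Cauchy sequences converge almost everywhere
    to a limit in norm. *)
Fact L2_complete (s : nat -> L2_type) :
  (forall k, Re (L2_ip (s k.+1 - s k) (s k.+1 - s k)) <= 8^-1 ^+ k) ->
  exists K u, forall k, Re (L2_ip (u - s k) (u - s k)) <= K * 4^-1 ^+ k.
Proof.
move=> hs.
have ms k : cmeasurable (s k) by exact: L2_meas (L2P _).
have hs' k : (\int[mu]_x (normsq ((s k.+1 - s k) x))%:E <= (8^-1 ^+ k)%:E)%E.
  rewrite -norm2sqE; last exact: L2P.
  by rewrite lee_fin -inner_self; exact: hs.
have normsqB k x : normsq ((s k.+1 - s k) x) =
    (Re (s k.+1 x) - Re (s k x)) ^+ 2 + (Im (s k.+1 x) - Im (s k x)) ^+ 2.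
  by rewrite -[(s k.+1 - s k) x]/(s k.+1 x - s k x) /normsq ReD ImD ReN ImN.
have mD k : measurable_fun setT (fun x => normsq ((s k.+1 - s k) x)).
  exact/measurable_normsq/L2_meas/L2P.
have [k|k|g1 mg1 g1P] := @riesz_fischer_real _ _ _ mu (fun k x => Re (s k x)).
- exact: (ms k).1.
- apply: le_trans (hs' k); apply: ge0_le_integral => //.
  + by move=> x _; rewrite lee_fin sqr_ge0.
  + apply/measurable_EFinP/measurable_funX/measurable_funB; [exact: (ms _).1..].
  + exact/measurable_EFinP.
  + by move=> x _; rewrite lee_fin normsqB lerDl sqr_ge0.
have [k|k|g2 mg2 g2P] := @riesz_fischer_real _ _ _ mu (fun k x => Im (s k x)).
- exact: (ms k).2.
- apply: le_trans (hs' k); apply: ge0_le_integral => //.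
  + by move=> x _; rewrite lee_fin sqr_ge0.
  + apply/measurable_EFinP/measurable_funX/measurable_funB; [exact: (ms _).2..].
  + exact/measurable_EFinP.
  + by move=> x _; rewrite lee_fin normsqB lerDr sqr_ge0.
pose g x := g1 x +i* g2 x.
have bound k : (\int[mu]_x (normsq (g x - s k x))%:E <= (16 * 4^-1 ^+ k)%:E)%E.
  under eq_integral do rewrite /normsq ReD ImD ReN ImN EFinD.
  rewrite ge0_integralD//; last 4 first.
  - by move=> x _; rewrite lee_fin sqr_ge0.
  - by apply/measurable_EFinP/measurable_funX/measurable_funB => //; exact: (ms _).1.
  - by move=> x _; rewrite lee_fin sqr_ge0.
  - by apply/measurable_EFinP/measurable_funX/measurable_funB => //; exact: (ms _).2.
  rewrite (_ : 16 * 4^-1 ^+ k = 8 * 4^-1 ^+ k + 8 * 4^-1 ^+ k); last by ring.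
  by rewrite EFinD leeD.
have lg : L2 mu g.
  have l0 : L2 mu (fun x => g x - s 0%N x).
    split; last by apply: le_lt_trans (bound 0%N) _; rewrite ltry.
    apply: cmeasurableD => //.
    have := ms 0%N => -[m1 m2]; split.
    - rewrite (_ : (fun x => _) = (fun x => 0 - Re (s 0%N x))); last first.
        by apply/funext => x; rewrite ReN sub0r.
      exact: measurable_funB.
    - rewrite (_ : (fun x => _) = (fun x => 0 - Im (s 0%N x))); last first.
        by apply/funext => x; rewrite ImN sub0r.
      exact: measurable_funB.
  have := L2_lin 1 l0 (L2P (s 0%N)).
  by congr (L2 mu _); apply/funext => x; rewrite mul1r subrK.
exists 16, (mkL2 lg) => k; rewrite -lee_fin inner_self norm2sqE; last exact: L2P.
exact: bound.
Qed.

Definition L2H : semihilbert R :=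
  SemiHilbert L2_ip_linear L2_ip_conj L2_ip_ge0 L2_complete.

Lemma ipE (f g : L2H) : ip f g = inner mu (f : L2_type) (g : L2_type).
Proof. by []. Qed.

Lemma nrm2E (f : L2H) : nrm2 f = norm2sq mu (f : L2_type).
Proof. exact: inner_self. Qed.

Lemma ip_eq_ae (f g : L2H) : (forall h, ip f h = ip g h) ->
  (f : L2_type) = (g : L2_type) %[ae mu].
Proof.
move=> fg; have : nrm2 (f - g) = 0 by exact: ip_eq_null.
rewrite nrm2E => /(norm2sq_eq0 (L2P _)); apply: filterS => x /[apply] /eqP.
by rewrite -[_ x]/((f : L2_type) x - (g : L2_type) x) subr_eq0 => /eqP.
Qed.

Lemma ae_ip_eq (f g : L2H) : (f : L2_type) = (g : L2_type) %[ae mu] ->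
  forall h, ip f h = ip g h.
Proof. by move=> fg h; apply: inner_ae => //; exact: L2P. Qed.

End L2type.

(** * Products of L2 spaces *)

Section ProductL2.
Context d1 (X : measurableType d1) d2 (Y : measurableType d2) (R : realType).
Variables (mu : {sigma_finite_measure set X -> \bar R})
  (nu : {sigma_finite_measure set Y -> \bar R}).
Let P := prodm mu nu.
Implicit Types (F G : X * Y -> R[i]).

Lemma cmeasurable_fst (f : X -> R[i]) : cmeasurable f ->
  cmeasurable (fun z : X * Y => f z.1).
Proof.
by move=> [f1 f2]; split; [apply: (measurableT_comp f1)|apply: (measurableT_comp f2)];
  exact: measurable_fst.
Qed.

Lemma cmeasurable_snd (f : Y -> R[i]) : cmeasurable f ->
  cmeasurable (fun z : X * Y => f z.2).
Proof.
by move=> [f1 f2]; split; [apply: (measurableT_comp f1)|apply: (measurableT_comp f2)];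
  exact: measurable_snd.
Qed.

Lemma cmeasurable_pair2 F y : cmeasurable F -> cmeasurable (fun x => F (x, y)).
Proof.
by move=> [f1 f2]; split; [apply: (measurableT_comp f1)|apply: (measurableT_comp f2)];
  exact: measurable_pair2.
Qed.

Lemma measurable_integral1 (f : X * Y -> \bar R) : measurable_fun setT f ->
  measurable_fun setT (fun y => \int[mu]_x f (x, y))%E.
Proof.
move=> mf; rewrite (_ : (fun y => _) =
  ((fun y => \int[mu]_x f^\+ (x, y)) \- (fun y => \int[mu]_x f^\- (x, y)))%E); last first.
  apply/funext=> y; rewrite [LHS]integralE.
  under eq_integral do rewrite funepos_comp/=.
  by under [X in (_ - X = _)%E]eq_integral do rewrite funeneg_comp/=.
apply: emeasurable_funB.
- by apply: (measurable_fun_fubini_tonelli_G (f^\+)%E); [exact: measurable_funepos|].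
- by apply: (measurable_fun_fubini_tonelli_G (f^\-)%E); [exact: measurable_funeneg|].
Qed.

Lemma measurable_Rintegral1 (f : X * Y -> R) : measurable_fun setT f ->
  measurable_fun setT (fun y => \int[mu]_x f (x, y)).
Proof.
move=> mf; rewrite (_ : (fun y => _) =
  fine \o (fun y => \int[mu]_x (f (x, y))%:E)%E)//.
apply: measurableT_comp => //.
by apply: (@measurable_integral1 (EFin \o f)); exact/measurable_EFinP.
Qed.

Lemma Rfubini1 (f : X * Y -> R) : P.-integrable setT (EFin \o f) ->
  mu.-integrable setT (EFin \o (fun x => \int[nu]_y f (x, y))) /\
  \int[mu]_x (\int[nu]_y f (x, y)) = \int[P]_z f z.
Proof.
move=> intf; have iF := integrable_fubini_F intf.
have mF := measurable_int _ iF.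
have mF' : measurable_fun setT (fun x => \int[nu]_y f (x, y)).
  by rewrite (_ : (fun x => _) = fine \o fubini_F nu (EFin \o f))//; exact: measurableT_comp.
have aeF : (EFin \o (fun x => \int[nu]_y f (x, y))) =
           fubini_F nu (EFin \o f) %[ae mu].
  have := ae_integrable1 intf; apply: filterS => x ix _ /=.
  by rewrite /Rintegral fineK//; apply: integrable_fin_num.
have e : (\int[mu]_x (\int[nu]_y f (x, y))%:E)%E = (\int[mu]_x fubini_F nu (EFin \o f) x)%E.
  by apply: ae_eq_integral => //; exact/measurable_EFinP.
split; last first.
  by rewrite /Rintegral e integral12_prod_meas1.
apply/integrableP; split; first exact/measurable_EFinP.
case/integrableP : iF => _; apply: le_lt_trans.
rewrite (@ae_eq_integral _ _ _ mu setT (abse \o fubini_F nu (EFin \o f)))//.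
- by apply: measurableT_comp => //; exact/measurable_EFinP.
- exact: measurableT_comp.
- by apply: filterS aeF => x /(_ I) h _ /=; rewrite -h.
Qed.

Lemma Rfubini2 (f : X * Y -> R) : P.-integrable setT (EFin \o f) ->
  nu.-integrable setT (EFin \o (fun y => \int[mu]_x f (x, y))) /\
  \int[nu]_y (\int[mu]_x f (x, y)) = \int[P]_z f z.
Proof.
move=> intf; have mF := measurable_fubini_G intf.
have mf := measurable_int _ intf.
have iF : nu.-integrable setT (fubini_G mu (EFin \o f)).
  apply/integrableP; split => //.
  apply: le_lt_trans ((integrable21ltyP mu nu mf).1 intf).
  apply: ge0_le_integral => //.
  - exact: measurableT_comp.
  - by apply: (measurable_integral1 (f := abse \o (EFin \o f))); exact: measurableT_comp.
  - by move=> y _; apply: le_abse_integral => //; exact: measurableT_comp.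
have mF' : measurable_fun setT (fun y => \int[mu]_x f (x, y)).
  by rewrite (_ : (fun x => _) = fine \o fubini_G mu (EFin \o f))//; exact: measurableT_comp.
have aeF : (EFin \o (fun y => \int[mu]_x f (x, y))) =
           fubini_G mu (EFin \o f) %[ae nu].
  have := ae_integrable2 intf; apply: filterS => x ix _ /=.
  by rewrite /Rintegral fineK//; apply: integrable_fin_num.
have e : (\int[nu]_y (\int[mu]_x f (x, y))%:E)%E = (\int[nu]_y fubini_G mu (EFin \o f) y)%E.
  by apply: ae_eq_integral => //; exact/measurable_EFinP.
split; last first.
  by rewrite /Rintegral e integral21_prod_meas1.
apply/integrableP; split; first exact/measurable_EFinP.
case/integrableP : iF => _; apply: le_lt_trans.
rewrite (@ae_eq_integral _ _ _ nu setT (abse \o fubini_G mu (EFin \o f)))//.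
- by apply: measurableT_comp => //; exact/measurable_EFinP.
- exact: measurableT_comp.
- by apply: filterS aeF => x /(_ I) h _ /=; rewrite -h.
Qed.

Lemma cfubini1 F : cintegrable P F ->
  cintegrable mu (fun x => cint nu (fun y => F (x, y))) /\
  cint mu (fun x => cint nu (fun y => F (x, y))) = cint P F.
Proof.
move=> [f1 f2]; have [i1 e1] := Rfubini1 f1; have [i2 e2] := Rfubini1 f2.
by split => //; apply: eq_ReIm.
Qed.

Lemma cfubini2 F : cintegrable P F ->
  cintegrable nu (fun y => cint mu (fun x => F (x, y))) /\
  cint nu (fun y => cint mu (fun x => F (x, y))) = cint P F.
Proof.
move=> [f1 f2]; have [i1 e1] := Rfubini2 f1; have [i2 e2] := Rfubini2 f2.
by split => //; apply: eq_ReIm.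
Qed.

Lemma cmeasurable_tens (f : X -> R[i]) (g : Y -> R[i]) :
  cmeasurable f -> cmeasurable g -> cmeasurable (tens f g).
Proof.
by move=> mf mg; apply: cmeasurableM; [exact: cmeasurable_fst|exact: cmeasurable_snd].
Qed.

Lemma L2_tens (f : X -> R[i]) (g : Y -> R[i]) : L2 mu f -> L2 nu g ->
  L2 P (tens f g).
Proof.
move=> lf lg; have mt := cmeasurable_tens (L2_meas lf) (L2_meas lg).
split => //; rewrite [ltLHS](@fubini_tonelli1 _ _ _ _ _ mu nu); last 2 first.
- exact/measurable_EFinP/measurable_normsq.
- by move=> z; rewrite lee_fin normsq_ge0.
rewrite [ltLHS](_ : _ = \int[mu]_x ((norm2sq nu g)%:E * (normsq (f x))%:E))%E.
  rewrite ge0_integralZl_EFin; last 4 first.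
  - exact: measurableT.
  - by move=> x _; rewrite lee_fin normsq_ge0.
  - exact/measurable_EFinP/measurable_normsq/(L2_meas lf).
  - exact: norm2sq_ge0.
  by rewrite lte_mul_pinfty ?lee_fin ?norm2sq_ge0//; case: lf.
apply: eq_integral => x _; rewrite /fubini_F (norm2sqE lg).
rewrite (eq_integral (fun y => (normsq (f x))%:E * (normsq (g y))%:E)%E); last first.
  by move=> y _; rewrite normsqM.
rewrite ge0_integralZl_EFin; first by rewrite muleC.
- exact: measurableT.
- by move=> y _; rewrite lee_fin normsq_ge0.
- exact/measurable_EFinP/measurable_normsq/(L2_meas lg).
- exact: normsq_ge0.
Qed.

Lemma inner_tens (f f' : X -> R[i]) (g g' : Y -> R[i]) :
  L2 mu f -> L2 mu f' -> L2 nu g -> L2 nu g' ->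
  inner P (tens f g) (tens f' g') = inner mu f f' * inner nu g g'.
Proof.
move=> lf lf' lg lg'.
rewrite innerE -(cfubini1 (L2_mul_integrable (L2_tens lf lg) (L2_tens lf' lg'))).2.
rewrite [inner mu f f']innerE mulrC -cintZ; last exact: L2_mul_integrable.
apply: eq_cint => x; rewrite mulrC innerE -cintZ; last first.
  exact: L2_mul_integrable.
by apply: eq_cint => y; rewrite /tens /= cjM; ring.
Qed.

(** Partial inner product in the first variable. *)
Definition pint (u : X -> R[i]) F : Y -> R[i] :=
  fun y => cint mu (fun x => F (x, y) * conj (u x)).

Lemma ae_L2_pair2 F : L2 P F -> {ae nu, forall y, L2 mu (fun x => F (x, y))}.
Proof.
move=> [mF Foo]; have := integrable_ge0 (measurable_normsq mF) _ Foo.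
move=> /(_ (fun z => normsq_ge0 _)) /ae_integrable2.
apply: filterS => y iy; split; first exact: cmeasurable_pair2.
by apply: integrable_lty_ge0 iy => x; exact: normsq_ge0.
Qed.

Lemma L2_pint (u : X -> R[i]) F : L2 mu u -> L2 P F -> L2 nu (pint u F) /\
  norm2sq nu (pint u F) <= norm2sq mu u * norm2sq P F.
Proof.
move=> lu lF; have mF := L2_meas lF.
have mp : cmeasurable (pint u F).
  have [m1 m2] : cmeasurable (fun z => F z * conj (u z.1)).
    apply: cmeasurableM => //; apply: (@cmeasurable_fst (fun x => conj (u x))).
    exact/cmeasurable_conj/(L2_meas lu).
  by split; [exact: measurable_Rintegral1 m1|exact: measurable_Rintegral1 m2].
have mN := measurable_normsq mF.
have le : (\int[nu]_y (normsq (pint u F y))%:E <=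
    (norm2sq mu u * norm2sq P F)%:E)%E.
  rewrite EFinM (norm2sqE lF) -/P.
  rewrite [X in (_ * X)%E](@fubini_tonelli2 _ _ _ _ _ mu nu); last 2 first.
  - exact/measurable_EFinP.
  - by move=> z; rewrite lee_fin normsq_ge0.
  rewrite -ge0_integralZl_EFin; last 4 first.
  - exact: measurableT.
  - by move=> y _; apply: integral_ge0 => x _; rewrite lee_fin normsq_ge0.
  - by apply: measurable_integral1; exact/measurable_EFinP.
  - exact: norm2sq_ge0.
  apply: ae_ge0_le_integral => //.
  - by move=> y _; rewrite lee_fin normsq_ge0.
  - exact/measurable_EFinP/measurable_normsq.
  - move=> y _; apply: mule_ge0; first by rewrite lee_fin norm2sq_ge0.
    by apply: integral_ge0 => x _; rewrite lee_fin normsq_ge0.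
  - by apply: measurable_funeM; apply: measurable_integral1; exact/measurable_EFinP.
  have := ae_L2_pair2 lF; apply: filterS => y ly _.
  rewrite /fubini_G -(norm2sqE ly) -EFinM lee_fin mulrC.
  have := cauchy_schwarz (mkL2 ly : L2H mu) (mkL2 lu : L2H mu).
  by rewrite !nrm2E.
have l2 : L2 nu (pint u F) by split => //; apply: le_lt_trans le _; rewrite ltry.
by split => //; rewrite -lee_fin norm2sqE.
Qed.

Lemma inner_pint (u : X -> R[i]) (v : Y -> R[i]) F : L2 mu u -> L2 nu v -> L2 P F ->
  inner nu (pint u F) v = inner P F (tens u v).
Proof.
move=> lu lv lF.
rewrite [RHS]innerE -(cfubini2 (L2_mul_integrable lF (L2_tens lu lv))).2.
rewrite innerE; apply: cint_ae.
- exact: (cintegrable_meas (L2_mul_integrable (L2_pint lu lF).1 lv)).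
- exact: (cintegrable_meas (cfubini2 (L2_mul_integrable lF (L2_tens lu lv))).1).
have := ae_L2_pair2 lF; apply: filterS => y ly _.
rewrite /pint mulrC -cintZ; last exact: L2_mul_integrable.
by apply: eq_cint => x; rewrite /tens /= cjM; ring.
Qed.

End ProductL2.

Section Bases.
Variable R : realType.

(** A complete orthonormal family. *)
Definition onb d (X : measurableType d) (mu : {measure set X -> \bar R})
    (I : choiceType) (e : I -> X -> R[i]) :=
  [/\ forall i, L2 mu (e i),
      forall i j, inner mu (e i) (e j) = (i == j)%:R
    & forall g, L2 mu g -> (forall i, inner mu g (e i) = 0) ->
        g = (fun=> 0) %[ae mu]].

Lemma ae_forall_inj d (X : measurableType d) (mu : {measure set X -> \bar R})
    (I : Type) (c : I -> nat) (P : I -> X -> Prop) : injective c ->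
  (forall i, {ae mu, forall x, P i x}) -> {ae mu, forall x i, P i x}.
Proof.
move=> cinj aeP.
have : {ae mu, forall x n i, c i = n -> P i x}.
  apply: (@ae_foralln _ _ _ mu (fun n x => forall i, c i = n -> P i x)) => n.
  have [[i ci]|nc] := pselect (exists i, c i = n).
    by apply: filterS (aeP i) => x Pix j cj; rewrite (_ : j = i)//; apply: cinj; rewrite cj.
  by apply: aeW => x i ci; exfalso; apply: nc; exists i.
by apply: filterS => x h i; exact: (h (c i)).
Qed.

Lemma onb_prodm d1 (X : measurableType d1) d2 (Y : measurableType d2)
    (mu : {sigma_finite_measure set X -> \bar R})
    (nu : {sigma_finite_measure set Y -> \bar R})
    (K J : choiceType) (c : K -> nat) e f : injective c ->
  @onb _ _ mu K e -> @onb _ _ nu J f ->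
  onb (prodm mu nu) (fun ij : K * J => tens (e ij.1) (f ij.2)).
Proof.
move=> cinj [le oe te] [lf of_ tf]; split.
- by move=> [i j]; exact: L2_tens.
- by move=> [i j] [i' j']; rewrite inner_tens// oe of_ -natrM mulnb.
move=> G lG Gorth.
have aep : {ae nu, forall y i, pint mu (e i) G y = 0}.
  apply: (ae_forall_inj cinj) => i.
  have lp := (L2_pint (le i) lG).1.
  have h : pint mu (e i) G = (fun=> 0) %[ae nu].
    by apply: tf => // j; rewrite inner_pint// (Gorth (i, j)).
  by apply: filterS h => y /(_ I).
have aeG : {ae nu, forall y, (\int[mu]_x (normsq (G (x, y)))%:E = 0)%E}.
  apply: filterS2 (ae_L2_pair2 lG) aep => y ly py.
  have h := te _ ly py; have := norm2sqE ly => <-; congr _%:E.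
  rewrite /norm2sq (@ae_eq_Rintegral _ _ _ _ _ (fun=> 0)) ?Rintegral_cst ?mul0r//.
  - exact/measurable_normsq/(L2_meas ly).
  - by apply: filterS h => x /[apply] ->; rewrite /normsq /= expr0n addr0.
apply: norm2sq_eq0 => //; apply/eqP; rewrite -eqe norm2sqE//.
have mN := measurable_normsq (L2_meas lG).
rewrite [X in X == _](@fubini_tonelli2 _ _ _ _ _ mu nu); last 2 first.
- exact/measurable_EFinP.
- by move=> z; rewrite lee_fin normsq_ge0.
rewrite (@ae_eq_integral _ _ _ nu setT (fun=> 0%E))//.
- by rewrite integral0.
- by apply: measurable_integral1; exact/measurable_EFinP.
- by apply: filterS aeG => y h _; exact: h.
Qed.

Lemma onb_parseval d (X : measurableType d) (mu : {measure set X -> \bar R})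
    (I : choiceType) (e : I -> L2H mu) : onb mu (fun i => e i : L2_type mu) ->
  (forall i j, ip (e i) (e j) = (i == j)%:R) /\
  (forall g : L2H mu, (forall i, ip g (e i) = 0) -> nrm2 g = 0).
Proof.
move=> [le oe te]; split => // g gorth.
have h : (g : L2_type mu) = (0 : L2_type mu) %[ae mu] by apply: te gorth; exact: L2P.
by rewrite -[nrm2 g]/(Re (ip g g)) (ae_ip_eq h) ip0l.
Qed.

End Bases.

(** * Characters of the circle *)

Section CircleBasis.
Variable R : realType.
Local Notation T := (circle R).

Lemma expiD (s t : R) : sval (expi (s + t)) = sval (expi s) * sval (expi t).
Proof.
rewrite /expi /= mulrDr cosD sinD; apply/eqP; rewrite eq_complex /=.
by apply/andP; split; apply/eqP; ring.
Qed.

Lemma expi0 : sval (expi (0 : R)) = 1.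
Proof. by rewrite /expi /= mulr0 cos0 sin0. Qed.

Lemma circle_unit (z : T) : sval z \is a GRing.unit.
Proof.
case: z => z /= /eqP z1; rewrite unitfE; apply/eqP => z0.
by move: z1; rewrite z0 normr0 => /esym/eqP; rewrite oner_eq0.
Qed.

Lemma zeta_expi (m : int) (t : R) : zeta m (expi t) = sval (expi (m%:~R * t)).
Proof.
have nat_case (n : nat) (u : R) : sval (expi u) ^+ n = sval (expi (n%:R * u)).
  elim: n => [|n IH]; first by rewrite expr0 mul0r expi0.
  by rewrite exprS IH -expiD -natr1; congr (sval (expi _)); ring.
rewrite /zeta; case: m => n; first exact: nat_case.
rewrite -[LHS]/((sval (expi t) ^+ n.+1)^-1) nat_case NegzE.
apply: (@mulrI _ (sval (expi (n.+1%:R * t)))).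
  exact: (circle_unit (expi (n.+1%:R * t))).
rewrite mulrV ?(circle_unit (expi (n.+1%:R * t)))// -expiD.
by rewrite mulrNz mulNr subrr expi0.
Qed.

Lemma Re_zeta_expi (m : int) (t : R) :
  Re (zeta m (expi t)) = cos (2 * pi * m%:~R * t).
Proof. by rewrite zeta_expi /expi /= mulrA. Qed.

Lemma Im_zeta_expi (m : int) (t : R) :
  Im (zeta m (expi t)) = sin (2 * pi * m%:~R * t).
Proof. by rewrite zeta_expi /expi /= mulrA. Qed.

Lemma cj_circle (z : T) : conj (sval z) = (sval z)^-1.
Proof.
case: z => z /= /eqP z1; apply: (@mulfI _ z).
  by apply/eqP => z0; move: z1; rewrite z0 normr0 => /esym/eqP; rewrite oner_eq0.
have zz : z * conj z = 1 by rewrite -normCK z1 expr1n.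
rewrite zz divff//; apply/eqP => z0.
by move: zz; rewrite z0 mul0r => /esym/eqP; rewrite oner_eq0.
Qed.

Lemma cj_zeta m (z : T) : conj (zeta m z) = zeta (- m) z.
Proof.
by rewrite /zeta rmorphXz ?circle_unit// -[GRing.RMorphism.sort _ _]/(conj (sval z)) cj_circle exprz_inv.
Qed.

Lemma zetaD m n (z : T) : zeta (m + n) z = zeta m z * zeta n z.
Proof. by rewrite /zeta expfzDr//; apply/eqP => z0; have := circle_unit z; rewrite z0 unitr0. Qed.

Lemma zeta0 (z : T) : zeta 0 z = 1. Proof. by rewrite /zeta expr0z. Qed.

Lemma normsq_zeta m (z : T) : normsq (zeta m z) = 1.
Proof.
have := normsqE (zeta m z); rewrite cj_zeta -zetaD subrr zeta0 => -[].
by move=> ->.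
Qed.

Lemma measurable_circle (g : T -> R) :
  measurable_fun setT (fun t : R => g (expi t)) -> measurable_fun setT g.
Proof.
move=> mg _ A mA; rewrite setTI.
rewrite -[measurable _]/(measurable ((fun t : measurableTypeR R => g (expi t)) @^-1` A)).
by rewrite -[_ @^-1` _]setTI; exact: mg.
Qed.

Lemma cmeasurable_zeta m : cmeasurable (@zeta R m).
Proof.
split; apply: measurable_circle; apply: continuous_measurable_fun.
- rewrite (_ : (fun t => _) = (fun t : R => cos (2 * pi * m%:~R * t))).
    move=> t.
    by apply: continuous_comp; [exact: mulrl_continuous|exact: continuous_cos].
  by apply/funext => t; rewrite Re_zeta_expi.
- rewrite (_ : (fun t => _) = (fun t : R => sin (2 * pi * m%:~R * t))).
    move=> t.
    by apply: continuous_comp; [exact: mulrl_continuous|exact: continuous_sin].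
  by apply/funext => t; rewrite Im_zeta_expi.
Qed.

Lemma mu_T_setT : mu_T R setT = 1%E.
Proof. exact: (@probability_setT _ _ _ (haar R)). Qed.

Lemma integrable_T_cst (M : R) : (mu_T R).-integrable setT (EFin \o fun=> M).
Proof.
apply/integrableP; split; first exact/measurable_EFinP/measurable_cst.
by rewrite /= integral_cst// [X in (_ * X)%E]mu_T_setT mule1 ltry.
Qed.

Lemma bounded_integrable_T (g : T -> R) (M : R) : measurable_fun setT g ->
  (forall z, `|g z| <= M) -> (mu_T R).-integrable setT (EFin \o g).
Proof. by move=> mg gM; exact: integrable_le (integrable_T_cst M). Qed.

Lemma Rintegral_T_cst (M : R) : \int[mu_T R]_z M = M.
Proof. by rewrite Rintegral_cst// [X in fine X]mu_T_setT mulr1. Qed.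

Lemma L2_zeta m : L2 (mu_T R) (zeta m).
Proof.
apply: (@L2_le _ _ _ _ _ (fun=> 1)); first exact: cmeasurable_zeta.
- by move=> z; rewrite normsq_zeta.
- exact: integrable_T_cst.
Qed.

Lemma is_derive_pair (F : R -> R) (t df : R) : is_derive t 1 F df ->
  derivable F t 1 /\ 'D_1 F t = df.
Proof. by case. Qed.

Lemma ge0_integral_T (g : T -> R) (F : R -> R) : measurable_fun setT g ->
  (forall z, 0 <= g z) -> continuous (fun t : R => g (expi t)) ->
  (forall t : R, derivable F t 1 /\ 'D_1 F t = g (expi t)) ->
  \int[mu_T R]_z g z = F 1 - F 0.
Proof.
move=> mg g0 cg dF; rewrite /Rintegral [X in fine X](_ : _ = (F 1)%:E - (F 0)%:E)%E//.
rewrite [LHS](@ge0_integral_pushforward _ _ _ _ R (@expi R) (@measurable_expi R)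
   (uniform_prob (@ltr01 R)) setT (EFin \o g)); last 3 first.
- exact: measurableT.
- exact/measurable_EFinP.
- by move=> z _; rewrite lee_fin.
rewrite preimage_setT integral_uniform; last 2 first.
- apply: (@measurableT_comp _ _ _ _ _ _ (EFin \o g) _ (@expi R)) => //.
  exact/measurable_EFinP.
- by move=> t; rewrite lee_fin.
rewrite subr0 invr1 mul1e; apply: continuous_FTC2 => //.
- exact: continuous_subspaceT.
- have dF1 t : derivable F t 1 by have [] := dF t.
  split; first by move=> t _; exact: dF1.
  + have /derivable1_diffP/differentiable_continuous := dF1 0.
    by move=> /cvg_at_right_filter.
  + have /derivable1_diffP/differentiable_continuous := dF1 1.
    by move=> /cvg_at_left_filter.
- by move=> t _; rewrite derive1E; have [_ ->] := dF t.
Qed.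

Lemma continuous_expi_lin (f : R -> R) (a : R) : continuous f ->
  continuous (fun t : R => f (a * t)).
Proof.
by move=> cf t; apply: (@continuous_comp _ _ _ (fun t : R => a * t) f);
  [exact: mulrl_continuous|exact: cf].
Qed.

Lemma zeta_expi1 (m : int) : zeta m (expi (1 : R)) = 1.
Proof.
rewrite /zeta (_ : sval _ = 1) ?exp1rz//.
by rewrite /expi /= mulr1 mulr_natl cos2pi sin2pi.
Qed.

Lemma cint_zeta (m : int) : cint (mu_T R) (zeta m) = (m == 0)%:R.
Proof.
have [->|m0] := eqVneq m 0.
  rewrite (@eq_cint _ _ _ _ _ (fun=> 1)); last by move=> z; rewrite zeta0.
  by apply: eq_ReIm; rewrite /= Rintegral_T_cst.
have [mRe mIm] := cmeasurable_zeta m.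
have a0 : 2 * pi * m%:~R != 0 :> R.
  by rewrite !mulf_neq0 ?intr_eq0// gt_eqF// pi_gt0.
set a : R := 2 * pi * m%:~R in a0.
have m1 : measurable_fun setT (fun _ : T => 1 : R) by exact: measurable_cst.
have zle (z : T) : `|Re (zeta m z)| <= 1 /\ `|Im (zeta m z)| <= 1.
  have h := normsq_zeta m z; move: h; rewrite /normsq => h.
  by split; rewrite -[_ <= 1]ler_sqr ?nnegrE// real_normK ?num_real// expr1n
    -[X in _ <= X]h ?lerDl ?lerDr sqr_ge0.
have iRe : (mu_T R).-integrable setT (EFin \o (fun z => Re (zeta m z))).
  by apply: (@bounded_integrable_T _ 1) => // z; exact: (zle z).1.
have iIm : (mu_T R).-integrable setT (EFin \o (fun z => Im (zeta m z))).
  by apply: (@bounded_integrable_T _ 1) => // z; exact: (zle z).2.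
have cosE : (fun t : R => 1 + Re (zeta m (expi t))) = (fun t => 1 + cos (a * t)).
  by apply/funext => t; rewrite Re_zeta_expi.
have sinE : (fun t : R => 1 + Im (zeta m (expi t))) = (fun t => 1 + sin (a * t)).
  by apply/funext => t; rewrite Im_zeta_expi.
have h1 : \int[mu_T R]_z (1 + Re (zeta m z)) = 1.
  rewrite (@ge0_integral_T _ (fun t => t + a^-1 * sin (a * t))).
  - rewrite mulr0 sin0 mulr0 addr0 subr0 -(Im_zeta_expi m 1) zeta_expi1.
    by rewrite /= mulr0 addr0.
  - exact: measurable_funD.
  - by move=> z; have [+ _] := zle z; rewrite ler_norml; lra.
  - rewrite cosE => t; apply: cvgD; first exact: cvg_cst.
    by apply: continuous_expi_lin; exact: continuous_cos.
  - move=> t; rewrite Re_zeta_expi -/a; apply: is_derive_pair.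
    have ds : is_derive t 1 (fun t => sin (a * t)) (a * cos (a * t)).
      have da : is_derive t 1 (fun t : R => a * t) a.
        have := @is_deriveZ _ _ _ id a t 1 1 (is_derive_id t 1).
        by rewrite /GRing.scale /= mulr1.
      have := @is_derive1_comp _ sin (fun t => a * t) t _ _ (is_derive_sin (a * t)) da.
      by rewrite mulrC.
    have := @is_deriveD _ _ _ id (a^-1 \*: (fun t => sin (a * t))) t 1 _ _
       (is_derive_id t 1) (@is_deriveZ _ _ _ _ a^-1 t 1 _ ds).
    by rewrite /GRing.scale /= mulKf.
have h2 : \int[mu_T R]_z (1 + Im (zeta m z)) = 1.
  rewrite (@ge0_integral_T _ (fun t => t - a^-1 * cos (a * t))).
  - rewrite mulr0 cos0 -(Re_zeta_expi m 1) zeta_expi1 /=; ring.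
  - exact: measurable_funD.
  - by move=> z; have [_] := zle z; rewrite ler_norml; lra.
  - rewrite sinE => t; apply: cvgD; first exact: cvg_cst.
    by apply: continuous_expi_lin; exact: continuous_sin.
  - move=> t; rewrite Im_zeta_expi -/a; apply: is_derive_pair.
    have ds : is_derive t 1 (fun t => cos (a * t)) (- (a * sin (a * t))).
      have da : is_derive t 1 (fun t : R => a * t) a.
        have := @is_deriveZ _ _ _ id a t 1 1 (is_derive_id t 1).
        by rewrite /GRing.scale /= mulr1.
      have := @is_derive1_comp _ cos (fun t => a * t) t _ _ (is_derive_cos (a * t)) da.
      by rewrite mulrC mulrN.
    have := @is_deriveD _ _ _ id ((- a^-1) \*: (fun t => cos (a * t))) t 1 _ _
       (is_derive_id t 1) (@is_deriveZ _ _ _ _ (- a^-1) t 1 _ ds).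
    rewrite /GRing.scale /= mulrNN mulKf// => h.
    rewrite (_ : (fun t => _) = (id + (- a^-1 \*: (fun t => cos (a * t))))%R)//.
    by apply/funext => u; rewrite -[RHS]/(u + - a^-1 * cos (a * u)) mulNr.
have i1 := integrable_T_cst 1.
apply: eq_ReIm => /=.
- by move: h1; rewrite RintegralD// Rintegral_T_cst; lra.
- by move: h2; rewrite RintegralD// Rintegral_T_cst; lra.
Qed.

Lemma inner_zeta m n : inner (mu_T R) (zeta m) (zeta n) = (m == n)%:R.
Proof.
rewrite innerE (@eq_cint _ _ _ _ _ (zeta (m - n))).
  by rewrite cint_zeta subr_eq0.
by move=> z; rewrite cj_zeta zetaD.
Qed.

End CircleBasis.

(** * Totality of the characters *)

Section CircleTotal.
Variable R : realType.
Local Notation T := (circle R).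
Local Notation mu := (mu_T R).

(** Integrable functions all of whose Fourier coefficients vanish. *)
Definition fourier_null (g : T -> R) :=
  mu.-integrable setT (EFin \o g) /\
  forall m : int, \int[mu]_z (g z * Re (zeta m z)) = 0 /\
                  \int[mu]_z (g z * Im (zeta m z)) = 0.

Definition null_multiplier (v : T -> R) :=
  [/\ measurable_fun setT v, exists M, forall z, `|v z| <= M
    & forall g, fourier_null g -> fourier_null (fun z => v z * g z)].

Lemma integrable_bmul (g v : T -> R) M : measurable_fun setT v ->
  (forall z, `|v z| <= M) -> mu.-integrable setT (EFin \o g) ->
  mu.-integrable setT (EFin \o (fun z => v z * g z)).
Proof.
move=> mv vM ig; apply: (@integrable_le _ _ _ _ _ (fun z => M * `|g z|)).
- apply: measurable_funM => //; apply/measurable_EFinP.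
  exact: measurable_int ig.
- by move=> z; rewrite normrM ler_wpM2r.
- by apply: RintegrableZ; exact: integrable_norm.
Qed.

Lemma Re_zeta_le m (z : T) : `|Re (zeta m z)| <= 1.
Proof.
rewrite -[_ <= 1]ler_sqr ?nnegrE// real_normK ?num_real// expr1n.
by rewrite -[X in _ <= X](normsq_zeta m z) /normsq lerDl sqr_ge0.
Qed.

Lemma Im_zeta_le m (z : T) : `|Im (zeta m z)| <= 1.
Proof.
rewrite -[_ <= 1]ler_sqr ?nnegrE// real_normK ?num_real// expr1n.
by rewrite -[X in _ <= X](normsq_zeta m z) /normsq lerDr sqr_ge0.
Qed.

Lemma measurable_Re_zeta m : measurable_fun setT (fun z : T => Re (zeta m z)).
Proof. by have [] := @cmeasurable_zeta R m. Qed.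

Lemma measurable_Im_zeta m : measurable_fun setT (fun z : T => Im (zeta m z)).
Proof. by have [] := @cmeasurable_zeta R m. Qed.

Lemma integrable_mul_Re m (g : T -> R) : mu.-integrable setT (EFin \o g) ->
  mu.-integrable setT (EFin \o (fun z => g z * Re (zeta m z))).
Proof.
move=> ig; rewrite (_ : (fun z => _) = (fun z => Re (zeta m z) * g z)).
  exact: integrable_bmul (measurable_Re_zeta m) (Re_zeta_le m) ig.
by apply/funext => z; rewrite mulrC.
Qed.

Lemma integrable_mul_Im m (g : T -> R) : mu.-integrable setT (EFin \o g) ->
  mu.-integrable setT (EFin \o (fun z => g z * Im (zeta m z))).
Proof.
move=> ig; rewrite (_ : (fun z => _) = (fun z => Im (zeta m z) * g z)).
  exact: integrable_bmul (measurable_Im_zeta m) (Im_zeta_le m) ig.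
by apply/funext => z; rewrite mulrC.
Qed.

Lemma fourier_nullD a b g h : fourier_null g -> fourier_null h ->
  fourier_null (fun z => a * g z + b * h z).
Proof.
move=> [ig gn] [ih hn]; split; first by apply: RintegrableD; exact: RintegrableZ.
move=> m; have [g1 g2] := gn m; have [h1 h2] := hn m; split.
- under eq_Rintegral do rewrite mulrDl -!mulrA.
  rewrite RintegralD//; [|apply: RintegrableZ; exact: integrable_mul_Re..].
  by rewrite !RintegralZl ?g1 ?h1 ?mulr0 ?addr0//; exact: integrable_mul_Re.
- under eq_Rintegral do rewrite mulrDl -!mulrA.
  rewrite RintegralD//; [|apply: RintegrableZ; exact: integrable_mul_Im..].
  by rewrite !RintegralZl ?g2 ?h2 ?mulr0 ?addr0//; exact: integrable_mul_Im.
Qed.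

Lemma null_multiplierM v w : null_multiplier v -> null_multiplier w ->
  null_multiplier (fun z => v z * w z).
Proof.
move=> [mv [M vM] nv] [mw [N wN] nw]; split; first exact: measurable_funM.
- by exists (M * N) => z; rewrite normrM ler_pM.
- move=> g /nw/nv; congr fourier_null; apply/funext => z; exact: mulrA.
Qed.

Lemma null_multiplierD a b v w : null_multiplier v -> null_multiplier w ->
  null_multiplier (fun z => a * v z + b * w z).
Proof.
move=> [mv [M vM] nv] [mw [N wN] nw]; split.
- by apply: measurable_funD; apply: measurable_funM => //; exact: measurable_cst.
- exists (`|a| * M + `|b| * N) => z; rewrite (le_trans (ler_normD _ _))// !normrM.
  by rewrite lerD// ler_wpM2l.
- move=> g ng; have := fourier_nullD a b (nv g ng) (nw g ng).
  by congr fourier_null; apply/funext => z; ring.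
Qed.

Lemma null_multiplier1 : null_multiplier (fun=> 1).
Proof.
split; first exact: measurable_cst.
- by exists 1 => z; rewrite normr1.
- by move=> g; congr fourier_null; apply/funext => z; rewrite mul1r.
Qed.

Lemma null_multiplier_Re : null_multiplier (fun z => Re (zeta 1 z)).
Proof.
split; [exact: measurable_Re_zeta|by exists 1 => z; exact: Re_zeta_le|].
move=> g [ig gn]; split.
  exact: integrable_bmul (measurable_Re_zeta 1) (Re_zeta_le 1) ig.
move=> m; have [p1 p2] := gn (m + 1); have [n1 n2] := gn (m - 1).
have zE (z : T) : zeta (m + 1) z = zeta m z * zeta 1 z /\
    zeta (m - 1) z = zeta m z * conj (zeta 1 z).
  by rewrite cj_zeta -!zetaD.
split.
- rewrite (@eq_Rintegral _ _ _ mu _ (fun z => 2^-1 * (g z * Re (zeta (m + 1) z))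
     + 2^-1 * (g z * Re (zeta (m - 1) z)))); last first.
    move=> z _; have [-> ->] := zE z.
    by case: (zeta m z) (zeta 1 z) => a b [c d] /=; field.
  rewrite RintegralD//; [|apply: RintegrableZ; exact: integrable_mul_Re..].
  by rewrite !RintegralZl ?p1 ?n1 ?mulr0 ?addr0//; exact: integrable_mul_Re.
- rewrite (@eq_Rintegral _ _ _ mu _ (fun z => 2^-1 * (g z * Im (zeta (m + 1) z))
     + 2^-1 * (g z * Im (zeta (m - 1) z)))); last first.
    move=> z _; have [-> ->] := zE z.
    by case: (zeta m z) (zeta 1 z) => a b [c d] /=; field.
  rewrite RintegralD//; [|apply: RintegrableZ; exact: integrable_mul_Im..].
  by rewrite !RintegralZl ?p2 ?n2 ?mulr0 ?addr0//; exact: integrable_mul_Im.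
Qed.

Lemma null_multiplier_Im : null_multiplier (fun z => Im (zeta 1 z)).
Proof.
split; [exact: measurable_Im_zeta|by exists 1 => z; exact: Im_zeta_le|].
move=> g [ig gn]; split.
  exact: integrable_bmul (measurable_Im_zeta 1) (Im_zeta_le 1) ig.
move=> m; have [p1 p2] := gn (m + 1); have [n1 n2] := gn (m - 1).
have zE (z : T) : zeta (m + 1) z = zeta m z * zeta 1 z /\
    zeta (m - 1) z = zeta m z * conj (zeta 1 z).
  by rewrite cj_zeta -!zetaD.
split.
- rewrite (@eq_Rintegral _ _ _ mu _ (fun z => 2^-1 * (g z * Im (zeta (m + 1) z))
     + (- 2^-1) * (g z * Im (zeta (m - 1) z)))); last first.
    move=> z _; have [-> ->] := zE z.
    by case: (zeta m z) (zeta 1 z) => a b [c d] /=; field.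
  rewrite RintegralD//; [|apply: RintegrableZ; exact: integrable_mul_Im..].
  by rewrite !RintegralZl ?p2 ?n2 ?mulr0 ?addr0//; exact: integrable_mul_Im.
- rewrite (@eq_Rintegral _ _ _ mu _ (fun z => (- 2^-1) * (g z * Re (zeta (m + 1) z))
     + 2^-1 * (g z * Re (zeta (m - 1) z)))); last first.
    move=> z _; have [-> ->] := zE z.
    by case: (zeta m z) (zeta 1 z) => a b [c d] /=; field.
  rewrite RintegralD//; [|apply: RintegrableZ; exact: integrable_mul_Re..].
  by rewrite !RintegralZl ?p1 ?n1 ?mulr0 ?addr0//; exact: integrable_mul_Re.
Qed.

Lemma cvg_Rintegral_dom (u : nat -> T -> R) (v g : T -> R) :
  (forall n, measurable_fun setT (u n)) -> measurable_fun setT v ->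
  (forall z, u ^~ z @ \oo --> v z) -> mu.-integrable setT (EFin \o g) ->
  (forall n z, `|u n z| <= g z) ->
  (fun n => \int[mu]_z u n z) @ \oo --> \int[mu]_z v z.
Proof.
move=> mu_ mv uv ig ug.
have mu' n : measurable_fun setT (EFin \o u n) by exact/measurable_EFinP.
have mv' : measurable_fun setT (EFin \o v) by exact/measurable_EFinP.
have uv' : {ae mu, forall z, setT z -> (fun n => (EFin \o u n) z) @ \oo --> (EFin \o v) z}.
  by apply: aeW => z _; apply: cvg_EFin; [exact: nearW|exact: uv].
have ug' : {ae mu, forall z n, setT z -> (`|(EFin \o u n) z| <= (EFin \o g) z)%E}.
  by apply: aeW => z n _; rewrite /= lee_fin.
have [iv _ h] := dominated_convergence measurableT mu' mv' uv' ig ug'.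
apply: fine_cvg; rewrite fineK//; exact: integrable_fin_num.
Qed.

Lemma null_multiplier_cvg (u : nat -> T -> R) (v : T -> R) :
  (forall n, null_multiplier (u n)) -> (forall n z, `|u n z| <= 1) ->
  (forall z, u ^~ z @ \oo --> v z) -> null_multiplier v.
Proof.
move=> nu u1 uv.
have mv : measurable_fun setT v.
  by apply: (@measurable_fun_cvg _ _ _ _ u) => [n|z _]; [have [] := nu n|exact: uv].
have v1 z : `|v z| <= 1.
  have h : (fun n => `|u n z|) @ \oo --> `|v z| by exact: cvg_norm (uv z).
  rewrite -(cvg_lim _ h)//; apply: limr_le.
    by apply/cvg_ex; eexists; exact: h.
  by apply: nearW => n; exact: u1.
split => //; first by exists 1.
move=> g ng; have [ig _] := ng; split; first exact: integrable_bmul mv v1 ig.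
have mg : measurable_fun setT g by apply/measurable_EFinP; exact: measurable_int ig.
have ign := integrable_norm ig.
move=> m; split.
- have : (fun n => \int[mu]_z (u n z * g z * Re (zeta m z))) @ \oo -->
      \int[mu]_z (v z * g z * Re (zeta m z)).
    apply: (@cvg_Rintegral_dom _ _ (fun z => `|g z|)) => //.
    + move=> n; have [mun _ _] := nu n.
      by apply: measurable_funM; [exact: measurable_funM|exact: measurable_Re_zeta].
    + by apply: measurable_funM; [exact: measurable_funM|exact: measurable_Re_zeta].
    + by move=> z; apply: cvgMl; apply: cvgMl; exact: uv.
    + move=> n z; rewrite !normrM -[leRHS]mulr1 ler_pM// ?mulr_ge0// ?Re_zeta_le//.
      by rewrite -[leRHS]mul1r ler_wpM2r.
  rewrite (_ : (fun n => _) = fun=> 0); last first.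
    by apply/funext => n; have [_ _ /(_ g ng)[_ /(_ m)[]]] := nu n.
  by move=> /cvg_lim => <-//; rewrite lim_cst.
- have : (fun n => \int[mu]_z (u n z * g z * Im (zeta m z))) @ \oo -->
      \int[mu]_z (v z * g z * Im (zeta m z)).
    apply: (@cvg_Rintegral_dom _ _ (fun z => `|g z|)) => //.
    + move=> n; have [mun _ _] := nu n.
      by apply: measurable_funM; [exact: measurable_funM|exact: measurable_Im_zeta].
    + by apply: measurable_funM; [exact: measurable_funM|exact: measurable_Im_zeta].
    + by move=> z; apply: cvgMl; apply: cvgMl; exact: uv.
    + move=> n z; rewrite !normrM -[leRHS]mulr1 ler_pM// ?mulr_ge0// ?Im_zeta_le//.
      by rewrite -[leRHS]mul1r ler_wpM2r.
  rewrite (_ : (fun n => _) = fun=> 0); last first.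
    by apply/funext => n; have [_ _ /(_ g ng)[_ /(_ m)[]]] := nu n.
  by move=> /cvg_lim => <-//; rewrite lim_cst.
Qed.

(** The iteration s |-> (3 s - s^3) / 2 fixes -1, 0 and 1, and converges to the
    sign of its starting point in [-1, 1]. *)
Definition sgn_step (s : R) : R := (3 * s - s ^+ 3) / 2.

Lemma sgn_step_itv (s : R) : 0 <= s <= 1 -> s <= sgn_step s <= 1.
Proof.
move=> /andP[s0 s1]; apply/andP; split; rewrite -subr_ge0.
- rewrite (_ : _ - _ = s * ((1 - s) * (1 + s)) / 2); last by rewrite /sgn_step; field.
  by rewrite divr_ge0// !mulr_ge0// ?subr_ge0// addr_ge0.
- rewrite (_ : _ - _ = (1 - s) ^+ 2 * (2 + s) / 2); last by rewrite /sgn_step; field.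
  by rewrite divr_ge0// mulr_ge0 ?sqr_ge0// addr_ge0.
Qed.

Lemma sgn_iter_cvg_ge0 (t : R) : 0 <= t <= 1 ->
  (forall n, `|iter n sgn_step t| <= 1) /\
  (fun n => iter n sgn_step t) @ \oo --> Num.sg t.
Proof.
move=> /andP[t0 t1].
have itv n : t <= iter n sgn_step t <= 1.
  elim: n => [|n /andP[h1 h2]] /=; first by rewrite lexx.
  have /sgn_step_itv/andP[h3 h4] : 0 <= iter n sgn_step t <= 1.
    by rewrite (le_trans t0).
  by rewrite h4 (le_trans h1).
split.
  move=> n; have /andP[h1 h2] := itv n.
  by rewrite ger0_norm// (le_trans t0).
have nd : nondecreasing_seq (fun n => iter n sgn_step t).
  apply/nondecreasing_seqP => n /=; have /andP[h1 h2] := itv n.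
  have /sgn_step_itv/andP[]// : 0 <= iter n sgn_step t <= 1.
  by rewrite (le_trans t0).
have cv : cvgn (fun n => iter n sgn_step t).
  apply: nondecreasing_is_cvgn => //; exists 1 => _ [n _ <-].
  by have /andP[] := itv n.
set l := limn (fun n => iter n sgn_step t) in cv *.
have lE : sgn_step l = l.
  have c1 : (fun n => iter n.+1 sgn_step t) @ \oo --> l.
    by move/cvg_ex : cv => [x cx]; rewrite /l (cvg_lim _ cx)// (cvg_shiftS (fun n => iter n sgn_step t)).
  have c2 : (fun n => iter n.+1 sgn_step t) @ \oo --> sgn_step l.
    have stepE x : sgn_step x = (3 * x - x * (x * x)) / 2 by rewrite /sgn_step; field.
    rewrite (_ : (fun n => _) = (fun n => (3 * iter n sgn_step t -
      iter n sgn_step t * (iter n sgn_step t * iter n sgn_step t)) / 2)).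
      rewrite stepE; apply: cvgMl; apply: cvgB; first exact: cvgMr.
      by do 2 apply: cvgM => //.
    by apply/funext => n /=; rewrite stepE.
  by apply: (cvg_unique _ c2 c1).
have tl : t <= l by apply: limr_ge => //; apply: nearW => n; have /andP[] := itv n.
have l1 : l <= 1 by apply: limr_le => //; apply: nearW => n; have /andP[] := itv n.
suff <- : l = Num.sg t by [].
have [tE|tN] := eqVneq t 0.
  rewrite tE sgr0 /l (_ : (fun n => _) = fun=> 0) ?lim_cst//.
  apply/funext => n; elim: n => [//|n /= ->]; rewrite /sgn_step; ring.
have tp : 0 < t by rewrite lt_neqAle eq_sym tN.
rewrite gtr0_sg//; have lp := lt_le_trans tp tl.
have /eqP : l * ((1 - l) * (1 + l)) = 0.
  by move: lE; rewrite /sgn_step => /eqP; rewrite -subr_eq0 => /eqP h; nra.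
rewrite !mulf_eq0 gt_eqF//= subr_eq0 => /orP[/eqP//|/eqP].
lra.
Qed.

Lemma sgn_iter_cvg (s : R) : `|s| <= 1 ->
  (forall n, `|iter n sgn_step s| <= 1) /\
  (fun n => iter n sgn_step s) @ \oo --> Num.sg s.
Proof.
have step_odd t n : iter n sgn_step (- t) = - iter n sgn_step t.
  by elim: n => [//|n /= ->]; rewrite /sgn_step; field.
move=> s1; have [s0|/ltW s0] := lerP 0 s.
  by apply: sgn_iter_cvg_ge0; apply/andP; split=> //; rewrite -(ger0_norm s0).
have [|h1 h2] := @sgn_iter_cvg_ge0 (- s).
  by apply/andP; split; rewrite ?oppr_ge0// -(ler0_norm s0).
rewrite -[s]opprK sgrN; split.
  by move=> n; rewrite step_odd normrN.
have -> : (fun n => iter n sgn_step (- - s)) = (fun n => - iter n sgn_step (- s)).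
  by apply/funext => n; rewrite step_odd.
exact: cvgN.
Qed.

Lemma null_multiplier_pos (v : T -> R) : null_multiplier v ->
  (forall z, `|v z| <= 1) -> null_multiplier (\1_[set z | 0 < v z]).
Proof.
move=> nv v1.
have nsg : null_multiplier (fun z => Num.sg (v z)).
  apply: (@null_multiplier_cvg (fun n z => iter n sgn_step (v z))).
  - elim=> [//|n IH] /=.
    have := null_multiplierD (3 / 2) (- 2^-1) IH (null_multiplierM IH (null_multiplierM IH IH)).
    by congr null_multiplier; apply/funext => z; rewrite /sgn_step; field.
  - by move=> n z; exact: (sgn_iter_cvg (v1 z)).1.
  - by move=> z; exact: (sgn_iter_cvg (v1 z)).2.
have := null_multiplierD 2^-1 2^-1 nsg (null_multiplierM nsg nsg).
congr null_multiplier; apply/funext => z; rewrite indicE.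
have [z0|z0|z0] := sgrP (v z).
- by rewrite memNset ?mulr0 ?addr0//= z0 ltxx.
- by rewrite mem_set//= !mulr1 [RHS](splitr 1) mul1r.
- rewrite memNset/=; first by rewrite mulrNN !mulr1 mulrN1 addNr.
  by apply/negP; rewrite -leNgt ltW.
Qed.

(** The sets whose indicator functions are multipliers form a sigma-algebra. *)
Definition null_set_multiplier (A : set T) :=
  measurable A /\ null_multiplier (\1_A : T -> R).

Lemma null_set_multiplier_sigma : sigma_algebra setT null_set_multiplier.
Proof.
split.
- split; first exact: measurable0.
  have := null_multiplierD 0 0 null_multiplier1 null_multiplier1.
  by congr null_multiplier; apply/funext => z; rewrite indic0 !mul0r addr0.
- move=> A [mA nA]; rewrite setTD; split; first exact: measurableC.
  have := null_multiplierD 1 (-1) null_multiplier1 nA.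
  congr null_multiplier; apply/funext => z; rewrite !indicE in_setC.
  by case: (z \in A) => /=; ring.
- move=> A nA; split; first by apply: bigcupT_measurable => n; exact: (nA n).1.
  have nU n : null_multiplier (\1_(\bigcup_(i < n) A i) : T -> R).
    elim: n => [|n IH].
      have := null_multiplierD 0 0 null_multiplier1 null_multiplier1.
      by rewrite bigcup_mkord big_ord0; congr null_multiplier; apply/funext => z;
        rewrite indic0 !mul0r addr0.
    have := null_multiplierD 1 1 (null_multiplierD 1 1 IH (nA n).2)
      (null_multiplierD 0 (-1) IH (null_multiplierM IH (nA n).2)).
    congr null_multiplier; apply/funext => z.
    rewrite !bigcup_mkord big_ord_recr /= !indicE in_setU.
    by case: (z \in _) (z \in A n) => -[] /=; ring.
  apply: (@null_multiplier_cvg (fun n => \1_(\bigcup_(i < n) A i))) => //.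
  + by move=> n z; rewrite indicE; case: (_ \in _); rewrite ?normr1 ?normr0.
  + move=> z; have [zA|zA] := pselect ((\bigcup_n A n) z).
      rewrite indicE mem_set//; case: zA => n _ Anz.
      apply: cvg_near_cst; exists n.+1 => // k /= nk.
      by rewrite indicE mem_set//; exists n.
    rewrite indicE memNset//; apply: cvg_near_cst; apply: nearW => n.
    by rewrite indicE memNset// => -[k _ Akz]; apply: zA; exists k.
Qed.

Lemma null_set_multiplier_gt (v : T -> R) (c : R) : null_multiplier v ->
  null_set_multiplier [set z | c < v z].
Proof.
move=> nv; have [mv [M vM] _] := nv.
split.
  rewrite (_ : [set z | _] = v @^-1` `]c, +oo[); last first.
    by apply/seteqP; split => z /=; rewrite in_itv/= andbT.
  by rewrite -[_ @^-1` _]setTI; apply: mv => //; exact: measurable_itv.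
pose k := 1 + `|M| + `|c|; have k0 : 0 < k by rewrite ltr_pwDl// addr_gt0// ltr_wpDr.
have /null_multiplier_pos := null_multiplierD k^-1 (- (k^-1 * c)) nv null_multiplier1.
rewrite (_ : [set z | 0 < _] = [set z | c < v z]); last first.
  apply/seteqP; split => z /=; rewrite mulr1 -mulrN -mulrDr pmulr_rgt0 ?invr_gt0//;
  by rewrite subr_gt0.
apply => z; rewrite mulr1 -mulrN -mulrDr normrM gtr0_norm ?invr_gt0//.
rewrite ler_pdivrMl// mulr1 (le_trans (ler_normD _ _))// normrN /k.
have := vM z; have := ler_norm M; lra.
Qed.

Lemma null_set_multiplier_lt (v : T -> R) (c : R) : null_multiplier v ->
  null_set_multiplier [set z | v z < c].
Proof.
move=> nv; have := null_multiplierD (-1) 0 nv nv => /(null_set_multiplier_gt (- c)).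
congr null_set_multiplier; apply/seteqP; split => z /=; rewrite mulN1r mul0r addr0 ltrN2//.
Qed.

End CircleTotal.

Section CircleComplete.
Variable R : realType.
Local Notation T := (circle R).
Local Notation mu := (mu_T R).

Definition angle (z : T) : R :=
  if 0 <= Im (sval z) then acos (Re (sval z)) / (2 * pi)
  else 1 - acos (Re (sval z)) / (2 * pi).

Lemma zeta1 (z : T) : zeta 1 z = sval z. Proof. by rewrite /zeta expr1z. Qed.

Lemma circle_Re_itv (z : T) : -1 <= Re (sval z) <= 1.
Proof. by have := Re_zeta_le 1 z; rewrite /zeta expr1z ler_norml. Qed.

Lemma two_pi_gt0 : 0 < 2 * pi :> R. Proof. by rewrite mulr_gt0// pi_gt0. Qed.

Lemma expi_angle (z : T) : expi (angle z) = z.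
Proof.
have h := circle_Re_itv z; have n1 := normsq_zeta 1 z.
rewrite /zeta expr1z /normsq in n1.
have p0 : 2 * pi != 0 :> R by rewrite gt_eqF// two_pi_gt0.
have e2 : 2 * pi = pi *+ 2 :> R by rewrite mulr_natl.
have ce : cos (acos (Re (sval z))) = Re (sval z) by apply: acosK; rewrite in_itv.
have se : sin (acos (Re (sval z))) = `|Im (sval z)|.
  by rewrite sin_acos// -[X in X - _]n1 addrAC subrr add0r sqrtr_sqr.
apply: val_inj; rewrite /= /angle; case: ifPn => [b0|/negbTE b0].
- rewrite mulrC divfK// ce se ger0_norm//; by case: (sval z).
- rewrite (_ : 2 * pi * _ = pi *+ 2 - acos (Re (sval z))); last first.
    by rewrite -e2 mulrBr mulr1 mulrCA divff// mulr1.
  rewrite cosB sinB cos2pi sin2pi ce se !mul0r !mul1r addr0 sub0r.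
  by move/negbT: b0; rewrite -ltNge => b0; rewrite ltr0_norm// opprK; case: (sval z).
Qed.

Lemma null_multiplier_set0 : null_set_multiplier (set0 : set T).
Proof. by have [] := @null_set_multiplier_sigma R. Qed.

Lemma null_multiplier_setT : null_set_multiplier (setT : set T).
Proof.
have [h0 hC _] := @null_set_multiplier_sigma R.
by have := hC _ h0; rewrite setTD setC0.
Qed.

Lemma null_multiplier_setU (A B : set T) : null_set_multiplier A ->
  null_set_multiplier B -> null_set_multiplier (A `|` B).
Proof.
move=> nA nB; have [_ _ hU] := @null_set_multiplier_sigma R.
have := hU (fun n => if n is 0%N then A else B); rewrite (_ : \bigcup_k _ = A `|` B).
  by apply => -[].
apply/seteqP; split => z; first by move=> [[|n] _ /=]; [left|right].
by move=> [zA|zB]; [exists 0%N|exists 1%N].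
Qed.

Lemma null_multiplier_setC (A : set T) : null_set_multiplier A ->
  null_set_multiplier (~` A).
Proof.
have [_ hC _] := @null_set_multiplier_sigma R.
by move=> /hC; rewrite setTD.
Qed.

Lemma null_multiplier_setI (A B : set T) : null_set_multiplier A ->
  null_set_multiplier B -> null_set_multiplier (A `&` B).
Proof.
move=> nA nB; rewrite -[A `&` B]setCK setCI; apply: null_multiplier_setC.
by apply: null_multiplier_setU; exact: null_multiplier_setC.
Qed.

Lemma null_multiplier_acos_lt (c : R) :
  null_set_multiplier [set z : T | acos (Re (sval z)) < c].
Proof.
have [c0|c0] := leP c 0.
  rewrite (_ : [set z | _] = set0); first exact: null_multiplier_set0.
  apply/seteqP; split => // z /=; rewrite ltNge (le_trans c0)//.
  exact/acos_ge0/circle_Re_itv.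
have [cpi|cpi] := ltP pi c.
  rewrite (_ : [set z | _] = setT); first exact: null_multiplier_setT.
  apply/seteqP; split => // z _ /=; apply: le_lt_trans cpi.
  exact/acos_lepi/circle_Re_itv.
rewrite (_ : [set z | _] = [set z : T | cos c < Re (zeta 1 z)]).
  exact/null_set_multiplier_gt/null_multiplier_Re.
have E (z : T) : (acos (Re (sval z)) < c) = (cos c < Re (sval z)).
  rewrite -[in RHS](@acosK _ (Re (sval z))) ?in_itv/= ?circle_Re_itv//.
  by rewrite ltr_cos// in_itv /= ?(ltW c0)// ?acos_ge0 ?acos_lepi// circle_Re_itv.
by apply/seteqP; split => z; rewrite /mkset zeta1 E.
Qed.

Lemma null_multiplier_acos_gt (c : R) :
  null_set_multiplier [set z : T | c < acos (Re (sval z))].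
Proof.
have [c0|c0] := ltP c 0.
  rewrite (_ : [set z | _] = setT); first exact: null_multiplier_setT.
  apply/seteqP; split => // z _ /=; rewrite (lt_le_trans c0)//.
  exact/acos_ge0/circle_Re_itv.
have [cpi|cpi] := leP pi c.
  rewrite (_ : [set z | _] = set0); first exact: null_multiplier_set0.
  apply/seteqP; split => // z /=; rewrite ltNge (le_trans _ cpi)//.
  exact/acos_lepi/circle_Re_itv.
rewrite (_ : [set z | _] = [set z : T | Re (zeta 1 z) < cos c]).
  exact/null_set_multiplier_lt/null_multiplier_Re.
have E (z : T) : (c < acos (Re (sval z))) = (Re (sval z) < cos c).
  rewrite -[in RHS](@acosK _ (Re (sval z))) ?in_itv/= ?circle_Re_itv//.
  by rewrite ltr_cos// in_itv /= ?c0 ?(ltW cpi)// ?acos_ge0 ?acos_lepi// circle_Re_itv.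
by apply/seteqP; split => z; rewrite /mkset zeta1 E.
Qed.

Lemma null_multiplier_angle_lt (s : R) :
  null_set_multiplier [set z : T | angle z < s].
Proof.
pose Up := [set z : T | 0 <= Im (sval z)].
have nUp : null_set_multiplier Up.
  rewrite (_ : Up = ~` [set z : T | Im (zeta 1 z) < 0]).
    exact/null_multiplier_setC/null_set_multiplier_lt/null_multiplier_Im.
  by apply/seteqP; split => z; rewrite /Up /setC /mkset zeta1 leNgt => /negP.
have p0 := two_pi_gt0.
rewrite (_ : [set z | _] =
  (Up `&` [set z : T | acos (Re (sval z)) < s * (2 * pi)]) `|`
  (~` Up `&` [set z : T | (1 - s) * (2 * pi) < acos (Re (sval z))])).
  apply: null_multiplier_setU; apply: null_multiplier_setI => //.
  - exact: null_multiplier_acos_lt.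
  - exact: null_multiplier_setC.
  - exact: null_multiplier_acos_gt.
apply/seteqP; split => z /=; rewrite /angle; case: ifPn => /=.
- by move=> b0; rewrite ltr_pdivrMr// => h; left.
- by move=> /negP b0 h; right; split => //; rewrite -ltr_pdivlMr//; lra.
- by move=> b0 [[_]|[/(_ b0)]//]; rewrite -ltr_pdivrMr.
- by move=> /negP b0 [[/b0]//|[_]]; rewrite -ltr_pdivlMr//; lra.
Qed.

Lemma null_set_multiplier_angle (B : set R) : measurable (B : set (measurableTypeR R)) ->
  null_set_multiplier (angle @^-1` B).
Proof.
have [h0 hC hU] := @null_set_multiplier_sigma R.
have sB : sigma_algebra setT [set B : set R | null_set_multiplier (angle @^-1` B)].
  split => /=.
  - by rewrite preimage_set0.
  - by move=> A /hC; rewrite !setTD -preimage_setC.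
  - by move=> F nF; rewrite preimage_bigcup; exact: hU.
rewrite -[measurable _]/((@ocitv R).-sigma.-measurable B) RGenInftyO.measurableE.
apply: (smallest_sub sB) => _ [x ->] /=.
rewrite (_ : _ @^-1` _ = [set z : T | angle z < x]); first exact: null_multiplier_angle_lt.
by apply/seteqP; split => z /=; rewrite in_itv.
Qed.

Lemma null_set_multiplier_measurable (A : set T) : measurable A -> null_set_multiplier A.
Proof.
move=> mA; pose B : set R := (fun t : measurableTypeR R => expi t) @^-1` A.
have : measurable (B : set (measurableTypeR R)) by exact: mA.
move=> /null_set_multiplier_angle; congr null_set_multiplier.
by apply/seteqP; split=> z; rewrite /B /preimage /mkset expi_angle.
Qed.

Lemma fourier_null_ae0 (g : T -> R) : fourier_null g -> g = (fun=> 0) %[ae mu].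
Proof.
move=> gn; have [ig _] := gn.
have h : ae_eq mu setT (EFin \o g) (cst 0%E).
  apply: integral_ae_eq => //.
  move=> E _ mE; have [_ [_ _ /(_ g gn)[iE /(_ 0)[+ _]]]] := null_set_multiplier_measurable mE.
  under eq_Rintegral do rewrite zeta0 /= mulr1.
  move=> h; rewrite integral0 [LHS]integral_mkcond.
  rewrite (_ : _ \_ _ = EFin \o (fun z => \1_E z * g z)); last first.
    by apply/funext => z; rewrite patchE /= indicE; case: (z \in E); rewrite ?mul1r ?mul0r.
  rewrite -[LHS]fineK; last exact: integrable_fin_num.
  by congr _%:E; exact: h.
by apply: filterS h => z /[apply] -[].
Qed.

Lemma zeta_total1 (f : T -> R[i]) : cintegrable mu f ->
  (forall m, cint mu (fun z => f z * zeta m z) = 0) -> f = (fun=> 0) %[ae mu].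
Proof.
move=> [i1 i2] f0.
have key m : [/\ \int[mu]_z (Re (f z) * Re (zeta m z)) = 0,
  \int[mu]_z (Re (f z) * Im (zeta m z)) = 0,
  \int[mu]_z (Im (f z) * Re (zeta m z)) = 0 &
  \int[mu]_z (Im (f z) * Im (zeta m z)) = 0].
  have ReE n : Re (cint mu (fun z => f z * zeta n z)) =
    \int[mu]_z (Re (f z) * Re (zeta n z)) - \int[mu]_z (Im (f z) * Im (zeta n z)).
    rewrite /= -RintegralB//; [|exact: integrable_mul_Re|exact: integrable_mul_Im].
    by apply: eq_Rintegral => z _; case: (f z) (zeta n z) => ? ? [].
  have ImE n : Im (cint mu (fun z => f z * zeta n z)) =
    \int[mu]_z (Re (f z) * Im (zeta n z)) + \int[mu]_z (Im (f z) * Re (zeta n z)).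
    rewrite /= -RintegralD//; [|exact: integrable_mul_Im|exact: integrable_mul_Re].
    by apply: eq_Rintegral => z _; case: (f z) (zeta n z) => ? ? [].
  have N1 (h : T -> R) : \int[mu]_z (h z * Re (zeta (- m) z)) = \int[mu]_z (h z * Re (zeta m z)).
    by apply: eq_Rintegral => z _; rewrite -cj_zeta ReJ.
  have N2 (h : T -> R) : mu.-integrable setT (EFin \o h) ->
     \int[mu]_z (h z * Im (zeta (- m) z)) = - \int[mu]_z (h z * Im (zeta m z)).
    move=> ih; rewrite -[RHS]mulN1r -RintegralZl//; last exact: integrable_mul_Im.
    by apply: eq_Rintegral => z _; rewrite -cj_zeta ImJ; ring.
  have := ReE m; have := ReE (- m); have := ImE m; have := ImE (- m).
  rewrite !f0 !N1 !N2//= => h1 h2 h3 h4.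
  by split; lra.
have h1 : fourier_null (fun z => Re (f z)) by split => // m; have [] := key m.
have h2 : fourier_null (fun z => Im (f z)) by split => // m; have [] := key m.
apply: filterS2 (fourier_null_ae0 h1) (fourier_null_ae0 h2) => z /[swap] e2 e1 _.
by apply: eq_ReIm; [exact: e1|exact: e2].
Qed.

Lemma L2_T_cintegrable (f : T -> R[i]) : L2 mu f -> cintegrable mu f.
Proof.
move=> lf; have := L2_mul_integrable lf (L2_zeta R 0).
by congr cintegrable; apply/funext => z; rewrite cj_zeta oppr0 zeta0 mulr1.
Qed.

Lemma onb_zeta : onb mu (@zeta R).
Proof.
split; [exact: L2_zeta|exact: inner_zeta|move=> g lg g0].
apply: zeta_total1 => [|m]; first exact: L2_T_cintegrable.
rewrite -[RHS](g0 (- m)) innerE; apply: eq_cint => z.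
by rewrite cj_zeta opprK.
Qed.

End CircleComplete.

(** * A symmetric finite q-sum *)

Section FiniteSymmetry.
Variables (K : fieldType) (Q : K).
Hypothesis Q1 : forall n, 1 - Q ^+ n.+1 != 0.

Definition gnum (L n : nat) : K := \prod_(i < n) (1 - Q ^+ (L - i)).
Definition gfact (n : nat) : K := \prod_(i < n) (1 - Q ^+ i.+1).
(** Gaussian binomial coefficient; it vanishes for n > L. *)
Definition gbin (L n : nat) : K := gnum L n / gfact n.

Lemma gfact_neq0 n : gfact n != 0.
Proof. by apply/prodf_neq0 => i _; exact: Q1. Qed.

Lemma gnum0 L n : (L < n)%N -> gnum L n = 0.
Proof.
move=> Ln; rewrite /gnum (bigD1 (Ordinal Ln))//= subnn expr0 subrr.
by rewrite mul0r.
Qed.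

Lemma gbin0 L n : (L < n)%N -> gbin L n = 0.
Proof. by move=> Ln; rewrite /gbin gnum0// mul0r. Qed.

Lemma gbin_n0 L : gbin L 0 = 1.
Proof. by rewrite /gbin /gnum /gfact !big_ord0 divr1. Qed.

Lemma gbinS L n : gbin L.+1 n.+1 = gbin L n.+1 + Q ^+ (L - n) * gbin L n.
Proof.
have fn := gfact_neq0 n; have fS := Q1 n.
have numS : gnum L.+1 n.+1 = (1 - Q ^+ L.+1) * gnum L n.
  by rewrite /gnum big_ord_recl subn0; congr (_ * _); apply: eq_bigr => i _.
have num1 : gnum L n.+1 = gnum L n * (1 - Q ^+ (L - n)) by rewrite /gnum big_ord_recr.
have facS : gfact n.+1 = gfact n * (1 - Q ^+ n.+1) by rewrite /gfact big_ord_recr.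
rewrite /gbin numS num1 facS; have [nL|Ln] := leqP n L; last first.
  by rewrite gnum0// !(mulr0, mul0r) addr0.
have -> : Q ^+ L.+1 = Q ^+ (L - n) * Q ^+ n.+1 by rewrite -exprD addnS subnK.
by field; rewrite fn fS.
Qed.

Lemma prodS_nat (f : nat -> K) n L : \prod_(n.+1 <= i < L.+1) f i = \prod_(n <= i < L) f i.+1.
Proof. by rewrite big_add1. Qed.

Definition symsum (e : K) (L : nat) (b z c : K) : K :=
  \sum_(n < L.+1) gbin L n * ((-1) ^+ n * Q ^+ 'C(n, 2)) *
    (\prod_(i < n) (z - c * Q ^+ i)) * \prod_(n <= i < L) (e - b * Q ^+ i).

Lemma symsum_rec e L b z c : symsum e L.+1 b z c =
  (e - b * Q ^+ L) * symsum e L b z c - Q ^+ L * (z - c) * symsum e L (b * Q) z (c * Q).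
Proof.
rewrite {1}/symsum big_ord_recl.
rewrite (eq_bigr (fun i : 'I_L.+1 => gbin L i.+1 * ((-1) ^+ i.+1 * Q ^+ 'C(i.+1, 2)) *
    (\prod_(k < i.+1) (z - c * Q ^+ k)) * \prod_(i.+1 <= k < L.+1) (e - b * Q ^+ k)
  + Q ^+ (L - i) * gbin L i * ((-1) ^+ i.+1 * Q ^+ 'C(i.+1, 2)) *
    (\prod_(k < i.+1) (z - c * Q ^+ k)) * \prod_(i.+1 <= k < L.+1) (e - b * Q ^+ k))); last first.
  by move=> i _; rewrite lift0 gbinS !mulrDl.
rewrite big_split /= addrA; congr (_ + _).
  rewrite (_ : gbin L.+1 0 = gbin L 0); last by rewrite !gbin_n0.
  pose G n := gbin L n * ((-1) ^+ n * Q ^+ 'C(n, 2)) *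
    (\prod_(i < n) (z - c * Q ^+ i)) * \prod_(n <= i < L.+1) (e - b * Q ^+ i).
  rewrite -[LHS]/(G 0%N + \sum_(i < L.+1) G i.+1).
  have <- : \sum_(i < L.+2) G i = G 0%N + \sum_(i < L.+1) G i.+1.
    by rewrite big_ord_recl; congr (_ + _); apply: eq_bigr => i _; rewrite lift0.
  rewrite {}/G big_ord_recr /= gbin0// !mul0r addr0 /symsum mulr_sumr.
  apply: eq_bigr => n _; rewrite big_nat_recr//=; last by rewrite -ltnS.
  by rewrite [RHS]mulrC mulrA.
rewrite /symsum -mulNr mulr_sumr; apply: eq_bigr => n _.
have nL : (n <= L)%N by rewrite -ltnS.
rewrite prodS_nat big_ord_recl expr0 mulr1.
have -> : \prod_(i < n) (z - c * Q ^+ lift ord0 i) = \prod_(i < n) (z - c * Q * Q ^+ i).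
  by apply: eq_bigr => i _; rewrite lift0 exprS mulrA.
have -> : \prod_(n <= i < L) (e - b * Q ^+ i.+1) = \prod_(n <= i < L) (e - b * Q * Q ^+ i).
  by apply: eq_bigr => i _; rewrite exprS mulrA.
have QL : Q ^+ L = Q ^+ (L - n) * Q ^+ n by rewrite -exprD subnK.
rewrite binS bin1 exprD exprS [in RHS]QL; ring.
Qed.

(** The second identity is what makes the recurrence symmetric in b and z; both
    are proved together by induction on L. *)
Lemma symsum_symm e L : forall b z c, symsum e L b z c = symsum e L z b c /\
  (z - b) * symsum e L b z c =
  (z - c) * symsum e L (b * Q) z (c * Q) - (b - c) * symsum e L b (z * Q) (c * Q).
Proof.
elim: L => [|L IH] b z c.
  have s0 u v w : symsum e 0 u v w = 1.
    by rewrite /symsum big_ord1 gbin_n0 !expr0 big_ord0 big_geq// !mulr1.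
  by rewrite !s0 !mulr1; split => //; ring.
have S u v w := (IH u v w).1.
have [_ star] := IH b z c.
have recS u v w : symsum e L.+1 u v w = (e - v * Q ^+ L) * symsum e L u v w -
    Q ^+ L * (u - w) * symsum e L u (v * Q) (w * Q).
  have [_ st] := IH u v w.
  rewrite symsum_rec; apply/eqP; rewrite -subr_eq0; apply/eqP.
  transitivity (Q ^+ L * ((v - u) * symsum e L u v w -
    ((v - w) * symsum e L (u * Q) v (w * Q) - (u - w) * symsum e L u (v * Q) (w * Q)))).
    ring.
  by rewrite st subrr mulr0.
split.
  rewrite symsum_rec recS (S z b) (S z (b * Q)); ring.
rewrite (recS (b * Q)) (symsum_rec e L b (z * Q)) (symsum_rec e L b z).
apply/eqP; rewrite -subr_eq0; apply/eqP.
transitivity ((e - b * Q ^+ L) * ((z - b) * symsum e L b z c -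
  ((z - c) * symsum e L (b * Q) z (c * Q) - (b - c) * symsum e L b (z * Q) (c * Q)))).
  ring.
by rewrite star subrr mulr0.
Qed.

End FiniteSymmetry.

(** * Dominated series and infinite q-products *)

Section DominatedSeries.
Variable R : realType.
Implicit Types (f g m u : nat -> R).

Lemma series_dom_cvg f m : cvgn (series m) -> (forall n, `|f n| <= m n) ->
  cvgn (series f).
Proof.
move=> cm fm; apply: normed_cvg.
apply: (@series_le_cvg _ (fun n => `|f n|) m) => // n.
by apply: le_trans (fm n); exact: normr_ge0.
Qed.

Lemma series_tailE f k N : (N <= k)%N -> series f k - series f N = \sum_(N <= i < k) f i.
Proof. by move=> Nk; rewrite /series /= (big_cat_nat (n := N))//= addrAC subrr add0r. Qed.

Lemma series_dom_tail f m N : cvgn (series m) -> (forall n, `|f n| <= m n) ->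
  `|limn (series f) - series f N| <= limn (series m) - series m N.
Proof.
move=> cm fm; have cf := series_dom_cvg cm fm.
apply: (@ler_cvg_to _ \oo _ _ (fun k => `|series f k - series f N|)
  (fun k => series m k - series m N)).
- by apply: cvg_norm; apply: cvgB => //; exact: cvg_cst.
- by apply: cvgB => //; exact: cvg_cst.
- exists N => // k /= Nk; rewrite !series_tailE//.
  by rewrite (le_trans (ler_norm_sum _ _ _))// ler_sum.
Qed.

(** Tannery's theorem: dominated convergence for series. *)
Lemma tannery (f : nat -> nat -> R) g m : cvgn (series m) ->
  (forall k n, `|f k n| <= m n) -> (forall n, f ^~ n @ \oo --> g n) ->
  (fun k => limn (series (f k))) @ \oo --> limn (series g).
Proof.
move=> cm fm fg.
have gm n : `|g n| <= m n.
  apply: (@ler_cvg_to _ \oo _ _ (fun k => `|f k n|) (fun=> m n)).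
  - by apply: cvg_norm; exact: fg.
  - exact: cvg_cst.
  - by apply: nearW => k; exact: fm.
have fin N : (fun k => series (f k) N) @ \oo --> series g N.
  elim: N => [|N IH].
    rewrite /series /= [X in _ --> X](big_geq _)// (_ : (fun k => _) = fun=> 0).
      exact: cvg_cst.
    by apply/funext => k; rewrite big_geq.
  have sS h : series h N.+1 = series h N + h N by rewrite /series /= big_nat_recr.
  rewrite sS (_ : (fun k => _) = (fun k => series (f k) N + f k N)).
    by apply: cvgD => //; exact: fg.
  by apply/funext => k; exact: sS.
apply/cvgrPdist_lt => e e0.
have e4 : 0 < e / 4 by rewrite divr_gt0.
move/cvgrPdist_lt : (cm) => /(_ _ e4)[N _ /(_ N (leqnn N)) hN].
have tail : limn (series m) - series m N < e / 4.
  by rewrite (le_lt_trans _ hN)// ler_norm.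
move/cvgrPdist_lt : (fin N) => /(_ _ e4); apply: filterS => k hk.
have h1 := series_dom_tail N cm gm.
have h2 := series_dom_tail N cm (fm k).
rewrite (_ : _ - _ = (limn (series g) - series g N) + (series g N - series (f k) N)
  - (limn (series (f k)) - series (f k) N)); last by ring.
apply: (le_lt_trans (ler_normB _ _)); apply: (le_lt_trans (lerD (ler_normD _ _) (lexx _))).
lra.
Qed.

Lemma finite_series_lim f N : (forall n, (N <= n)%N -> f n = 0) ->
  limn (series f) = \sum_(n < N) f n.
Proof.
move=> f0; apply/cvg_lim => //; apply: cvg_near_cst; exists N => // k /= Nk.
rewrite /series /= (big_cat_nat (n := N))//= [X in _ + X]big1_seq ?addr0 ?big_mkord//.
by move=> i; rewrite mem_index_iota => /andP[_ /andP[Ni _]]; exact: f0.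
Qed.

Lemma ratio_cvg u (K r : R) : 0 <= r < 1 -> (forall n, 0 <= u n) ->
  (forall n, u n.+1 <= K * r ^+ n * u n) -> cvgn (series u).
Proof.
move=> r01 u0 uS; have [r0 r1] := andP r01.
have [N hN] := @geometric_small R r `|K| 2^-1 r01 ltac:(by rewrite invr_gt0).
pose v n := u n * 2 ^+ n.
have vS n : (N <= n)%N -> v n.+1 <= v n.
  move=> Nn; rewrite /v exprS mulrCA mulrA ler_wpM2r ?exprn_ge0//.
  have h : K * r ^+ n <= 2^-1.
    apply: (@le_trans _ _ (`|K| * r ^+ n)); first by rewrite ler_wpM2r ?exprn_ge0// ler_norm.
    apply: ltW; apply: le_lt_trans hN; rewrite ler_wpM2l//.
    by apply: ler_wiXn2l => //; exact: ltW.
  have := uS n; have := ler_wpM2r (u0 n) h; lra.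
pose C := \sum_(k < N.+1) v k.
have v0 n : 0 <= v n by rewrite mulr_ge0// exprn_ge0.
have vC n : v n <= C.
  have small k : (k <= N)%N -> v k <= C.
    by move=> kN; rewrite /C (bigD1 (inord k : 'I_N.+1))//= inordK// lerDl sumr_ge0.
  have [nN|/ltnW Nn] := leqP n N; first exact: small.
  rewrite -(subnK Nn); elim: (n - N)%N => [|j IH]; first exact: small.
  by rewrite addSn; apply: le_trans IH; apply: vS; exact: leq_addl.
apply: (@series_le_cvg _ _ (geometric C 2^-1)) => // [n|n|].
- by rewrite /geometric /= mulr_ge0 ?exprn_ge0// (le_trans (v0 0%N)).
- by rewrite /geometric /= exprVn ler_pdivlMr ?exprn_gt0//; exact: vC.
- by apply: is_cvg_geometric_series; rewrite ger0_norm; lra.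
Qed.

End DominatedSeries.

Section QPochhammer.
Variables (R : realType) (q : R).
Hypotheses (q_gt0 : 0 < q) (q_lt1 : q < 1).
Let Q := q ^+ 2.
Implicit Types a b z : R.

Lemma Q_itv : 0 <= Q < 1.
Proof. by rewrite /Q exprn_ge0 ?exprn_ilt1// ltW. Qed.

Lemma Q_gt0 : 0 < Q. Proof. by rewrite exprn_gt0. Qed.
Lemma Q_lt1 : Q < 1. Proof. by have /andP[] := Q_itv. Qed.

Lemma Qn_ge0 i : 0 <= Q ^+ i.
Proof. by apply: exprn_ge0; exact/ltW/Q_gt0. Qed.

Lemma Qn_le1 i : Q ^+ i <= 1.
Proof. by apply: exprn_ile1; [exact/ltW/Q_gt0|exact/ltW/Q_lt1]. Qed.

Lemma qpochE a n : qpoch q a n = \prod_(i < n) (1 - a * Q ^+ i).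
Proof. by apply: eq_bigr => i _; rewrite exprM mulrC. Qed.

Lemma qpochS a n : qpoch q a n.+1 = qpoch q a n * (1 - a * Q ^+ n).
Proof. by rewrite !qpochE big_ord_recr. Qed.

Lemma qpoch0 a : qpoch q a 0 = 1. Proof. by rewrite qpochE big_ord0. Qed.

Lemma qpochD a n m : qpoch q a (n + m) = qpoch q a n * qpoch q (a * Q ^+ n) m.
Proof.
elim: m => [|m IH]; first by rewrite addn0 qpoch0 mulr1.
by rewrite addnS !qpochS IH -!mulrA -exprD.
Qed.

Definition qbound a : R := expR (`|a| / (1 - Q)).

Lemma geometric_sum_le n : \sum_(i < n) Q ^+ i <= (1 - Q)^-1.
Proof.
have /andP[Q0 Q1] := Q_itv; have h : 0 < 1 - Q by rewrite subr_gt0.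
rewrite -[leRHS]mul1r ler_pdivlMr// mulrC.
have -> : (1 - Q) * (\sum_(i < n) Q ^+ i) = 1 - Q ^+ n.
  have := subrX1 Q n; rewrite -[X in _ = X -> _]opprK => e.
  by rewrite -[LHS]opprK -mulNr opprB -subrX1 opprB.
by rewrite gerBl Qn_ge0.
Qed.

Lemma qpoch_le a n : `|qpoch q a n| <= qbound a.
Proof.
have /andP[Q0 Q1] := Q_itv.
apply: (@le_trans _ _ (expR (\sum_(i < n) `|a| * Q ^+ i))).
  rewrite qpochE expR_sum normr_prod; apply: ler_prod => i _; rewrite normr_ge0 /=.
  apply: (le_trans (ler_normB _ _)); rewrite normr1 normrM [`|Q ^+ i|]ger0_norm ?Qn_ge0//.
  exact: expR_ge1Dx.
by rewrite /qbound ler_expR -mulr_sumr ler_wpM2l// geometric_sum_le.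
Qed.

Lemma qpoch_cvg_dist a : cvgn (qpoch q a) /\
  forall k, `|qpoch_oo q a - qpoch q a k| <= qbound a * `|a| / (1 - Q) * Q ^+ k.
Proof.
apply: geometric_cauchy_cvg; first exact: Q_itv.
have /andP[Q0 Q1] := Q_itv.
move=> k; rewrite qpochS mulrBr mulr1 addrAC subrr sub0r normrN !normrM.
by rewrite [`|Q ^+ k|]ger0_norm ?Qn_ge0// mulrA !ler_wpM2r ?Qn_ge0// qpoch_le.
Qed.

Lemma qpoch_cvg a : qpoch q a @ \oo --> qpoch_oo q a.
Proof. exact: (qpoch_cvg_dist a).1. Qed.

Lemma qpoch_oo_le a : `|qpoch_oo q a| <= qbound a.
Proof.
apply: (@ler_cvg_to _ \oo _ _ (fun k => `|qpoch q a k|) (fun=> qbound a)).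
- by apply: cvg_norm; exact: qpoch_cvg.
- exact: cvg_cst.
- by apply: nearW => k; exact: qpoch_le.
Qed.

Lemma qpoch_ooD a n : qpoch_oo q a = qpoch q a n * qpoch_oo q (a * Q ^+ n).
Proof.
apply/cvg_lim => //; rewrite -(cvg_shiftn n).
rewrite (_ : (fun k => _) = (fun k => qpoch q a n * qpoch q (a * Q ^+ n) k)).
  by apply: cvgMr; exact: qpoch_cvg.
by apply/funext => k; rewrite /= addnC qpochD.
Qed.

Lemma qbound_ge0 a : 0 <= qbound a. Proof. exact: expR_ge0. Qed.

Lemma qbound_mono a b : `|a| <= `|b| -> qbound a <= qbound b.
Proof.
move=> ab; rewrite /qbound ler_expR ler_wpM2r// invr_ge0 subr_ge0.
exact/ltW/Q_lt1.
Qed.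

Lemma qpoch_gt0 a n : a < 1 -> 0 < qpoch q a n.
Proof.
move=> a1; have /andP[Q0 Q1] := Q_itv.
rewrite qpochE; apply: prodr_gt0 => i _; rewrite subr_gt0.
have [a0|a0] := leP 0 a; last by rewrite (le_lt_trans _ ltr01)// mulr_le0_ge0 ?Qn_ge0 ?ltW.
by rewrite (le_lt_trans _ a1)// ler_piMr// Qn_le1.
Qed.

Lemma qpoch_ge_half b k : b <= (1 - Q) / 2 -> 2^-1 <= qpoch q b k.
Proof.
have /andP[Q0 Q1] := Q_itv; have h : 0 < 1 - Q by rewrite subr_gt0.
move=> bb; have [b0|b0] := lerP b 0.
  apply: (@le_trans _ _ 1); first by lra.
  rewrite qpochE; elim/big_rec: _ => // i x _ x1.
  rewrite -[leLHS]mulr1 ler_pM// lerBrDr gerDl.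
  by rewrite mulr_le0_ge0// Qn_ge0.
have bl1 : b <= 1 by lra.
have b1 i : 0 <= b * Q ^+ i <= 1.
  have b0' := ltW b0; apply/andP; split; first by rewrite mulr_ge0// Qn_ge0.
  by rewrite mulr_ile1// ?Qn_ge0 ?Qn_le1.
have : 1 - b * (\sum_(i < k) Q ^+ i) <= qpoch q b k <= 1.
  elim: k => [|k /andP[IH1 IH2]]; first by rewrite big_ord0 qpoch0; apply/andP; split; lra.
  have p0 : 0 < qpoch q b k by apply: qpoch_gt0; lra.
  rewrite big_ord_recr /= qpochS; have /andP[h1 h2] := b1 k.
  apply/andP; split; nra.
move=> /andP[+ _]; apply: le_trans.
have := ler_wpM2l (ltW b0) (geometric_sum_le k).
have : b * (1 - Q)^-1 <= 2^-1 by rewrite ler_pdivrMr// mulrC.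
lra.
Qed.

Lemma qpoch_oo_gt0 a : a < 1 -> 0 < qpoch_oo q a.
Proof.
move=> a1; have h : 0 < 1 - Q by rewrite subr_gt0 Q_lt1.
have [n hn] := @geometric_small R Q `|a| ((1 - Q) / 2) Q_itv ltac:(by rewrite divr_gt0).
rewrite (qpoch_ooD a n) mulr_gt0 ?qpoch_gt0//.
have bb : a * Q ^+ n <= (1 - Q) / 2.
  by apply: ltW; apply: le_lt_trans hn; rewrite ler_wpM2r ?Qn_ge0// ler_norm.
apply: (@lt_le_trans _ _ 2^-1); first by rewrite invr_gt0.
apply: limr_ge; first exact: (qpoch_cvg_dist _).1.
by apply: nearW => k; exact: qpoch_ge_half.
Qed.

(** The numerators (c/z; Q)_n z^n, as polynomials in z and c. *)
Definition zpoch (z c : R) (n : nat) : R := \prod_(i < n) (z - c * Q ^+ i).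

Lemma zpochE a z n : zpoch z (a * z) n = qpoch q a n * z ^+ n.
Proof.
rewrite /zpoch qpochE; elim: n => [|n IH]; first by rewrite !big_ord0 expr0 mulr1.
by rewrite !big_ord_recr /= IH exprS; ring.
Qed.

Lemma zpoch_le z c n : `|zpoch z c n| <= (`|z| + `|c|) ^+ n.
Proof.
rewrite /zpoch normr_prod -[n in X in _ <= X]card_ord -prodr_const.
apply: ler_prod => i _; rewrite normr_ge0 /= (le_trans (ler_normB _ _))// lerD2l.
by rewrite normrM [`|Q ^+ _|]ger0_norm ?Qn_ge0// ler_piMr// Qn_le1.
Qed.

Lemma Q_neq1 n : 1 - Q ^+ n.+1 != 0.
Proof.
by rewrite subr_eq0 eq_sym lt_eqF// exprn_ilt1// ?Q_lt1// ltW// Q_gt0.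
Qed.

Lemma gfactE n : gfact Q n = qpoch q (q ^+ 2) n.
Proof. by rewrite qpochE; apply: eq_bigr => i _; rewrite exprS. Qed.

Lemma gfact_ge n : (1 - Q) ^+ n <= gfact Q n.
Proof.
rewrite /gfact -[n in X in X <= _]card_ord -prodr_const; apply: ler_prod => i _.
rewrite subr_ge0 ltW ?Q_lt1//= lerD2l lerN2.
by rewrite exprS ler_piMr ?Qn_le1// ltW// Q_gt0.
Qed.

Lemma gnum_itv L n : 0 <= gnum Q L n <= 1.
Proof.
rewrite /gnum; apply/andP; split.
  by apply: prodr_ge0 => i _; rewrite subr_ge0 Qn_le1.
by apply: prodr_ile1 => i _; rewrite subr_ge0 Qn_le1 /= gerBl Qn_ge0.
Qed.

Definition psi_term (b z c : R) (n : nat) : R :=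
  zpoch z c n * qpoch_oo q (b * Q ^+ n) / gfact Q n * ((-1) ^+ n * Q ^+ 'C(n, 2)).

Lemma Psi_psi_term a b z : Psi q a b z = limn (series (psi_term b z (a * z))).
Proof.
congr (limn (series _)); apply/funext => n; rewrite /psi_term zpochE gfactE.
have -> : q ^+ (n * n.-1) = Q ^+ 'C(n, 2).
  rewrite /Q -exprM mul2n bin2 halfK oddM.
  by rewrite (_ : odd n && odd n.-1 = false) ?subn0//; case: n => [//|n] /=; case: (odd n).
by rewrite (exprM q 2 n) -/Q; ring.
Qed.

Definition psi_major (b z c : R) (n : nat) : R :=
  qbound b * (((`|z| + `|c|) / (1 - Q)) ^+ n * Q ^+ 'C(n, 2)).

Lemma psi_major_cvg b z c : cvgn (series (psi_major b z c)).
Proof.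
apply: (@ratio_cvg _ _ ((`|z| + `|c|) / (1 - Q)) Q Q_itv) => n.
  have h : 0 <= 1 - Q by rewrite subr_ge0 ltW// Q_lt1.
  rewrite /psi_major mulr_ge0 ?qbound_ge0// mulr_ge0 ?Qn_ge0//.
  by apply: exprn_ge0; apply: divr_ge0 => //; exact: addr_ge0.
by rewrite /psi_major binS bin1 exprD exprS; apply: eq_ler; ring.
Qed.

Lemma psi_gen_le b z c n (w g : R) : `|w| <= qbound b -> 0 <= g <= 1 ->
  `|zpoch z c n * w * (g / gfact Q n) * ((-1) ^+ n * Q ^+ 'C(n, 2))| <= psi_major b z c n.
Proof.
move=> wb /andP[g0 g1]; have f0 : 0 < (1 - Q) ^+ n by rewrite exprn_gt0// subr_gt0 Q_lt1.
have fp := lt_le_trans f0 (gfact_ge n).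
rewrite !normrM normrX normrN1 expr1n mul1r [`|Q ^+ _|]ger0_norm ?Qn_ge0//.
rewrite normfV (ger0_norm g0) (gtr0_norm fp) /psi_major [leRHS]mulrA.
apply: ler_wpM2r; first exact: Qn_ge0.
have -> : ((`|z| + `|c|) / (1 - Q)) ^+ n = (`|z| + `|c|) ^+ n * ((1 - Q) ^+ n)^-1.
  by rewrite exprMn exprVn.
rewrite [X in X * (g * _)]mulrC -mulrA.
apply: ler_pM => //; first by rewrite !mulr_ge0// invr_ge0 ltW.
apply: ler_pM => //; first by rewrite mulr_ge0// invr_ge0 ltW.
  exact: zpoch_le.
rewrite -[leRHS]mul1r; apply: ler_pM => //; first by rewrite invr_ge0 ltW.
by rewrite lef_pV2// gfact_ge.
Qed.

Lemma cvg_Qn : (fun n => Q ^+ n) @ \oo --> (0 : R).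
Proof. by apply: cvg_expr; rewrite ger0_norm ?Q_lt1// ltW// Q_gt0. Qed.

Lemma gnum_cvg n : (fun L => gnum Q L n) @ \oo --> (1 : R).
Proof.
elim: n => [|n IH].
  by rewrite (_ : (fun L => _) = fun=> 1); [exact: cvg_cst|
    apply/funext => L; rewrite /gnum big_ord0].
rewrite (_ : (fun L => _) = (fun L => gnum Q L n * (1 - Q ^+ (L - n)))); last first.
  by apply/funext => L; rewrite /gnum big_ord_recr.
rewrite -[X in _ --> X]mulr1; apply: cvgM => //.
rewrite -[X in _ --> X]subr0; apply: cvgB; first exact: cvg_cst.
rewrite -(cvg_shiftn n) (_ : (fun L => _) = (fun n => Q ^+ n)); first exact: cvg_Qn.
by apply/funext => L /=; rewrite addnK.
Qed.

Lemma symsum_cvg b z c :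
  (fun L => symsum Q 1 L b z c) @ \oo --> limn (series (psi_term b z c)).
Proof.
pose f L n := zpoch z c n * qpoch q (b * Q ^+ n) (L - n) * (gnum Q L n / gfact Q n) *
  ((-1) ^+ n * Q ^+ 'C(n, 2)).
have prodE L n : \prod_(n <= i < L) (1 - b * Q ^+ i) = qpoch q (b * Q ^+ n) (L - n).
  rewrite qpochE -{1}[n]add0n big_addn big_mkord; apply: eq_bigr => i _.
  by rewrite addnC exprD mulrA.
have fE : (fun L => symsum Q 1 L b z c) = (fun L => limn (series (f L))).
  apply/funext => L; rewrite (@finite_series_lim _ _ L.+1).
    apply: eq_bigr => n _; rewrite prodE /f /gbin -/(zpoch _ _ _); ring.
  by move=> n Ln; rewrite /f gnum0// mul0r mulr0 mul0r.
rewrite fE; apply: (@tannery _ f _ _ (@psi_major_cvg b z c)).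
  move=> L n; apply: psi_gen_le (gnum_itv _ _).
  apply: (le_trans (qpoch_le _ _)); apply: qbound_mono.
  by rewrite normrM [`|Q ^+ n|]ger0_norm ?Qn_ge0// ler_piMr// Qn_le1.
move=> n; have -> : psi_term b z c n = zpoch z c n * qpoch_oo q (b * Q ^+ n) *
    (1 / gfact Q n) * ((-1) ^+ n * Q ^+ 'C(n, 2)) by rewrite /psi_term mul1r.
apply: cvgMl; apply: cvgM.
  apply: cvgMr; rewrite -(cvg_shiftn n).
  rewrite (_ : (fun L => _) = qpoch q (b * Q ^+ n)); first exact: qpoch_cvg.
  by apply/funext => k /=; rewrite addnK.
apply: cvgMl; exact: gnum_cvg.
Qed.

Lemma psi_lim_symm b z c : limn (series (psi_term b z c)) = limn (series (psi_term z b c)).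
Proof.
rewrite -(cvg_lim _ (@symsum_cvg b z c))// -(cvg_lim _ (@symsum_cvg z b c))//.
by congr (limn _); apply/funext => L; have [] := symsum_symm Q_neq1 1 L b z c.
Qed.

End QPochhammer.

(** * Elements of I_q and Gaussian factors *)

Section GaussSymmetry.
Variables (K : fieldType) (Q : K).
Hypothesis Q1 : forall n, 1 - Q ^+ n.+1 != 0.

Lemma gnum_gfact L n : (n <= L)%N -> gnum Q L n * gfact Q (L - n) = gfact Q L.
Proof.
elim: n => [|n IH] nL; first by rewrite /gnum big_ord0 mul1r subn0.
rewrite -(IH (ltnW nL)) /gnum big_ord_recr /= -mulrA; congr (_ * _).
by rewrite subnS -[in RHS](prednK (_ : 0 < L - n)%N) ?subn_gt0// /gfact big_ord_recr /= mulrC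
  prednK// subn_gt0.
Qed.

Lemma gbin_sub L n : (n <= L)%N -> gbin Q L (L - n) = gbin Q L n.
Proof.
move=> nL; have f0 := gfact_neq0 Q1.
have h1 := gnum_gfact nL; have h2 := gnum_gfact (leq_subr n L).
rewrite subKn// in h2; apply: (mulIf (f0 n)); apply: (mulIf (f0 (L - n)%N)).
rewrite /gbin [in RHS]divfK// h1 -h2; field; exact: f0.
Qed.

Lemma symsum0E L b z c : symsum Q 0 L b z c = (-1) ^+ L * Q ^+ 'C(L, 2) *
  \sum_(n < L.+1) gbin Q L n * (\prod_(i < n) (z - c * Q ^+ i)) * b ^+ (L - n).
Proof.
have triang n : Q ^+ 'C(n, 2) = \prod_(i < n) Q ^+ i.
  elim: n => [|n IH]; first by rewrite big_ord0 expr0.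
  by rewrite binS bin1 exprD big_ord_recr /= -IH.
rewrite /symsum mulr_sumr; apply: eq_bigr => n _.
have nL : (n <= L)%N by rewrite -ltnS.
have -> : \prod_(n <= i < L) (0 - b * Q ^+ i) =
    (-1) ^+ (L - n) * b ^+ (L - n) * \prod_(n <= i < L) Q ^+ i.
  under eq_bigr do rewrite sub0r -mulNr.
  by rewrite big_split /= prodr_const_nat -[- b]mulN1r exprMn.
have e1 : Q ^+ 'C(L, 2) = Q ^+ 'C(n, 2) * \prod_(n <= i < L) Q ^+ i.
  rewrite !triang -(big_mkord predT (fun i => Q ^+ i)) (big_cat_nat (n := n))//=.
  by rewrite big_mkord.
have e2 : (-1) ^+ L = (-1) ^+ n * (-1) ^+ (L - n) :> K by rewrite -exprD subnKC.
rewrite e1 e2; ring.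
Qed.

End GaussSymmetry.

Section Elements.
Variables (R : realType) (q : R).
Hypotheses (q_gt0 : 0 < q) (q_lt1 : q < 1).
Let Q := q ^+ 2.

Lemma q_neq0 : q != 0. Proof. by rewrite gt_eqF. Qed.

Lemma ln_expz (k : int) : ln (q ^ k) = k%:~R * ln q.
Proof.
case: k => n; first by rewrite -[q ^ _]/(q ^+ n) lnXn// mulr_natl.
rewrite -[q ^ _]/((q ^+ n.+1)^-1) lnV ?posrE ?exprn_gt0// lnXn//.
by rewrite NegzE mulrNz mulNr -mulr_natl.
Qed.

Lemma qz_gt0 (k : int) : 0 < q ^ k. Proof. exact: exprz_gt0. Qed.

Lemma chi_abs (x : R) (k : int) : `|x| = q ^ k -> chi q x = k.
Proof.
move=> xk; rewrite /chi xk ln_expz mulfK ?intrKfloor//.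
by rewrite lt_eqF// ln_lt0// q_gt0.
Qed.

Lemma nu_q_abs (x : R) (k : int) : `|x| = q ^ k ->
  nu_q q x = q `^ ((k%:~R - 1) * (k%:~R - 2) / 2).
Proof. by move=> xk; rewrite /nu_q (chi_abs xk). Qed.

Lemma nu_q_swap (u v : R) (i j l : int) : `|u| = q ^ (i + l) -> `|v| = q ^ (l - i) ->
  nu_q q u = nu_q q v * q ^ (i * (2 * l - 3)).
Proof.
move=> /nu_q_abs -> /nu_q_abs ->.
rewrite -powR_intmul ?(ltW q_gt0)// -powRD; last by rewrite q_neq0 implybT.
by congr (_ `^ _); rewrite !intrD !intrM !intrN; field.
Qed.

End Elements.

(** * Exchange of arguments, equal signs *)

Section PsiSwap.
Variables (R : realType) (q : R).
Hypotheses (q_gt0 : 0 < q) (q_lt1 : q < 1).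
Local Notation Q := (q ^+ 2).
Implicit Types b z c P X Y : R.

Definition psi_lim b z c : R := limn (series (psi_term q b z c)).

Let Q0 : Q != 0. Proof. by rewrite expf_neq0// gt_eqF. Qed.
Let Qn0 n : Q ^+ n != 0. Proof. by rewrite expf_neq0. Qed.

Let QS n : Q ^+ n.+1 = Q * Q ^+ n. Proof. exact: exprS. Qed.
Let QD n m : Q ^+ (n + m) = Q ^+ n * Q ^+ m. Proof. exact: exprD. Qed.

Lemma qpoch_oo_vanish n k : (k < n)%N -> qpoch_oo q (Q / Q ^+ n * Q ^+ k) = 0.
Proof.
move=> kn; rewrite (qpoch_ooD q_gt0 q_lt1 _ (n - k)) (_ : qpoch _ _ _ = 0) ?mul0r//.
have -> : (n - k)%N = (n - k.+1).+1 by rewrite subnSK.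
rewrite qpochS (_ : _ * Q ^+ (n - k.+1) = 1) ?subrr ?mulr0//.
have -> : Q ^+ n = Q ^+ (n - k.+1) * (Q * Q ^+ k) by rewrite -QS -QD subnK.
by field; rewrite !Qn0 gt_eqF.
Qed.

Lemma gfactD n j : gfact Q (n + j) = gfact Q j * qpoch q (Q * Q ^+ j) n.
Proof.
rewrite addnC; elim: n => [|n IH]; first by rewrite addn0 qpoch0 mulr1.
rewrite addnS (_ : gfact Q (j + n).+1 = gfact Q (j + n) * (1 - Q ^+ (j + n).+1)).
  2: by rewrite /gfact big_ord_recr.
rewrite IH qpochS; by rewrite QS QD; ring.
Qed.

Lemma zpochS z c n : zpoch q z c n.+1 = zpoch q z c n * (z - c * Q ^+ n).
Proof. by rewrite /zpoch big_ord_recr. Qed.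

Lemma zpoch0 z c : zpoch q z c 0 = 1.
Proof. by rewrite /zpoch big_ord0. Qed.

Lemma zpochD z c n j : zpoch q z c (n + j) = zpoch q z c n * zpoch q z (c * Q ^+ n) j.
Proof.
elim: j => [|j IH]; first by rewrite addn0 zpoch0 mulr1.
by rewrite addnS !zpochS IH QD; ring.
Qed.

Lemma zpochM t z c n : zpoch q (t * z) (t * c) n = t ^+ n * zpoch q z c n.
Proof.
elim: n => [|n IH]; first by rewrite !zpoch0 expr0 mulr1.
by rewrite !zpochS IH (exprS t); ring.
Qed.

Lemma binD2 n j : 'C(n + j, 2) = ('C(n, 2) + 'C(j, 2) + n * j)%N.
Proof.
elim: j => [|j IH]; first by rewrite addn0 muln0 bin0n !addn0.
by rewrite addnS !binS !bin1 IH mulnS; lia.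
Qed.

Lemma series_shift (u : nat -> R) n : (forall k, (k < n)%N -> u k = 0) ->
  limn (series u) = limn (series (fun j => u (n + j)%N)).
Proof.
move=> u0; suff e : (fun N => series u (N + n)%N) = series (fun j => u (n + j)%N).
  rewrite -e; apply/esym.
  have [cu|ncu] := pselect (cvgn (series u)).
    by apply/cvg_lim => //; rewrite (cvg_shiftn n (series u)).
  rewrite (dvgP _) ?(dvgP ncu)//.
  move=> /cvg_ex[l]; rewrite (cvg_shiftn n (series u)) => h; apply: ncu.
  by apply/cvg_ex; exists l.
apply/funext => N; rewrite /series /= addnC (big_cat_nat (n := n)) ?leq_addr//=.
rewrite big_nat_cond big1 ?add0r; last by move=> i /andP[/andP[_ ik] _]; exact: u0.
by rewrite -{1}[n]add0n big_addn addKn; apply: eq_bigr => i _; rewrite addnC.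
Qed.

Lemma psi_lim_shift z c n : psi_lim (Q / Q ^+ n) z c =
  (-1) ^+ n * Q ^+ 'C(n, 2) * zpoch q z c n *
  psi_lim (Q ^+ n.+1) (z * Q ^+ n) (c * Q ^+ n * Q ^+ n).
Proof.
rewrite /psi_lim (@series_shift _ n); last first.
  by move=> k kn; rewrite /psi_term qpoch_oo_vanish// mulr0 mul0r mul0r.
have e : (fun j => psi_term q (Q / Q ^+ n) z c (n + j)) =
  ((-1) ^+ n * Q ^+ 'C(n, 2) * zpoch q z c n) *:
    psi_term q (Q ^+ n.+1) (z * Q ^+ n) (c * Q ^+ n * Q ^+ n).
  apply/funext => j; rewrite -[RHS]/(_ * _) /psi_term zpochD.
  rewrite [z * _]mulrC [c * Q ^+ n * _]mulrC zpochM gfactD.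
  have -> : Q / Q ^+ n * Q ^+ (n + j) = Q * Q ^+ j.
    by rewrite QD mulrA divfK.
  rewrite (qpoch_ooD q_gt0 q_lt1 (Q * Q ^+ j) n).
  have -> : Q * Q ^+ j * Q ^+ n = Q ^+ n.+1 * Q ^+ j by rewrite QS; ring.
  rewrite binD2 (exprD (-1)) !QD [Q ^+ (n * j)]exprM.
  have f0 : gfact Q j != 0 by apply: gfact_neq0 => i; exact: Q_neq1.
  have q0 : qpoch q (Q * Q ^+ j) n != 0.
    by rewrite gt_eqF// qpoch_gt0// -QS exprn_ilt1 ?Q_lt1// exprn_ge0// ltW.
  move: f0 q0; move: (gfact _ _) (qpoch _ _ _) (qpoch_oo _ _) (zpoch _ _ _ n) (zpoch _ _ _ j).
  move: ((-1) ^+ n) ((-1) ^+ j) (Q ^+ 'C(n, 2)) (Q ^+ 'C(j, 2)) (Q ^+ n ^+ j).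
  by move=> x1 x2 x3 x4 x5 f1 f2 f3 f4 f5 f0 q0; field; rewrite f0 q0.
rewrite e lim_seriesZ//.
apply: (series_dom_cvg (@psi_major_cvg _ q q_gt0 q_lt1 (Q ^+ n.+1) (z * Q ^+ n) (c * Q ^+ n * Q ^+ n))).
move=> k; have := @psi_gen_le _ q q_gt0 q_lt1 (Q ^+ n.+1) (z * Q ^+ n) (c * Q ^+ n * Q ^+ n) k
  (qpoch_oo q (Q ^+ n.+1 * Q ^+ k)) 1.
rewrite mul1r => h; apply: h; last by rewrite ler01 lexx.
apply: (le_trans (qpoch_oo_le q_gt0 q_lt1 _)); apply: qbound_mono => //.
rewrite normrM [`|Q ^+ k|]ger0_norm ?Qn_ge0// ler_piMr//; exact: Qn_le1.
Qed.

Lemma triangular n : Q ^+ 'C(n, 2) = \prod_(i < n) Q ^+ i.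
Proof.
elim: n => [|n IH]; first by rewrite big_ord0 expr0.
by rewrite binS bin1 QD big_ord_recr /= -IH.
Qed.

(** The exchange of P and X when they have the same sign. *)
Lemma psi_lim_swap_pos P X Y n : P != 0 -> Y != 0 -> X = P * Q ^+ n ->
  psi_lim (Q * P / Y) (Q * P / X) (- (Q ^+ 2 * P / (Y * X))) * qpoch_oo q (- X) =
  (-1) ^+ n * (Q / Y) ^+ n *
    (psi_lim (Q * X / Y) (Q * X / P) (- (Q ^+ 2 * X / (Y * P))) * qpoch_oo q (- P)).
Proof.
move=> P0 Y0 XE; have X0 : X != 0 by rewrite XE mulf_neq0.
rewrite {1}/psi_lim psi_lim_symm// -/(psi_lim _ _ _).
have -> : Q * P / X = Q / Q ^+ n by rewrite XE; field; rewrite P0 Qn0.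
rewrite psi_lim_shift.
set c1 := - (Q ^+ 2 * P / (Y * X)); have -> : c1 * Q ^+ n * Q ^+ n = - (Q ^+ 2 * X / (Y * P)).
  by rewrite /c1 XE; field; rewrite P0 Qn0 Y0.
have -> : Q * P / Y * Q ^+ n = Q * X / Y by rewrite XE; field; rewrite Y0.
have -> : Q ^+ n.+1 = Q * X / P by rewrite XE QS; field; rewrite P0.
rewrite {1}/psi_lim psi_lim_symm// -/(psi_lim _ _ _).
have -> : qpoch_oo q (- P) = qpoch q (- P) n * qpoch_oo q (- X).
  by rewrite (qpoch_ooD q_gt0 q_lt1 (- P) n) mulNr XE.
suff h : Q ^+ 'C(n, 2) * zpoch q (Q * P / Y) c1 n = (Q / Y) ^+ n * qpoch q (- P) n.
  transitivity ((-1) ^+ n * (Q ^+ 'C(n, 2) * zpoch q (Q * P / Y) c1 n) *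
    psi_lim (Q * X / Y) (Q * X / P) (- (Q ^+ 2 * X / (Y * P))) * qpoch_oo q (- X)).
    by ring.
  by rewrite h; ring.
have -> : Q ^+ 'C(n, 2) = \prod_(i < n) Q ^+ (n - i.+1).
  by rewrite triangular (reindex_inj rev_ord_inj).
rewrite /zpoch qpochE -big_split /=.
rewrite [RHS](_ : _ = \prod_(i < n) ((Q / Y) * (1 - - P * Q ^+ i))); last first.
  by rewrite big_split /= prodr_const card_ord.
rewrite [RHS](reindex_inj rev_ord_inj) /=; apply: eq_bigr => i _.
have : Q ^+ n = Q ^+ (n - i.+1) * Q ^+ i.+1 by rewrite -QD subnK.
rewrite /c1 XE QS => ->; move: (Qn0 (n - i.+1)) (Qn0 i) (Qn0 n) Q0.
move: (Q ^+ (n - i.+1)) (Q ^+ i) Q => A B S A0 B0 _ S0.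
by field; rewrite P0 Y0 A0 B0 S0.
Qed.

End PsiSwap.

(** * Exchange of arguments, opposite signs *)

Section Terminating.
Variables (R : realType) (q : R).
Hypotheses (q_gt0 : 0 < q) (q_lt1 : q < 1).
Local Notation Q := (q ^+ 2).
Local Notation t := (Q^-1).
Implicit Types P X Y : R.

Let Q0 : Q != 0. Proof. by rewrite expf_neq0// gt_eqF. Qed.
Let Qn0 n : Q ^+ n != 0. Proof. by rewrite expf_neq0. Qed.

Lemma t_neq1 n : 1 - t ^+ n.+1 != 0.
Proof.
rewrite exprVn subr_eq0 eq_sym invr_eq1 lt_eqF// exprn_ilt1 ?Q_lt1//.
by rewrite exprn_ge0// ltW.
Qed.

Definition term_sum (N : nat) X P : R :=
  \sum_(n < N.+1) gbin t N n * (X / P) ^+ n * \prod_(i < N - n) (1 + X * t ^+ i.+1).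

Lemma qpoch_oo_up X M : qpoch_oo q (- X * t ^+ M) =
  (\prod_(i < M) (1 + X * t ^+ i.+1)) * qpoch_oo q (- X).
Proof.
rewrite (qpoch_ooD q_gt0 q_lt1 _ M) -mulrA -exprMn mulVf// expr1n mulr1.
congr (_ * _); rewrite qpochE (reindex_inj rev_ord_inj) /=; apply: eq_bigr => i _.
have -> : t ^+ M = t ^+ (M - i.+1) * t ^+ i.+1 by rewrite -exprD subnK.
rewrite mulNr mulNr opprK; congr (1 + _).
have : t ^+ (M - i.+1) * Q ^+ (M - i.+1) = 1 by rewrite -exprMn mulVf// expr1n.
by move: (t ^+ _) (t ^+ _) (Q ^+ _) => A B S AS; rewrite -[RHS]mulr1 -AS; ring.
Qed.

Lemma psi_term_terminating N X P n : P != 0 -> (n <= N)%N ->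
  psi_term q (- X / Q ^+ N) (Q * X / P) (Q * X / (P * Q ^+ N)) n =
  qpoch_oo q (- X) *
    (gbin t N n * (X / P) ^+ n * \prod_(i < N - n) (1 + X * t ^+ i.+1)).
Proof.
move=> P0 nN; rewrite /psi_term.
have -> : - X / Q ^+ N * Q ^+ n = - X * t ^+ (N - n).
  have -> : Q ^+ N = Q ^+ (N - n) * Q ^+ n by rewrite -exprD subnK.
  rewrite exprVn; move: (Qn0 (N - n)) (Qn0 n).
  by move: (Q ^+ (N - n)) (Q ^+ n) => A B A0 B0; field; rewrite A0 B0.
rewrite qpoch_oo_up.
suff h : zpoch q (Q * X / P) (Q * X / (P * Q ^+ N)) n / gfact Q n *
    ((-1) ^+ n * Q ^+ 'C(n, 2)) = gbin t N n * (X / P) ^+ n.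
  transitivity (zpoch q (Q * X / P) (Q * X / (P * Q ^+ N)) n / gfact Q n *
    ((-1) ^+ n * Q ^+ 'C(n, 2)) *
    ((\prod_(i < N - n) (1 + X * t ^+ i.+1)) * qpoch_oo q (- X))); first by ring.
  by rewrite h; ring.
have fQ : gfact Q n != 0 by apply: gfact_neq0 => i; exact: Q_neq1.
have ft : gfact t n != 0 by apply: gfact_neq0; exact: t_neq1.
have e1 : zpoch q (Q * X / P) (Q * X / (P * Q ^+ N)) n = (X / P) ^+ n * Q ^+ n * gnum t N n.
  rewrite /zpoch /gnum -exprMn -[n in X in _ = X * _]card_ord -prodr_const -big_split /=.
  apply: eq_bigr => i _.
  have iN : (i <= N)%N by rewrite (leq_trans _ nN)// ltnW.
  have -> : Q ^+ N = Q ^+ (N - i) * Q ^+ i by rewrite -exprD subnK.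
  rewrite exprVn; move: (Qn0 (N - i)) (Qn0 i).
  by move: (Q ^+ (N - i)) (Q ^+ i) Q => A B S A0 B0; field; rewrite A0 B0 P0.
have e2 : gfact Q n = (-1) ^+ n * Q ^+ 'C(n, 2) * Q ^+ n * gfact t n.
  rewrite triangular /gfact -[n in (-1) ^+ n]card_ord -prodr_const.
  rewrite -[n in Q ^+ n]card_ord -prodr_const -!big_split /=.
  apply: eq_bigr => i _; rewrite exprVn exprS; move: (Qn0 i) Q0.
  by move: (Q ^+ i) Q => A B A0 B0; field; rewrite A0 B0.
have s1 : (-1) ^+ n * (-1) ^+ n = 1 :> R by rewrite -exprMn mulrNN mulr1 expr1n.
rewrite /gbin e1 e2; move: (Qn0 n) (Qn0 'C(n, 2)) ft s1.
move: (Q ^+ n) (Q ^+ 'C(n, 2)) (gfact t n) ((-1) ^+ n) (gnum t N n) ((X / P) ^+ n).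
move=> A B C D F G A0 B0 C0 DD.
have D0 : D != 0 by apply/eqP => D0; move: DD; rewrite D0 mul0r => /esym/eqP; rewrite oner_eq0.
by field; rewrite A0 B0 C0 D0.
Qed.

Lemma psi_lim_terminating N X P : P != 0 ->
  psi_lim q (- X / Q ^+ N) (Q * X / P) (Q * X / (P * Q ^+ N)) =
  qpoch_oo q (- X) * term_sum N X P.
Proof.
move=> P0; rewrite /psi_lim (@finite_series_lim _ _ N.+1).
  rewrite /term_sum mulr_sumr; apply: eq_bigr => n _.
  by apply: psi_term_terminating => //; rewrite -ltnS.
move=> n Nn; rewrite /psi_term /zpoch (bigD1 (Ordinal Nn))//=.
have -> : Q * X / P - Q * X / (P * Q ^+ N) * Q ^+ N = 0.
  by move: (Qn0 N); move: (Q ^+ N) => A A0; field; rewrite A0 P0.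
by rewrite !mul0r.
Qed.

Lemma term_sum_symm N X P : X != 0 -> P != 0 ->
  P ^+ N * term_sum N X P = X ^+ N * term_sum N P X.
Proof.
pose S U W := \sum_(n < N.+1) gbin t N n * (\prod_(i < n) (U - (- (X * P * t)) * t ^+ i)) * W ^+ (N - n).
suff key U W : U != 0 -> W != 0 -> U * W = X * P -> U ^+ N * term_sum N W U = S U W.
  move=> X0 P0; rewrite (key P X P0 X0 (mulrC _ _)) (key X P X0 P0 erefl) /S.
  have := (symsum_symm t_neq1 0 N X P (- (X * P * t))).1.
  rewrite !symsum0E => /mulfI; apply.
  by rewrite mulf_neq0 ?expf_neq0 ?oppr_eq0 ?oner_eq0 ?invr_neq0.
move=> U0 W0 UW; rewrite /term_sum mulr_sumr (reindex_inj rev_ord_inj) /=.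
apply: eq_bigr => n _; rewrite subSS; have nN : (n <= N)%N by rewrite -ltnS.
rewrite subKn// (gbin_sub t_neq1)//.
have -> : U ^+ N = U ^+ n * U ^+ (N - n) by rewrite -exprD subnKC.
have -> : \prod_(i < n) (U - - (X * P * t) * t ^+ i) =
    U ^+ n * \prod_(i < n) (1 + W * t ^+ i.+1).
  rewrite -[n in U ^+ n]card_ord -prodr_const -big_split /=; apply: eq_bigr => i _.
  by rewrite -UW (exprS t); ring.
have -> : (W / U) ^+ (N - n) = W ^+ (N - n) / U ^+ (N - n) by rewrite expr_div_n.
by field; rewrite expf_neq0.
Qed.

(** The exchange of P and X when Y = - Q^(N + 1): the series terminates. *)
Lemma psi_lim_swap_neg N P X : P != 0 -> X != 0 ->
  P ^+ N * (psi_lim q (- X / Q ^+ N) (Q * X / P) (Q * X / (P * Q ^+ N)) * qpoch_oo q (- P)) =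
  X ^+ N * (psi_lim q (- P / Q ^+ N) (Q * P / X) (Q * P / (X * Q ^+ N)) * qpoch_oo q (- X)).
Proof.
move=> P0 X0; rewrite !psi_lim_terminating//.
have := term_sum_symm N X0 P0.
move: (term_sum N X P) (term_sum N P X) (qpoch_oo _ (- X)) (qpoch_oo _ (- P)) => a b c d h.
transitivity (c * d * (P ^+ N * a)); first by ring.
by rewrite h; ring.
Qed.

End Terminating.

(** * The exchange relation for a_p *)

Section Exchange.
Variables (R : realType) (q : R).
Hypotheses (q_gt0 : 0 < q) (q_lt1 : q < 1).
Local Notation Q := (q ^+ 2).

Lemma Iq_abs (p : Iq q) : `|Iq_val p| = q ^ (chi q (Iq_val p)).
Proof.
have [k hk] : exists k : int, `|Iq_val p| = q ^ k.
  have := svalP p; rewrite inE /Iq_val => -[[k _ ->]|[k ->]].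
    by exists k; rewrite normrN normrX gtr0_norm.
  by exists k; rewrite gtr0_norm// qz_gt0.
by rewrite (chi_abs q_gt0 q_lt1 hk).
Qed.

Lemma Iq_neq0 (p : Iq q) : Iq_val p != 0.
Proof. by rewrite -normr_gt0 Iq_abs qz_gt0. Qed.

Lemma Iq_neg (p : Iq q) : Iq_val p < 0 ->
  exists N : nat, Iq_val p = - q ^+ N.+1.
Proof.
have := svalP p; rewrite inE /Iq_val => -[[[//|k] _ ->]|[k ->]].
  by exists k.
by rewrite ltNge (ltW (qz_gt0 _ _)).
Qed.

Lemma Iq_kappa_lt1 (p : Iq q) : - kappa (Iq_val p) < 1.
Proof.
have [p0|p0|p0] := ltgtP (Iq_val p) 0; last by move: (Iq_neq0 p); rewrite p0 eqxx.
- have [N ->] := Iq_neg p0.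
  rewrite /kappa ltr0_sg ?oppr_lt0 ?exprn_gt0// mulN1r opprK sqrrN -exprM.
  by rewrite exprn_ilt1// ltW.
- by rewrite /kappa gtr0_sg// mul1r (le_lt_trans _ ltr01)// oppr_le0 sqr_ge0.
Qed.

Lemma kappa_div (x y : R) : kappa (x / y) = kappa x / kappa y.
Proof.
by rewrite /kappa sgrM sgrV expr_div_n -{1}(invr_sg y) mulrACA -invfM.
Qed.

Lemma kappa_neq0 (x : R) : x != 0 -> kappa x != 0.
Proof. by move=> x0; rewrite /kappa mulf_neq0 ?sgr_eq0 ?expf_neq0. Qed.

Lemma Psi_psi_lim (x y p : R) : x != 0 -> y != 0 -> p != 0 ->
  Psi q (- Q / kappa y) (Q * kappa (x / y)) (Q * kappa (x / p)) =
  psi_lim q (Q * kappa x / kappa y) (Q * kappa x / kappa p)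
    (- (Q ^+ 2 * kappa x / (kappa y * kappa p))).
Proof.
move=> /kappa_neq0 x0 /kappa_neq0 y0 /kappa_neq0 p0.
rewrite Psi_psi_term !kappa_div.
have -> : - Q / kappa y * (Q * (kappa x / kappa p)) =
    - (Q ^+ 2 * kappa x / (kappa y * kappa p)).
  by move: (kappa x) (kappa y) (kappa p) Q y0 p0 => X Y P A y0 p0; field; rewrite y0 p0.
by rewrite -!(mulrA Q).
Qed.

Lemma psi_exchange_pos P X Y (i : int) : P != 0 -> Y != 0 -> X = P * Q ^ i ->
  psi_lim q (Q * X / Y) (Q * X / P) (- (Q ^+ 2 * X / (Y * P))) * qpoch_oo q (- P) =
  (-1) ^ i * (Y / Q) ^ i *
  (psi_lim q (Q * P / Y) (Q * P / X) (- (Q ^+ 2 * P / (Y * X))) * qpoch_oo q (- X)).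
Proof.
have Q0 : Q != 0 by rewrite expf_neq0// gt_eqF.
have ss n : (-1) ^+ n * (-1) ^+ n = 1 :> R by rewrite -exprMn mulrNN mulr1 expr1n.
move=> P0 Y0; case: (intP i) => [|n|n] XE.
- rewrite !expr0z !mul1r; have -> : X = P by rewrite XE expr0z mulr1.
  by [].
- rewrite (psi_lim_swap_pos q_gt0 q_lt1 P0 Y0 XE).
  rewrite -!exprnP !expr_div_n; move: (ss n.+1) (expf_neq0 n.+1 Q0) (expf_neq0 n.+1 Y0).
  move: ((-1) ^+ n.+1) (Q ^+ n.+1) (Y ^+ n.+1) (psi_lim _ _ _ _ * _) => s A B C s1 A0 B0.
  by transitivity (s * s * C); [rewrite s1 mul1r|field; rewrite A0 B0].
- have X0 : X != 0 by rewrite XE mulf_neq0// expfz_neq0.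
  have PE : P = X * Q ^+ n.+1.
    by rewrite XE -invr_expz -exprnP -mulrA mulVf ?mulr1// expf_neq0.
  rewrite (psi_lim_swap_pos q_gt0 q_lt1 X0 Y0 PE).
  have -> : (-1) ^ (- n.+1%:Z) = (-1) ^+ n.+1 :> R by rewrite -invr_expz -exprnP -exprVn invrN1.
  have -> : (Y / Q) ^ (- n.+1%:Z) = (Q / Y) ^+ n.+1 by rewrite -invr_expz -exprnP -exprVn invf_div.
  by [].
Qed.

(** The exchange relation between the matrix coefficients a_p(x, y) and a_x(p, y). *)
Lemma a_swap (p x y : Iq q) :
  a_ q (Iq_val p) (Iq_val x) (Iq_val y) =
  (-1) ^ (chi q (Iq_val x) + chi q (Iq_val p)) *
  (Num.sg (Iq_val y)) ^ (chi q (Iq_val y)) * (`|Iq_val x| / `|Iq_val p|) *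
  a_ q (Iq_val x) (Iq_val p) (Iq_val y).
Proof.
have [p0 x0 y0] : [/\ Iq_val p != 0, Iq_val x != 0 & Iq_val y != 0].
  by split; exact: Iq_neq0.
have [Dp Dx Dy] : [/\ 0 < qpoch_oo q (- kappa (Iq_val p)),
    0 < qpoch_oo q (- kappa (Iq_val x)) & 0 < qpoch_oo q (- kappa (Iq_val y))].
  by split; apply: qpoch_oo_gt0 => //; exact: Iq_kappa_lt1.
have [[ap ax] ay] := (Iq_abs p, Iq_abs x, Iq_abs y).
have yneg := @Iq_neg y.
move: (Iq_val p) (Iq_val x) (Iq_val y) p0 x0 y0 Dp Dx Dy ap ax ay yneg => {}p {}x {}y.
move=> p0 x0 y0 Dp Dx Dy ap ax ay yneg.
rewrite /a_ !sgrM.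
have sgc : (Num.sg x * Num.sg y != Num.sg p) = (Num.sg p * Num.sg y != Num.sg x).
  congr (~~ _); have : Num.sg y * Num.sg y = 1 by rewrite -expr2 sqr_sg y0.
  by move=> yy; apply/eqP/eqP => <-; rewrite -mulrA yy mulr1.
rewrite -sgc; case: ifPn => [_|]; first by rewrite mulr0.
rewrite negbK => /eqP sp.
set kp := chi q p; set kx := chi q x; set ky := chi q y.
have qn0 : q != 0 by rewrite gt_eqF.
have nuE : nu_q q (x * y / p) = nu_q q (p * y / x) * q ^ ((kx - kp) * (2 * ky - 3)).
  apply: nu_q_swap => //; rewrite !normrM normfV ax ap ay.
    by rewrite invr_expz -!(expfzDr _ _ qn0); congr (q ^ _); rewrite -/kx -/kp -/ky; ring.
  by rewrite invr_expz -!(expfzDr _ _ qn0); congr (q ^ _); rewrite -/kx -/kp -/ky; ring.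
rewrite nuE !Psi_psi_lim//.
set Psi1 := psi_lim _ _ _ _; set Psi2 := psi_lim _ _ _ _.
set S := Num.sqrt (qpoch_oo q (- kappa y) / (qpoch_oo q (- kappa p) * qpoch_oo q (- kappa x))).
have sqrtE A B C : 0 < A -> 0 < B -> 0 < C ->
    Num.sqrt (A * B / C) = A * Num.sqrt (B / (A * C)).
  move=> A0 B0 C0; rewrite -{2}(ger0_norm (ltW A0)) -sqrtr_sqr -sqrtrM ?sqr_ge0//.
  by congr Num.sqrt; field; rewrite !gt_eqF.
rewrite !sqrtE// -/S [qpoch_oo q (- kappa x) * qpoch_oo q (- kappa p)]mulrC -/S.
have sq : (-1) ^ (kx + kp) = (-1) ^ kx * (-1) ^ kp :> R by rewrite expfzDr// oppr_eq0 oner_eq0.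
have s2 k : (-1) ^ k * (-1) ^ k = 1 :> R by rewrite -expfzMl mulrNN mulr1 exp1rz.
suff core : sgnxy x y * (- Num.sg y) ^ kx * (Psi1 * qpoch_oo q (- kappa p)) =
    (Num.sg y) ^ ky * (`|x| / `|p|) * q ^ ((kx - kp) * (2 * ky - 3)) * sgnxy p y *
    (- Num.sg y) ^ kp * (Psi2 * qpoch_oo q (- kappa x)).
  rewrite sq; move: core (s2 kx).
  move: (sgnxy x y) (sgnxy p y) ((- Num.sg y) ^ kx) ((- Num.sg y) ^ kp) (Num.sg y ^ ky).
  move: (c_q q) ((-1) ^ kp) ((-1) ^ kx) (nu_q q _) (q ^ _) (qpoch_oo q (- kappa p))
    (qpoch_oo q (- kappa x)) S Psi1 Psi2 (`|y|) (`|x| / `|p|).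
  move=> c n m nu e D1 D2 {}S {}Psi1 {}Psi2 Y r s1 s3 a b g core ss.
  transitivity (c * n * Y * nu * S * (s1 * a * (Psi1 * D1))); first by ring.
  rewrite core; transitivity (m * m * (c * n * Y * nu * S * (g * r * e * s3 * b * (Psi2 * D2)))).
    by rewrite ss mul1r.
  by ring.
have -> : `|x| / `|p| = q ^ (kx - kp) by rewrite ax ap invr_expz -expfzDr ?gt_eqF.
have kabs u : kappa u = Num.sg u * `|u| ^+ 2.
  by rewrite /kappa real_normK// num_real.
have Qz (k : int) : (q ^ k) ^+ 2 = Q ^ k.
  by rewrite !exprnP !exprz_exp mulrC.
have [yn|yp|yE] := ltgtP y 0; last by move: y0; rewrite yE eqxx.
- have [N yN] := yneg yn.
  have kyN : ky = N.+1 by apply: chi_abs; rewrite // yN normrN normrX gtr0_norm.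
  have sgy : Num.sg y = -1 by rewrite ltr0_sg.
  have kY : kappa y = - Q ^+ N.+1.
    by rewrite /kappa sgy mulN1r yN sqrrN -!exprM mulnC.
  have Q0 : Q != 0 by rewrite expf_neq0// gt_eqF.
  have sxp : sgnxy x y = - sgnxy p y.
    rewrite /sgnxy yn !andbT; move: sp; rewrite sgy mulrN1.
    have [xn|xp|xE] := ltgtP x 0; last by move: x0; rewrite xE eqxx.
      rewrite ltr0_sg// opprK => /esym/eqP; rewrite sgr_cp0 => ->.
      by rewrite opprK.
    rewrite gtr0_sg// => /esym/eqP; rewrite sgr_cp0 => pn.
    by rewrite ltNge (ltW pn).
  have XP : kappa x = - kappa p * Q ^ (kx - kp).
    rewrite !kabs ax ap !Qz -sp sgy expfzDr// -invr_expz; move: (expfz_neq0 kp Q0).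
    by move: (Q ^ kp) (Q ^ kx) => A B A0; field.
  have := psi_lim_swap_neg q_gt0 q_lt1 N (kappa_neq0 p0) (kappa_neq0 x0).
  have e1 : - kappa x / Q ^+ N = Q * kappa x / kappa y.
    by rewrite kY (exprS Q N); move: (expf_neq0 N Q0) (Q0); move: (Q ^+ N) (Q) => A B A0 B0; field; rewrite A0 B0.
  have e1' : - kappa p / Q ^+ N = Q * kappa p / kappa y.
    by rewrite kY (exprS Q N); move: (expf_neq0 N Q0) (Q0); move: (Q ^+ N) (Q) => A B A0 B0; field; rewrite A0 B0.
  have e2 : Q * kappa x / (kappa p * Q ^+ N) = - (Q ^+ 2 * kappa x / (kappa y * kappa p)).
    rewrite kY (exprS Q N); move: (expf_neq0 N Q0) (Q0) (kappa_neq0 p0).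
    by move: (Q) (Q ^+ N) (kappa p) => B A C A0 B0 C0; field; rewrite A0 B0 C0.
  have e2' : Q * kappa p / (kappa x * Q ^+ N) = - (Q ^+ 2 * kappa p / (kappa y * kappa x)).
    rewrite kY (exprS Q N); move: (expf_neq0 N Q0) (Q0) (kappa_neq0 x0).
    by move: (Q) (Q ^+ N) (kappa x) => B A C A0 B0 C0; field; rewrite A0 B0 C0.
  rewrite e1 e1' e2 e2' -/Psi1 -/Psi2 => h.
  have h2 : Psi1 * qpoch_oo q (- kappa p) =
     (-1) ^+ N * (Q ^ (kx - kp)) ^+ N * (Psi2 * qpoch_oo q (- kappa x)).
    apply: (mulfI (expf_neq0 N (kappa_neq0 p0))); rewrite h XP mulNr.
    rewrite -[- (kappa p * _)]mulN1r !exprMn; move: (kappa p ^+ N) (Psi2 * _) => A B.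
    by move: ((Q ^ _) ^+ N) ((-1) ^+ N) => C D; ring.
  rewrite h2 sgy opprK !exp1rz kyN sxp -exprnP (exprS (-1)).
  have -> : (Q ^ (kx - kp)) ^+ N = q ^ (kx - kp) * q ^ ((kx - kp) * (2 * N.+1%:Z - 3)).
    rewrite -expfzDr ?gt_eqF// !exprnP !exprz_exp; congr (q ^ _).
    by rewrite -(addn1 N) PoszD; ring.
  move: (Psi2 * _) (sgnxy p y) ((-1) ^+ N) (q ^ (kx - kp)) (q ^ (_ * _)) => A B C D E.
  by ring.
- have sgy : Num.sg y = 1 by rewrite gtr0_sg.
  have kY : kappa y = Q ^ ky by rewrite kabs sgy mul1r ay Qz.
  have Q0 : Q != 0 by rewrite expf_neq0// gt_eqF.
  have XP : kappa x = kappa p * Q ^ (kx - kp).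
    rewrite !kabs ax ap !Qz -sp sgy mulr1 expfzDr// -invr_expz; move: (expfz_neq0 kp Q0).
    by move: (Q ^ kp) (Q ^ kx) => A B A0; field.
  rewrite /Psi1 (psi_exchange_pos (kappa_neq0 p0) (kappa_neq0 y0) XP) -/Psi2.
  rewrite sgy exp1rz mul1r /sgnxy !ltNge !(ltW yp) !andbF !mul1r mulr1.
  have -> : (kappa y / Q) ^ (kx - kp) = q ^ (kx - kp) * q ^ ((kx - kp) * (2 * ky - 3)).
    rewrite kY -expfzDr ?gt_eqF// -{2}[Q]expr1z invr_expz -expfzDr// !exprnP !exprz_exp.
    by congr (q ^ _); ring.
  have -> : (-1) ^ kx = (-1) ^ (kx - kp) * (-1) ^ kp :> R.
    by rewrite -expfzDr ?subrK// oppr_eq0 oner_eq0.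
  move: (s2 (kx - kp)); move: (Psi2 * _) ((-1) ^ (kx - kp)) ((-1) ^ kp).
  move: (q ^ (kx - kp)) (q ^ (_ * _)) => A B C D E DD.
  transitivity (D * D * (A * B * E * C)); first by ring.
  by rewrite DD; ring.
Qed.

End Exchange.

(** * The counting measure on I_q *)

Section DiscretePart.
Variables (R : realType) (q : R).
Hypotheses (q_gt0 : 0 < q) (q_lt1 : q < 1).
Local Notation I := (Iq q).

Lemma counting_set1 (p : I) : counting_Iq q [set p] = 1%E.
Proof.
rewrite /counting_Iq /counting /= asboolT; last exact: finite_set1.
by rewrite fset_set1 finmap.cardfs1.
Qed.

Lemma cmeasurable_Iq (f : I -> R[i]) : cmeasurable f.
Proof. by split. Qed.

Lemma integral_single (f : I -> \bar R) (p : I) : (forall x, x != p -> f x = 0%E) ->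
  (\int[mu_I q]_x f x = f p)%E.
Proof.
move=> f0; transitivity (\int[mu_I q]_(x in [set p]) f x)%E.
  rewrite [RHS]integral_mkcond; apply: eq_integral => x _.
  rewrite patchE; case: ifPn => // xp; apply: f0; apply: contraNN xp => /eqP ->.
  by rewrite inE.
rewrite (@eq_integral _ _ _ _ _ (cst (f p))); last by move=> x; rewrite inE => ->.
by rewrite integral_cst// [X in (_ * X)%E]counting_set1 mule1.
Qed.

Lemma ae_Iq (P : I -> Prop) : {ae mu_I q, forall x, P x} -> forall x, P x.
Proof.
move=> [A [mA A0 PA]] x; apply: contrapT => nP.
have : (mu_I q [set x] <= mu_I q A)%E.
  by apply: le_measure; rewrite ?inE// => y ->; exact: PA.
by rewrite [mu_I q [set x]]counting_set1 [mu_I q A]A0 lee_fin ler10.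
Qed.

Lemma cint_single (f : I -> R[i]) (p : I) : (forall x, x != p -> f x = 0) ->
  cintegrable (mu_I q) f /\ cint (mu_I q) f = f p.
Proof.
move=> f0; split.
  split; apply/integrableP; split => //; rewrite (@integral_single _ p) ?ltry//;
  by move=> x /f0 /= ->; rewrite normr0.
by apply: eq_ReIm; rewrite /cint /= /Rintegral (@integral_single _ p)// => x /f0 ->.
Qed.

Lemma L2_delta (p : I) : L2 (mu_I q) (delta p).
Proof.
split; first exact: cmeasurable_Iq.
rewrite (@integral_single _ p) ?ltry// => x xp.
by rewrite /delta (negbTE xp) /normsq /= expr0n addr0.
Qed.

Lemma inner_delta_r (f : I -> R[i]) (p : I) : inner (mu_I q) f (delta p) = f p.
Proof.
rewrite innerE (@cint_single _ p _).2 /delta ?eqxx ?cj1 ?mulr1// => x xp.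
by rewrite (negbTE xp) cj0 mulr0.
Qed.

Lemma onb_delta : onb (mu_I q) (@delta R q).
Proof.
split; first exact: L2_delta.
  by move=> p r; rewrite inner_delta_r /delta eq_sym.
move=> g lg g0; apply: aeW => x; rewrite -(inner_delta_r g x) => _; exact: g0.
Qed.

Definition Iq_pow (k : int) : I :=
  exist (fun x : R => x \in Iq_set q) (q ^ k)
    (mem_set (or_intror (ex_intro _ k erefl) : Iq_set q (q ^ k))).

Fact Iq_npow_subproof (k : nat) : - q ^+ k.+1 \in Iq_set q.
Proof. by apply/mem_set; left; exists k.+1. Qed.

Definition Iq_npow (k : nat) : I :=
  exist (fun x : R => x \in Iq_set q) (- q ^+ k.+1) (Iq_npow_subproof k).

Lemma Iq_pow_inj : injective Iq_pow.
Proof.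
move=> j k /(congr1 (@Iq_val _ _)); rewrite /Iq_val /= => jk.
by rewrite -(@chi_abs _ _ q_gt0 q_lt1 (q ^ j) j) ?gtr0_norm ?qz_gt0// jk;
  apply: chi_abs; rewrite ?gtr0_norm ?qz_gt0.
Qed.

Lemma Iq_npow_inj : injective Iq_npow.
Proof.
move=> j k /(congr1 (@Iq_val _ _)); rewrite /Iq_val /= => /oppr_inj jk.
have := @Iq_pow_inj j.+1 k.+1; rewrite (_ : Iq_pow j.+1 = Iq_pow k.+1).
  by move=> /(_ erefl) [].
by apply: val_inj; rewrite /= -!exprnP.
Qed.

Lemma Iq_cases (p : I) : (exists k : nat, p = Iq_npow k) \/ (exists k : int, p = Iq_pow k).
Proof.
have := svalP p; rewrite inE => -[[[//|k] _ e]|[k e]].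
- by left; exists k; apply: val_inj.
- by right; exists k; apply: val_inj.
Qed.

(** An enumeration of I_q and its inverse. *)
Lemma Iq_enumeration : exists (e : nat -> I) (c : I -> nat), cancel e c /\ cancel c e.
Proof.
have [c cinj] : exists c : I -> nat, injective c.
  pose c (p : I) := pickle (Iq_val p < 0, chi q (Iq_val p)).
  exists c => p r /(pcan_inj pickleK) [sg ch].
  have ab : `|Iq_val p| = `|Iq_val r| by rewrite !Iq_abs// ch.
  apply: val_inj; rewrite -[LHS]/(Iq_val p) -[RHS]/(Iq_val r).
  move: ab sg; have [p0|p0] := ltP (Iq_val p) 0; have [r0|r0] := ltP (Iq_val r) 0 => //.
    by rewrite !ltr0_norm// => /oppr_inj.
  by rewrite !ger0_norm.
have cI : countable [set: I] by apply/countable_injP; exists c => x y _ _; exact: cinj.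
have iI : infinite_set [set: I].
  move=> fI; apply: infinite_nat; rewrite -(preimage_setT (fun n : nat => Iq_pow n)).
  by apply: finite_preimage fI => j k _ _ /Iq_pow_inj [].
have /card_set_bijP[e [_ einj esurj]] : ([set: nat] #= [set: I])%card.
  by rewrite card_eq_sym; exact: eq_card_nat.
have ex p : exists n, e n = p by have [n _ <-] := esurj p Logic.I; exists n.
exists e, (fun p => projT1 (cid (ex p))); split => [n|p]; last by case: cid.
by case: cid => m /= /einj; apply; rewrite inE.
Qed.

Lemma integral_Iq_esum (f : I -> \bar R) : (forall x, 0 <= f x)%E ->
  (\int[mu_I q]_x f x = \esum_(x in [set: I]) f x)%E.
Proof.
move=> f0; have [e [c [ec ce]]] := Iq_enumeration.
have bij : set_bij [set: nat] [set: I] e.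
  by split=> // [m n _ _ /(can_inj ec)|p _ /=] //; exists (c p).
rewrite (reindex_esum _ _ _ _ bij) -nneseries_esumT//.
have -> : [set: I] = \bigcup_n [set e n].
  by apply/seteqP; split => // p _; exists (c p).
rewrite ge0_integral_bigcup//.
  apply: eq_eseriesr => n _.
  rewrite (@eq_integral _ _ _ _ _ (cst (f (e n)))); last by move=> x; rewrite inE => ->.
  by rewrite integral_cst// [X in (_ * X)%E]counting_set1 mule1.
by apply/trivIsetP => i j _ _ ij; apply/seteqP; split => // x [/= -> /(can_inj ec) ji];
  move: ij; rewrite ji eqxx.
Qed.

Lemma nneseries_lty (u : nat -> R) : (forall n, 0 <= u n) -> cvgn (series u) ->
  (\sum_(0 <= n <oo) (u n)%:E = (limn (series u))%:E)%E.
Proof.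
move=> u0 cu; rewrite -EFin_lim//; congr (limn _); apply/funext => n /=.
by rewrite /series /= sumEFin.
Qed.

Lemma esum_Iq_lty (h : I -> R) : (forall x, 0 <= h x) ->
  cvgn (series (fun k : nat => h (Iq_npow k))) ->
  cvgn (series (fun k : nat => h (Iq_pow k))) ->
  cvgn (series (fun k : nat => h (Iq_pow (- k.+1%:Z)))) ->
  (\esum_(x in [set: I]) (h x)%:E < +oo)%E.
Proof.
move=> h0 c1 c2 c3; pose f x := (h x)%:E.
have f0 x : (0 <= f x)%E by rewrite lee_fin.
have fin (g : nat -> I) : injective g -> cvgn (series (fun k => h (g k))) ->
    (\esum_(x in range g) f x < +oo)%E.
  move=> ginj cg; rewrite esum_image; last by move=> i j _ _; exact: ginj.
  by rewrite -nneseries_esumT// nneseries_lty ?ltry.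
have sub A B : A `<=` B -> (\esum_(x in A) f x <= \esum_(x in B) f x)%E.
  move=> AB; rewrite esum_mkcond [leRHS]esum_mkcond; apply: le_esum => x _.
  by case: ifPn => [|_]; [rewrite inE => /AB xB; rewrite mem_set|case: ifP].
change (\esum_(x in [set: I]) f x < +oo)%E.
rewrite (esumID (range Iq_npow))// !setTI lte_add_pinfty//; first exact: fin Iq_npow_inj _.
have i1 : injective (fun k : nat => Iq_pow k) by move=> j k /Iq_pow_inj [].
have i2 : injective (fun k : nat => Iq_pow (- k.+1%:Z)) by move=> j k /Iq_pow_inj /oppr_inj [].
rewrite (esumID (range (fun k : nat => Iq_pow k)))// lte_add_pinfty//.
  by apply: le_lt_trans (fin _ i1 c2); apply: (sub _ _) => x [].
apply: le_lt_trans (fin _ i2 c3); apply: sub => x [] nx1 nx2.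
have [[k ke]|[[k|k] ke]] := Iq_cases x.
- by case: nx1; exists k.
- by case: nx2; exists k.
- by exists k => //; rewrite ke NegzE.
Qed.

End DiscretePart.

(** * Square summability of a_p *)

Section Summability.
Variables (R : realType) (q : R).
Hypotheses (q_gt0 : 0 < q) (q_lt1 : q < 1).
Local Notation Q := (q ^+ 2).
Local Notation I := (Iq q).

Definition psi_bound (B Z C : R) : R := limn (series (psi_major q B Z C)).

Lemma psi_lim_le (b z c B Z C : R) : `|b| <= B -> `|z| <= Z -> `|c| <= C ->
  `|psi_lim q b z c| <= psi_bound B Z C.
Proof.
move=> bB zZ cC.
have h : 0 < 1 - Q by rewrite subr_gt0 Q_lt1.
have le n : `|psi_term q b z c n| <= psi_major q B Z C n.
  have w : `|qpoch_oo q (b * Q ^+ n)| <= qbound q b.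
    apply: (le_trans (qpoch_oo_le _ _ _)) => //; apply: qbound_mono => //.
    by rewrite normrM [`|Q ^+ n|]ger0_norm ?Qn_ge0// ler_piMr ?Qn_le1.
  have := psi_gen_le q_gt0 q_lt1 z c n w (g := 1).
  rewrite ler01 lexx mul1r => /(_ isT); rewrite -/(psi_term q b z c n) => /le_trans; apply.
  apply: ler_pM; [exact: expR_ge0| |by apply: qbound_mono => //; rewrite [leRHS]ger0_norm// (le_trans _ bB)|].
    apply: mulr_ge0; [apply: exprn_ge0; apply: divr_ge0; [exact: addr_ge0|exact: ltW]|exact: Qn_ge0].
  rewrite ler_wpM2r ?Qn_ge0//.
  have Z0 : 0 <= Z by apply: le_trans zZ.
  have C0 : 0 <= C by apply: le_trans cC.
  apply: lerXn2r; rewrite ?nnegrE.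
  - by apply: divr_ge0; [exact: addr_ge0|exact: ltW].
  - by apply: divr_ge0; [exact: addr_ge0|exact: ltW].
  - apply: ler_wpM2r; first by rewrite invr_ge0 ltW.
    by rewrite (ger0_norm Z0) (ger0_norm C0) lerD.
have := series_dom_tail 0 (@psi_major_cvg _ _ q_gt0 q_lt1 B Z C) le.
by rewrite /series /= !big_geq// !subr0.
Qed.

Lemma qpoch_oo_anti a b : a <= b -> b < 1 -> qpoch_oo q b <= qpoch_oo q a.
Proof.
move=> ab b1; apply: (@ler_cvg_to _ \oo _ _ (qpoch q b) (qpoch q a)).
- exact: qpoch_cvg.
- exact: qpoch_cvg.
apply: nearW => k; rewrite !qpochE; apply: ler_prod => i _.
have Qi := Qn_ge0 q_gt0 i; have Qi1 := Qn_le1 q_gt0 q_lt1 i.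
rewrite subr_ge0 lerD2l lerN2 ler_wpM2r// andbT.
have [b0|b0] := leP 0 b; last by rewrite (le_trans _ ler01)// mulr_le0_ge0// ltW.
by rewrite (le_trans _ (ltW b1))// ler_piMr.
Qed.

Lemma Iq_kappa_leQ (p : I) : - kappa (Iq_val p) <= Q.
Proof.
have [p0|p0|p0] := ltgtP (Iq_val p) 0; last by move: (Iq_neq0 q_gt0 q_lt1 p); rewrite p0 eqxx.
- have [N ->] := Iq_neg q_gt0 p0.
  rewrite /kappa ltr0_sg ?oppr_lt0 ?exprn_gt0// mulN1r opprK sqrrN -exprM.
  by rewrite mulnC exprM (exprS Q) ler_piMr ?Qn_le1// ltW// Q_gt0.
- by rewrite /kappa gtr0_sg// mul1r (le_trans _ (ltW (Q_gt0 q_gt0)))// oppr_le0 sqr_ge0.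
Qed.

Lemma norm_kappa (u : R) : u != 0 -> `|kappa u| = u ^+ 2.
Proof. by move=> u0; rewrite /kappa normrM normr_sg u0 mul1r ger0_norm ?sqr_ge0. Qed.

Lemma sqr_signz (k : int) (e : R) : e ^+ 2 = 1 -> (e ^ k) ^+ 2 = 1.
Proof.
move=> e2; have -> : (e ^ k) ^+ 2 = (e ^+ 2) ^ k by rewrite !exprnP !exprz_exp mulrC.
by rewrite e2 exp1rz.
Qed.

Let D u := qpoch_oo q (- kappa u).

Lemma a_sqr_le (p x y : I) (B Z C : R) :
  Q * Iq_val x ^+ 2 / Iq_val y ^+ 2 <= B -> Q * Iq_val x ^+ 2 / Iq_val p ^+ 2 <= Z ->
  Q ^+ 2 * Iq_val x ^+ 2 / (Iq_val y ^+ 2 * Iq_val p ^+ 2) <= C ->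
  a_ q (Iq_val p) (Iq_val x) (Iq_val y) ^+ 2 <=
  (c_q q * psi_bound B Z C) ^+ 2 / qpoch_oo q Q *
    (Iq_val y ^+ 2 * nu_q q (Iq_val p * Iq_val y / Iq_val x) ^+ 2 * (D (Iq_val p) * D (Iq_val y))).
Proof.
have Dpos (u : I) : 0 < D (Iq_val u) by apply: qpoch_oo_gt0 => //; exact: Iq_kappa_lt1.
have dpos : 0 < qpoch_oo q Q by apply: qpoch_oo_gt0 => //; exact: Q_lt1.
have := qpoch_oo_anti (Iq_kappa_leQ x) (Q_lt1 q_gt0 q_lt1); rewrite -/(D _) => dD.
have := (Dpos p, Dpos x, Dpos y, Iq_neq0 q_gt0 q_lt1 p, Iq_neq0 q_gt0 q_lt1 x, Iq_neq0 q_gt0 q_lt1 y).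
move: dD; move: (Iq_val p) (Iq_val x) (Iq_val y) => {}p {}x {}y dD [[[[[Dp Dx] Dy] p0] x0] y0].
move=> hB hZ hC; rewrite /a_; case: ifPn => [_|_].
  rewrite expr0n mulr_ge0//; first by rewrite divr_ge0 ?sqr_ge0// ltW.
  by rewrite mulr_ge0 ?(mulr_ge0 (ltW Dp) (ltW Dy))// mulr_ge0 ?sqr_ge0.
rewrite Psi_psi_lim//.
have psiM : `|psi_lim q (Q * kappa x / kappa y) (Q * kappa x / kappa p)
  (- (Q ^+ 2 * kappa x / (kappa y * kappa p)))| <= psi_bound B Z C.
  have nQ : `|Q| = Q by rewrite ger0_norm// sqr_ge0.
  have nQ2 : `|Q ^+ 2| = Q ^+ 2 by rewrite ger0_norm// sqr_ge0.
  apply: psi_lim_le.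
  - by rewrite normf_div (normrM Q) nQ !norm_kappa.
  - by rewrite normf_div (normrM Q) nQ !norm_kappa.
  - by rewrite normrN normf_div (normrM (Q ^+ 2)) (normrM (kappa y)) nQ2 !norm_kappa.
rewrite -/(D p) -/(D x) -/(D y); move: psiM; move: (psi_lim _ _ _ _) => ps psM.
have M0 : 0 <= psi_bound B Z C by apply: le_trans psM.
have ps2 : ps ^+ 2 <= psi_bound B Z C ^+ 2.
  by rewrite -[ps ^+ 2]real_normK ?num_real// lerXn2r.
have s1 : sgnxy x y ^+ 2 = 1 by rewrite /sgnxy; case: ifP; rewrite ?sqrrN expr1n.
have s2 : ((-1) ^ chi q p : R) ^+ 2 = 1 by apply: sqr_signz; rewrite sqrrN expr1n.
have s3 : ((- Num.sg y) ^ chi q x) ^+ 2 = 1 by apply: sqr_signz; rewrite sqrrN sqr_sg y0.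
have s4 : Num.sqrt (D p * D y / D x) ^+ 2 = D p * D y / D x.
  by rewrite sqr_sqrtr// divr_ge0 ?mulr_ge0 ?(ltW Dp) ?(ltW Dy) ?(ltW Dx).
have s5 : `|y| ^+ 2 = y ^+ 2 by rewrite real_normK ?num_real.
rewrite !exprMn s1 s2 s3 s4 s5 !mulr1.
have n0 : 0 <= nu_q q (p * y / x) ^+ 2 by exact: sqr_ge0.
move: (nu_q q _ ^+ 2) (c_q q ^+ 2) (sqr_ge0 (c_q q)) (y ^+ 2) (sqr_ge0 y) n0.
move: (psi_bound B Z C ^+ 2) (ps ^+ 2) ps2 (sqr_ge0 ps) dD Dx Dp Dy dpos.
move: (D x) (D p) (D y) (qpoch_oo q Q) => dx dp dy d M s sM s0 dle dx0 dp0 dy0 d0 n c c0 Y Y0 n0.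
have -> : c * Y * n * (dp * dy / dx) * s = (c * Y * n * (dp * dy)) * (s * dx^-1) by ring.
have -> : c * M / d * (Y * n * (dp * dy)) = (c * Y * n * (dp * dy)) * (M * d^-1) by ring.
apply: ler_wpM2l; first by rewrite !mulr_ge0// ltW.
apply: ler_pM => //; first by rewrite invr_ge0 ltW.
by rewrite lef_pV2 ?posrE.
Qed.

End Summability.

Section Majorant.
Variables (R : realType) (q : R).
Hypotheses (q_gt0 : 0 < q) (q_lt1 : q < 1).
Local Notation Q := (q ^+ 2).
Local Notation I := (Iq q).

Let D u := qpoch_oo q (- kappa u).
Let q0 : q != 0. Proof. by rewrite gt_eqF. Qed.
Let Q0 : Q != 0. Proof. by rewrite expf_neq0. Qed.

Lemma nu_q_norm (u v : R) : `|u| = `|v| -> nu_q q u = nu_q q v.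
Proof. by rewrite /nu_q /chi => ->. Qed.

Lemma qpoch_oo_step (a : R) : qpoch_oo q (a / Q) = (1 - a / Q) * qpoch_oo q a.
Proof.
rewrite (qpoch_ooD q_gt0 q_lt1 _ 1) expr1 mulfVK//.
by rewrite /qpoch big_ord_recl big_ord0 muln0 expr0 mul1r mulr1.
Qed.

Lemma sqr_qz (k : int) : (q ^ k) ^+ 2 = Q ^ k.
Proof. by rewrite !exprnP !exprz_exp mulrC. Qed.

(** Growth rate of the bound on a_p(x, q^m x)^2 along x = q^-(k + 1): the
    Gaussian decay of nu beats the growth of the infinite products. *)
Definition growth (p : R) (m : int) (x : R) : R :=
  x ^+ 2 * (Q ^ m * x ^+ 2) * nu_q q (q ^ m * x ^+ 2 / p) ^+ 2 * (D x * D (q ^ m * x)).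

Lemma growth_cvg (p : I) (m : int) : 0 < Iq_val p ->
  cvgn (series (fun k : nat => growth (Iq_val p) m (q ^ (- k.+1%:Z)))).
Proof.
move=> p0; set kp := chi q (Iq_val p).
have pE : Iq_val p = q ^ kp by rewrite -Iq_abs// gtr0_norm.
pose L := Q ^ (9 - 2 * m + 2 * kp).
have Qg : 0 < Q by rewrite exprn_gt0.
have L0 : 0 < L by exact: exprz_gt0.
have Qm0 : 0 < Q ^ m by exact: exprz_gt0.
have Dpos (x : R) : 0 < x -> 0 < D x.
  move=> x0; apply: qpoch_oo_gt0 => //; rewrite /kappa gtr0_sg// mul1r.
  by rewrite (le_lt_trans _ ltr01)// oppr_le0 sqr_ge0.
apply: (@ratio_cvg _ _ (Q^-1 ^+ 2 * L * (2 * (1 + Q ^ m) * Q^-1 ^+ 4)) (Q ^+ 2)).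
- rewrite sqr_ge0/= exprn_ilt1// ?Q_lt1// ltW//.
- move=> k; have x0 := qz_gt0 q_gt0 (- k.+1%:Z).
  rewrite /growth; apply: mulr_ge0; last first.
    by rewrite ltW// mulr_gt0// Dpos// mulr_gt0// qz_gt0.
  by apply: mulr_ge0; rewrite ?sqr_ge0// !mulr_ge0 ?sqr_ge0// ltW.
move=> k; set x := q ^ (- k.+1%:Z); have x0 : 0 < x by exact: qz_gt0.
have -> : q ^ (- k.+2%:Z) = x / q.
  by rewrite /x -[X in _ / X]expr1z invr_expz -expfzDr//; congr (q ^ _); rewrite -(addn1 k.+1) PoszD opprD.
pose t := Q ^+ k.
have t0 : 0 < t by rewrite exprn_gt0.
have t1 : t <= 1 by exact: Qn_le1.
have x2 : x ^+ 2 = Q^-1 * t^-1.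
  by rewrite /x sqr_qz -invr_expz -exprnP (exprS Q) invfM.
have y0 : 0 < q ^ m * x by rewrite mulr_gt0// qz_gt0.
have kap (u : R) : 0 < u -> kappa u = u ^+ 2 by move=> u0; rewrite /kappa gtr0_sg// mul1r.
have Dx : D (x / q) = (1 + x ^+ 2 / Q) * D x.
  rewrite /D !kap ?divr_gt0// expr_div_n.
  by have := qpoch_oo_step (- x ^+ 2); rewrite mulNr opprK.
have Dy : D (q ^ m * (x / q)) = (1 + Q ^ m * x ^+ 2 / Q) * D (q ^ m * x).
  have -> : q ^ m * (x / q) = q ^ m * x / q by rewrite mulrA.
  rewrite /D (kap (q ^ m * x / q)); last by rewrite divr_gt0.
  rewrite (kap (q ^ m * x))// expr_div_n.
  have := qpoch_oo_step (- (q ^ m * x) ^+ 2); rewrite mulNr opprK => ->.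
  by rewrite exprMn sqr_qz.
have nuE : nu_q q (q ^ m * (x / q) ^+ 2 / Iq_val p) ^+ 2 =
    nu_q q (q ^ m * x ^+ 2 / Iq_val p) ^+ 2 * (L * t ^+ 4).
  have e1 : q ^ m * x ^+ 2 / Iq_val p = q ^ (m - 2 * k.+1%:Z - kp).
    rewrite pE /x invr_expz exprnP exprz_exp -!expfzDr//; congr (q ^ _); ring.
  have e2 : q ^ m * (x / q) ^+ 2 / Iq_val p = q ^ (m - 2 * k.+1%:Z - kp - 2).
    by rewrite (expfzDr _ _ q0) -e1 expr_div_n; move: (x ^+ 2) (Iq_val p)^-1 => A B; rewrite -!mulrA; congr (_ * (_ * _)); rewrite mulrC.
  pose j := (m - 2 * k.+1%:Z - kp - 1).
  rewrite (@nu_q_swap _ _ q_gt0 q_lt1 _ (q ^ m * x ^+ 2 / Iq_val p) (- 1) 0 j).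
  - rewrite exprMn; congr (_ * _); rewrite sqr_qz /L /t -exprM (exprnP Q (k * 4)%N) -expfzDr//.
    by congr (Q ^ _); rewrite /j PoszM -(addn1 k) PoszD; ring.
  - by rewrite e2 gtr0_norm ?qz_gt0//; congr (q ^ _); rewrite /j; ring.
  - by rewrite e1 gtr0_norm ?qz_gt0//; congr (q ^ _); rewrite /j; ring.
pose n' := nu_q q (q ^ m * x ^+ 2 / Iq_val p) ^+ 2.
have n0' : 0 <= n' by exact: sqr_ge0.
rewrite /growth nuE -/n' Dx Dy expr_div_n x2.
have -> : (Q ^+ 2) ^+ k = t ^+ 2 by rewrite /t exprAC.
have hb : 1 <= Q^-1 * t^-1 / Q.
  have i1 : 1 <= Q^-1 by rewrite invf_ge1// ltW// Q_lt1.
  have i2 : 1 <= t^-1 by rewrite invf_ge1.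
  by rewrite mulr_ege1// mulr_ege1.
have b1 : 1 + Q^-1 * t^-1 / Q <= 2 * Q^-1 ^+ 2 * t^-1.
  move: hb; move: (Q^-1) (t^-1) => a b hb.
  by rewrite (_ : 2 * a ^+ 2 * b = a * b * a + a * b * a); [rewrite lerD2r|ring].
have b2 : 1 + Q ^ m * (Q^-1 * t^-1) / Q <= (1 + Q ^ m) * Q^-1 ^+ 2 * t^-1.
  move: hb; move: (Q^-1) (t^-1) (Q ^ m) => a b d hb.
  by rewrite (_ : (1 + d) * a ^+ 2 * b = a * b * a + d * (a * b) * a); [rewrite lerD2r|ring].
move: (Dpos _ x0) (Dpos _ y0) n0'.
have r0 : 0 < Q^-1 by rewrite invr_gt0.
have s0 : 0 < t^-1 by rewrite invr_gt0.
have st : t^-1 * t = 1 by rewrite mulVf// gt_eqF.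
move: b1 b2 t0 Qm0 L0 s0 r0 st.
move: (D x) (D (q ^ m * x)) n' (t^-1) (Q ^ m) (L) (Q^-1) => dx dy n s M L1 r.
move=> b1 b2 t0 M0 L0 s0 r0 st dx0 dy0 n0.
pose W := r * s * r * (M * (r * s * r)) * (n * (L1 * t ^+ 4)) * (dx * dy).
have W0 : 0 <= W.
  have [r0' s0' M0' L0'] : [/\ 0 <= r, 0 <= s, 0 <= M & 0 <= L1] by split; exact: ltW.
  rewrite /W; apply: mulr_ge0; last exact: ltW (mulr_gt0 dx0 dy0).
  apply: mulr_ge0; last exact: mulr_ge0 n0 (mulr_ge0 L0' (exprn_ge0 _ (ltW t0))).
  by rewrite !mulr_ge0.
have [c1 c2] : 0 <= 1 + r * s * r /\ 0 <= 1 + M * (r * s) * r.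
  by have [r0' s0' M0'] : [/\ 0 <= r, 0 <= s & 0 <= M]; [split; exact: ltW|split; rewrite addr_ge0// !mulr_ge0].
apply: (@le_trans _ _ (W * ((2 * r ^+ 2 * s) * ((1 + M) * r ^+ 2 * s)))).
  apply: (@le_trans _ _ (W * ((1 + r * s * r) * (1 + M * (r * s) * r)))).
    by apply: eq_ler; rewrite /W; ring.
  by apply: ler_wpM2l => //; exact: ler_pM.
apply: eq_ler; rewrite /W.
transitivity (r ^+ 2 * L1 * (2 * (1 + M) * r ^+ 4) * t ^+ 2 *
  (r * s * (M * (r * s)) * n * (dx * dy)) * (s * t) ^+ 2); first by ring.
by rewrite st expr1n mulr1.
Qed.

End Majorant.

Section MajorantA.
Variables (R : realType) (q : R).
Hypotheses (q_gt0 : 0 < q) (q_lt1 : q < 1).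
Local Notation Q := (q ^+ 2).
Local Notation I := (Iq q).

Let D u := qpoch_oo q (- kappa u).
Let q0 : q != 0. Proof. by rewrite gt_eqF. Qed.
Let Q0 : Q != 0. Proof. by rewrite expf_neq0. Qed.

Lemma a_sqr_small (p : I) (m : int) : exists2 K : R, 0 <= K & forall x y : I,
  Iq_val x ^+ 2 <= 1 -> `|Iq_val y| = q ^ m * `|Iq_val x| ->
  a_ q (Iq_val p) (Iq_val x) (Iq_val y) ^+ 2 <= K * Iq_val x ^+ 2.
Proof.
have Dp : 0 < D (Iq_val p) by apply: qpoch_oo_gt0 => //; exact: Iq_kappa_lt1.
have d0 : 0 < qpoch_oo q Q by apply: qpoch_oo_gt0 => //; exact: Q_lt1.
have p0 := Iq_neq0 q_gt0 q_lt1 p; have Qm0 : 0 < Q ^ m by rewrite exprz_gt0// exprn_gt0.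
set B := Q / Q ^ m; set Z := Q / Iq_val p ^+ 2; set C := Q ^+ 2 / (Q ^ m * Iq_val p ^+ 2).
pose L := (c_q q * psi_bound q B Z C) ^+ 2 / qpoch_oo q Q.
have L0 : 0 <= L by rewrite divr_ge0 ?sqr_ge0 ?ltW.
pose n := nu_q q (Iq_val p * q ^ m) ^+ 2.
exists (L * (Q ^ m * n * (D (Iq_val p) * qbound q (Q ^ m)))).
  apply: mulr_ge0 => //; apply: mulr_ge0; first by rewrite mulr_ge0 ?sqr_ge0 ?ltW.
  by rewrite mulr_ge0 ?expR_ge0 ?ltW.
move=> x y x1 yx; have x0 := Iq_neq0 q_gt0 q_lt1 x; have y0 := Iq_neq0 q_gt0 q_lt1 y.
have yx2 : Iq_val y ^+ 2 = Q ^ m * Iq_val x ^+ 2.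
  by rewrite -[LHS]real_normK ?num_real// yx exprMn sqr_qz real_normK ?num_real.
have X0 : 0 < Iq_val x ^+ 2 by rewrite exprn_even_gt0.
have P0 : 0 < Iq_val p ^+ 2 by rewrite exprn_even_gt0.
apply: (le_trans (@a_sqr_le _ _ q_gt0 q_lt1 p x y B Z C _ _ _)).
- rewrite yx2 /B; apply: eq_ler; move: (Iq_val x ^+ 2) X0 (Q ^ m) Qm0 => a a0 b b0.
  by field; rewrite !gt_eqF.
- by rewrite /Z ler_pM2r ?invr_gt0// ler_piMr// sqr_ge0.
- rewrite yx2 /C; apply: eq_ler; move: (Iq_val x ^+ 2) X0 (Q ^ m) Qm0 (Iq_val p ^+ 2) P0 => a a0 b b0 c c0.
  by field; rewrite !gt_eqF.
rewrite -/L -[leRHS]mulrA; apply: ler_wpM2l => //.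
have -> : nu_q q (Iq_val p * Iq_val y / Iq_val x) = nu_q q (Iq_val p * q ^ m).
  apply: nu_q_norm; rewrite !normrM normfV yx (gtr0_norm (qz_gt0 _ _))//.
  by rewrite -!mulrA divff ?normr_eq0// mulr1.
rewrite -/n -/(D _) -/(D _) yx2.
have DyB : D (Iq_val y) <= qbound q (Q ^ m).
  apply: (le_trans (ler_norm _)); apply: (le_trans (qpoch_oo_le q_gt0 q_lt1 _)).
  apply: qbound_mono => //; rewrite normrN norm_kappa// yx2 (gtr0_norm Qm0).
  by rewrite ler_piMr// ltW.
have Dy0 : 0 < D (Iq_val y) by apply: qpoch_oo_gt0 => //; exact: Iq_kappa_lt1.
have n0 : 0 <= n by exact: sqr_ge0.
apply: (@le_trans _ _ (Q ^ m * Iq_val x ^+ 2 * n * (D (Iq_val p) * qbound q (Q ^ m)))).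
  apply: ler_wpM2l; first by apply: mulr_ge0 => //; apply: mulr_ge0; exact: ltW.
  by apply: ler_wpM2l => //; exact: ltW.
by apply: eq_ler; ring.
Qed.

Lemma a_sqr_large (p : I) (m : int) : 0 < Iq_val p -> exists2 K : R, 0 <= K & forall x y : I,
  1 <= Iq_val x ^+ 2 -> 0 < Iq_val x -> Iq_val y = q ^ m * Iq_val x ->
  a_ q (Iq_val p) (Iq_val x) (Iq_val y) ^+ 2 <= K * growth q (Iq_val p) m (Iq_val x).
Proof.
move=> pgt; have d0 : 0 < qpoch_oo q Q by apply: qpoch_oo_gt0 => //; exact: Q_lt1.
have Qm0 : 0 < Q ^ m by rewrite exprz_gt0// exprn_gt0.
have P0 : 0 < Iq_val p ^+ 2 by rewrite exprn_gt0.
set B := Q * Iq_val p ^+ 2 / Q ^ m; set Z := Q * Iq_val p ^+ 2.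
set C := Q ^+ 2 * Iq_val p ^+ 2 / Q ^ m.
pose L := (c_q q * psi_bound q B Z C) ^+ 2 / qpoch_oo q Q.
have L0 : 0 <= L by rewrite divr_ge0 ?sqr_ge0 ?ltW.
exists (L / Iq_val p ^+ 2); first by rewrite divr_ge0// ltW.
move=> x y x1 xgt yx.
have ygt : 0 < Iq_val y by rewrite yx mulr_gt0// qz_gt0.
have yx2 : Iq_val y ^+ 2 = Q ^ m * Iq_val x ^+ 2 by rewrite yx exprMn sqr_qz.
have X0 : 0 < Iq_val x ^+ 2 by rewrite exprn_gt0.
have s1 k : ((-1) ^ k : R) ^+ 2 = 1 by apply: sqr_signz; rewrite sqrrN expr1n.
rewrite a_swap// !exprMn s1 mul1r gtr0_sg// exp1rz expr1n mul1r !gtr0_norm// exprVn.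
have le := @a_sqr_le _ _ q_gt0 q_lt1 x p y B Z C.
have {le} : a_ q (Iq_val x) (Iq_val p) (Iq_val y) ^+ 2 <=
  L * (Iq_val y ^+ 2 * nu_q q (Iq_val x * Iq_val y / Iq_val p) ^+ 2 * (D (Iq_val x) * D (Iq_val y))).
  apply: le.
  - rewrite yx2 /B ler_pM2l; last by rewrite mulr_gt0// exprn_gt0.
    by rewrite lef_pV2 ?posrE ?mulr_gt0// ler_peMr// ltW.
  - by rewrite /Z ler_piMr ?invf_le1// ltW// mulr_gt0// exprn_gt0.
  - rewrite yx2 /C ler_pM2l; last by rewrite mulr_gt0// exprn_gt0// exprn_gt0.
    by rewrite lef_pV2 ?posrE ?mulr_gt0// -mulrA ler_peMr ?(ltW Qm0)// mulr_ege1.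
rewrite /growth.
have -> : Iq_val x * Iq_val y / Iq_val p = q ^ m * Iq_val x ^+ 2 / Iq_val p.
  by rewrite yx; ring.
rewrite yx2 -yx -/(D _) -/(D _) => h.
apply: (@le_trans _ _ (Iq_val x ^+ 2 / Iq_val p ^+ 2 * (L * (Q ^ m * Iq_val x ^+ 2 *
   nu_q q (q ^ m * Iq_val x ^+ 2 / Iq_val p) ^+ 2 * (D (Iq_val x) * D (Iq_val y)))))).
  by apply: ler_wpM2l => //; rewrite divr_ge0// ltW.
move: (D _) (D _) (nu_q q _ ^+ 2) => a b c; apply: eq_ler.
by move: (Iq_val p ^- 2) (Iq_val x ^+ 2) (Q ^ m) => f g h'; ring.
Qed.

Lemma geometric_cvg (K : R) (n : nat) : cvgn (series (fun k : nat => K * Q ^+ (k + n))).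
Proof.
have -> : (fun k : nat => K * Q ^+ (k + n)) = (fun k => (K * Q ^+ n) * Q ^+ k).
  by apply/funext => k; rewrite exprD; ring.
apply: is_cvg_geometric_series; rewrite ger0_norm ?Q_lt1//.
exact: sqr_ge0.
Qed.

Lemma a_majorant (p : I) (m : int) : exists h : I -> R,
  [/\ forall x, 0 <= h x, (\esum_(x in [set: I]) (h x)%:E < +oo)%E &
    forall x y : I, Iq_val y = Num.sg (Iq_val p) * q ^ m * Iq_val x ->
      a_ q (Iq_val p) (Iq_val x) (Iq_val y) ^+ 2 <= h x].
Proof.
have [K K0 hK] := a_sqr_small p m.
have [u [u0 uc hu]] : exists u : I -> R, [/\ forall x : I, 0 < Iq_val x -> 0 <= u x,
    cvgn (series (fun k : nat => u (Iq_pow q (- k.+1%:Z)))) &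
    forall x y : I, 1 <= Iq_val x ^+ 2 -> 0 < Iq_val x ->
      Iq_val y = Num.sg (Iq_val p) * q ^ m * Iq_val x ->
      a_ q (Iq_val p) (Iq_val x) (Iq_val y) ^+ 2 <= u x].
  have [pn|pp|p0] := ltgtP (Iq_val p) 0.
  - pose u (x : I) := if q ^ m * Iq_val x < 1 then
      a_ q (Iq_val p) (Iq_val x) (Num.sg (Iq_val p) * q ^ m * Iq_val x) ^+ 2 else 0.
    exists u; split.
    + by move=> x _; rewrite /u; case: ifP => _; rewrite ?sqr_ge0.
    + have [N hN] : exists N : nat, forall k, (N <= k)%N -> u (Iq_pow q (- k.+1%:Z)) = 0.
        exists `|m|%N => k mk; rewrite /u /Iq_val /= -expfzDr//.
        have -> : m + (- k.+1%:Z) = - (`|k.+1%:Z - m|%N)%:Z by lia.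
        by rewrite ltNge -invr_expz -exprnP invf_ge1 ?exprn_gt0// exprn_ile1// ltW.
      apply/cvg_ex; exists (\sum_(k < N) u (Iq_pow q (- k.+1%:Z))); apply: cvg_near_cst.
      exists N => // k /= Nk; rewrite /series /= (big_cat_nat (n := N))//= [X in _ + X]big1_seq ?addr0 ?big_mkord//.
      by move=> i; rewrite mem_index_iota => /andP[_ /andP[Ni _]]; exact: hN.
    + move=> x y x1 x0 yx; rewrite /u -yx; case: ifPn => // /negP; case.
      have yn : Iq_val y < 0 by rewrite yx ltr0_sg// mulN1r mulNr oppr_lt0 mulr_gt0// qz_gt0.
      have : Iq_val y = - (q ^ m * Iq_val x) by rewrite yx ltr0_sg// mulN1r mulNr.
      move/eqP; rewrite -eqr_oppLR => /eqP <-.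
      by have [N ->] := Iq_neg q_gt0 yn; rewrite opprK exprn_ilt1// ltW.
  - have [K' K'0 hK'] := a_sqr_large m pp.
    exists (fun x => K' * growth q (Iq_val p) m (Iq_val x)); split.
    + move=> x x0; apply: mulr_ge0 => //; rewrite /growth.
      have Dpos (z : R) : 0 < z -> 0 < qpoch_oo q (- kappa z).
        move=> z0; apply: qpoch_oo_gt0 => //; rewrite /kappa gtr0_sg// mul1r.
        by rewrite (le_lt_trans _ ltr01)// oppr_le0 sqr_ge0.
      apply: mulr_ge0; last by rewrite ltW// mulr_gt0// Dpos// mulr_gt0// qz_gt0.
      apply: mulr_ge0; rewrite ?sqr_ge0// mulr_ge0 ?sqr_ge0// mulr_ge0 ?sqr_ge0//.
      by rewrite ltW// exprz_gt0// exprn_gt0.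
    + have := @growth_cvg _ _ q_gt0 q_lt1 p m pp => gc.
      have -> : (fun k : nat => K' * growth q (Iq_val p) m (Iq_val (Iq_pow q (- k.+1%:Z)))) =
        (fun k => K' *: growth q (Iq_val p) m (q ^ (- k.+1%:Z))) by [].
      exact: is_cvg_seriesZ.
    + by move=> x y x1 x0; rewrite gtr0_sg// mul1r => yx; exact: hK'.
  - by move: (Iq_neq0 q_gt0 q_lt1 p); rewrite p0 eqxx.
exists (fun x => if Iq_val x ^+ 2 <= 1 then K * Iq_val x ^+ 2 else u x).
have big_pos (x : I) : ~~ (Iq_val x ^+ 2 <= 1) -> 0 < Iq_val x.
  move=> x1; rewrite ltNge le_eqVlt (negbTE (Iq_neq0 q_gt0 q_lt1 x)) /=; apply: contraNN x1.
  move=> /(Iq_neg q_gt0) [N ->]; rewrite sqrrN exprn_ile1//.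
    by rewrite exprn_ge0// ltW.
  by rewrite exprn_ile1// ltW.
split.
- by move=> x; case: ifPn => [_|/big_pos]; [rewrite mulr_ge0// sqr_ge0|exact: u0].
- apply: esum_Iq_lty => //.
  + by move=> x; case: ifPn => [_|/big_pos]; [rewrite mulr_ge0// sqr_ge0|exact: u0].
  + have -> : (fun k : nat => if Iq_val (Iq_npow q k) ^+ 2 <= 1 then K * Iq_val (Iq_npow q k) ^+ 2 else
      u (Iq_npow q k)) = (fun k => K * Q ^+ (k + 1)).
      apply/funext => k.
      have -> : Iq_val (Iq_npow q k) ^+ 2 = Q ^+ k.+1 by rewrite /Iq_val /= sqrrN exprAC.
      by rewrite (Qn_le1 q_gt0 q_lt1) addn1.
    exact: geometric_cvg.
  + have -> : (fun k : nat => if Iq_val (Iq_pow q k) ^+ 2 <= 1 then K * Iq_val (Iq_pow q k) ^+ 2 else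
      u (Iq_pow q k)) = (fun k => K * Q ^+ (k + 0)).
      apply/funext => k.
      have -> : Iq_val (Iq_pow q k) ^+ 2 = Q ^+ k by rewrite /Iq_val /= sqr_qz.
      by rewrite (Qn_le1 q_gt0 q_lt1) addn0.
    exact: geometric_cvg.
  + have -> // : (fun k : nat => if Iq_val (Iq_pow q (- k.+1%:Z)) ^+ 2 <= 1 then
      K * Iq_val (Iq_pow q (- k.+1%:Z)) ^+ 2 else u (Iq_pow q (- k.+1%:Z))) =
      (fun k => u (Iq_pow q (- k.+1%:Z))).
    apply/funext => k; rewrite ifF// /Iq_val /= sqr_qz; apply/negbTE; rewrite -ltNge.
    rewrite -invr_expz -exprnP invf_gt1 ?exprn_gt0// ?exprn_gt0//.
    by rewrite exprn_ilt1// ?Q_lt1// sqr_ge0.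
- move=> x y yx; case: ifPn => [x1|x1].
    apply: hK => //; rewrite yx !normrM normr_sg (Iq_neq0 q_gt0 q_lt1 p) mul1r.
    by rewrite (gtr0_norm (qz_gt0 _ _)).
  by apply: hu yx; [rewrite ltW// ltNge|exact: big_pos].
Qed.

End MajorantA.

Section Fbasis.
Variables (R : realType) (q : R).
Hypotheses (q_gt0 : 0 < q) (q_lt1 : q < 1).
Local Notation I := (Iq q).
Local Notation T := (circle R).

(** A function given by a measurable expression on each level set of a
    measurable map into the countable set I_q is measurable. *)
Lemma measurable_by_Iq d (X : measurableType d) (g : X -> I) (F : I -> X -> R) :
  measurable_fun setT g -> (forall p, measurable_fun setT (F p)) ->
  measurable_fun setT (fun x => F (g x) x).
Proof.
move=> mg mF _ B mB; rewrite setTI.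
have [e [c [ec ce]]] := Iq_enumeration q_gt0 q_lt1.
rewrite (_ : _ @^-1` _ = \bigcup_n ((g @^-1` [set e n]) `&` (F (e n) @^-1` B))).
  apply: bigcupT_measurable => n; apply: measurableI.
    by rewrite -[X in measurable X]setTI; exact: mg.
  by rewrite -[X in measurable X]setTI; exact: mF.
apply/seteqP; split=> [x /= Bx|x [n _ [/= <-]]//].
by exists (c (g x)) => //=; rewrite ce.
Qed.

Lemma cmeasurable_by_Iq d (X : measurableType d) (g : X -> I) (F : I -> X -> R[i]) :
  measurable_fun setT g -> (forall p, cmeasurable (F p)) ->
  cmeasurable (fun x => F (g x) x).
Proof.
move=> mg mF; split.
- by apply: (@measurable_by_Iq _ _ g (fun p x => Re (F p x))) => // p; case: (mF p).
- by apply: (@measurable_by_Iq _ _ g (fun p x => Im (F p x))) => // p; case: (mF p).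
Qed.

Lemma integral_T_cst (r : \bar R) : (\int[mu_T R]_t r = r)%E.
Proof. by rewrite integral_cst// [X in (_ * X)%E]mu_T_setT mule1. Qed.

Lemma integral_H_snd (f : I -> \bar R) : (forall x, 0 <= f x)%E ->
  (\int[mu_H q]_z f z.2 = \int[mu_I q]_x f x)%E.
Proof.
move=> f0; rewrite [LHS](@fubini_tonelli1 _ _ _ _ _ (mu_T R) (mu_I q))//.
  by rewrite /fubini_F /= integral_T_cst.
by apply: (@measurableT_comp _ _ _ _ _ _ f) => //; exact: measurable_snd.
Qed.

Lemma F_E (r s m : int) (p : I) z : F_ r s m p z =
  (if Iq_val z.2.2 == Num.sg (Iq_val p) * q ^ m * Iq_val z.1.2
   then (a_ q (Iq_val p) (Iq_val z.1.2) (Iq_val z.2.2))%:C else 0) *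
  (zeta (r + chi q (Iq_val z.2.2 / Iq_val p)) z.1.1 *
   zeta (s - chi q (Iq_val z.1.2 / Iq_val p)) z.2.1).
Proof. by rewrite /F_ /zeta; case: ifP => _; rewrite ?mul0r// mulrA. Qed.

Lemma L2_F (r s m : int) (p : I) : L2 (mu_HH q) (F_ r s m p).
Proof.
have -> : F_ r s m p = fun z => (if Iq_val z.2.2 == Num.sg (Iq_val p) * q ^ m * Iq_val z.1.2
   then (a_ q (Iq_val p) (Iq_val z.1.2) (Iq_val z.2.2))%:C else 0) *
  (zeta (r + chi q (Iq_val z.2.2 / Iq_val p)) z.1.1 *
   zeta (s - chi q (Iq_val z.1.2 / Iq_val p)) z.2.1).
  by apply/funext => z; exact: F_E.
pose N (x y : I) := if Iq_val y == Num.sg (Iq_val p) * q ^ m * Iq_val x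
   then a_ q (Iq_val p) (Iq_val x) (Iq_val y) ^+ 2 else 0.
split.
  pose G (x y : I) (z : (T * I) * (T * I)) := (if Iq_val y == Num.sg (Iq_val p) * q ^ m * Iq_val x
   then (a_ q (Iq_val p) (Iq_val x) (Iq_val y))%:C else 0) *
  (zeta (r + chi q (Iq_val y / Iq_val p)) z.1.1 *
   zeta (s - chi q (Iq_val x / Iq_val p)) z.2.1).
  apply: (@cmeasurable_by_Iq _ _ (fun z : (T * I) * (T * I) => z.1.2) (fun x z => G x z.2.2 z)).
    by apply: measurableT_comp; [exact: measurable_snd|exact: measurable_fst].
  move=> x; apply: (@cmeasurable_by_Iq _ _ (fun z : (T * I) * (T * I) => z.2.2) (fun y z => G x y z)).
    by apply: measurableT_comp; [exact: measurable_snd|exact: measurable_snd].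
  move=> y; apply: cmeasurableM; first exact: cmeasurable_cst.
  apply: cmeasurableM.
    apply: (@cmeasurable_fst _ _ _ _ R (fun w : T * I => zeta _ w.1)).
    by apply: (@cmeasurable_fst _ _ _ _ R (zeta _)); exact: cmeasurable_zeta.
  apply: (@cmeasurable_snd _ _ _ _ R (fun w : T * I => zeta _ w.1)).
  by apply: (@cmeasurable_fst _ _ _ _ R (zeta _)); exact: cmeasurable_zeta.
rewrite [ltLHS](_ : _ = \int[mu_HH q]_z (N z.1.2 z.2.2)%:E)%E; last first.
  apply: eq_integral => z _; rewrite !normsqM !normsq_zeta !mulr1 /N.
  by case: ifP => _; rewrite normsqR ?expr0n.
have N0 x y : 0 <= N x y by rewrite /N; case: ifP => _; rewrite ?sqr_ge0.
have mN : measurable_fun setT (fun z : (T * I) * (T * I) => (N z.1.2 z.2.2)%:E).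
  apply/measurable_EFinP.
  apply: (@measurable_by_Iq _ _ (fun z : (T * I) * (T * I) => z.1.2) (fun x z => N x z.2.2)).
    by apply: measurableT_comp; [exact: measurable_snd|exact: measurable_fst].
  move=> x; apply: (@measurable_by_Iq _ _ (fun z : (T * I) * (T * I) => z.2.2) (fun y z => N x y)).
    by apply: measurableT_comp; [exact: measurable_snd|exact: measurable_snd].
  by move=> y; exact: measurable_cst.
rewrite [ltLHS](@fubini_tonelli1 _ _ _ _ _ (mu_H q) (mu_H q))//; last first.
  by move=> z; rewrite lee_fin.
rewrite /fubini_F /=.
rewrite (@eq_integral _ _ _ _ _ (fun z : T * I => \int[mu_I q]_y (N z.2 y)%:E)%E); last first.
  move=> z _; apply: (@integral_H_snd (fun y => (N z.2 y)%:E)) => y.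
  by rewrite lee_fin.
rewrite (@integral_H_snd (fun x => \int[mu_I q]_y (N x y)%:E)%E); last first.
  by move=> x; apply: integral_ge0 => y _; rewrite lee_fin.
rewrite integral_Iq_esum//; last by move=> x; apply: integral_ge0 => y _; rewrite lee_fin.
have [h [h0 hoo hle]] := a_majorant q_gt0 q_lt1 p m.
apply: le_lt_trans hoo; apply: le_esum => x _.
have [[y0 yE]|nex] := pselect (exists y : I, Iq_val y = Num.sg (Iq_val p) * q ^ m * Iq_val x).
  rewrite (@integral_single _ _ _ y0) /N.
    by rewrite yE eqxx -yE lee_fin; exact: hle.
  move=> y yy; rewrite ifF//; apply/negbTE; apply: contraNN yy => /eqP.
  by rewrite -yE => /val_inj ->.
rewrite (@integral_single _ _ _ x) /N; last first.
  by move=> y _; rewrite ifF//; apply/negbTE/eqP => yE; apply: nex; exists y.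
by rewrite ifF ?lee_fin//; apply/negbTE/eqP => yE; apply: nex; exists x.
Qed.

End Fbasis.

(** * Orthonormal bases of H and of its tensor powers *)

Section Lift.
Context d1 (X : measurableType d1) d2 (Y : measurableType d2) (R : realType).
Variables (mu : {measure set X -> \bar R}) (nu : {measure set Y -> \bar R}).
Variables (A : op X Y R) (bA : bounded_op mu nu A).

Lemma bounded_L2 f : L2 mu f -> L2 nu (A f).
Proof. by have [h _ _] := bA; exact: h. Qed.

Definition lift_op (f : L2H mu) : L2H nu :=
  mkL2 (bounded_L2 (L2P (f : L2_type mu))).

Lemma wop_lift : wop lift_op.
Proof.
have [_ lA [M MA]] := bA; split => [a u v w|]; last first.
  by exists M => u; rewrite !nrm2E; apply: MA; exact: L2P.
rewrite -ip_linear; apply: ae_ip_eq.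
have -> : (lift_op (a *: u + v) : L2_type nu) = A (a *: (u : L2_type mu) + (v : L2_type mu) : L2_type mu) :> (Y -> R[i]) by [].
rewrite L2_val_lin; apply: filterS (lA a _ _ (L2P (u : L2_type mu)) (L2P (v : L2_type mu))) => y.
by move=> /[apply] ->; rewrite (L2_val_lin a (lift_op u : L2_type nu) (lift_op v : L2_type nu)).
Qed.

End Lift.

Section HBases.
Variables (R : realType) (q : R).
Hypotheses (q_gt0 : 0 < q) (q_lt1 : q < 1).
Local Notation I := (Iq q).
Local Notation T := (circle R).

Definition bH (i : int * I) : T * I -> R[i] := ebasis i.1 i.2.
Definition bHH (i : (int * I) * (int * I)) : (T * I) * (T * I) -> R[i] :=
  tens (bH i.1) (bH i.2).
Definition bTTH (i : int * (int * (int * I))) : T * (T * (T * I)) -> R[i] :=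
  tens (zeta i.1) (tens (zeta i.2.1) (bH i.2.2)).

Lemma onb_H : onb (mu_H q) bH.
Proof.
exact: (@onb_prodm _ _ _ _ _ (mu_T R) (mu_I q) _ _ pickle _ _ (pcan_inj pickleK)
  (onb_zeta R) (@onb_delta R q)).
Qed.

Lemma Iq_inj : exists c : int * I -> nat, injective c.
Proof.
have [e [c [_ ce]]] := Iq_enumeration q_gt0 q_lt1.
by exists (fun i => pickle (i.1, c i.2)) => -[m p] [n r] /(pcan_inj pickleK) [-> /(can_inj ce) ->].
Qed.

Lemma onb_HH : onb (mu_HH q) bHH.
Proof. by have [c cinj] := Iq_inj; exact: (onb_prodm cinj onb_H onb_H). Qed.

Lemma onb_TTH : onb (mu_TTH q) bTTH.
Proof.
apply: (@onb_prodm _ _ _ _ _ (mu_T R) (mu_TH q) _ _ pickle _ (fun j => tens (zeta j.1) (bH j.2))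
  (pcan_inj pickleK) (onb_zeta R)).
exact: (@onb_prodm _ _ _ _ _ (mu_T R) (mu_H q) _ _ pickle _ _ (pcan_inj pickleK)
  (onb_zeta R) onb_H).
Qed.

Lemma L2_bH i : L2 (mu_H q) (bH i).
Proof. by have [h _ _] := onb_H. Qed.

Definition vH (i : int * I) : L2H (mu_H q) := mkL2 (L2_bH i).

Lemma vH_orth i j : ip (vH i) (vH j) = (i == j)%:R.
Proof. by have [_ h _] := onb_H; exact: h. Qed.

Lemma vH_total (g : L2H (mu_H q)) : (forall i, ip g (vH i) = 0) -> nrm2 g = 0.
Proof. by have [_ h] := onb_parseval (e := vH) onb_H; exact: h. Qed.

Lemma vH_eq (f g : L2H (mu_H q)) : (forall i, ip f (vH i) = ip g (vH i)) ->
  forall w, ip f w = ip g w.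
Proof.
move=> fg w; apply/eqP; rewrite -subr_eq0 -ipBl; apply/eqP/ip_null/vH_total => i.
by rewrite ipBl fg subrr.
Qed.

(** Multiplication by a bounded real function of the second variable. *)
Definition mulI (rho : I -> R) (f : T * I -> R[i]) : T * I -> R[i] :=
  fun z => (rho z.2)%:C * f z.

Definition bshift (f : T * I -> R[i]) : T * I -> R[i] := fun z => zeta 1 z.1 * f z.

Lemma cmeasurable_mulI rho f : cmeasurable f -> cmeasurable (mulI rho f).
Proof.
move=> mf; apply: cmeasurableM => //.
by apply: (@cmeasurable_snd _ _ _ _ R (fun x : I => (rho x)%:C)); exact: cmeasurable_Iq.
Qed.

Lemma normsq_mulI rho M f z : (forall x, rho x ^+ 2 <= M) ->
  normsq (mulI rho f z) <= M * normsq (f z).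
Proof. by move=> h; rewrite normsqM normsqR ler_wpM2r ?normsq_ge0. Qed.

Lemma L2_mulI rho M f : (forall x, rho x ^+ 2 <= M) -> L2 (mu_H q) f ->
  L2 (mu_H q) (mulI rho f).
Proof.
move=> h lf; apply: (@L2_le _ _ _ _ _ (fun z => M * normsq (f z))).
- exact: cmeasurable_mulI (L2_meas lf).
- by move=> z; exact: normsq_mulI.
- exact/RintegrableZ/L2_integrable.
Qed.

Lemma L2_bshift f : L2 (mu_H q) f -> L2 (mu_H q) (bshift f).
Proof.
move=> lf; apply: (@L2_le _ _ _ _ _ (fun z => normsq (f z))).
- apply: cmeasurableM; last exact: L2_meas lf.
  by apply: (@cmeasurable_fst _ _ _ _ R (zeta 1)); exact: cmeasurable_zeta.
- by move=> z; rewrite normsqM normsq_zeta mul1r.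
- exact: L2_integrable.
Qed.

Lemma inner_mulI rho M f i : (forall x, rho x ^+ 2 <= M) -> L2 (mu_H q) f ->
  inner (mu_H q) (mulI rho f) (bH i) = (rho i.2)%:C * inner (mu_H q) f (bH i).
Proof.
move=> h lf; rewrite !innerE -cintZ; last exact: L2_mul_integrable lf (L2_bH i).
apply: eq_cint => z; rewrite /mulI /bH /ebasis /tens /delta.
by case: eqP => [->|_]; rewrite ?mulrA// mulr0 cj0 !mulr0.
Qed.

Lemma inner_bshift f m p : L2 (mu_H q) f ->
  inner (mu_H q) (bshift f) (bH (m + 1, p)) = inner (mu_H q) f (bH (m, p)).
Proof.
move=> lf; rewrite !innerE; apply: eq_cint => z.
rewrite /bshift /bH /ebasis /tens /= zetaD !cjM !cj_zeta.
have : zeta 1 z.1 * zeta (- 1) z.1 = 1 by rewrite -zetaD subrr zeta0.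
move: (zeta 1 _) (zeta (-1) _) (zeta (- m) _) (conj _) => a b c e ab.
by transitivity (f z * ((a * b) * (c * e))); [ring|rewrite ab mul1r].
Qed.

Lemma bounded_mulI rho M : (forall x, rho x ^+ 2 <= M) ->
  bounded_op (mu_H q) (mu_H q) (mulI rho).
Proof.
move=> h; split.
- by move=> f lf; exact: L2_mulI h lf.
- by move=> a f g _ _; apply: aeW => z _; rewrite /mulI; ring.
- exists M => f lf; rewrite /norm2sq.
  rewrite -RintegralZl//; last exact: L2_integrable.
  apply: le_Rintegral => //.
  + by apply: L2_integrable; exact: L2_mulI h lf.
  + exact/RintegrableZ/L2_integrable.
  + by move=> z _; exact: normsq_mulI.
Qed.

End HBases.

(** * The density of phi *)

Section Weight.
Variables (R : realType) (q : R).
Hypotheses (q_gt0 : 0 < q) (q_lt1 : q < 1).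
Local Notation I := (Iq q).
Local Notation T := (circle R).
Local Notation muH := (mu_H q).
Local Notation vH := (@vH R q).
Local Notation bH := (@bH R q).

Let iv (p : I) := (Iq_val p)^-1.

Lemma slice_integral (g : T * I -> R[i]) (p : I) : L2 muH g ->
  (\int[mu_T R]_t (Re (g (t, p)))%:E = (Re (inner muH g (ebasis 0 p)))%:E)%E.
Proof.
move=> lg; have := cfubini1 (L2_mul_integrable lg (L2_bH (0, p))).
have -> : (fun t => cint (mu_I q) (fun x => g (t, x) * conj (bH (0, p) (t, x)))) =
    (fun t => g (t, p)).
  apply/funext => t; rewrite (@cint_single _ _ _ p _).2 /bH /ebasis /tens /=.
    by rewrite zeta0 mul1r /delta eqxx cj1 mulr1.
  by move=> x xp; rewrite /delta (negbTE xp) mulr0 cj0 mulr0.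
move=> [[i1 i2] e]; rewrite innerE -e /cint /=.
by rewrite /Rintegral fineK//; exact: integrable_fin_num i1.
Qed.

Lemma gamma_basis m p : gamma (bH (m, p)) (fun z => (iv p)%:C * bH (m + 1, p) z).
Proof.
have l1 := L2_bH (m, p); have l2 : L2 muH (fun z => (iv p)%:C * bH (m + 1, p) z).
  have := L2_lin (iv p)%:C (L2_bH (m + 1, p)) (L2_0 _); congr (L2 _ _).
  by apply/funext => z; rewrite addr0.
have n0 (u : T * I -> R[i]) : norm2sq muH (fun z => u z - u z) = 0.
  rewrite (_ : (fun z => _) = (0 : L2_type muH)); first by rewrite -nrm2E /nrm2 ip0l.
  by apply/funext => z; rewrite subrr.
split => // e e0; exists (bH (m, p)), (fun z => (iv p)%:C * bH (m + 1, p) z); split.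
- exists 1%N, (fun=> 1), (fun=> m), (fun=> p).
  by split; apply/funext => z; rewrite big_ord1 mul1r.
- by rewrite n0.
- by rewrite n0.
Qed.

(** A relation between u and v that holds on the basis extends to the closure. *)
Lemma gamma_form (u v : L2H muH) :
  (forall m p, (iv p)%:C * ip (vH (m + 1, p)) u = ip (vH (m, p)) v) ->
  forall f h, gamma f h -> inner muH h (u : L2_type muH) = inner muH f (v : L2_type muH).
Proof.
move=> uv f h [lf lh cl].
pose F : L2H muH := mkL2 lf; pose H : L2H muH := mkL2 lh.
rewrite -[LHS]/(ip H u) -[RHS]/(ip F v); apply/eqP; rewrite -subr_eq0; apply/eqP.
apply: normsq_eq0; apply/eqP; rewrite eq_le normsq_ge0 andbT.
apply: (@le0_small _ _ (2 * nrm2 u + 2 * nrm2 v)) => e e0.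
have [f' [h' [[n [c [m [p [fE hE]]]]] df dh]]] := cl e e0.
pose F' : L2H muH := \sum_(i < n) c i *: vH (m i, p i).
pose H' : L2H muH := \sum_(i < n) (c i * (iv (p i))%:C) *: vH (m i + 1, p i).
have F'E : (F' : L2_type muH) = f' :> (_ -> _) by rewrite fE L2_val_sum.
have H'E : (H' : L2_type muH) = h' :> (_ -> _).
  by rewrite hE (L2_val_sum (index_enum 'I_n) (fun i => c i * (iv (p i))%:C) (fun i => vH (m i + 1, p i))).
have nF : nrm2 (F - F') < e by rewrite nrm2E; rewrite -F'E in df.
have nH : nrm2 (H - H') < e by rewrite nrm2E; rewrite -H'E in dh.
have FH : ip H' u = ip F' v.
  rewrite !ip_suml; apply: eq_bigr => i _.
  by rewrite !ipZl -mulrA uv.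
have -> : ip H u - ip F v = ip (H - H') u - ip (F - F') v.
  by rewrite !ipBl FH; ring.
apply: (le_trans (normsqD_le _ _)); rewrite -mulN1r normsqM.
have -> : normsq (-1 : R[i]) = 1 by rewrite /normsq /= sqrrN expr1n oppr0 expr0n addr0.
rewrite mul1r (mulrDl (2 * nrm2 u)); apply: lerD; rewrite -mulrA ler_pM2l//.
  by rewrite mulrC (le_trans (cauchy_schwarz _ _))// ler_wpM2r ?nrm2_ge0 1?ltW.
by rewrite mulrC (le_trans (cauchy_schwarz _ _))// ler_wpM2r ?nrm2_ge0 1?ltW.
Qed.

Lemma gamma_coef g h m p : gamma g h ->
  inner muH h (bH (m + 1, p)) = (iv p)%:C * inner muH g (bH (m, p)).
Proof.
move=> gh; have [lg lh _] := gh.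
have := @gamma_form (vH (m + 1, p)) ((iv p)%:C *: vH (m, p)) _ _ _ gh.
move=> -> //.
  rewrite -[LHS]/(ip (mkL2 lg : L2H muH) ((iv p)%:C *: vH (m, p))) ipZr cj_real.
  by [].
move=> n r; rewrite ipZr cj_real !vH_orth !xpair_eqE (inj_eq (addIr 1)).
by case: (r =P p) => [->|_]; rewrite ?andbF ?mulr0//.
Qed.

Lemma gamma_star_coef g k m p : graph_adjoint muH (@gamma R q) g k ->
  inner muH k (bH (m, p)) = (iv p)%:C * inner muH g (bH (m + 1, p)).
Proof.
move=> [lg lk /(_ _ _ (gamma_basis m p))] h.
have l1 := L2_bH (m, p); have l2 := L2_bH (m + 1, p).
rewrite (inner_conj l1 lk) -h (inner_conj l2 lg).
rewrite -[X in conj X]/(inner muH ((iv p)%:C *: vH (m + 1, p) : L2_type muH) g).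
by rewrite -[X in conj X]/(ip ((iv p)%:C *: vH (m + 1, p)) (mkL2 lg : L2H muH)) ipZl cjM cj_real.
Qed.

Lemma gamma2_coef g k i : @gamma_star_gamma R q g k ->
  inner muH k (bH i) = ((iv i.2) ^+ 2)%:C * inner muH g (bH i).
Proof.
case: i => m p [h gh hk]; rewrite (gamma_star_coef m p hk) (gamma_coef m p gh).
by rewrite mulrA -rcM.
Qed.

(** The eigenvalues of the square root of h_e. *)
Definition lam (e : R) (p : I) : R := Num.sqrt ((Iq_val p ^+ 2 + e)^-1).

Lemma lam_sqr e p : 0 < e -> lam e p ^+ 2 = (Iq_val p ^+ 2 + e)^-1.
Proof.
by move=> e0; rewrite sqr_sqrtr// invr_ge0 addr_ge0 ?sqr_ge0// ltW.
Qed.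

Lemma lam_gt0 e p : 0 < e -> 0 < lam e p.
Proof. by move=> e0; rewrite sqrtr_gt0 invr_gt0 ltr_wpDl ?sqr_ge0. Qed.

(** k e_p is an eigenvector: (k + lam)(k - lam) e_p = 0 and k + lam is
    bounded below. *)
Lemma sqrt_reg_eigen e k (p : I) : 0 < e -> is_sqrt_reg muH (@gamma_star_gamma R q) e k ->
  k (ebasis 0 p) = (fun z => (lam e p)%:C * ebasis 0 p z) %[ae muH].
Proof.
move=> e0 [bk pk reg]; pose K := lift_op bk.
have wK : wop K := wop_lift bk.
have pK u : 0 <= ip (K u) u by apply: pk; exact: L2P.
pose v := vH (0, p); set l := lam e p.
have kk : forall w, ip (K (K v)) w = ip ((l ^+ 2)%:C *: v) w.
  apply: vH_eq => i; have [g [hg [ghg fE kE]]] := reg _ (L2_bH (0, p)).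
  have [lg lhg] : L2 muH g /\ L2 muH hg by move: ghg => [? [? _ _] [_ ? _]].
  have lkk : L2 muH (k (k (bH (0, p)))) by do 2 apply: (bounded_L2 bk); exact: L2_bH.
  have -> : ip (K (K v)) (vH i) = inner muH hg (bH i).
    by apply: inner_ae => //; exact: L2_bH.
  have fi : ip v (vH i) = inner muH g (bH i) + e%:C * inner muH hg (bH i).
    rewrite -[ip v _]/(inner muH (bH (0, p)) (bH i)).
    have le1 := L2_lin e%:C lhg lg.
    rewrite addrC -(inner_linear e%:C lhg lg (L2_bH i)); apply: inner_ae => //; try exact: L2_bH.
    by apply: filterS fE => z /[apply] ->; rewrite addrC.
  rewrite (gamma2_coef i ghg) in fi *.
  rewrite ipZl fi lam_sqr//; have P0 := Iq_neq0 q_gt0 q_lt1 i.2.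
  have fi0 : (0, p) != i -> inner muH g (bH i) = 0.
    move=> ne; move: fi; rewrite vH_orth (negbTE ne) /= mulrA -rcM -{1}[inner _ _ _]mul1r -mulrDl.
    rewrite -[1 in LHS]/(1%:C) => /esym /eqP; rewrite -[1 + _]/(1%:C + _) -rcD mulf_eq0 => /orP[/eqP[] /eqP|/eqP//].
    by rewrite gt_eqF// ltr_pwDl// mulr_ge0 ?sqr_ge0// ltW.
  have [ei|ne] := eqVneq (0, p) i; last by rewrite fi0// !mulr0 addr0 mulr0.
  rewrite -ei /=.
  have h : (iv p ^+ 2)%:C = ((Iq_val p ^+ 2 + e)^-1)%:C * (1 + e%:C * (iv p ^+ 2)%:C) :> R[i].
    rewrite -[1]/(1%:C) -!rcM -rcD -rcM; congr (_%:C); rewrite /iv.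
    have P0' := Iq_neq0 q_gt0 q_lt1 p; have : Iq_val p ^+ 2 + e != 0 by rewrite gt_eqF// ltr_wpDl ?sqr_ge0.
    by move: (Iq_val p) P0' => x x0 xe; field; rewrite xe x0.
  move: h (inner _ g _); move: (iv p ^+ 2)%:C (_^-1)%:C e%:C => a b c h A.
  by rewrite {1}h; ring.
have nv : nrm2 (K v - l%:C *: v) = 0.
  set w := K v - l%:C *: v.
  have : ip (K w) w + l%:C * ip w w = 0.
    rewrite {1}/w (wopB wK) (wopZ wK) kk {3}/w !ipBl !ipZl rcX; ring.
  move/(congr1 (fun z => Re z)); rewrite ReD ReZ -/(nrm2 w) => h.
  have h1 : 0 <= Re (ip (K w) w) by have := pK w; rewrite lecE => /andP[].
  have h2 := nrm2_ge0 w; have l0 : 0 < l := lam_gt0 p e0.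
  by apply/eqP; rewrite eq_le h2 andbT; nra.
have e1 w : ip (K v) w = ip (l%:C *: v) w.
  by apply/eqP; rewrite -subr_eq0 -ipBl ip_null.
by apply: filterS (ip_eq_ae e1) => z.
Qed.

Lemma Tr_sqrt_reg e k (x : opH q) : 0 < e -> is_sqrt_reg muH (@gamma_star_gamma R q) e k ->
  bounded_op muH muH x ->
  Tr (k \o x \o k) = (\esum_(p in [set: I])
    ((Iq_val p ^+ 2 + e)^-1 * Re (inner muH (x (ebasis 0 p)) (ebasis 0 p)))%:E)%E.
Proof.
move=> e0 rk bx; have [bk pk _] := rk; apply: eq_esum => p _.
have lv := L2_bH (0, p).
have lk := bounded_L2 bk lv; have lxk := bounded_L2 bx lk; have lkxk := bounded_L2 bk lxk.
rewrite slice_integral//; congr (_%:E).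
pose K := lift_op bk; pose X := lift_op bx; pose v := vH (0, p).
have wK : wop K := wop_lift bk.
have pK u : 0 <= ip (K u) u by apply: pk; exact: L2P.
rewrite -[inner muH _ _]/(ip (K (X (K v))) v) (pos_sym wK pK).
have eig : forall w, ip (K v) w = ip ((lam e p)%:C *: v) w.
  apply: ae_ip_eq; apply: filterS (sqrt_reg_eigen p e0 rk) => z /[apply]; exact.
rewrite -ip_cj eig ip_cj (wop_null (wop_lift bx) (ip_eq_null eig)).
rewrite (wopZ (wop_lift bx)) ipZr cj_real -/(X v) mulrA -rcM -expr2 lam_sqr// ReZ.
by [].
Qed.

End Weight.

(** * The diagonal formula for phi *)

Lemma cvgn_sum (R : realType) (J : Type) (s : seq J) (u : J -> nat -> R) (l : J -> R) :
  (forall i, u i @ \oo --> l i) ->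
  (fun n => \sum_(i <- s) u i n) @ \oo --> \sum_(i <- s) l i.
Proof.
move=> ul; elim: s => [|i s IH].
  by rewrite big_nil; under eq_fun do rewrite big_nil; exact: cvg_cst.
by rewrite big_cons; under eq_fun do rewrite big_cons; exact: cvgD.
Qed.

Section WeightFormula.
Variables (R : realType) (q : R).
Hypotheses (q_gt0 : 0 < q) (q_lt1 : q < 1).
Local Notation I := (Iq q).
Local Notation T := (circle R).
Local Notation muH := (mu_H q).
Local Notation vH := (@vH R q).
Local Notation bH := (@bH R q).

Let iv (p : I) := (Iq_val p)^-1.

Let shift (i : int * I) : int * I := (i.1 + 1, i.2).
Let unshift (i : int * I) : int * I := (i.1 - 1, i.2).

Lemma gamma_of_coef (g h : L2H muH) :
  (forall i, ip h (vH (shift i)) = (iv i.2)%:C * ip g (vH i)) ->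
  gamma (g : L2_type muH) (h : L2_type muH).
Proof.
move=> gh; split; [exact: L2P|exact: L2P|] => e e0.
have [s1 u1 h1] := parseval_cvg (@vH_orth R q) (@vH_total R q) g e0.
have [s2 u2 h2] := parseval_cvg (@vH_orth R q) (@vH_total R q) h e0.
pose s := undup (s1 ++ map unshift s2).
have us : uniq s := undup_uniq _.
have sinj : injective shift by move=> [m p] [n r] [/addIr -> ->].
pose f' := fourier_sum vH g s; pose h' := fourier_sum vH h (map shift s).
exists (f' : L2_type muH), (h' : L2_type muH); split.
- pose i0 : int * I := (0, point); pose i_ (j : 'I_(size s)) := nth i0 s j.
  exists (size s), (fun j => ip g (vH (i_ j))), (fun j => (i_ j).1), (fun j => (i_ j).2).
  split.
    rewrite /f' /fourier_sum (L2_val_sum s (fun i => ip g (vH i)) vH).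
    by apply/funext => z; rewrite (big_nth i0) big_mkord.
  rewrite /h' /fourier_sum big_map.
  rewrite (L2_val_sum s (fun i => ip h (vH (shift i))) (fun i => vH (shift i))).
  apply/funext => z; rewrite (big_nth i0) big_mkord; apply: eq_bigr => j _.
  by rewrite gh [_ * ip _ _]mulrC.
- rewrite -[X in X < _]/(norm2sq muH (g - f' : L2_type muH)) -nrm2E.
  by apply: h1 => // i i1; rewrite mem_undup mem_cat i1.
- rewrite -[X in X < _]/(norm2sq muH (h - h' : L2_type muH)) -nrm2E.
  apply: h2; first by rewrite map_inj_uniq.
  move=> i i2; have -> : i = shift (unshift i) by case: i {i2} => m p; rewrite /shift /= subrK.
  by rewrite mem_map// mem_undup mem_cat map_f ?orbT.
Qed.

Lemma sqrt_reg_exists (e : R) : 0 < e ->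
  is_sqrt_reg muH (@gamma_star_gamma R q) e (mulI (lam e)).
Proof.
move=> e0; have lame (p : I) : lam e p ^+ 2 <= e^-1.
  by rewrite lam_sqr// lef_pV2 ?posrE ?ltr_wpDl ?sqr_ge0// lerDr sqr_ge0.
have D0 (p : I) : 0 < Iq_val p ^+ 2 + e by rewrite ltr_wpDl ?sqr_ge0.
split; first exact: bounded_mulI lame.
  move=> f lf; rewrite lecE /=; apply/andP; split.
    apply/eqP; rewrite /Rintegral integral0_eq// => z _.
    by rewrite /mulI -mulrA -normsqE -rcM.
  apply: Rintegral_ge0 => z _; rewrite /mulI -mulrA -normsqE -rcM /=.
  by rewrite mulr_ge0 ?normsq_ge0// ltW// lam_gt0.
move=> f lf.
pose r1 (p : I) := Iq_val p ^+ 2 / (Iq_val p ^+ 2 + e).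
pose r2 (p : I) := (Iq_val p ^+ 2 + e)^-1.
pose r3 (p : I) := Iq_val p / (Iq_val p ^+ 2 + e).
have b1 p : r1 p ^+ 2 <= 1.
  have r0 : 0 <= r1 p by rewrite /r1 divr_ge0 ?sqr_ge0// (ltW (D0 p)).
  by rewrite expr_le1// /r1 (ler_pdivrMr _ _ (D0 p)) mul1r lerDl ltW.
have b2 p : r2 p ^+ 2 <= (e^-1) ^+ 2.
  have r0 : 0 <= r2 p by rewrite /r2 invr_ge0 (ltW (D0 p)).
  have e1 : 0 <= e^-1 by rewrite invr_ge0 ltW.
  by rewrite ler_sqr ?nnegrE// /r2 lef_pV2 ?posrE// lerDr sqr_ge0.
have b3 p : r3 p ^+ 2 <= e^-1.
  rewrite /r3 expr_div_n ler_pdivrMr ?exprn_gt0// mulrC ler_pdivlMr//.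
  by have := sqr_ge0 (Iq_val p); move: (D0 p) e0 (Iq_val p ^+ 2) => _ ? a ?; nra.
have l1 := L2_mulI b1 lf; have l2 := L2_mulI b2 lf; have l3 := L2_bshift (L2_mulI b3 lf).
exists (mulI r1 f), (mulI r2 f); split.
- exists (bshift (mulI r3 f)).
    apply: (@gamma_of_coef (mkL2 l1) (mkL2 l3)) => -[m p].
    rewrite -[LHS]/(inner muH _ _) -[X in _ * X]/(inner muH (mulI r1 f) (bH (m, p))).
    rewrite inner_bshift; last exact: L2_mulI b3 lf.
    rewrite (inner_mulI _ b3 lf) (inner_mulI _ b1 lf) mulrA -rcM; congr (_%:C * _).
    rewrite /r3 /r1 /iv /=; have x0 := Iq_neq0 q_gt0 q_lt1 p; have := D0 p.
    by move: (Iq_val p) x0 => x x0 xe; field; rewrite x0 gt_eqF.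
  split=> // u h uh.
  apply: (gamma_form (u := mkL2 l3) (v := mkL2 l2)) uh => m p.
  rewrite -(ip_cj (mkL2 l3 : L2H muH)) -(ip_cj (mkL2 l2 : L2H muH)).
  rewrite -[X in conj X]/(inner muH (bshift (mulI r3 f)) (bH (m + 1, p))).
  rewrite -[X in _ = conj X]/(inner muH (mulI r2 f) (bH (m, p))).
  rewrite inner_bshift; last exact: L2_mulI b3 lf.
  rewrite (inner_mulI _ b3 lf) (inner_mulI _ b2 lf) !cjM !cj_real mulrA -rcM; congr (_%:C * _).
  rewrite /r3 /r2 /=; have x0 := Iq_neq0 q_gt0 q_lt1 p; have := D0 p.
  by move: (Iq_val p) x0 => x x0 xe; field; rewrite x0 gt_eqF.
- apply: aeW => z _; rewrite /mulI mulrA -rcM -mulrDl -rcD.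
  rewrite (_ : r1 z.2 + e * r2 z.2 = 1); first by rewrite mul1r.
  rewrite /r1 /r2; have := D0 z.2; move: (Iq_val z.2 ^+ 2) => x xe.
  by rewrite -mulrDl divff// gt_eqF.
- by apply: aeW => z _; rewrite /mulI mulrA -rcM -expr2 lam_sqr.
Qed.

(** The density of phi is diagonal, so phi only sees the diagonal of x. *)
Theorem phi_formula (x : opH q) : bounded_op muH muH x ->
  (forall p, 0 <= Re (inner muH (x (ebasis 0 p)) (ebasis 0 p))) ->
  phi x = (\esum_(p in [set: I])
    ((Iq_val p ^+ 2)^-1 * Re (inner muH (x (ebasis 0 p)) (ebasis 0 p)))%:E)%E.
Proof.
move=> bx; set X := fun p : I => Re (inner muH (x (ebasis 0 p)) (ebasis 0 p)) => X0.
rewrite -/(X _); have P0 (p : I) : 0 < Iq_val p ^+ 2 by rewrite exprn_even_gt0// Iq_neq0.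
apply/eqP; rewrite eq_le; apply/andP; split.
  apply: ge_ereal_sup => _ [e [k [e0 rk ->]]]; rewrite (Tr_sqrt_reg q_gt0 q_lt1 e0 rk bx).
  apply: le_esum => p _; rewrite lee_fin ler_wpM2r ?X0//.
  by rewrite lef_pV2 ?posrE ?addr_gt0// lerDl ltW.
apply: ge_ereal_sup => _ [F [fF _] <-].
have phi_ge e : 0 < e -> (\sum_(p \in F) ((Iq_val p ^+ 2 + e)^-1 * X p)%:E <= phi x)%E.
  move=> e0; apply: (@le_trans _ _ (Tr (mulI (lam e) \o x \o mulI (lam e)))); last first.
    by apply: ereal_sup_ubound; exists e, (mulI (lam e)); split => //; exact: sqrt_reg_exists.
  rewrite (Tr_sqrt_reg q_gt0 q_lt1 e0 (sqrt_reg_exists e0) bx).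
  by apply: ereal_sup_ubound; exists F.
rewrite fsumEFin//.
have sE e : (\sum_(p \in F) ((Iq_val p ^+ 2 + e)^-1 * X p)%:E = (\sum_(p \in F) ((Iq_val p ^+ 2 + e)^-1 * X p))%:E)%E.
  by rewrite fsumEFin.
apply/lee_addgt0Pr => d d0; rewrite -leeBlDr//.
pose G (n : nat) := \sum_(p \in F) ((Iq_val p ^+ 2 + n.+1%:R^-1)^-1 * X p).
have Gc : G @ \oo --> \sum_(p \in F) ((Iq_val p ^+ 2)^-1 * X p).
  rewrite /G; under eq_fun do rewrite fsbig_finite//=.
  rewrite fsbig_finite//=; apply: cvgn_sum => p; apply: cvgMl.
  apply: cvgV; first by rewrite gt_eqF.
  rewrite -[X in _ --> X]addr0; apply: cvgD; first exact: cvg_cst.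
  exact: cvg_harmonic.
have /cvgrPdist_lt/(_ _ d0)[N _ /(_ N (leqnn N))] := Gc => hN.
apply: (le_trans _ (phi_ge N.+1%:R^-1 _)); last by rewrite invr_gt0.
rewrite sE -EFinB lee_fin lerBlDr -lerBlDl; apply: ltW.
by apply: le_lt_trans hN; exact: ler_norm.
Qed.

End WeightFormula.

(** * Limits of operators *)

Section Lift0.
Context d1 (X : measurableType d1) d2 (Y : measurableType d2) (R : realType).
Variables (mu : {measure set X -> \bar R}) (nu : {measure set Y -> \bar R}).
Variables (A : op X Y R) (lA : forall f, L2 mu f -> L2 nu (A f)).

Definition wrapL2 (f : L2H mu) : L2H nu := mkL2 (lA (L2P (f : L2_type mu))).

Lemma bounded_of_wop : wop wrapL2 -> bounded_op mu nu A.
Proof.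
move=> [lin [M MA]]; split=> // [a f g lf lg|]; last first.
  by exists M => f lf; have := MA (mkL2 lf); rewrite !nrm2E.
pose F : L2H mu := mkL2 lf; pose G : L2H mu := mkL2 lg.
have h w : ip (wrapL2 (a *: F + G)) w = ip (a *: wrapL2 F + wrapL2 G) w.
  by rewrite lin ip_linear.
have := ip_eq_ae h.
rewrite (L2_val_lin a (wrapL2 F : L2_type nu) (wrapL2 G : L2_type nu)).
rewrite -[(wrapL2 (a *: F + G) : L2_type nu) : _ -> _]/(A (a *: (F : L2_type mu) + (G : L2_type mu) : L2_type mu)).
by rewrite L2_val_lin.
Qed.

End Lift0.

Section ComplexLimits.
Variable R : realType.
Implicit Types (u v : nat -> R[i]) (l a : R[i]).

(** Convergence of complex sequences, through real and imaginary parts. *)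
Definition ccvg u l := (fun n => Re (u n)) @ \oo --> Re l /\ (fun n => Im (u n)) @ \oo --> Im l.

Lemma ccvg_normsq u l :
  (forall e : R, 0 < e -> exists N, forall k, (N <= k)%N -> normsq (u k - l) < e) -> ccvg u l.
Proof.
have gen (f : R[i] -> R) : (forall z w, f (z - w) = f z - f w) -> (forall z, f z ^+ 2 <= normsq z) ->
    (forall e : R, 0 < e -> exists N, forall k, (N <= k)%N -> normsq (u k - l) < e) ->
    (fun n => f (u n)) @ \oo --> f l.
  move=> fB fn h; apply/cvgrPdist_lt => e e0; have [N hN] := h _ (exprn_gt0 2 e0).
  exists N => // k /= Nk; rewrite -[ltLHS]ger0_norm// -ltr_sqr ?nnegrE ?(ltW e0)//.
  rewrite normr_id distrC -fB real_normK ?num_real//.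
  by apply: (le_lt_trans (fn _)); exact: hN.
move=> h; split; apply: gen h => //.
- by move=> z w; rewrite ReD ReN.
- exact: Re_sqr_le.
- by move=> z w; rewrite ImD ImN.
- by move=> z; rewrite /normsq lerDr sqr_ge0.
Qed.

Lemma ccvgZ a u l : ccvg u l -> ccvg (fun n => a * u n) (a * l).
Proof.
have reM (z w : R[i]) : Re (z * w) = Re z * Re w - Im z * Im w by case: z w => ? ? [].
have imM (z w : R[i]) : Im (z * w) = Re z * Im w + Im z * Re w by case: z w => ? ? [].
move=> [h1 h2]; split.
- by under eq_fun do rewrite reM; rewrite reM; apply: cvgB; apply: cvgMr.
- by under eq_fun do rewrite imM; rewrite imM; apply: cvgD; apply: cvgMr.
Qed.

Lemma ccvg_sum (J : Type) (s : seq J) (u : J -> nat -> R[i]) (l : J -> R[i]) :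
  (forall i, ccvg (u i) (l i)) ->
  ccvg (fun n => \sum_(i <- s) u i n) (\sum_(i <- s) l i).
Proof.
move=> h; split.
- by under eq_fun do rewrite Re_sum; rewrite Re_sum; apply: cvgn_sum => i; case: (h i).
- by under eq_fun do rewrite Im_sum; rewrite Im_sum; apply: cvgn_sum => i; case: (h i).
Qed.

Lemma ccvg_unique u l l' : ccvg u l -> ccvg u l' -> l = l'.
Proof.
move=> [h1 h2] [h3 h4]; apply: eq_ReIm.
- by rewrite -(cvg_lim _ h1)// -(cvg_lim _ h3).
- by rewrite -(cvg_lim _ h2)// -(cvg_lim _ h4).
Qed.

End ComplexLimits.

Lemma wop_pos_dense (R : realType) (E : semihilbert R) (T : E -> E) (D : set E) :
  wop T -> hdense D -> (forall u, D u -> 0 <= ip (T u) u) -> forall u, 0 <= ip (T u) u.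
Proof.
move=> wT dD pD u; have [M M0 MT] := wop_bound wT.
pose K : R := 2 * (M * nrm2 u) + 2 * (M * (2 * nrm2 u + 2)).
have close (e : R) : 0 < e -> e <= 1 -> exists2 v, 0 <= ip (T v) v &
    normsq (ip (T u) u - ip (T v) v) <= K * e.
  move=> e0 e1; have [v Dv uv] := dD u _ e0; exists v; first exact: pD.
  have -> : ip (T u) u - ip (T v) v = ip (T (u - v)) u + ip (T v) (u - v).
    by rewrite (wopB wT) ipBr; ring.
  have nv : nrm2 v <= 2 * nrm2 u + 2.
    have -> : v = u + - (u - v) by rewrite opprB addrC subrK.
    apply: (le_trans (nrm2D_le _ _)); rewrite nrm2N lerD2l.
    by rewrite -[leRHS]mulr1 ler_pM2l// (le_trans (ltW uv)).
  apply: (le_trans (normsqD_le _ _)); rewrite /K (mulrDl (2 * (M * nrm2 u))).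
  have := cauchy_schwarz (T (u - v)) u; have := cauchy_schwarz (T v) (u - v).
  have := MT (u - v); have := MT v.
  have := nrm2_ge0 u; have := nrm2_ge0 v; have := nrm2_ge0 (u - v); have := nrm2_ge0 (T v).
  move: (normsq (ip (T (u - v)) u)) (normsq (ip (T v) (u - v))) nv uv; move: (nrm2 (u - v)) (nrm2 (T (u - v))) (nrm2 (T v)).
  move=> a b c z y nv uv c0 a0 v0 u0 h1 h2 h3 h4.
  have k1 : z <= M * nrm2 u * e.
    apply: (le_trans h4); apply: (@le_trans _ _ (M * a * nrm2 u)); first exact: ler_wpM2r.
    by rewrite -!mulrA ler_pM2l// [a * _]mulrC ler_wpM2l// ltW.
  have k2 : y <= M * (2 * nrm2 u + 2) * e.
    apply: (le_trans h3); apply: ler_pM => //; last exact: ltW.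
    by apply: (le_trans h1); rewrite ler_pM2l.
  by apply: lerD; rewrite -mulrA ler_pM2l.
have K0 : 0 <= K.
  by have u0 := nrm2_ge0 u; rewrite /K; apply: addr_ge0; rewrite !mulr_ge0 ?addr_ge0 ?mulr_ge0// ltW.
have small (a : R) : (forall e : R, 0 < e -> e <= 1 -> a <= K * e) -> a <= 0.
  move=> h; apply: (@le0_small _ _ K) => e e0; have [e1|e1] := leP e 1; first exact: h.
  by apply: (le_trans (h 1 _ _)) => //; rewrite ler_wpM2l// ltW.
rewrite lecE /=; apply/andP; split.
  rewrite -sqrf_eq0 eq_le sqr_ge0 andbT; apply: small => e e0 e1.
  have [v + le] := close e e0 e1; rewrite lecE /= => /andP[/eqP iv _].
  apply: le_trans le; rewrite /normsq ImD ImN iv oppr0 addr0 lerDr.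
  exact: sqr_ge0.
rewrite leNgt; apply/negP => neg.
have : Re (ip (T u) u) ^+ 2 <= 0.
  apply: small => e e0 e1; have [v + le] := close e e0 e1; rewrite lecE /= => /andP[_ rv].
  apply: le_trans le; apply: le_trans (Re_sqr_le _); rewrite ReD ReN.
  by move: (Re _) (Re _) neg rv => a b; nra.
by rewrite le_eqVlt ltNge sqr_ge0 orbF sqrf_eq0 => /eqP e0; move: neg; rewrite e0 ltxx.
Qed.

Section Expansion.
Variables (R : realType) (E : semihilbert R) (J : choiceType) (b : J -> E).
Hypothesis orth : forall i j, ip (b i) (b j) = (i == j)%:R.
Hypothesis total : forall g : E, (forall i, ip g (b i) = 0) -> nrm2 g = 0.

(** A vector whose coefficients live on a sequence of basis vectors is the
    sum of the corresponding series. *)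
Lemma expand_series (w : E) (iota_ : nat -> J) : injective iota_ ->
  (forall i, ip w (b i) != 0 -> exists n, i = iota_ n) ->
  forall (F : semihilbert R) (S : E -> F) v, wop S ->
  ccvg (fun N => \sum_(0 <= n < N) ip w (b (iota_ n)) * ip (S (b (iota_ n))) v) (ip (S w) v).
Proof.
move=> inj supp F S v wS; apply: ccvg_normsq => e e0; have [M M0 SM] := wop_bound wS.
have e1 : 0 < e / (M * nrm2 v + 1).
  by rewrite divr_gt0// ltr_wpDl// mulr_ge0 ?nrm2_ge0 ?(ltW M0).
have [s0 us0 h] := parseval_cvg orth total w e1.
have [N hN] : exists N, forall i, i \in s0 -> ip w (b i) != 0 -> exists2 n, (n < N)%N & i = iota_ n.
  elim: s0 {us0 h} => [|j s [N IH]]; first by exists 0%N.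
  have [j0|j0] := eqVneq (ip w (b j)) 0.
    by exists N => i; rewrite inE => /orP[/eqP ->|]; [rewrite j0 eqxx|exact: IH].
  have [n jn] := supp _ j0; exists (maxn N n.+1) => i; rewrite inE => /orP[/eqP -> _|si i0].
    by exists n => //; rewrite leq_max leqnn orbT.
  by have [k kN ->] := IH _ si i0; exists k => //; rewrite leq_max kN.
exists N => k Nk; pose t := map iota_ (iota 0 k).
have ut : uniq t by rewrite map_inj_uniq// iota_uniq.
have sumE : \sum_(0 <= n < k) ip w (b (iota_ n)) * ip (S (b (iota_ n))) v =
    ip (S (fourier_sum b w t)) v.
  by rewrite /fourier_sum (wop_sum wS) big_map /index_iota subn0.
rewrite sumE -(wopB wS).
have nt : nrm2 (fourier_sum b w t - w) < e / (M * nrm2 v + 1).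
  rewrite nrm2BC; apply: le_lt_trans (h _ us0 (fun _ => id)).
  rewrite !(nrm2_sub_fourier_sum orth)// lerD2l lerN2.
  rewrite (bigID (fun i => i \in t)) /= [X in _ + X]big1_seq ?addr0; last first.
    move=> i /andP[it si]; have [->|i0] := eqVneq (ip w (b i)) 0.
      by rewrite /normsq /= expr0n addr0.
    have [n nN iE] := hN _ si i0; move: it; rewrite iE map_f//.
    by rewrite mem_iota (leq_trans nN Nk).
  rewrite -big_filter; apply: (le_sum_normsq orth) => //; first exact: filter_uniq.
  by move=> i; rewrite mem_filter => /andP[].
apply: (le_lt_trans (cauchy_schwarz _ _)).
apply: (@le_lt_trans _ _ (nrm2 (fourier_sum b w t - w) * (M * nrm2 v + 1))).
  apply: (@le_trans _ _ (M * nrm2 (fourier_sum b w t - w) * nrm2 v)).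
    by rewrite ler_wpM2r ?nrm2_ge0.
  by rewrite [M * _]mulrC -mulrA ler_wpM2l ?nrm2_ge0// lerDl.
by rewrite -ltr_pdivlMr// ltr_wpDl// mulr_ge0 ?nrm2_ge0 ?(ltW M0).
Qed.

(** An increasing sequence of positive operators whose matrix converges to a
    scalar matrix converges weakly to that scalar, which bounds it. *)
Variables (T : nat -> E -> E) (phi : R).
Hypotheses (phi_ge0 : 0 <= phi) (wT : forall N, wop (T N)).
Hypothesis pT : forall N u, 0 <= ip (T N u) u.
Hypothesis mT : forall N u, Re (ip (T N u) u) <= Re (ip (T N.+1 u) u).
Hypothesis limT : forall i j, ccvg (fun N => ip (T N (b i)) (b j)) (phi%:C * (i == j)%:R).

Let D N u : E := phi%:C *: u - T N u.

Let wD N : wop (D N).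
Proof.
apply: wop_sub => //; split=> [a u v w|]; first by rewrite scalerDr !ipDl !ipZl; ring.
by exists (normsq phi%:C) => u; rewrite nrm2Z.
Qed.

Let limD u : lspan b u -> (fun N => Re (ip (D N u) u)) @ \oo --> (0 : R).
Proof.
move=> [s [c ->]]; set v := \sum_(i <- s) _.
have := @ccvg_sum _ _ s (fun i N => \sum_(j <- s) c i * conj (c j) * ip (T N (b i)) (b j))
  (fun i => \sum_(j <- s) c i * conj (c j) * (phi%:C * (i == j)%:R)) _.
have h1 N : \sum_(i <- s) \sum_(j <- s) c i * conj (c j) * ip (T N (b i)) (b j) = ip (T N v) v.
  rewrite /v (wop_sum (wT N)); apply: eq_bigr => i _; rewrite ip_sumr mulr_sumr.
  by apply: eq_bigr => j _; rewrite ipZr mulrA.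
have h2 : \sum_(i <- s) \sum_(j <- s) c i * conj (c j) * (phi%:C * (i == j)%:R) = phi%:C * ip v v.
  rewrite /v ip_suml mulr_sumr; apply: eq_bigr => i _; rewrite ipZl ip_sumr !mulr_sumr.
  by apply: eq_bigr => j _; rewrite ipZr orth; ring.
rewrite h2; under eq_fun do rewrite h1.
have h3 i : ccvg (fun N => \sum_(j <- s) c i * conj (c j) * ip (T N (b i)) (b j))
   (\sum_(j <- s) c i * conj (c j) * (phi%:C * (i == j)%:R)).
  by apply: ccvg_sum => j; apply: ccvgZ.
move=> /(_ h3) [h _].
have -> : (fun N => Re (ip (D N v) v)) = (fun N => Re (phi%:C * ip v v) - Re (ip (T N v) v)).
  by apply/funext => N; rewrite /D ipBl ipZl ReD ReN.
by rewrite -(subrr (Re (phi%:C * ip v v))); apply: cvgB => //; exact: cvg_cst.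
Qed.

Let antiD N M u : (N <= M)%N -> Re (ip (D M u) u) <= Re (ip (D N u) u).
Proof.
move=> /subnK <-; elim: (M - N)%N => [|k IH]//; apply: le_trans IH.
by rewrite /D !ipBl !ReD !ReN lerD2l lerN2 addSn.
Qed.

Let posD N u : 0 <= ip (D N u) u.
Proof.
apply: (wop_pos_dense (wD N) (hdense_lspan orth total)) => {}u su.
rewrite lecE /=; apply/andP; split.
  rewrite /D ipBl ipZl ImD ImN ImZ.
  have : 0 <= ip (T N u) u by exact: pT.
  rewrite lecE /= => /andP[/eqP -> _]; rewrite subr0.
  by rewrite ip_nrm2 /= mulr0.
apply: (@ler_cvg_to _ \oo _ _ (fun N => Re (ip (D N u) u)) (fun=> Re (ip (D N u) u)) 0).
- exact: limD.
- exact: cvg_cst.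
- by exists N => // M /= NM; exact: antiD.
Qed.

Let Re_posD N u : 0 <= Re (ip (D N u) u).
Proof. by have := posD N u; rewrite lecE => /andP[]. Qed.

Let D_le N u : Re (ip (D N u) u) <= phi * nrm2 u.
Proof.
rewrite /D ipBl ipZl ReD ReN ReZ gerBl.
by have := pT N u; rewrite lecE => /andP[].
Qed.

Lemma increasing_bound N u v : `|Re (ip (T N u) v)| <= phi * (nrm2 u + nrm2 v).
Proof.
have le w : Re (ip (T N w) w) <= phi * nrm2 w.
  by have := Re_posD N w; rewrite /D ipBl ipZl ReD ReN ReZ subr_ge0.
have ge w : 0 <= Re (ip (T N w) w) by have := pT N w; rewrite lecE => /andP[].
have u0 := nrm2_ge0 u; have v0 := nrm2_ge0 v.
rewrite -ler_sqr ?nnegrE ?mulr_ge0 ?addr_ge0// real_normK ?num_real//.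
apply: (le_trans (Re_sqr_le _)); apply: (le_trans (pos_cauchy_schwarz (wT N) (pT N) u v)).
apply: (@le_trans _ _ ((phi * nrm2 u) * (phi * nrm2 v))); first exact: ler_pM.
have : 0 <= phi ^+ 2 * (nrm2 u ^+ 2 + nrm2 u * nrm2 v + nrm2 v ^+ 2).
  by rewrite mulr_ge0 ?sqr_ge0// !addr_ge0 ?sqr_ge0// mulr_ge0.
by move=> h; rewrite -subr_ge0; apply: (le_trans h); apply: eq_ler; ring.
Qed.

Lemma increasing_cvg u v : ccvg (fun N => ip (T N u) v) (phi%:C * ip u v).
Proof.
have to0 w : forall e : R, 0 < e -> exists N, forall k, (N <= k)%N -> Re (ip (D k w) w) < e.
  move=> e e0; have d0 : 0 < e / (4 * (phi + 1)) by rewrite divr_gt0// mulr_gt0// ltr_wpDl.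
  have [z sz wz] := hdense_lspan orth total w d0.
  have e4 : 0 < e / 4 by rewrite divr_gt0.
  have /cvgrPdist_lt/(_ _ e4)[N _ hN] := limD sz.
  exists N => k Nk; have := hN k Nk; rewrite sub0r normrN ger0_norm// => hz.
  have par : Re (ip (D k w) w) <= 2 * Re (ip (D k z) z) + 2 * Re (ip (D k (w - z)) (w - z)).
    have := Re_posD k (z - (w - z)).
    have -> : ip (D k w) w = ip (D k z) z + ip (D k (w - z)) (w - z) +
        (ip (D k z) (w - z) + ip (D k (w - z)) z).
      by rewrite !(wopB (wD k)) !ipBr; ring.
    rewrite (wopB (wD k)) ipBr [ip (D k (w - z)) (z - _)]ipBr !ReD !ReN !ReD !ReN.
    by move: (Re _) (Re _) (Re _) (Re _) => x1 x2 x3 x4; lra.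
  apply: (le_lt_trans par); have hD := D_le k (w - z); move: wz.
  rewrite ltr_pdivlMr ?mulr_gt0 ?ltr_wpDl// => wz.
  have : phi * nrm2 (w - z) <= nrm2 (w - z) * (phi + 1).
    by have := nrm2_ge0 (w - z); move: (nrm2 _) => x x0; nra.
  by move: hz wz hD; move: (nrm2 _) (Re _) (Re _) => x1 x2 x3; nra.
apply: ccvg_normsq => e e0.
have e1 : 0 < e / (phi * nrm2 v + 1) by rewrite divr_gt0// ltr_wpDl// mulr_ge0 ?nrm2_ge0.
have [N hN] := to0 u _ e1; exists N => k /hN; have h0 := Re_posD k u; rewrite ltr_pdivlMr; last first.
  by rewrite ltr_wpDl// mulr_ge0 ?nrm2_ge0.
apply: le_lt_trans.
have -> : ip (T k u) v - phi%:C * ip u v = - ip (D k u) v by rewrite /D ipBl ipZl; ring.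
have -> (z : R[i]) : normsq (- z) = normsq z by case: z => a c; rewrite /normsq /= !sqrrN.
apply: (le_trans (pos_cauchy_schwarz (wD k) (posD k) u v)).
by apply: ler_wpM2l => //; rewrite (le_trans (D_le k v))// lerDl.
Qed.

End Expansion.

(** * Invariance under the anti-automorphism and shifts *)

Lemma bounded_comp (R : realType) d1 (X : measurableType d1) d2 (Y : measurableType d2)
    d3 (Z : measurableType d3) (mu : {measure set X -> \bar R})
    (nu : {measure set Y -> \bar R}) (la : {measure set Z -> \bar R})
    (A : op X Y R) (B : op Y Z R) :
  bounded_op mu nu A -> bounded_op nu la B -> bounded_op mu la (B \o A).
Proof.
move=> bA bB; apply: (@bounded_of_wop _ _ _ _ _ _ _ _ (fun f lf => bounded_L2 bB (bounded_L2 bA lf))).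
exact: (wop_comp (wop_lift bB) (wop_lift bA)).
Qed.

Lemma bounded_id (R : realType) d (X : measurableType d) (mu : {measure set X -> \bar R}) :
  bounded_op mu mu id.
Proof. by split=> // [a f g _ _|]; [exact: aeW|exists 1 => f _; rewrite mul1r]. Qed.

Section Inversion.
Variables (R : realType) (q : R).
Hypotheses (q_gt0 : 0 < q) (q_lt1 : q < 1).
Local Notation I := (Iq q).
Local Notation T := (circle R).
Local Notation muH := (mu_H q).
Local Notation vH := (@vH R q).
Local Notation bH := (@bH R q).

Lemma positive_diag (a : opH q) (p : I) : positive_op muH a ->
  0 <= Re (inner muH (a (ebasis 0 p)) (ebasis 0 p)).
Proof. by move=> /(_ _ (L2_bH (0, p))); rewrite lecE => /andP[]. Qed.

(** Since J e_p is e_p up to a sign, J a* J and a have the same diagonal. *)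
Lemma phi_R (J a b : opH q) : is_J J -> bounded_op muH muH a ->
  positive_op muH a -> is_R J a b -> phi b = phi a.
Proof.
move=> [[JL Jl Ji _] Je] ba pa [astar [bs adj] ->].
pose JJ : L2H muH -> L2H muH := wrapL2 JL; pose A := lift_op ba; pose As := lift_op bs.
have JJlin c u v w : ip (JJ (c *: u + v)) w = conj c * ip (JJ u) w + ip (JJ v) w.
  rewrite -ip_linear; apply: ae_ip_eq.
  rewrite (L2_val_lin (conj c) (JJ u : L2_type muH) (JJ v : L2_type muH)).
  have -> : (JJ (c *: u + v) : L2_type muH) = J (c *: (u : L2_type muH) + (v : L2_type muH) : L2_type muH) :> (_ -> _) by [].
  by rewrite L2_val_lin; exact: Jl (L2P (u : L2_type muH)) (L2P (v : L2_type muH)).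
have JJip u v : ip (JJ u) (JJ v) = ip v u by apply: Ji; exact: L2P.
have JJn u : nrm2 (JJ u) = nrm2 u by rewrite /nrm2 JJip.
have JJnull u v : nrm2 (u - v) = 0 -> forall w, ip (JJ u) w = ip (JJ v) w.
  move=> uv w; have := JJlin (-1) v u w.
  rewrite ip_null; last by rewrite JJn scaleN1r addrC.
  by rewrite cjN cj1 mulN1r => /esym/eqP; rewrite addrC subr_eq0 => /eqP.
have wAs : wop As := wop_lift bs.
have bb : bounded_op muH muH (J \o astar \o J).
  apply: (@bounded_of_wop _ _ _ _ _ _ _ _ (fun f lf => JL _ (bounded_L2 bs (JL f lf)))).
  split=> [c u v w|]; last first.
    have [M M0 AM] := wop_bound wAs; exists M => u.
    by rewrite -[leLHS]/(nrm2 (JJ (As (JJ u)))) JJn (le_trans (AM _))// JJn.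
  rewrite -[LHS]/(ip (JJ (As (JJ (c *: u + v)))) w).
  rewrite -[ip (wrapL2 _ u) w]/(ip (JJ (As (JJ u))) w) -[ip (wrapL2 _ v) w]/(ip (JJ (As (JJ v))) w).
  rewrite -[X in X * _ + _](cjK c) -JJlin; apply: JJnull; apply: ip_eq_null => z.
  rewrite ip_linear -wAs.1; apply: wop_null => //; apply: ip_eq_null => y.
  by rewrite JJlin ip_linear.
have diag p : inner muH ((J \o astar \o J) (ebasis 0 p)) (ebasis 0 p) =
    inner muH (a (ebasis 0 p)) (ebasis 0 p).
  pose v := vH (0, p); pose sg : R := Num.sg (Iq_val p) ^ chi q (Iq_val p).
  have s2 : sg%:C * sg%:C = 1 :> R[i].
    rewrite -rcM -expr2 /sg (_ : _ ^+ 2 = 1)//.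
    have -> : (Num.sg (Iq_val p) ^ chi q (Iq_val p)) ^+ 2 = (Num.sg (Iq_val p) ^+ 2) ^ chi q (Iq_val p).
      by rewrite !exprnP !exprz_exp mulrC.
    by rewrite sqr_sg Iq_neq0// exp1rz.
  have Jv w : ip (JJ v) w = sg%:C * ip v w.
    rewrite -ipZl; apply: ae_ip_eq; apply: filterS (Je 0 p) => z; rewrite oppr0.
    by move=> /[apply].
  rewrite -[LHS]/(ip (JJ (As (JJ v))) v).
  have flip y : ip y v = sg%:C * ip y (JJ v).
    by rewrite -[ip y (JJ v)]ip_cj Jv cjM cj_real ip_cj mulrA s2 mul1r.
  rewrite flip JJip -[ip v (As _)]ip_cj.
  have -> : ip (As (JJ v)) v = sg%:C * ip (As v) v.
    rewrite -(wopZ wAs); apply: wop_null => //; apply: ip_eq_null => y.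
    by rewrite Jv ipZl.
  rewrite cjM cj_real mulrA s2 mul1r ip_cj.
  by apply/esym; apply: adj; exact: L2_bH (0, p).
rewrite (phi_formula q_gt0 q_lt1 bb); last by move=> p; rewrite diag positive_diag.
rewrite (phi_formula q_gt0 q_lt1 ba); last by move=> p; exact: positive_diag.
by apply: eq_esum => p _; rewrite diag.
Qed.

(** Bounded operators with the same matrix coincide. *)
Lemma coef_ext (B C : opH q) : bounded_op muH muH B -> bounded_op muH muH C ->
  (forall i j, inner muH (B (bH i)) (bH j) = inner muH (C (bH i)) (bH j)) ->
  forall f, L2 muH f -> B f = C f %[ae muH].
Proof.
move=> bB bC BC f lf.
apply: (@ip_eq_ae _ _ _ muH (lift_op bB (mkL2 lf)) (lift_op bC (mkL2 lf))).
apply: (wop_ext (wop_lift bB) (wop_lift bC) (hdense_lspan (@vH_orth R q) (@vH_total R q))) => i.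
by apply: vH_eq => j; exact: BC.
Qed.

Lemma bshift_bH m p : bshift (bH (m, p)) = bH (m + 1, p).
Proof.
apply/funext => z; rewrite /bshift /bH /ebasis /tens /= zetaD.
by rewrite mulrA [zeta 1 _ * _]mulrC.
Qed.

Lemma bounded_bshift : bounded_op muH muH (@bshift R q).
Proof.
split; first by move=> f lf; exact: L2_bshift.
  by move=> a f g _ _; apply: aeW => z _; rewrite /bshift; ring.
exists 1 => f lf; rewrite mul1r /norm2sq; under eq_Rintegral do rewrite normsqM normsq_zeta mul1r.
by [].
Qed.

Definition shift_invariant (B : opH q) := forall k p n r,
  inner muH (B (bH (k + 1, p))) (bH (n + 1, r)) = inner muH (B (bH (k, p))) (bH (n, r)).

Lemma shift_invariant_comm (B : opH q) : bounded_op muH muH B ->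
  (forall f, L2 muH f -> B (bshift f) = bshift (B f) %[ae muH]) -> shift_invariant B.
Proof.
move=> bB h k p n r; have lb := L2_bH (k, p); have lB := bounded_L2 bB lb.
rewrite -(inner_bshift n r lB) -bshift_bH; apply: inner_ae.
- by apply: (bounded_L2 bB); exact: L2_bshift.
- exact: L2_bshift.
- exact: L2_bH.
- exact: h.
Qed.

Local Notation gens := [set C | exists A B, [/\ Linfty_T A, BL2 (mu_I q) B &
  is_tensor_op (mu_T R) (mu_I q) A B C]].

Lemma Linfty_zeta : Linfty_T (fun u (t : T) => zeta 1 t * u t).
Proof.
have nz (t : T) (z : R[i]) : normsq (zeta 1 t * z) = normsq z by rewrite normsqM normsq_zeta mul1r.
split.
  split.
  - move=> f lf; apply: (@L2_le _ _ _ _ _ (fun t => normsq (f t))).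
    + by apply: cmeasurableM; [exact: cmeasurable_zeta|exact: L2_meas lf].
    + by move=> t; rewrite nz.
    + exact: L2_integrable.
  - by move=> a f g _ _; apply: aeW => t _; ring.
  - exists 1 => f lf; rewrite mul1r /norm2sq; under eq_Rintegral do rewrite nz.
    by [].
exists (zeta 1); split; first exact: cmeasurable_zeta.
  by exists 1; apply: aeW => t; rewrite normsq_zeta.
by move=> u _; exact: aeW.
Qed.

Lemma Linfty_id : Linfty_T (@id (T -> R[i])).
Proof.
split; first exact: bounded_id.
exists (fun=> 1); split; first exact: cmeasurable_cst.
  by exists 1; apply: aeW => t; rewrite /normsq /= expr1n expr0n addr0.
by move=> u _; apply: aeW => t _; rewrite mul1r.
Qed.

Lemma inner_bH_tens u v n r : L2 (mu_T R) u -> L2 (mu_I q) v ->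
  inner muH (tens u v) (bH (n, r)) = inner (mu_T R) u (zeta n) * v r.
Proof.
move=> lu lv; rewrite (inner_tens lu (L2_zeta R n) lv (L2_delta r)).
by rewrite inner_delta_r.
Qed.

Lemma commutant_bshift : commutant muH gens (@bshift R q).
Proof.
split; first exact: bounded_bshift.
move=> C [A [B [[bA [g [_ _ gE]]] bB [bC tC]]]].
apply: (coef_ext (bounded_comp bC bounded_bshift) (bounded_comp bounded_bshift bC)).
move=> [m p] [n r] /=; rewrite -(subrK 1 n).
have lz := L2_zeta R m; have lz1 := L2_zeta R (m + 1); have ld := L2_delta p.
have lC := bounded_L2 bC (L2_bH (m, p)).
rewrite inner_bshift// bshift_bH.
have cE k : inner muH (C (bH (k, p))) (bH (n - 1, r)) = inner (mu_T R) (A (zeta k)) (zeta (n - 1)) * B (delta p) r.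
  have l1 := bounded_L2 bC (L2_bH (k, p)).
  have l2 := L2_tens (bounded_L2 bA (L2_zeta R k)) (bounded_L2 bB ld).
  rewrite -(inner_bH_tens _ _ (bounded_L2 bA (L2_zeta R k)) (bounded_L2 bB ld)).
  by apply: (inner_ae l1 l2 (L2_bH _)); apply: tC ld; exact: L2_zeta.
rewrite cE.
have -> : inner muH (C (bH (m + 1, p))) (bH (n - 1 + 1, r)) =
    inner (mu_T R) (A (zeta (m + 1))) (zeta (n - 1 + 1)) * B (delta p) r.
  have l1 := bounded_L2 bC (L2_bH (m + 1, p)).
  have l2 := L2_tens (bounded_L2 bA lz1) (bounded_L2 bB ld).
  rewrite -(inner_bH_tens _ _ (bounded_L2 bA lz1) (bounded_L2 bB ld)).
  by apply: (inner_ae l1 l2 (L2_bH _)); exact: tC ld.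
congr (_ * _); rewrite !innerE.
have mA k : cmeasurable (fun t => A (zeta k) t * conj (zeta (n - 1) t)) by
  apply: cmeasurableM; [exact: L2_meas (bounded_L2 bA (L2_zeta R k))|apply: cmeasurable_conj; exact: cmeasurable_zeta].
apply: cint_ae.
- exact: mA.
- apply: cmeasurableM; [exact: L2_meas (bounded_L2 bA lz1)|apply: cmeasurable_conj; exact: cmeasurable_zeta].
- apply: filterS2 (gE _ lz) (gE _ lz1) => t h1 h2 tt; rewrite (h1 tt) (h2 tt) (zetaD m 1) (zetaD (n - 1) 1) cjM.
  have : zeta 1 t * conj (zeta 1 t) = 1 by rewrite cj_zeta -zetaD subrr zeta0.
  move: (zeta 1 t) (conj (zeta 1 t)) (g t) (zeta m t) (conj (zeta (n - 1) t)) => a b c e h ab.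
  by transitivity (c * e * h * (a * b)); [rewrite ab mulr1|ring].
Qed.

Lemma Mq_bounded (x : opH q) : Mq q x -> bounded_op muH muH x.
Proof. by case. Qed.

Lemma Mq_bshift (x : opH q) : Mq q x -> forall f, L2 muH f -> x (bshift f) = bshift (x f) %[ae muH].
Proof. by move=> [_ h]; apply: h; exact: commutant_bshift. Qed.

Lemma Mq_shift (x : opH q) : Mq q x -> shift_invariant x.
Proof.
move=> Mx; apply: shift_invariant_comm; first exact: Mq_bounded Mx.
exact: Mq_bshift Mx.
Qed.

End Inversion.

(** * Membership in M_q *)

Section Membership.
Variables (R : realType) (q : R).
Hypotheses (q_gt0 : 0 < q) (q_lt1 : q < 1).
Local Notation I := (Iq q).
Local Notation T := (circle R).
Local Notation muH := (mu_H q).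
Local Notation vH := (@vH R q).
Local Notation bH := (@bH R q).
Local Notation gens := [set C | exists A B, [/\ Linfty_T A, BL2 (mu_I q) B &
  is_tensor_op (mu_T R) (mu_I q) A B C]].

(** The matrix unit 1 (x) E_(r, p). *)
Definition munit (r p : I) (f : T * I -> R[i]) : T * I -> R[i] :=
  tens (fun t => f (t, p)) (delta r).

Lemma norm2sq_tens (u : T -> R[i]) (v : I -> R[i]) : L2 (mu_T R) u -> L2 (mu_I q) v ->
  norm2sq muH (tens u v) = norm2sq (mu_T R) u * norm2sq (mu_I q) v.
Proof.
move=> lu lv; rewrite -!inner_self (inner_tens lu lu lv lv).
have := ip_nrm2 (mkL2 lv : L2H (mu_I q)); rewrite ipE => ->.
by rewrite mulrC ReZ mulrC.
Qed.

Lemma norm2sq_delta (p : I) : norm2sq (mu_I q) (@delta R q p) = 1.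
Proof. by rewrite -inner_self inner_delta_r /delta eqxx. Qed.

Lemma L2_column (f : T * I -> R[i]) p : L2 muH f -> L2 (mu_T R) (fun t => f (t, p)).
Proof. by move=> lf; have h := ae_Iq (ae_L2_pair2 lf); exact: h p. Qed.

Lemma inner_column (f : T * I -> R[i]) p n : L2 muH f ->
  inner (mu_T R) (fun t => f (t, p)) (zeta n) = inner muH f (bH (n, p)).
Proof.
move=> lf; have [_ e] := cfubini1 (L2_mul_integrable lf (L2_bH (n, p))).
rewrite [RHS]innerE -[RHS]e innerE; apply: eq_cint => t; rewrite (@cint_single _ _ _ p _).2 /bH /ebasis /tens /=.
  by rewrite /delta eqxx mulr1.
by move=> x xp; rewrite /delta (negbTE xp) mulr0 cj0 mulr0.
Qed.

Lemma norm2sq_column (f : T * I -> R[i]) p : L2 muH f ->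
  norm2sq (mu_T R) (fun t => f (t, p)) <= norm2sq muH f.
Proof.
move=> lf; have lc := L2_column p lf.
rewrite -[leLHS]mulr1 -(norm2sq_delta p) -norm2sq_tens//; last exact: L2_delta.
apply: le_Rintegral => //.
- by apply: L2_integrable; apply: L2_tens => //; exact: L2_delta.
- exact: L2_integrable.
- move=> [t x] _; rewrite /tens /delta normsqM /=; case: eqP => [->|_].
    by rewrite [normsq 1%:R]/normsq /= expr1n expr0n addr0 mulr1.
  by rewrite [normsq 0%:R]/normsq /= expr0n addr0 mulr0 normsq_ge0.
Qed.

Lemma bounded_munit r p : bounded_op muH muH (munit r p).
Proof.
split.
- by move=> f lf; apply: L2_tens; [exact: L2_column|exact: L2_delta].
- by move=> a f g _ _; apply: aeW => z _; rewrite /munit /tens; ring.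
- exists 1 => f lf; rewrite mul1r norm2sq_tens; [|exact: L2_column|exact: L2_delta].
  by rewrite norm2sq_delta mulr1 norm2sq_column.
Qed.

Lemma gens_munit r p : gens (munit r p).
Proof.
exists id, (fun u x => u p * delta r x); split; first exact: Linfty_id.
  split.
  - move=> u lu; have := L2_lin (u p) (L2_delta r) (L2_0 (mu_I q)).
    by congr (L2 _ _); apply/funext => x; rewrite addr0.
  - by move=> a f g _ _; apply: aeW => x _; ring.
  - exists 1 => u lu; rewrite mul1r.
    pose U : L2H (mu_I q) := mkL2 lu; pose dl s : L2H (mu_I q) := mkL2 (L2_delta s).
    have -> : norm2sq (mu_I q) (fun x => u p * delta r x) = nrm2 (u p *: dl r) by rewrite nrm2E.
    have n1 s : nrm2 (dl s) = 1 by rewrite nrm2E norm2sq_delta.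
    rewrite nrm2Z n1 mulr1; have := cauchy_schwarz U (dl p).
    by rewrite n1 mulr1 nrm2E ipE inner_delta_r.
split; first exact: bounded_munit.
by move=> f g _ _; apply: aeW => z _; rewrite /munit /tens /= mulrA.
Qed.

Lemma gens_bshift : gens (@bshift R q).
Proof.
exists (fun u t => zeta 1 t * u t), id; split; first exact: Linfty_zeta.
  exact: bounded_id.
split; first exact: bounded_bshift.
by move=> f g _ _; apply: aeW => z _; rewrite /bshift /tens mulrA.
Qed.

Lemma inner_munit r p f n s : L2 muH f ->
  inner muH (munit r p f) (bH (n, s)) = (s == r)%:R * inner muH f (bH (n, p)).
Proof.
move=> lf; rewrite (inner_bH_tens _ _ (L2_column p lf) (L2_delta r)).
by rewrite inner_column// mulrC.
Qed.

Lemma munit_bH r p k s : munit r p (bH (k, s)) = fun z => (s == p)%:R * bH (k, r) z.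
Proof.
apply/funext => z; rewrite /munit /bH /ebasis /tens /= /delta [p == s]eq_sym.
by rewrite mulrAC [_ * (_ == p)%:R]mulrC mulrA [_ * zeta _ _]mulrC mulrAC.
Qed.

Lemma shift_invariant_diff (B : opH q) k p n r : shift_invariant B ->
  inner muH (B (bH (k, p))) (bH (n, r)) = inner muH (B (bH (0, p))) (bH (n - k, r)).
Proof.
move=> sB; elim/int_ind: k n => [n|k IH n|k IH n]; first by rewrite subr0.
  have kE : k.+1%:Z = k%:Z + 1 by rewrite -(addn1 k) PoszD.
  have nE : n - (k%:Z + 1) = n - 1 - k%:Z by rewrite opprD addrA addrAC.
  by rewrite kE nE -[in LHS](subrK 1 n) sB IH.
have kE : - k.+1%:Z + 1 = - k%:Z by rewrite -(addn1 k) PoszD opprD subrK.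
have nE : n - - k.+1%:Z = n + 1 - - k%:Z by rewrite -kE opprD addrACA subrr addr0.
by rewrite nE -sB kE IH.
Qed.

Lemma int_enumeration : exists z : nat -> int, injective z /\ forall k, exists n, k = z n.
Proof.
exists (fun n => if odd n then Negz n./2 else Posz n./2); split=> [m n|[n|n]].
- move=> h; rewrite -(odd_double_half m) -(odd_double_half n); move: h.
  by case: (odd m); case: (odd n) => // -[->].
- by exists n.*2; rewrite odd_double doubleK.
- by exists n.*2.+1; rewrite /= odd_double /= uphalf_double.
Qed.

(** An operator C in the commutant of the generators acts as a multiplication
    by a function c of the circle variable. Both B C and C B therefore have
    the coefficients sum_k c^(k - m) b_(p, r)(n - k). *)
Lemma Mq_of_shift_invariant (B : opH q) : bounded_op muH muH B -> shift_invariant B ->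
  Mq q B.
Proof.
move=> bB sB; split=> // C [bC hC].
have lB i := bounded_L2 bB (L2_bH i); have lC i := bounded_L2 bC (L2_bH i).
have sC : shift_invariant C.
  by apply: shift_invariant_comm => //; apply: hC; exact: gens_bshift.
have munitC r p f n s : L2 muH f -> inner muH (C (munit r p f)) (bH (n, s)) =
    (s == r)%:R * inner muH (C f) (bH (n, p)).
  move=> lf; have lCf := bounded_L2 bC lf; have lM := bounded_L2 (bounded_munit r p) lf.
  rewrite -(inner_munit r p n s lCf).
  apply: (inner_ae (bounded_L2 bC lM) (bounded_L2 (bounded_munit r p) lCf) (L2_bH _)).
  exact: (hC _ (gens_munit r p)).
have Cdiag k p n s : inner muH (C (bH (k, p))) (bH (n, s)) =
    (s == p)%:R * inner muH (C (bH (k, p))) (bH (n, p)).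
  rewrite -munitC; last exact: L2_bH.
  by rewrite munit_bH eqxx; congr (inner _ (C _) _); apply/funext => z; rewrite mul1r.
have Cp k p r n : inner muH (C (bH (k, p))) (bH (n, p)) = inner muH (C (bH (k, r))) (bH (n, r)).
  have := munitC r p (bH (k, p)) n r (L2_bH _); rewrite munit_bH !eqxx mul1r => <-.
  by congr (inner _ (C _) _); apply/funext => z; rewrite mul1r.
have [z [zinj zsurj]] := int_enumeration.
apply: (coef_ext (bounded_comp bC bB) (bounded_comp bB bC)) => -[m p] [n r].
pose CC := lift_op bC; pose BB := lift_op bB.
pose ch k := inner muH (C (bH (0, p))) (bH (k, p)).
pose bt k := inner muH (B (bH (0, p))) (bH (k, r)).
apply: (@ccvg_unique _ (fun N => \sum_(0 <= j < N) ch (z j - m) * bt (n - z j))).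
- have := expand_series (@vH_orth R q) (@vH_total R q) (w := CC (vH (m, p)))
    (iota_ := fun j => (z j, p)).
  have iinj : injective (fun j => (z j, p)) by move=> i j [/zinj].
  move=> /(_ iinj) h; have := h _ _ BB (vH (n, r)) (wop_lift bB).
  rewrite -[X in ccvg _ X]/(inner muH (B (C (bH (m, p)))) (bH (n, r))).
  have e N : \sum_(0 <= j < N) ip (CC (vH (m, p))) (vH (z j, p)) * ip (BB (vH (z j, p))) (vH (n, r)) =
      \sum_(0 <= j < N) ch (z j - m) * bt (n - z j).
    apply: eq_bigr => j _; rewrite -[ip (CC _) _]/(inner muH (C (bH (m, p))) (bH (z j, p))).
    rewrite -[ip (BB _) _]/(inner muH (B (bH (z j, p))) (bH (n, r))).
    by rewrite (shift_invariant_diff m p (z j) p sC) (shift_invariant_diff (z j) p n r sB).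
  under eq_fun do rewrite e.
  apply=> -[k s]; rewrite -[ip _ _]/(inner muH (C (bH (m, p))) (bH (k, s))) Cdiag => h0.
  have [j kj] := zsurj k; exists j; rewrite kj; congr (_, _).
  by apply/eqP; apply: contraNT h0 => sp; rewrite (negbTE sp) mul0r.
- pose w := mkL2 (bounded_L2 (bounded_munit r r) (lB (m, p))) : L2H muH.
  have := expand_series (@vH_orth R q) (@vH_total R q) (w := w)
    (iota_ := fun j => (n + m - z j, r)).
  have iinj : injective (fun j => (n + m - z j, r)) by move=> i j [/addrI/oppr_inj/zinj].
  move=> /(_ iinj) h; have := h _ _ CC (vH (n, r)) (wop_lift bC).
  rewrite -[X in ccvg _ X]/(inner muH (C (munit r r (B (bH (m, p))))) (bH (n, r))).
  rewrite munitC// eqxx mul1r.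
  have e N : \sum_(0 <= j < N) ip w (vH (n + m - z j, r)) * ip (CC (vH (n + m - z j, r))) (vH (n, r)) =
      \sum_(0 <= j < N) ch (z j - m) * bt (n - z j).
    apply: eq_bigr => j _; rewrite -[ip w _]/(inner muH (munit r r (B (bH (m, p)))) (bH (n + m - z j, r))).
    rewrite -[ip (CC _) _]/(inner muH (C (bH (n + m - z j, r))) (bH (n, r))).
    rewrite inner_munit// eqxx mul1r (shift_invariant_diff m p _ r sB).
    rewrite (shift_invariant_diff _ r n r sC) (Cp 0 r p) /ch /bt mulrC.
    have e1 : n - (n + m - z j) = z j - m by ring.
    have e2 : n + m - z j - m = n - z j by ring.
    by rewrite e1 e2.
  under eq_fun do rewrite e.
  apply=> -[k s]; rewrite -[ip _ _]/(inner muH (munit r r (B (bH (m, p)))) (bH (k, s))) inner_munit// => h0.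
  have [j kj] := zsurj (n + m - k); exists j; rewrite -kj; congr (_, _); first by ring.
  by apply/eqP; apply: contraNT h0 => sp; rewrite (negbTE sp) mul0r.
Qed.

End Membership.

(** * Matrix of V *)

Section TensorPositive.
Context d (Y : measurableType d) (R : realType).
Variables (nu : {sigma_finite_measure set Y -> \bar R}) (J : choiceType) (b : J -> Y -> R[i]).
Hypothesis onbb : onb nu b.
Variables (A : op Y Y R) (C : op (circle R * Y)%type (circle R * Y)%type R).
Hypotheses (bA : bounded_op nu nu A) (tC : is_tensor_op (mu_T R) nu id A C).
Local Notation P := (prodm (mu_T R) nu).

Lemma tensor_id_coef m n u v : L2 nu u -> L2 nu v ->
  inner P (C (tens (zeta m) u)) (tens (zeta n) v) = (m == n)%:R * inner nu (A u) v.
Proof.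
move=> lu lv; have [bC hC] := tC; have lz k := @L2_zeta R k.
have l1 := bounded_L2 bC (L2_tens (lz m) lu).
rewrite -(inner_zeta R) -(inner_tens (lz m) (lz n) (bounded_L2 bA lu) lv).
apply: (inner_ae l1 (L2_tens (lz m) (bounded_L2 bA lu)) (L2_tens (lz n) lv)).
exact: hC.
Qed.

(** On a finite sum of tensors zeta^n (x) y_n with distinct n the form of
    1 (x) A is the sum of the forms of A at the y_n. *)
Lemma tensor_id_pos : positive_op nu A -> positive_op P C.
Proof.
move=> pA; have [bC _] := tC; have [lb ob tb] := onbb.
have oP : onb P (fun ij : int * J => tens (zeta ij.1) (b ij.2)).
  exact: (@onb_prodm _ _ _ _ _ (mu_T R) nu _ _ pickle _ _ (pcan_inj pickleK) (onb_zeta R) onbb).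
have [lP _ _] := oP; pose g (i : int * J) : L2H P := mkL2 (lP i).
have [og tg] := onb_parseval (e := g) oP.
pose CC := lift_op bC; pose AA := lift_op bA; pose bv j : L2H nu := mkL2 (lb j).
have wC : wop CC := wop_lift bC; have wA : wop AA := wop_lift bA.
suff h (u : L2H P) : 0 <= ip (CC u) u by move=> f lf; exact: (h (mkL2 lf)).
apply: (wop_pos_dense wC (hdense_lspan og tg)) => {}u [s [c ->]].
pose L := undup (map fst s).
pose y n : L2H nu := \sum_(i <- s) ((i.1 == n)%:R * c i) *: bv i.2.
suff -> : ip (CC (\sum_(i <- s) c i *: g i)) (\sum_(i <- s) c i *: g i) =
    \sum_(n <- L) ip (AA (y n)) (y n).
  by apply: sumr_ge0 => n _; apply: pA; exact: L2P.
pose G i j := c i * conj (c j) * ip (AA (bv i.2)) (bv j.2).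
transitivity (\sum_(i <- s) \sum_(j <- s) (i.1 == j.1)%:R * G i j).
  rewrite (wop_sum wC); apply: eq_bigr => i _; rewrite ip_sumr mulr_sumr.
  apply: eq_bigr => j _; rewrite ipZr.
  have -> : ip (CC (g i)) (g j) = (i.1 == j.1)%:R * ip (AA (bv i.2)) (bv j.2).
    exact: tensor_id_coef.
  by rewrite /G; ring.
have yE n : ip (AA (y n)) (y n) =
    \sum_(i <- s) \sum_(j <- s) ((i.1 == n)%:R * (j.1 == n)%:R) * G i j.
  rewrite /y (wop_sum wA); apply: eq_bigr => i _; rewrite ip_sumr mulr_sumr.
  by apply: eq_bigr => j _; rewrite ipZr cjM rmorph_nat /G; ring.
under [RHS]eq_bigr do rewrite yE.
rewrite [RHS]exchange_big /=; rewrite big_seq [RHS]big_seq; apply: eq_bigr => i si.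
rewrite exchange_big /=; apply: eq_bigr => j _; rewrite -mulr_suml; congr (_ * _).
have iL : i.1 \in L by rewrite mem_undup map_f.
rewrite (bigD1_seq i.1) ?undup_uniq//= eqxx mul1r big1 ?addr0 1?eq_sym// => n ni.
by rewrite eq_sym (negbTE ni) mul0r.
Qed.

End TensorPositive.

Section CoefficientsOfV.
Variables (R : realType) (q : R).
Hypotheses (q_gt0 : 0 < q) (q_lt1 : q < 1).
Local Notation I := (Iq q).
Local Notation T := (circle R).
Local Notation bHH := (@bHH R q).
Local Notation bTTH := (@bTTH R q).
Local Notation ch p := (chi q (Iq_val p)).

Lemma chi_div (x y : I) : chi q (Iq_val x / Iq_val y) = ch x - ch y.
Proof.
apply: chi_abs => //; rewrite normrM normfV !Iq_abs// invr_expz -expfzDr//.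
by rewrite gt_eqF.
Qed.

Lemma L2_bHH i : L2 (mu_HH q) (bHH i).
Proof. by have [h _ _] := onb_HH q_gt0 q_lt1. Qed.

Lemma L2_bTTH i : L2 (mu_TTH q) (bTTH i).
Proof. by have [h _ _] := onb_TTH q. Qed.

Definition vHH i : L2H (mu_HH q) := mkL2 (L2_bHH i).
Definition vTTH i : L2H (mu_TTH q) := mkL2 (L2_bTTH i).

Lemma vHH_orth i j : ip (vHH i) (vHH j) = (i == j)%:R.
Proof. by have [_ h _] := onb_HH q_gt0 q_lt1; exact: h. Qed.

Lemma vTTH_orth i j : ip (vTTH i) (vTTH j) = (i == j)%:R.
Proof. by have [_ h _] := onb_TTH q; exact: h. Qed.

Lemma vTTH_total (g : L2H (mu_TTH q)) : (forall i, ip g (vTTH i) = 0) -> nrm2 g = 0.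
Proof. by have [_ h] := onb_parseval (e := vTTH) (onb_TTH q); exact: h. Qed.

Lemma inner_F j (p' : I) k (t : I) r s m p :
  inner (mu_HH q) (bHH ((j, p'), (k, t))) (F_ r s m p) =
  (if Iq_val t == Num.sg (Iq_val p) * q ^ m * Iq_val p'
   then a_ q (Iq_val p) (Iq_val p') (Iq_val t) else 0)%:C *
  ((j == r + (ch t - ch p)) && (k == s - (ch p' - ch p)))%:R.
Proof.
set N : R := if _ then _ else _; set al := r + _; set be := s - _.
have [_ ob _] := onb_HH q_gt0 q_lt1.
have -> : ((j == al) && (k == be))%:R = inner (mu_HH q) (bHH ((j, p'), (k, t))) (bHH ((al, p'), (be, t))) :> R[i].
  by rewrite ob !xpair_eqE !eqxx !andbT.
rewrite !innerE -cintZ; last exact: L2_mul_integrable (L2_bHH _) (L2_bHH _).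
apply: eq_cint => -[[l x] [u y]]; rewrite F_E /=.
have [->|xp] := eqVneq x p'; last first.
  by rewrite /bHH /bH /ebasis /tens /= /delta (negbTE xp) !(mulr0, mul0r).
have [->|yt] := eqVneq y t; last first.
  by rewrite /bHH /bH /ebasis /tens /= /delta (negbTE yt) !(mulr0, mul0r).
rewrite !chi_div -/al -/be.
have -> : (if Iq_val t == Num.sg (Iq_val p) * q ^ m * Iq_val p'
   then (a_ q (Iq_val p) (Iq_val p') (Iq_val t))%:C else 0) = N%:C by rewrite /N; case: ifP.
rewrite /bHH /bH /ebasis /tens /= /delta !eqxx !mulr1 !cjM cj_real.
by rewrite mulrCA.
Qed.

Definition iota_ j (p' : I) k (t p : I) : int * (int * (int * I)) :=
  (j - (ch t - ch p), (k + (ch p' - ch p), (ch t - ch p', p))).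

Lemma iota_inj j p' k t : injective (iota_ j p' k t).
Proof. by move=> p r [_ _ ->]. Qed.

Lemma sign_cond (p p' t : I) m : Iq_val t = Num.sg (Iq_val p) * q ^ m * Iq_val p' ->
  m = ch t - ch p'.
Proof.
move=> tE; have : `|Iq_val t| = q ^ (m + ch p').
  rewrite tE !normrM normr_sg Iq_neq0// mul1r (gtr0_norm (qz_gt0 _ _))// Iq_abs//.
  by rewrite expfzDr// gt_eqF.
by move/(chi_abs q_gt0 q_lt1) => ->; rewrite addrK.
Qed.

Lemma sign_cond_conv (p p' t : I) :
  Num.sg (Iq_val p' * Iq_val t) = Num.sg (Iq_val p) ->
  Iq_val t = Num.sg (Iq_val p) * q ^ (ch t - ch p') * Iq_val p'.
Proof.
move=> <-; rewrite sgrM.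
have E (a b x y : R) : a * b * x * y = b * x * (y * a) by ring.
rewrite E [Iq_val p' * _]mulrC -normrEsg Iq_abs//.
by rewrite -mulrA -expfzDr ?gt_eqF// subrK -Iq_abs// -numEsg.
Qed.

Lemma a_sign0 (p x y : I) : Num.sg (Iq_val x * Iq_val y) != Num.sg (Iq_val p) ->
  a_ q (Iq_val p) (Iq_val x) (Iq_val y) = 0.
Proof. by move=> h; rewrite /a_ h. Qed.

Variable V : op ((T * I) * (T * I))%type (T * (T * (T * I)))%type R.
Hypothesis HV : is_V V.

Lemma V_bounded : bounded_op (mu_HH q) (mu_TTH q) V.
Proof. by have [[]] := HV. Qed.

Definition VV : L2H (mu_HH q) -> L2H (mu_TTH q) := lift_op V_bounded.

Lemma VV_ip u v : ip (VV u) (VV v) = ip u v.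
Proof. by have [[_ h _] _] := HV; apply: h; exact: L2P. Qed.

Lemma V_coef i r s m p : ip (VV (vHH i)) (vTTH (r, (s, (m, p)))) =
  inner (mu_HH q) (bHH i) (F_ r s m p).
Proof.
pose F : L2H (mu_HH q) := mkL2 (L2_F q_gt0 q_lt1 r s m p).
rewrite -[RHS]/(ip (vHH i) F) -VV_ip -[LHS]ip_cj -[RHS]ip_cj; congr (conj _).
by apply/esym; apply: ae_ip_eq; have [_ h] := HV; exact: h.
Qed.

Lemma V_coef_iota j p' k t p : ip (VV (vHH ((j, p'), (k, t)))) (vTTH (iota_ j p' k t p)) =
  (a_ q (Iq_val p) (Iq_val p') (Iq_val t))%:C.
Proof.
rewrite V_coef inner_F subrK addrK !eqxx mulr1; congr (_%:C).
case: ifPn => // nc; apply/esym/a_sign0; apply: contraNN nc => /eqP sg.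
by rewrite -sign_cond_conv.
Qed.

Lemma V_coef_supp j p' k t i : ip (VV (vHH ((j, p'), (k, t)))) (vTTH i) != 0 ->
  exists p, i = iota_ j p' k t p.
Proof.
case: i => r [s [m p]]; rewrite V_coef inner_F.
case: ifP => [/eqP/sign_cond mE|_]; last by rewrite mul0r eqxx.
case: andP => [[/eqP jE /eqP kE] _|_]; last by rewrite mulr0 eqxx.
by exists p; rewrite /iota_ jE kE mE addrK subrK.
Qed.

Variables (e : nat -> I) (c : I -> nat).
Hypotheses (ec : cancel e c) (ce : cancel c e).

Lemma V_expand j p' k t (F : semihilbert R) (S : L2H (mu_TTH q) -> F) v : wop S ->
  ccvg (fun N => \sum_(0 <= n < N) (a_ q (Iq_val (e n)) (Iq_val p') (Iq_val t))%:C *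
      ip (S (vTTH (iota_ j p' k t (e n)))) v) (ip (S (VV (vHH ((j, p'), (k, t))))) v).
Proof.
move=> wS; have := expand_series vTTH_orth vTTH_total (w := VV (vHH ((j, p'), (k, t))))
  (iota_ := fun n => iota_ j p' k t (e n)).
have iinj : injective (fun n => iota_ j p' k t (e n)) by move=> m n /iota_inj /(can_inj ec).
move=> /(_ iinj) h; have := h _ _ S v wS.
under eq_fun do under eq_bigr do rewrite V_coef_iota.
by apply=> i /V_coef_supp [p ->]; exists (c p); rewrite ce.
Qed.

(** The rows of the unitary V are orthogonal. *)
Lemma a_orthogonality (p' t p'' t' : I) : ch t - ch p' = ch t' - ch p'' ->
  ccvg (fun N => (\sum_(0 <= n < N) a_ q (Iq_val (e n)) (Iq_val p') (Iq_val t) *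
    a_ q (Iq_val (e n)) (Iq_val p'') (Iq_val t'))%:C) ((p' == p'') && (t == t'))%:R.
Proof.
move=> m; have wid : wop (@id (L2H (mu_TTH q))).
  by split=> [a u v w|]; [rewrite ip_linear|exists 1 => u; rewrite mul1r].
have := V_expand (ch t) p' (- ch p') t (VV (vHH ((ch t', p''), (- ch p'', t')))) wid.
rewrite VV_ip vHH_orth !xpair_eqE.
have -> : ((ch t == ch t') && (p' == p'')) && ((- ch p' == - ch p'') && (t == t')) = (p' == p'') && (t == t').
  have [->|] := eqVneq p' p''; last by rewrite andbF.
  by rewrite eqxx andbT; have [->|] := eqVneq t t'; rewrite ?eqxx// !andbF.
congr (ccvg _ _); apply/funext => N; rewrite rc_sum; apply: eq_bigr => n _.
rewrite rcM; congr (_ * _); rewrite -ip_cj.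
have -> : iota_ (ch t) p' (- ch p') t (e n) = iota_ (ch t') p'' (- ch p'') t' (e n).
  by rewrite /iota_ m; congr (_, (_, _)); ring.
by rewrite V_coef_iota cj_real.
Qed.

Lemma a_sum_le1 (p' t : I) N : \sum_(0 <= n < N) a_ q (Iq_val (e n)) (Iq_val p') (Iq_val t) ^+ 2 <= 1.
Proof.
have iinj : injective (fun n => iota_ 0 p' 0 t (e n)) by move=> m n /iota_inj /(can_inj ec).
have := bessel vTTH_orth (VV (vHH ((0, p'), (0, t))))
  (s := map (fun n => iota_ 0 p' 0 t (e n)) (iota 0 N)).
rewrite map_inj_uniq// iota_uniq /nrm2 VV_ip vHH_orth eqxx => /(_ isT).
rewrite big_map /index_iota subn0.
by under eq_bigr do rewrite V_coef_iota normsqR.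
Qed.

Lemma a_cross_le1 (p' t p'' t' : I) N :
  `|\sum_(0 <= n < N) a_ q (Iq_val (e n)) (Iq_val p') (Iq_val t) *
    a_ q (Iq_val (e n)) (Iq_val p'') (Iq_val t')| <= 1.
Proof.
apply: (le_trans (ler_norm_sum _ _ _)).
have h1 := a_sum_le1 p' t N; have h2 := a_sum_le1 p'' t' N.
apply: (@le_trans _ _ (\sum_(0 <= n < N) 2^-1 * (a_ q (Iq_val (e n)) (Iq_val p') (Iq_val t) ^+ 2 +
   a_ q (Iq_val (e n)) (Iq_val p'') (Iq_val t') ^+ 2))).
  apply: ler_sum => n _; have amgm (x y : R) : `|x * y| <= 2^-1 * (x ^+ 2 + y ^+ 2).
    have := sqr_ge0 (x + y); have := sqr_ge0 (x - y); rewrite ler_norml => u v.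
    by apply/andP; split; nra.
  exact: amgm.
rewrite -mulr_sumr big_split /= mulrDr.
have h0 : 0 <= 2^-1 :> R by [].
by apply: (le_trans (lerD (ler_wpM2l h0 h1) (ler_wpM2l h0 h2))); lra.
Qed.

End CoefficientsOfV.

(** * Slices of the comultiplication *)

Section SeriesTools.
Variable R : realType.

Lemma cvgn_of_nneseries (u : nat -> R) : (forall n, 0 <= u n) ->
  (\sum_(0 <= n <oo) (u n)%:E < +oo)%E -> cvgn (series u).
Proof.
move=> u0 uoo; set S := (\sum_(0 <= n <oo) (u n)%:E)%E in uoo.
have S0 : (0 <= S)%E by apply: nneseries_ge0 => n _ _; rewrite lee_fin.
apply: nondecreasing_is_cvgn.
  by apply/nondecreasing_seqP => n; rewrite /series /= big_nat_recr//= lerDl.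
exists (fine S) => _ [n _ <-]; rewrite -lee_fin fineK ?ge0_fin_numE//.
rewrite /series /= -sumEFin; apply: (@nneseries_lim_ge _ (fun n => (u n)%:E) predT).
by move=> k _ _; rewrite lee_fin.
Qed.

Lemma cvgn_injection (u : nat -> R) (D : set nat) (s : nat -> nat) : (forall n, 0 <= u n) ->
  cvgn (series u) -> {in D &, injective s} ->
  cvgn (series (fun n => if n \in D then u (s n) else 0)).
Proof.
move=> u0 cu sinj; apply: cvgn_of_nneseries => [n|]; first by case: ifP.
rewrite nneseries_esumT; last by move=> n; case: ifP; rewrite lee_fin.
apply: (@le_lt_trans _ _ (\esum_(i in [set: nat]) (u i)%:E)%E); last first.
  by rewrite -nneseries_esumT ?nneseries_lty ?ltry// => n; rewrite lee_fin.
rewrite (_ : (fun n => _) = fun n => if n \in D then (u (s n))%:E else 0%E); last first.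
  by apply/funext => n; case: ifP.
rewrite -esum_mkcond -(@esum_image _ _ _ D s (fun i => (u i)%:E)); last exact: sinj.
rewrite esum_mkcond; apply: le_esum => n _.
by case: ifP => _; rewrite ?lexx// lee_fin.
Qed.

Lemma ccvg_conj (u : nat -> R[i]) l : ccvg u l -> ccvg (fun n => conj (u n)) (conj l).
Proof.
move=> [h1 h2]; split; first by under eq_fun do rewrite ReJ; rewrite ReJ.
by under eq_fun do rewrite ImJ; rewrite ImJ; apply: cvgN.
Qed.

Lemma ccvg_near_cst (u : nat -> R[i]) l N : (forall n, (N <= n)%N -> u n = l) -> ccvg u l.
Proof. by move=> h; split; apply: cvg_near_cst; exists N => // n /= /h ->. Qed.

(** A sequence with at most one nonzero term. *)
Lemma ccvg_single (z : nat -> R[i]) (m : nat) : (forall n, n != m -> z n = 0) ->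
  ccvg (fun N => \sum_(0 <= n < N) z n) (z m).
Proof.
move=> z0; apply: (@ccvg_near_cst _ _ m.+1) => N mN.
rewrite (bigD1_seq m) ?iota_uniq ?mem_index_iota//= big1 ?addr0// => n; exact: z0.
Qed.

Lemma wop_lincomb (E : semihilbert R) (s : seq nat) (c : nat -> R[i]) (B : nat -> E -> E) :
  (forall i, wop (B i)) -> wop (fun u => \sum_(i <- s) c i *: B i u).
Proof.
move=> wB; split=> [a u v w|].
  rewrite !ip_suml mulr_sumr -big_split; apply: eq_bigr => i _ /=.
  by rewrite !ipZl (wB i).1; ring.
elim: s => [|i s [M IH]]; first by exists 0 => u; rewrite big_nil mul0r /nrm2 ip0l.
have [K K0 hK] := wop_bound (wB i).
exists (2 * (normsq (c i) * K) + 2 * M) => u; rewrite big_cons.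
apply: (le_trans (nrm2D_le _ _)); rewrite nrm2Z (mulrDl (2 * _)) -!mulrA lerD// ler_pM2l//.
by rewrite ler_wpM2l ?normsq_ge0.
Qed.

End SeriesTools.

Section Invariance.
Variables (R : realType) (q : R).
Hypotheses (q_gt0 : 0 < q) (q_lt1 : q < 1).
Local Notation I := (Iq q).
Local Notation T := (circle R).
Local Notation muH := (mu_H q).
Local Notation vH := (@vH R q).
Local Notation bH := (@bH R q).
Local Notation bHH := (@bHH R q).
Local Notation ch p := (chi q (Iq_val p)).
Variable V : op ((T * I) * (T * I))%type (T * (T * (T * I)))%type R.
Hypothesis HV : is_V V.
Variables (x : op (T * I)%type (T * I)%type R) (Mx : Mq q x) (px : positive_op muH x).
Variables (Vs : op (T * (T * (T * I)))%type ((T * I) * (T * I))%type R)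
  (a1 : op (T * (T * I))%type (T * (T * I))%type R)
  (a11 : op (T * (T * (T * I)))%type (T * (T * (T * I)))%type R).
Hypotheses (adjV : is_adjoint (mu_HH q) (mu_TTH q) V Vs)
  (t1 : is_tensor_op (mu_T R) muH id x a1) (t11 : is_tensor_op (mu_T R) (mu_TH q) id a1 a11).
Variables (e : nat -> I) (c : I -> nat).
Hypotheses (ec : cancel e c) (ce : cancel c e).

Local Notation VV := (VV HV).
Local Notation vHH := (vHH q_gt0 q_lt1).
Local Notation vTTH := (@vTTH R q).

Let bx : bounded_op muH muH x := Mq_bounded Mx.
Let b1 : bounded_op (mu_TH q) (mu_TH q) a1 := proj1 t1.
Let b11 : bounded_op (mu_TTH q) (mu_TTH q) a11 := proj1 t11.

Definition AA : L2H (mu_TTH q) -> L2H (mu_TTH q) := lift_op b11.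

Let wAA : wop AA := wop_lift b11.

Lemma AA_pos u : 0 <= ip (AA u) u.
Proof.
have oTH : onb (mu_TH q) (fun j : int * (int * I) => tens (zeta j.1) (bH j.2)).
  exact: (@onb_prodm _ _ _ _ _ (mu_T R) muH _ _ pickle _ _ (pcan_inj pickleK)
    (onb_zeta R) (onb_H q)).
have p1 : positive_op (mu_TH q) a1 := tensor_id_pos (onb_H q) bx t1 px.
exact: (tensor_id_pos oTH b1 t11 p1 (L2P (u : L2_type (mu_TTH q)))).
Qed.

Lemma AA_coef r s i r' s' i' : ip (AA (vTTH (r, (s, i)))) (vTTH (r', (s', i'))) =
  ((r == r') && (s == s'))%:R * inner muH (x (bH i)) (bH i').
Proof.
have lt s0 (i0 : int * I) := L2_tens (L2_zeta R s0) (L2_bH i0).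
rewrite -[LHS]/(inner _ (a11 (tens (zeta r) (tens (zeta s) (bH i)))) (tens (zeta r') (tens (zeta s') (bH i')))).
rewrite (tensor_id_coef b1 t11 r r' (lt s i) (lt s' i')).
rewrite (tensor_id_coef bx t1 s s' (L2_bH i) (L2_bH i')) mulrA; congr (_ * _).
by case: (r == r'); rewrite ?mul1r ?mul0r.
Qed.

(* e_p (x) u *)
Definition W (p : I) (u : L2H muH) : L2H (mu_HH q) :=
  mkL2 (L2_tens (L2_bH (0, p)) (L2P (u : L2_type muH))).

Lemma W_ip p u v : ip (W p u) (W p v) = ip u v.
Proof.
have lp := L2_bH (0, p); have lu := L2P (u : L2_type muH); have lv := L2P (v : L2_type muH).
rewrite -[LHS]/(inner (mu_HH q) (tens (bH (0, p)) (u : L2_type muH)) (tens (bH (0, p)) (v : L2_type muH))).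
rewrite (inner_tens lp lp lu lv) -[X in X * _]/(ip (vH (0, p)) (vH (0, p))) vH_orth eqxx mul1r.
by [].
Qed.

Lemma wop_W p : wop (W p).
Proof.
split=> [a u v w|]; last by exists 1 => u; rewrite /nrm2 W_ip mul1r.
rewrite -ip_linear; apply: ae_ip_eq; apply: aeW => z _.
rewrite (L2_val_lin a (W p u : L2_type (mu_HH q)) (W p v : L2_type (mu_HH q))).
rewrite -[LHS]/(bH (0, p) z.1 * (a *: (u : L2_type muH) + (v : L2_type muH) : L2_type muH) z.2).
rewrite L2_val_lin -[X in _ = _ * X + _]/(bH (0, p) z.1 * (u : L2_type muH) z.2).
rewrite -[X in _ = _ + X]/(bH (0, p) z.1 * (v : L2_type muH) z.2).
by ring.
Qed.

Local Notation Dx := (Vs \o a11 \o V).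

Lemma bounded_Dx : bounded_op (mu_HH q) (mu_HH q) Dx.
Proof.
by apply: bounded_comp (V_bounded HV) _; apply: bounded_comp b11 _; case: adjV.
Qed.

Definition DD : L2H (mu_HH q) -> L2H (mu_HH q) := lift_op bounded_Dx.

Lemma DD_ip u v : ip (DD u) v = ip (AA (VV u)) (VV v).
Proof.
have [_ h] := adjV; rewrite -[LHS]ip_cj -[RHS]ip_cj; congr (conj _).
exact: (esym (h _ _ (L2P (v : L2_type (mu_HH q))) (L2P (AA (VV u) : L2_type (mu_TTH q))))).
Qed.

(** The slices B_p = (omega_p (x) iota)(Delta x) at the vector states of e_p. *)
Definition slice (p : I) : op (T * I)%type (T * I)%type R :=
  fun f => pint muH (bH (0, p)) (Dx (tens (bH (0, p)) f)).

Lemma L2_slice p f : L2 muH f -> L2 muH (slice p f).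
Proof.
move=> lf; have lt := L2_tens (L2_bH (0, p)) lf.
exact: (L2_pint (L2_bH (0, p)) (bounded_L2 bounded_Dx lt)).1.
Qed.

Definition BB p : L2H muH -> L2H muH := wrapL2 (@L2_slice p).

Lemma BB_DD p u v : ip (BB p u) v = ip (DD (W p u)) (W p v).
Proof.
have lt := L2_tens (L2_bH (0, p)) (L2P (u : L2_type muH)).
exact: (inner_pint (L2_bH (0, p)) (L2P (v : L2_type muH)) (bounded_L2 bounded_Dx lt)).
Qed.

Lemma BB_ip p u v : ip (BB p u) v = ip (AA (VV (W p u))) (VV (W p v)).
Proof. by rewrite BB_DD DD_ip. Qed.

Lemma wop_BB p : wop (BB p).
Proof.
have wDW := wop_comp (wop_lift bounded_Dx) (wop_W p).
split=> [a u v w|]; first by rewrite !BB_DD; exact: wDW.1.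
have [M hM] := wDW.2; exists M => u; apply: le_trans (hM u).
have lt := L2_tens (L2_bH (0, p)) (L2P (u : L2_type muH)).
have := (L2_pint (L2_bH (0, p)) (bounded_L2 bounded_Dx lt)).2.
have -> : norm2sq muH (bH (0, p)) = 1.
  by rewrite -[LHS]/(norm2sq muH (vH (0, p) : L2_type muH)) -nrm2E /nrm2 vH_orth eqxx.
by rewrite mul1r !nrm2E.
Qed.

Lemma bounded_slice p : bounded_op muH muH (slice p).
Proof. exact: bounded_of_wop (wop_BB p). Qed.

Lemma BB_pos p u : 0 <= ip (BB p u) u.
Proof. by rewrite BB_ip AA_pos. Qed.

(* 1 (x) (multiplication by zeta) *)
Definition bshift2 (F : (T * I) * (T * I) -> R[i]) : (T * I) * (T * I) -> R[i] :=
  fun z => zeta 1 z.2.1 * F z.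

Lemma normsq_bshift2 F z : normsq (bshift2 F z) = normsq (F z).
Proof. by rewrite normsqM normsq_zeta mul1r. Qed.

Lemma bounded_bshift2 : bounded_op (mu_HH q) (mu_HH q) bshift2.
Proof.
split.
- move=> F lF; apply: (@L2_le _ _ _ _ _ (fun z => normsq (F z))).
  + apply: cmeasurableM; last exact: L2_meas lF.
    apply: (@cmeasurable_snd _ _ _ _ R (fun w : T * I => zeta 1 w.1)).
    by apply: (@cmeasurable_fst _ _ _ _ R (zeta 1)); exact: cmeasurable_zeta.
  + by move=> z; rewrite normsq_bshift2.
  + exact: L2_integrable.
- by move=> a f g _ _; apply: aeW => z _; rewrite /bshift2; ring.
- exists 1 => f lf; rewrite mul1r /norm2sq; under eq_Rintegral do rewrite normsq_bshift2.
  by [].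
Qed.

Lemma bshift2_bHH i m p : bshift2 (bHH (i, (m, p))) = bHH (i, (m + 1, p)).
Proof.
apply/funext => z; rewrite /bshift2 /bHH /= -bshift_bH /tens /bshift.
by rewrite mulrCA.
Qed.

Lemma inner_bshift2 F i n r : inner (mu_HH q) (bshift2 F) (bHH (i, (n + 1, r))) =
  inner (mu_HH q) F (bHH (i, (n, r))).
Proof.
rewrite !innerE; apply: eq_cint => z; rewrite -bshift2_bHH /bshift2 cjM.
have : zeta 1 z.2.1 * conj (zeta 1 z.2.1) = 1 by rewrite cj_zeta -zetaD subrr zeta0.
move: (zeta 1 _) (conj (zeta 1 _)) (F z) (conj (bHH _ z)) => a b f g ab.
by transitivity (f * g * (a * b)); [ring|rewrite ab mulr1].
Qed.

Lemma commutant_bshift2 :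
  commutant (mu_HH q) [set C | exists A B, [/\ Mq q A, Mq q B & is_tensor_op muH muH A B C]] bshift2.
Proof.
split; first exact: bounded_bshift2.
move=> C [A [B [MA MB [bC tC]]]] f lf.
have lA i := bounded_L2 (Mq_bounded MA) (L2_bH i); have lB i := bounded_L2 (Mq_bounded MB) (L2_bH i).
have cE i j i' j' : inner (mu_HH q) (C (bHH (i, j))) (bHH (i', j')) =
    inner muH (A (bH i)) (bH i') * inner muH (B (bH j)) (bH j').
  rewrite -(inner_tens (lA i) (L2_bH i') (lB j) (L2_bH j')).
  apply: (inner_ae (bounded_L2 bC (L2_bHH q_gt0 q_lt1 (i, j))) (L2_tens (lA i) (lB j)) (L2_bHH q_gt0 q_lt1 (i', j'))).
  by apply: tC; exact: L2_bH.
have b12 := bounded_comp bC bounded_bshift2; have b21 := bounded_comp bounded_bshift2 bC.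
apply: (@ip_eq_ae _ _ _ (mu_HH q) (lift_op b12 (mkL2 lf)) (lift_op b21 (mkL2 lf))).
have [oo tt] := onb_parseval (e := vHH) (onb_HH q_gt0 q_lt1).
apply: (wop_ext (wop_lift b12) (wop_lift b21) (hdense_lspan oo tt)) => -[i [m p]] w.
apply/eqP; rewrite -subr_eq0 -ipBl; apply/eqP/ip_null/tt => -[i' [n r]].
rewrite ipBl; apply/eqP; rewrite subr_eq0; apply/eqP.
rewrite -[LHS]/(inner (mu_HH q) (bshift2 (C (bHH (i, (m, p))))) (bHH (i', (n, r)))).
rewrite -[RHS]/(inner (mu_HH q) (C (bshift2 (bHH (i, (m, p))))) (bHH (i', (n, r)))).
rewrite -(subrK 1 n) inner_bshift2 bshift2_bHH !cE; congr (_ * _).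
by rewrite (Mq_shift MB).
Qed.

Lemma Mq_slice p : vN_tensor muH muH (Mq q) (Mq q) Dx -> Mq q (slice p).
Proof.
move=> [_ hD]; apply: Mq_of_shift_invariant => //; first exact: bounded_slice.
move=> k s n r; have := hD _ commutant_bshift2 (bHH ((0, p), (k, s))) (L2_bHH q_gt0 q_lt1 _).
rewrite bshift2_bHH => h.
rewrite -[LHS]/(ip (BB p (vH (k + 1, s))) (vH (n + 1, r))) -[RHS]/(ip (BB p (vH (k, s))) (vH (n, r))).
rewrite !BB_DD.
rewrite -[LHS]/(inner (mu_HH q) (Dx (bHH ((0, p), (k + 1, s)))) (bHH ((0, p), (n + 1, r)))).
rewrite -[RHS]/(inner (mu_HH q) (Dx (bHH ((0, p), (k, s)))) (bHH ((0, p), (n, r)))).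
rewrite -[RHS]inner_bshift2.
have l1 := bounded_L2 bounded_Dx (L2_bHH q_gt0 q_lt1 ((0, p), (k + 1, s))).
have l2 := bounded_L2 bounded_Dx (L2_bHH q_gt0 q_lt1 ((0, p), (k, s))).
exact: (inner_ae l1 (bounded_L2 bounded_bshift2 l2) (L2_bHH q_gt0 q_lt1 _) h).
Qed.

Local Notation A p y z := (a_ q (Iq_val p) (Iq_val y) (Iq_val z)).

Definition diag (n : nat) : R :=
  (Iq_val (e n) ^+ 2)^-1 * Re (inner muH (x (ebasis 0 (e n))) (ebasis 0 (e n))).

Lemma diag_ge0 n : 0 <= diag n.
Proof. by rewrite mulr_ge0 ?invr_ge0 ?sqr_ge0// (positive_diag _ px). Qed.

Definition TN (N : nat) (v : L2H muH) : L2H muH :=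
  \sum_(i <- iota 0 N) ((Iq_val (e i) ^+ 2)^-1)%:C *: BB (e i) v.

Lemma wop_TN N : wop (TN N).
Proof. by apply: wop_lincomb => i; exact: wop_BB. Qed.

Lemma TN_ip N v w : ip (TN N v) w =
  \sum_(i <- iota 0 N) ((Iq_val (e i) ^+ 2)^-1)%:C * ip (BB (e i) v) w.
Proof. by rewrite ip_suml; apply: eq_bigr => i _; rewrite ipZl. Qed.

Lemma TN_term_ge0 i v : 0 <= ((Iq_val (e i) ^+ 2)^-1)%:C * ip (BB (e i) v) v.
Proof. by rewrite mulr_ge0 ?BB_pos// lecE /= eqxx invr_ge0 sqr_ge0. Qed.

Lemma TN_pos N v : 0 <= ip (TN N v) v.
Proof. by rewrite TN_ip; apply: sumr_ge0 => i _; exact: TN_term_ge0. Qed.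

Lemma TN_mono N v : Re (ip (TN N v) v) <= Re (ip (TN N.+1 v) v).
Proof.
rewrite !TN_ip -[N.+1]addn1 iotaD big_cat big_seq1 ReD lerDl add0n.
by have := TN_term_ge0 N v; rewrite lecE => /andP[].
Qed.

Section Entry.
Variables (k k' : int) (t t' : I).

Definition rel (n m : nat) := Iq_val (e m) * Iq_val t == Iq_val (e n) * Iq_val t'.
Definition dom : set nat := [set n | exists m, rel n m].
Definition pr (n : nat) : nat := xget 0%N [set m | rel n m].
Definition kt := k - k' == ch t - ch t'.
Definition Y (n m : nat) := inner muH (x (bH (0, e n))) (bH (ch t' - ch t, e m)).

Lemma rel_pr n : n \in dom -> rel n (pr n).
Proof. by rewrite inE => -[m h]; exact: (@xgetPex _ 0%N [set m | rel n m] (ex_intro _ m h)). Qed.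

Lemma rel_uniq n m m' : rel n m -> rel n m' -> m = m'.
Proof.
move=> /eqP h /eqP; rewrite -h => /mulIf; rewrite Iq_neq0// => /(_ isT) /val_inj.
by move/(can_inj ec).
Qed.

Lemma rel_eq_pr n m : rel n m = (n \in dom) && (m == pr n).
Proof.
apply/idP/andP => [h|[nd /eqP ->]]; last exact: rel_pr.
have nd : n \in dom by rewrite inE; exists m.
by split => //; apply/eqP; apply: rel_uniq h _; exact: rel_pr.
Qed.

Lemma pr_inj : {in dom &, injective pr}.
Proof.
move=> n m /rel_pr /eqP h1 /rel_pr /eqP h2 prE; move: h1; rewrite prE h2.
by move/mulIf; rewrite Iq_neq0// => /(_ isT) /val_inj /(can_inj ec).
Qed.

Lemma rel_chi n m : rel n m -> ch (e m) + ch t = ch (e n) + ch t'.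
Proof.
move=> /eqP h; have : `|Iq_val (e m) * Iq_val t| = q ^ (ch (e n) + ch t').
  by rewrite h normrM !Iq_abs// expfzDr// gt_eqF.
move/(chi_abs q_gt0 q_lt1) => <-; apply/esym/chi_abs => //.
by rewrite normrM !Iq_abs// expfzDr// gt_eqF.
Qed.

Lemma entry_term (p : I) n m : (A (e n) p t)%:C *
   ((A (e m) p t')%:C * ip (AA (vTTH (iota_ 0 p k t (e n)))) (vTTH (iota_ 0 p k' t' (e m)))) =
  (kt && rel n m)%:R * ((A (e n) p t * A (e m) p t')%:C * Y n m).
Proof.
have [->|n0] := eqVneq (A (e n) p t) 0; first by rewrite !mul0r mulr0.
have [->|m0] := eqVneq (A (e m) p t') 0; first by rewrite mul0r !mulr0 mul0r mulr0.
have sn : Num.sg (Iq_val p * Iq_val t) = Num.sg (Iq_val (e n)).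
  by apply/eqP; apply: contraNT n0 => /a_sign0 ->.
have sm : Num.sg (Iq_val p * Iq_val t') = Num.sg (Iq_val (e m)).
  by apply/eqP; apply: contraNT m0 => /a_sign0 ->.
rewrite AA_coef (shift_invariant_diff _ _ _ _ (Mq_shift Mx)).
have -> : ch t' - ch p - (ch t - ch p) = ch t' - ch t by ring.
have -> : (0 - (ch t - ch (e n)) == 0 - (ch t' - ch (e m))) &&
    (k + (ch p - ch (e n)) == k' + (ch p - ch (e m))) = kt && rel n m.
  apply/andP/andP => [[/eqP h1 /eqP h2]|[/eqP h1 h2]].
    have h3 : ch (e m) + ch t = ch (e n) + ch t' by lia.
    split; first by apply/eqP; lia.
    have qn0 : q != 0 by rewrite gt_eqF.
    have ab : `|Iq_val (e m) * Iq_val t| = `|Iq_val (e n) * Iq_val t'|.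
      by rewrite !normrM !Iq_abs// -!(expfzDr _ _ qn0) h3.
    have sg : Num.sg (Iq_val (e m) * Iq_val t) = Num.sg (Iq_val (e n) * Iq_val t').
      by rewrite !sgrM -sn -sm !sgrM mulrAC.
    by apply/eqP; rewrite (numEsg (Iq_val (e m) * Iq_val t)) ab sg -numEsg.
  by have h3 := rel_chi h2; split; apply/eqP; lia.
by rewrite rcM /Y; case: (_ && _); rewrite ?mul1r ?mul0r ?mulr0// mulrA.
Qed.

Lemma entry_inner p n : (A (e n) p t)%:C *
    ip (AA (vTTH (iota_ 0 p k t (e n)))) (VV (vHH ((0, p), (k', t')))) =
  (kt && (n \in dom))%:R * ((A (e n) p t * A (e (pr n)) p t')%:C * Y n (pr n)).
Proof.
have wid : wop (@id (L2H (mu_TTH q))).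
  by split=> [a u v w|]; [rewrite ip_linear|exists 1 => u; rewrite mul1r].
have h := ccvgZ (A (e n) p t)%:C (ccvg_conj (V_expand q_gt0 q_lt1 HV ec ce 0 p k' t'
  (AA (vTTH (iota_ 0 p k t (e n)))) wid)).
move: h; rewrite ip_cj => h; apply: (ccvg_unique h).
have -> : (kt && (n \in dom))%:R * ((A (e n) p t * A (e (pr n)) p t')%:C * Y n (pr n)) =
    (kt && rel n (pr n))%:R * ((A (e n) p t * A (e (pr n)) p t')%:C * Y n (pr n)).
  by rewrite rel_eq_pr eqxx andbT.
have := @ccvg_single R (fun m => (kt && rel n m)%:R * ((A (e n) p t * A (e m) p t')%:C * Y n m)) (pr n).
have z0 m : m != pr n -> (kt && rel n m)%:R * ((A (e n) p t * A (e m) p t')%:C * Y n m) = 0.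
  by move=> mp; rewrite rel_eq_pr (negbTE mp) !andbF mul0r.
move/(_ z0); congr (ccvg _ _); apply/funext => M.
have cj_sum (F : nat -> R[i]) : conj (\sum_(0 <= m < M) F m) = \sum_(0 <= m < M) conj (F m).
  exact: rmorph_sum.
by rewrite cj_sum mulr_sumr; apply: eq_bigr => m _; rewrite cjM cj_real ip_cj entry_term.
Qed.

(** Unitarity of V turns the matrix entries of B_p into a series over the
    elements e n of I_q; the partner e (pr n) is the only element that the
    exponents of the two circle variables allow. *)
Lemma entry_series p : ccvg (fun M => \sum_(0 <= n < M)
    (kt && (n \in dom))%:R * ((A (e n) p t * A (e (pr n)) p t')%:C * Y n (pr n)))
  (ip (BB p (vH (k, t))) (vH (k', t'))).
Proof.
have := V_expand q_gt0 q_lt1 HV ec ce 0 p k t (VV (vHH ((0, p), (k', t')))) wAA.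
rewrite BB_ip -[X in ccvg _ X -> _]/(ip (AA (VV (W p (vH (k, t))))) (VV (W p (vH (k', t'))))).
by congr (ccvg _ _); apply/funext => M; apply: eq_bigr => n _; rewrite entry_inner.
Qed.

Definition sc (n m : nat) : R := (-1) ^ ch (e n) * (-1) ^ ch (e m) *
  (Num.sg (Iq_val t) ^ ch t * Num.sg (Iq_val t') ^ ch t') *
  (`|Iq_val (e n)|^-1 * `|Iq_val (e m)|^-1).

(** The exchange relation trades the weight p^-2 for weights depending on the
    summation index only, which leaves a row product of V. *)
Lemma entry_swap (p : I) n m : (Iq_val p ^+ 2)^-1 * (A (e n) p t * A (e m) p t') =
  sc n m * (A p (e n) t * A p (e m) t').
Proof.
rewrite (a_swap q_gt0 q_lt1 (e n) p t) (a_swap q_gt0 q_lt1 (e m) p t') /sc.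
have n1 : -1 != 0 :> R by rewrite oppr_eq0 oner_eq0.
rewrite !(expfzDr _ _ n1); have : (-1) ^ ch p * (-1) ^ ch p = 1 :> R.
  by rewrite -expfzMl mulrNN mulr1 exp1rz.
have p2 : (Iq_val p ^+ 2)^-1 * (`|Iq_val p| * `|Iq_val p|) = 1.
  by rewrite -expr2 real_normK ?num_real// mulVf// expf_neq0// Iq_neq0.
move: p2; move: (A p (e n) t) (A p (e m) t') (Num.sg _ ^ ch t) (Num.sg _ ^ ch t').
move: (`|Iq_val (e n)|^-1) (`|Iq_val (e m)|^-1) (`|Iq_val p|) ((Iq_val p ^+ 2)^-1).
move: ((-1) ^ ch p) ((-1) ^ ch (e n)) ((-1) ^ ch (e m)) => z1 z2 z3 y1 y2 y3 y4 x1 x2 x3 x4 h1 h2.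
transitivity ((z1 * z1) * (y4 * (y3 * y3)) * (z2 * z3 * (x3 * x4) * (y1 * y2) * (x1 * x2))).
  by ring.
by rewrite h1 h2 !mul1r.
Qed.

Definition gN (N n : nat) : R := \sum_(0 <= l < N) A (e l) (e n) t * A (e l) (e (pr n)) t'.

Definition rc_ n : R := if kt && (n \in dom) then sc n (pr n) else 0.

Lemma TN_expand N : ccvg (fun M => \sum_(0 <= n < M) (rc_ n * gN N n)%:C * Y n (pr n))
  (ip (TN N (vH (k, t))) (vH (k', t'))).
Proof.
rewrite TN_ip; have := @ccvg_sum R _ (iota 0 N) _ _ (fun l => ccvgZ ((Iq_val (e l) ^+ 2)^-1)%:C (entry_series (e l))).
congr (ccvg _ _); apply/funext => M; under eq_bigr do rewrite mulr_sumr.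
rewrite exchange_big /=; apply: eq_bigr => n _.
rewrite /gN mulr_sumr rc_sum mulr_suml /index_iota subn0; apply: eq_bigr => l _.
rewrite /rc_; case: (kt && _); last by rewrite !mul0r mulr0.
by rewrite mul1r mulrA -rcM entry_swap.
Qed.

Lemma sc_sqr n m : sc n m ^+ 2 = (Iq_val (e n) ^+ 2)^-1 * (Iq_val (e m) ^+ 2)^-1.
Proof.
have s1 (j : int) : ((-1) ^ j : R) ^+ 2 = 1 by apply: sqr_signz; rewrite sqrrN expr1n.
have s2 (y : I) (j : int) : (Num.sg (Iq_val y) ^ j) ^+ 2 = 1.
  by apply: sqr_signz; rewrite sqr_sg Iq_neq0.
by rewrite /sc !exprMn !s1 !s2 !mul1r !exprVn !real_normK ?num_real.
Qed.

Lemma Y_le n m : normsq (Y n m) <= Re (inner muH (x (ebasis 0 (e n))) (ebasis 0 (e n))) *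
   Re (inner muH (x (ebasis 0 (e m))) (ebasis 0 (e m))).
Proof.
have wx := wop_lift bx; have pX u : 0 <= ip (lift_op bx u) u by apply: px; exact: L2P.
set d := ch t' - ch t.
have h : normsq (Y n m) <= Re (inner muH (x (bH (0, e n))) (bH (0, e n))) *
    Re (inner muH (x (bH (d, e m))) (bH (d, e m))).
  exact: (pos_cauchy_schwarz wx pX (vH (0, e n)) (vH (d, e m))).
apply: (le_trans h).
by rewrite (shift_invariant_diff d (e m) d (e m) (Mq_shift Mx)) subrr.
Qed.

Hypothesis ucvg : cvgn (series diag).

(** The row products are bounded by 1 and tend to 0 or 1, so dominated
    convergence applies with the diagonal of x as majorant. *)
Lemma part_cvg (f : R[i] -> R) : (forall (r : R) z, f (r%:C * z) = r * f z) ->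
  (forall z, f z ^+ 2 <= normsq z) ->
  (forall N, (fun M => \sum_(0 <= n < M) f ((rc_ n * gN N n)%:C * Y n (pr n))) @ \oo -->
     f (ip (TN N (vH (k, t))) (vH (k', t')))) ->
  (fun N => f (ip (TN N (vH (k, t))) (vH (k', t')))) @ \oo -->
  f ((limn (series diag))%:C * ((k, t) == (k', t'))%:R).
Proof.
move=> fZ fle fcvg.
have fb (b : bool) : f b%:R = b%:R * f 1.
  by rewrite -fZ; case: b; rewrite ?mulr1// mul0r.
pose L n : R := ((e n == e (pr n)) && (t == t'))%:R.
have termE n : rc_ n * L n * f (Y n (pr n)) = (((k, t) == (k', t'))%:R * f 1) * diag n.
  rewrite xpair_eqE /L; have [tt|tt] := eqVneq t t'; last by rewrite !andbF mulr0 !mul0r.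
  have relnn : rel n n by rewrite /rel tt.
  have := relnn; rewrite rel_eq_pr => /andP[nd /eqP prE]; rewrite /rc_ -prE eqxx andbT mulr1.
  rewrite /kt nd andbT -tt subrr subr_eq0; case: (k == k'); last by rewrite !mul0r.
  rewrite /sc -tt; have s1 : (-1) ^ ch (e n) * (-1) ^ ch (e n) = 1 :> R.
    by rewrite -expfzMl mulrNN mulr1 exp1rz.
  have s2 : Num.sg (Iq_val t) ^ ch t * Num.sg (Iq_val t) ^ ch t = 1.
    by rewrite -expfzMl -expr2 sqr_sg Iq_neq0// exp1rz.
  rewrite s1 s2 !mul1r -invfM -expr2 real_normK ?num_real//.
  have -> : Y n n = (Re (inner muH (x (ebasis 0 (e n))) (ebasis 0 (e n))))%:C * 1.
    rewrite /Y -tt subrr mulr1; apply: eq_ReIm => //=.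
    by have := px (L2_bH (0, e n)); rewrite lecE => /andP[/eqP].
  by rewrite fZ /diag mulrA mulrC.
have -> : f ((limn (series diag))%:C * ((k, t) == (k', t'))%:R) =
    limn (series (fun n => rc_ n * L n * f (Y n (pr n)))).
  rewrite fZ fb; apply/esym/cvg_lim => //.
  have -> : series (fun n => rc_ n * L n * f (Y n (pr n))) =
      (fun M => (((k, t) == (k', t'))%:R * f 1) * series diag M).
    by apply/funext => M; rewrite /series /= mulr_sumr; apply: eq_bigr => n _; rewrite termE.
  by rewrite [limn (series diag) * _]mulrC; apply: cvgMr; exact: ucvg.
rewrite (_ : (fun N => f _) = fun N => limn (series (fun n => rc_ n * gN N n * f (Y n (pr n))))); last first.
  apply/funext => N; apply/esym/cvg_lim => //.
  have -> : series (fun n => rc_ n * gN N n * f (Y n (pr n))) =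
      (fun M => \sum_(0 <= n < M) f ((rc_ n * gN N n)%:C * Y n (pr n))).
    by apply/funext => M; rewrite /series /=; apply: eq_bigr => n _; rewrite fZ.
  exact: fcvg.
apply: (@tannery _ (fun N n => rc_ n * gN N n * f (Y n (pr n))) (fun n => rc_ n * L n * f (Y n (pr n)))
   (fun n => diag n + (if n \in dom then diag (pr n) else 0))).
- have c2 := cvgn_injection diag_ge0 ucvg pr_inj.
  by have := is_cvg_seriesD ucvg c2.
- move=> N n; rewrite /rc_; case: ifP => [/andP[_ ->]|_]; last first.
    by rewrite !mul0r normr0 addr_ge0 ?diag_ge0//; case: ifP => _; rewrite ?diag_ge0.
  have h1 := diag_ge0 n; have h2 := diag_ge0 (pr n).
  rewrite -ler_sqr ?nnegrE ?addr_ge0// real_normK ?num_real//.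
  have sq3 (a b d : R) : (a * b * d) ^+ 2 = a ^+ 2 * b ^+ 2 * d ^+ 2 by rewrite !exprMn.
  rewrite sq3 sc_sqr.
  have g1 : gN N n ^+ 2 <= 1.
    have ga : `|gN N n| <= 1 by exact: (a_cross_le1 q_gt0 q_lt1 HV ec).
    have := normr_ge0 (gN N n); rewrite -[gN N n ^+ 2]real_normK ?num_real//.
    by move: ga; move: `|gN N n| => g g_le g_ge; nra.
  have y1 := le_trans (fle (Y n (pr n))) (Y_le n (pr n)).
  apply: (@le_trans _ _ (diag n * diag (pr n))); last first.
    by move: h1 h2; move: (diag n) (diag (pr n)) => d1 d2 d10 d20; nra.
  have P0 j : 0 <= (Iq_val (e j) ^+ 2)^-1 by rewrite invr_ge0 sqr_ge0.
  rewrite /diag [leRHS]mulrACA -[leLHS]mulrA; apply: ler_wpM2l.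
    by apply: mulr_ge0; exact: P0.
  by apply: le_trans y1; rewrite ler_piMl ?sqr_ge0.
- move=> n; rewrite /rc_; case: ifP => [/andP[_ nd]|_]; last first.
    by under eq_fun do rewrite !mul0r; rewrite !mul0r; exact: cvg_cst.
  apply: cvgMl; apply: cvgMr.
  have hc := rel_chi (rel_pr nd).
  have m : ch t - ch (e n) = ch t' - ch (e (pr n)) by lia.
  have [h _] := a_orthogonality q_gt0 q_lt1 HV ec ce m.
  by move: h; rewrite /L; case: (_ && _).
Qed.

Lemma entry_cvg : ccvg (fun N => ip (TN N (vH (k, t))) (vH (k', t')))
  ((limn (series diag))%:C * ((k, t) == (k', t'))%:R).
Proof.
split; apply: part_cvg.
- exact: ReZ.
- exact: Re_sqr_le.
- by move=> N; have [h _] := TN_expand N; move: h; under eq_fun do rewrite Re_sum.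
- exact: ImZ.
- by move=> z; rewrite /normsq lerDr sqr_ge0.
- by move=> N; have [_ h] := TN_expand N; move: h; under eq_fun do rewrite Im_sum.
Qed.

End Entry.

End Invariance.

(** * Right invariance *)

Section ComplexSeries.
Variable R : realType.

Definition csum (z : nat -> R[i]) : R[i] :=
  limn (series (fun n => Re (z n))) +i* limn (series (fun n => Im (z n))).

Lemma ccvg_series (z : nat -> R[i]) l :
  ccvg (fun N => \sum_(0 <= n < N) z n) l <->
  series (fun n => Re (z n)) @ \oo --> Re l /\ series (fun n => Im (z n)) @ \oo --> Im l.
Proof.
have e1 : (fun N => Re (\sum_(0 <= n < N) z n)) = series (fun n => Re (z n)).
  by apply/funext => N; rewrite Re_sum.
have e2 : (fun N => Im (\sum_(0 <= n < N) z n)) = series (fun n => Im (z n)).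
  by apply/funext => N; rewrite Im_sum.
by rewrite /ccvg e1 e2.
Qed.

Lemma csum_eq (z : nat -> R[i]) l : ccvg (fun N => \sum_(0 <= n < N) z n) l -> csum z = l.
Proof.
by move=> /ccvg_series [h1 h2]; apply: eq_ReIm; [exact: cvg_lim h1|exact: cvg_lim h2].
Qed.

End ComplexSeries.

Section RightInvariance.
Variables (R : realType) (q : R).
Hypotheses (q_gt0 : 0 < q) (q_lt1 : q < 1).
Local Notation I := (Iq q).
Local Notation T := (circle R).
Local Notation muH := (mu_H q).
Local Notation bH := (@bH R q).
Local Notation vH := (@vH R q).

Lemma cvgn_norms (xi : nat -> T * I -> R[i]) : (\sum_(0 <= n <oo) (norm2sq muH (xi n))%:E < +oo)%E ->
  cvgn (series (fun n => norm2sq muH (xi n))).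
Proof. by move=> h; apply: cvgn_of_nneseries h => n; exact: norm2sq_ge0. Qed.

Lemma Mq_id : Mq q (@id (T * I -> R[i])).
Proof. by split; [exact: bounded_id|move=> B _ f _; exact: aeW]. Qed.

Lemma phi_right_invariant (V : op ((T * I) * (T * I))%type (T * (T * (T * I)))%type R)
  (w : op (T * I)%type (T * I)%type R -> R[i]) (x : op (T * I)%type (T * I)%type R)
  (Dx : op ((T * I) * (T * I))%type ((T * I) * (T * I))%type R)
  (y : op (T * I)%type (T * I)%type R) :
  is_V V -> predual muH (Mq q) w -> positive_functional muH (Mq q) w ->
  Mq q x -> positive_op muH x -> (phi x < +oo)%E -> is_Delta V x Dx ->
  is_slice muH muH (Mq q) (Mq q) w Dx y -> (phi y = phi x * (Re (w id))%:E)%E.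
Proof.
move=> HV [xi [eta [lxe xoo eoo wE]]] wpos Mx px phix [Vs [a1 [a11 [adjV t1 t11 ->]]]].
move=> [MD My slc]; have [e [c [ec ce]]] := Iq_enumeration q_gt0 q_lt1.
have lxi n : L2 muH (xi n) by case: (lxe n).
have leta n : L2 muH (eta n) by case: (lxe n).
have bx := Mq_bounded Mx.
pose B p := slice V Vs a11 p.
have MB p : Mq q (B p) := Mq_slice q_gt0 q_lt1 HV adjV t11 p MD.
have lb p := L2_bH (0, p) : L2 muH (bH (0, p)).
have ne p : norm2sq muH (bH (0, p)) = 1.
  by rewrite -[LHS]/(norm2sq muH (vH (0, p) : L2_type muH)) -nrm2E /nrm2 vH_orth eqxx.
have lt p f (lf : L2 muH f) := L2_tens (lb p) lf.
have nt p f : L2 muH f -> norm2sq (mu_HH q) (tens (bH (0, p)) f) = norm2sq muH f.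
  move=> lf; rewrite -!inner_self (inner_tens (lb p) (lb p) lf lf).
  by rewrite -[X in X * _]/(ip (vH (0, p)) (vH (0, p))) vH_orth eqxx mul1r.
have wB p : ccvg (fun N => \sum_(0 <= n < N) inner muH (B p (xi n)) (eta n)) (w (B p)).
  by apply/ccvg_series; exact: wE.
(* the normal functional omega_p (x) w *)
have yB p : inner muH (y (bH (0, p))) (bH (0, p)) = w (B p).
  pose rho (Z : op (T * I)%type (T * I)%type R) := inner muH (Z (bH (0, p))) (bH (0, p)).
  pose zt (Z : op ((T * I) * (T * I))%type ((T * I) * (T * I))%type R) n :=
    inner (mu_HH q) (Z (tens (bH (0, p)) (xi n))) (tens (bH (0, p)) (eta n)).
  pose rhow Z := csum (zt Z).
  have prho : predual muH (Mq q) rho.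
    pose u n := if n is 0%N then bH (0, p) else fun=> 0.
    have n0 : norm2sq muH (fun=> 0) = 0.
      by have := nrm2E (0 : L2H muH); rewrite /nrm2 ip0l => /esym.
    have uoo : (\sum_(0 <= n <oo) (norm2sq muH (u n))%:E < +oo)%E.
      rewrite nneseries_lty ?ltry// => [n|]; first exact: norm2sq_ge0.
      apply/cvg_ex; exists (norm2sq muH (u 0%N)); apply: cvg_near_cst; exists 1%N => // n /= n1.
      rewrite /series /= big_ltn// big1_seq ?addr0// => -[|i] /andP[_]; rewrite mem_index_iota//.
    exists u, u; split=> // [n|Z MZ].
      by case: n => [|n]; split; (exact: lb || exact: L2_0).
    apply/ccvg_series; apply: (@ccvg_single R (fun n => inner muH (Z (u n)) (u n)) 0%N) => -[//|n] _.
    have lZ := bounded_L2 (Mq_bounded MZ) (L2_0 muH).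
    by rewrite -[LHS]/(ip (mkL2 lZ : L2H muH) 0) ip0r.
  have prhow : predual (mu_HH q) (vN_tensor muH muH (Mq q) (Mq q)) rhow.
    exists (fun n => tens (bH (0, p)) (xi n)), (fun n => tens (bH (0, p)) (eta n)); split.
    - by move=> n; split; exact: lt.
    - by rewrite (eq_eseriesr (fun n _ => congr1 EFin (nt p _ (lxi n)))).
    - by rewrite (eq_eseriesr (fun n _ => congr1 EFin (nt p _ (leta n)))).
    move=> Z [bZ _]; have [M M0 hM] := wop_bound (wop_lift bZ).
    pose m n := (M + 1) * (norm2sq muH (xi n) + norm2sq muH (eta n)).
    have cm : cvgn (series m).
      have cD := is_cvg_seriesD (cvgn_norms xoo) (cvgn_norms eoo).
      have -> : m = (fun n => (M + 1) *: ((fun k => norm2sq muH (xi k)) + (fun k => norm2sq muH (eta k))) n) by [].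
      exact: is_cvg_seriesZ.
    have zle n : normsq (zt Z n) <= m n ^+ 2.
      have := cauchy_schwarz (lift_op bZ (mkL2 (lt p _ (lxi n)))) (mkL2 (lt p _ (leta n)) : L2H (mu_HH q)).
      have := hM (mkL2 (lt p _ (lxi n))).
      rewrite -[X in normsq X <= _ -> _]/(zt Z n) !nrm2E !nt// => h1 h2.
      apply: (le_trans h2); have a0 := norm2sq_ge0 muH (xi n); have b0 := norm2sq_ge0 muH (eta n).
      apply: (le_trans (ler_wpM2r b0 h1)); rewrite /m.
      move: M0 a0 b0; move: (norm2sq _ (xi n)) (norm2sq _ (eta n)) => a b M0 a0 b0.
      have h : 0 <= M * (a * b) by rewrite !mulr_ge0// ltW.
      have h' : 0 <= M ^+ 2 * (a + b) ^+ 2 by rewrite mulr_ge0 ?sqr_ge0.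
      have h3 : 0 <= a * b by exact: mulr_ge0.
      have h4 : M * (a * b) <= M * (a + b) ^+ 2.
        by rewrite ler_pM2l//; have := sqr_ge0 a; have := sqr_ge0 b; nra.
      have -> : ((M + 1) * (a + b)) ^+ 2 = M ^+ 2 * (a + b) ^+ 2 + 2 * (M * (a + b) ^+ 2) + (a + b) ^+ 2 by ring.
      by have h5 := sqr_ge0 (a + b); lra.
    have m0 n : 0 <= m n by rewrite mulr_ge0 ?addr_ge0 ?norm2sq_ge0// ltW.
    have le1 (r z : R) : r ^+ 2 <= z ^+ 2 -> 0 <= z -> `|r| <= z.
      by move=> h z0; rewrite -ler_sqr ?nnegrE// real_normK ?num_real.
    split.
    - rewrite /rhow /csum /=; apply: (@series_dom_cvg _ _ m cm) => n.
      by apply: le1 => //; exact: le_trans (Re_sqr_le _) (zle n).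
    - rewrite /rhow /csum /=; apply: (@series_dom_cvg _ _ m cm) => n.
      by apply: le1 => //; apply: le_trans (zle n); rewrite /normsq lerDr sqr_ge0.
  have E : rho y = rhow (Vs \o a11 \o V).
    apply: (slc rho rhow prho prhow).
    move=> A1 B1 C1 MA1 MB1 [bC1 tC1]; rewrite /rhow; apply: csum_eq.
    have /ccvg_series h : _ := wE _ MB1; have := ccvgZ (rho A1) h.
    congr (ccvg _ _); apply/funext => N; rewrite mulr_sumr; apply: eq_bigr => n _.
    have lA := bounded_L2 (Mq_bounded MA1) (lb p); have lB := bounded_L2 (Mq_bounded MB1) (lxi n).
    rewrite /zt /rho -(inner_tens lA (lb p) lB (leta n)); apply/esym.
    by apply: (inner_ae (bounded_L2 bC1 (lt p _ (lxi n))) (L2_tens lA lB) (lt p _ (leta n))); exact: tC1.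
  rewrite -[LHS]/(rho y) E.
  rewrite /rhow; apply: csum_eq; move: (wB p); congr (ccvg _ _); apply/funext => N.
  apply: eq_bigr => n _; rewrite /B /slice.
  have := bounded_L2 (bounded_Dx HV adjV t11) (lt p _ (lxi n)) => lD.
  by rewrite (inner_pint (lb p) (leta n) lD).
have Bpos p : 0 <= w (B p).
  apply: wpos (MB p) _ => f lf; exact: (BB_pos HV Mx px adjV t1 t11 p (mkL2 lf)).
have ReB p : 0 <= Re (w (B p)) by have := Bpos p; rewrite lecE => /andP[].
have bij : set_bij [set: nat] [set: I] e.
  by split=> // [m n _ _ /(can_inj ec)|p _ /=] //; exists (c p).
have iv0 p : 0 <= (Iq_val (e p) ^+ 2)^-1 by rewrite invr_ge0 sqr_ge0.
pose u := diag x e; have u0 n : 0 <= u n by exact: diag_ge0.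
have phixE : phi x = (\sum_(0 <= n <oo) (u n)%:E)%E.
  rewrite (phi_formula q_gt0 q_lt1 bx); last by move=> p; exact: positive_diag.
  by rewrite (reindex_esum _ _ _ _ bij) nneseries_esumT// => n; rewrite lee_fin; exact: u0.
have ucvg : cvgn (series u) by apply: cvgn_of_nneseries => //; rewrite -phixE.
pose h n := (Iq_val (e n) ^+ 2)^-1 * Re (w (B (e n))).
have h0 n : 0 <= h n by rewrite mulr_ge0.
have phiyE : phi y = (\sum_(0 <= n <oo) (h n)%:E)%E.
  rewrite (phi_formula q_gt0 q_lt1 (Mq_bounded My)); last by move=> p; rewrite [inner _ _ _]yB.
  rewrite (reindex_esum _ _ _ _ bij) nneseries_esumT; last by move=> n; rewrite lee_fin.
  by apply: eq_esum => n _; rewrite [inner _ _ _]yB.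
set P := limn (series u); have P0 : 0 <= P.
  by apply: limr_ge => //; apply: nearW => n; apply: sumr_ge0.
pose TT := TN HV adjV t11 e.
have wT := wop_TN HV adjV t11 e.
have pT := TN_pos HV Mx px adjV t1 t11 e.
have mT := TN_mono HV Mx px adjV t1 t11 e.
have limT i j : ccvg (fun N => ip (TT N (vH i)) (vH j)) (P%:C * (i == j)%:R).
  by case: i j => [k t] [k' t']; exact: (entry_cvg q_gt0 q_lt1 HV Mx px adjV t1 t11 ec ce).
have Tb := increasing_bound (@vH_orth R q) (@vH_total R q) P0 wT pT mT limT.
have Tc := increasing_cvg (@vH_orth R q) (@vH_total R q) P0 wT pT mT limT.
pose X n : L2H muH := mkL2 (lxi n); pose Et n : L2H muH := mkL2 (leta n).
have hser N : series h N = limn (series (fun n => Re (ip (TT N (X n)) (Et n)))).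
  have := @ccvg_sum R _ (iota 0 N) _ _ (fun l => ccvgZ ((Iq_val (e l) ^+ 2)^-1)%:C (wB (e l))).
  move=> [hc _]; have -> : series h N = \sum_(i <- iota 0 N) h i by rewrite /series /= /index_iota subn0.
  have -> : \sum_(i <- iota 0 N) h i = Re (\sum_(i <- iota 0 N) ((Iq_val (e i) ^+ 2)^-1)%:C * w (B (e i))).
    by rewrite Re_sum; apply: eq_bigr => i _; rewrite ReZ.
  apply/esym/cvg_lim => //.
  have tn : (fun n => Re (ip (TT N (X n)) (Et n))) = (fun n => Re (\sum_(i <- iota 0 N)
      ((Iq_val (e i) ^+ 2)^-1)%:C * inner muH (B (e i) (xi n)) (eta n))).
    by apply/funext => n; congr (Re _); exact: TN_ip.
  rewrite tn; have -> : series (fun n => Re (\sum_(i <- iota 0 N)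
      ((Iq_val (e i) ^+ 2)^-1)%:C * inner muH (B (e i) (xi n)) (eta n))) =
      (fun M => Re (\sum_(i <- iota 0 N)
      ((Iq_val (e i) ^+ 2)^-1)%:C * \sum_(0 <= n < M) inner muH (B (e i) (xi n)) (eta n))).
    apply/funext => M; rewrite /series /=; under [in RHS]eq_bigr do rewrite mulr_sumr.
    by rewrite exchange_big /= Re_sum.
  exact: hc.
have hlim : series h @ \oo --> P * Re (w id).
  have -> : P * Re (w id) = limn (series (fun n => Re (P%:C * ip (X n) (Et n)))).
    apply/esym/cvg_lim => //; have [hid _] := wE _ Mq_id.
    have -> : series (fun n => Re (P%:C * ip (X n) (Et n))) =
        (fun N => P * series (fun n => Re (inner muH (xi n) (eta n))) N).
      by apply/funext => N; rewrite /series mulr_sumr; apply: eq_bigr => n _; exact: ReZ.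
    by apply: cvgMr; exact: hid.
  rewrite (_ : series h = fun N => limn (series (fun n => Re (ip (TT N (X n)) (Et n))))); last exact/funext.
  apply: (@tannery _ _ _ (fun n => P * (nrm2 (X n) + nrm2 (Et n)))).
  - have cD := is_cvg_seriesD (cvgn_norms xoo) (cvgn_norms eoo).
    have -> : (fun n => P * (nrm2 (X n) + nrm2 (Et n))) =
        (fun n => P *: ((fun k => norm2sq muH (xi k)) + (fun k => norm2sq muH (eta k))) n).
      by apply/funext => n; rewrite !nrm2E.
    exact: is_cvg_seriesZ.
  - by move=> N n; exact: Tb.
  - by move=> n; have [] := Tc (X n) (Et n).
rewrite phiyE phixE !nneseries_lty//; last by apply/cvg_ex; exists (P * Re (w id)).
by rewrite -/P (cvg_lim _ hlim)// EFinM.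
Qed.

End RightInvariance.

Theorem proposition4p8 (R : realType) (q : R) (q_gt0 : 0 < q) (q_lt1 : q < 1)
    (V : opHH_TTH q) (HV : is_V V) (J : opH q) (HJ : is_J J) :
  (* phi = phi R on M_q^+ *)
  (forall a b : opH q,
     Mq q a -> positive_op (mu_H q) a -> is_R J a b -> phi b = phi a)
  /\
  (* right invariance: Dx = Delta(x) and y = (iota (x) w)(Delta(x)) *)
  (forall (w : opH q -> R[i]) (x : opH q) (Dx : opHH q) (y : opH q),
     predual (mu_H q) (Mq q) w -> positive_functional (mu_H q) (Mq q) w ->
     Mq q x -> positive_op (mu_H q) x -> (phi x < +oo)%E ->
     is_Delta V x Dx ->
     is_slice (mu_H q) (mu_H q) (Mq q) (Mq q) w Dx y ->
     (phi y = phi x * (complex.Re (w id))%:E)%E).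
Proof.
split=> [a b Ma pa Rab|w x Dx y pw ww Mx px phix Delta slc].
  exact: (phi_R q_gt0 q_lt1 HJ (Mq_bounded Ma) pa Rab).
exact: (phi_right_invariant q_gt0 q_lt1 HV pw ww Mx px phix Delta slc).
Qed.
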